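(* Let $\beta>1$ and let $\{X_n\}_{n\in\mathbb N}$ ($\mathbb N=\{0,1,2,\dots\}$) be random variables bounded from below, with $X_n\in L_G^\beta(\Omega_n)$ for every $n$ and $\hat{\mathbb E}[\sup_{n\in\mathbb N}|X_n|^\beta]<\infty$. For each $N\in\mathbb N$ define $\tilde V^N_N=X_N$ and $\tilde V^N_n=\max\{X_n,\hat{\mathbb E}_n[\tilde V^N_{n+1}]\}$ for $n\le N-1$, and let $\tilde V_n^\infty=\lim_{N\ge n,\,N\to\infty}\tilde V_n^N$ (an increasing limit). For $j\in\mathbb N$ let $\mathcal T_j$ be the collection of all $G$-stopping times $\tau$ taking values in $\{j,j+1,\dots\}$ with $\lim_{N\to\infty}c(\tau>N)=0$. Assume that $$\tau_j=\inf\{l\ge j:\tilde V_l^\infty=X_l\}$$ satisfies $\lim_{N\to\infty}c(\tau_j>N)=0$. Then: (i) $\tau_j\in\mathcal T_j$ and $\tilde V^\infty_{n\wedge\tau_j}\in L_G^{1^*_*}(\Omega_n)$ for each $n\in\mathbb N$; (ii) $\{\tilde V^\infty_{n\wedge\tau_j},\ n=j,j+1,\dots\}$ is a $G$-martingale; (iii) for any $j\in\mathbb N$, $$\tilde V_j^\infty=\hat{\mathbb E}_j[X_{\tau_j}]=\operatorname*{ess\,sup}_{\tau\in\mathcal T_j}\hat{\mathbb E}_j[X_\tau].$$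
   Context: Framework. Fix $0\le\underline\sigma\le\bar\sigma<\infty$ and $G(a)=\frac12(\bar\sigma^2a^+-\underline\sigma^2a^-)$. $\Omega=C_0([0,\infty);\mathbb R)$ is the space of continuous paths starting at $0$ (locally uniform topology, Borel $\sigma$-field $\mathcal B(\Omega)$), $B$ the canonical process, $\Omega_t=\{\omega_{\cdot\wedge t}:\omega\in\Omega\}$. $L_{ip}(\Omega_t)=\{\varphi(B_{t_1},\dots,B_{t_m}): m\ge1,\ t_i\in[0,t],\ \varphi \text{ bounded Lipschitz}\}$, $L_{ip}(\Omega)=\bigcup_tL_{ip}(\Omega_t)$. $\hat{\mathbb E}$ is the $G$-expectation, with conditional $G$-expectations $\hat{\mathbb E}_t$: for $X=\varphi(B_{t_1},B_{t_2}-B_{t_1},\dots,B_{t_m}-B_{t_{m-1}})$ one sets $\hat{\mathbb E}_{t_j}[X]=\varphi_j(B_{t_1},\dots,B_{t_j}-B_{t_{j-1}})$, where $\varphi_m=\varphi$ and $\varphi_{i-1}(x_1,\dots,x_{i-1})=u(t_i-t_{i-1},0)$ with $u$ the viscosity solution of $\partial_tu=G(\partial^2_{yy}u)$, $u(0,y)=\varphi_i(x_1,\dots,x_{i-1},y)$; $\hat{\mathbb E}=\hat{\mathbb E}_0$. $L_G^p(\Omega_t)$ is the completion of $L_{ip}(\Omega_t)$ under $\hat{\mathbb E}[|\cdot|^p]^{1/p}$. $\mathcal P$ is the weakly compact set of all probability measures $P$ on $\Omega$ with $E^P[X]\le\hat{\mathbb E}[X]$ for all $X\in L_{ip}(\Omega)$;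 it represents $\hat{\mathbb E}$, and for Borel $X$ such that $E^P[X]$ exists for all $P\in\mathcal P$ one sets $\hat{\mathbb E}[X]=\sup_{P\in\mathcal P}E^P[X]$. $c(A)=\sup_{P\in\mathcal P}P(A)$; ''q.s.'' means outside a set of capacity $c$ zero. Relations between random variables are q.s. Spaces. $L^0(\Omega)$: Borel maps $\Omega\to[-\infty,\infty]$; $\mathcal L(\Omega)$: those $X\in L^0(\Omega)$ for which $E^P[X]$ exists for every $P\in\mathcal P$; $\mathbb L^1(\Omega)=\{X\in L^0(\Omega):\hat{\mathbb E}[|X|]<\infty\}$; $L_G^{1^*}(\Omega)$: $X\in\mathbb L^1(\Omega)$ with $X_n\downarrow X$ q.s. for some $\{X_n\}\subset L_G^1(\Omega)$; $L_G^{1^*_*}(\Omega)$: $X\in\mathbb L^1(\Omega)$ with $X_n\uparrow X$ q.s. for some $\{X_n\}\subset L_G^{1^*}(\Omega)$; $\bar L_G^{1^*_*}(\Omega)$: $X\in\mathbb L^1(\Omega)$ with $\hat{\mathbb E}[|X_n-X|]\to0$ for some $\{X_n\}\subset L_G^{1^*_*}(\Omega)$. The same definitions with $\Omega_t$ give the spaces over $\Omega_t$. Conditional expectation on $\bar L_G^{1^*_*}(\Omega)$. $\hat{\mathbb E}_t$ is extended from $L_{ip}(\Omega)$ to $L^1_G(\Omega)$ and $\bar L_G^{1^*_*}(\Omega)$ by norm limits and monotone limits; it is characterized by $\hat{\mathbb E}_t[X]=\operatorname{ess\,sup}^P_{Q\in\mathcal P(t,P)}E^Q[X|\mathcal F_t]$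 $P$-a.s. for every $P\in\mathcal P$, where $\mathcal F_t=\mathcal B(\Omega_t)$ and $\mathcal P(t,P)=\{Q\in\mathcal P:E^Q[X]=E^P[X]\ \forall X\in L_{ip}(\Omega_t)\}$. A random time $\tau:\Omega\to[0,\infty)$ is a $G$-stopping time if $I_{\{\tau\le t\}}\in L_G^{1^*}(\Omega_t)$ for each $t\ge0$. $X_\tau$ denotes $\omega\mapsto X_{\tau(\omega)}(\omega)$. Convention: $\inf\emptyset=\infty$, and a time that is infinite only on a set of capacity zero is regarded as finite. $\{M_n\}$ is a $G$-martingale if $M_n\in\bar L_G^{1^*_*}(\Omega_n)$ for each $n$ and $\hat{\mathbb E}_m[M_n]=M_m$ for all $m\le n$. Essential supremum (quasi-sure): for $\mathcal H\subset\mathbb L^1(\Omega)$, $\operatorname{ess\,sup}_{\xi\in\mathcal H}\xi$ is a random variable $\eta\in L^0(\Omega)$ with (i) $\eta\ge\xi$ q.s. for all $\xi\in\mathcal H$, and (ii) if $\eta'\in\mathcal L(\Omega)$ satisfies $\eta'\ge\xi$ q.s. for all $\xi\in\mathcal H$ then $\eta\le\eta'$ q.s. It need not exist in general, but is unique if it does; the asserted equality includes existence. *)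

(* Defs.v *)
From HB Require Import structures.
From mathcomp Require Import all_boot all_order all_algebra.
From mathcomp Require Import all_classical all_reals all_analysis.
From mathcomp Require Import measurable_realfun.

Set Implicit Arguments.
Unset Strict Implicit.
Unset Printing Implicit Defensive.

Import Order.TTheory GRing.Theory Num.Theory.
Import numFieldNormedType.Exports.

Local Open Scope classical_set_scope.
Local Open Scope ring_scope.
Local Open Scope ereal_scope.

(* C_0([0,oo); R): a path is encoded as a continuous function on the whole line
   that vanishes on the negative half-line, so that Leibniz equality of paths is
   equality on [0,oo). *)
Definition cpath (R : realType) : Type :=
  {w : R -> R | continuous w /\ forall s, (s <= 0)%R -> w s = 0%R}.

Definition path_val (R : realType) (w : cpath R) : R -> R := sval w.

Fact zero_path_subproof (R : realType) :
  continuous (cst 0%R : R -> R) /\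
  forall s : R, (s <= 0)%R -> (cst 0%R : R -> R) s = 0%R.
Proof. by split => // x; exact: cst_continuous. Qed.

HB.instance Definition _ (R : realType) := gen_eqMixin (cpath R).
HB.instance Definition _ (R : realType) := gen_choiceMixin (cpath R).
HB.instance Definition _ (R : realType) :=
  isPointed.Build (cpath R) (exist _ _ (zero_path_subproof R)).

(* Locally uniform topology: since all paths agree on (-oo,0], compact subsets of
   the line may be used instead of compact subsets of [0,oo). *)
Definition path_top (R : realType) : topologicalType :=
  initial_topology (@path_val R : cpath R -> {family compact, R -> R}).

Definition Omega (R : realType) :=
  g_sigma_algebraType (@open (path_top R)).

Definition canon (R : realType) (s : R) (w : Omega R) : R := path_val w s.

(* The spaces over Omega_t and over Omega are treated uniformly: the horizon t
   ranges over the extended reals, and t = +oo stands for Omega itself. *)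
Fact stop_subproof (R : realType) (t : \bar R) (w : cpath R) :
  let f := fun s : R => path_val w (fine (mine s%:E t)) in
  continuous f /\ forall s : R, (s <= 0)%R -> f s = 0%R.
Proof.
case: w => w [cw w0] /=; rewrite /path_val /=; split; last first.
  move=> s s0; apply: w0; case: t => [t| |].
  - by rewrite -EFin_min /= ge_min s0.
  - by rewrite min_l ?leey.
  - by rewrite min_r ?leNye.
case: t => [t| |].
- move=> s; have -> : (fun x : R => w (fine (mine x%:E t%:E))) =
      w \o (fun x : R => Num.min x t).
    by apply/funext => x /=; rewrite -EFin_min.
  by apply: continuous_comp; [apply: continuous_min => //; exact: cvg_cst|exact: cw].
- move=> s; have -> : (fun x : R => w (fine (mine x%:E +oo))) = w.
    by apply/funext => x; rewrite min_l ?leey.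
  exact: cw.
- move=> s; have -> : (fun x : R => w (fine (mine x%:E -oo))) = cst (w 0%R).
    by apply/funext => x; rewrite min_r ?leNye.
  exact: cst_continuous.
Qed.

Definition stop (R : realType) (t : \bar R) (w : Omega R) : Omega R :=
  exist _ _ (stop_subproof t w).

(* B(Omega_t), seen as a sigma-field on Omega *)
Definition F_ (R : realType) (t : \bar R) : set (set (Omega R)) :=
  preimage_set_system setT (@stop R t) measurable.

Definition F_measurable (R : realType) (t : \bar R) (X : Omega R -> \bar R) :=
  forall A : set (\bar R), measurable A -> F_ t (X @^-1` A).

Definition bounded_lipschitz (R : realType) (m : nat) (phi : 'rV[R]_m.+1 -> R) :=
  bounded_fun (phi : 'rV[R]_m.+1 -> R^o) /\ lipschitz (phi : 'rV[R]_m.+1 -> R^o).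

Definition Lip (R : realType) (t : \bar R) : set (Omega R -> R) :=
  [set X | exists m (ts : 'I_m.+1 -> R) (phi : 'rV[R]_m.+1 -> R),
    [/\ bounded_lipschitz phi,
        (forall i, (0 <= ts i)%R /\ (ts i)%:E <= t)
      & X = fun w => phi (\row_i canon (ts i) w)]].

Definition Gfun (R : realType) (slo shi a : R) : R :=
  (2^-1 * (shi ^+ 2 * Num.max a 0 - slo ^+ 2 * Num.max (- a) 0))%R.

Definition dt (R : realType) (u : R -> R -> R) (t y : R) : R :=
  derive1 (fun s => u s y) t.
Definition dy (R : realType) (u : R -> R -> R) (t y : R) : R :=
  derive1 (u t) y.
Definition dyy (R : realType) (u : R -> R -> R) (t y : R) : R :=
  derive1 (derive1 (u t)) y.

(* C^{1,2} on (0,oo) x R only: psi is unconstrained for t <= 0. *)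
Definition C12 (R : realType) (psi : R -> R -> R) :=
  forall t y : R, (0 < t)%R ->
  [/\ derivable (fun s => psi s y) t 1%R,
      derivable (psi t) y 1%R & derivable (derive1 (psi t)) y 1%R] /\
  [/\ {for (t, y), continuous (fun z : R * R => dt psi z.1 z.2)},
      {for (t, y), continuous (fun z : R * R => dy psi z.1 z.2)}
    & {for (t, y), continuous (fun z : R * R => dyy psi z.1 z.2)}].

Definition visc_subsol (R : realType) (slo shi : R) (u : R -> R -> R) :=
  forall (t y : R) (psi : R -> R -> R), (0 < t)%R -> C12 psi ->
  (forall s z : R, (0 < s)%R -> (u s z <= psi s z)%R) -> u t y = psi t y ->
  (dt psi t y - Gfun slo shi (dyy psi t y) <= 0)%R.

Definition visc_supersol (R : realType) (slo shi : R) (u : R -> R -> R) :=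
  forall (t y : R) (psi : R -> R -> R), (0 < t)%R -> C12 psi ->
  (forall s z : R, (0 < s)%R -> (psi s z <= u s z)%R) -> u t y = psi t y ->
  (0 <= dt psi t y - Gfun slo shi (dyy psi t y))%R.

(* Boundedness is the growth condition under which the viscosity solution with
   bounded Lipschitz initial datum phi is unique. *)
Definition Gheat_sol (R : realType) (slo shi : R) (phi : R -> R)
    (u : R -> R -> R) :=
  [/\ {within [set z : R * R | (0 <= z.1)%R],
         continuous (fun z : R * R => u z.1 z.2)},
      (exists C : R, forall t y : R, (0 <= t)%R -> (`|u t y| <= C)%R),
      u 0%R = phi, visc_subsol slo shi u & visc_supersol slo shi u].

Definition Gheat (R : realType) (slo shi : R) (phi : R -> R) : R -> R -> R :=
  xget (fun _ _ => 0%R) [set u | Gheat_sol slo shi phi u].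

(* Backward recursion phi_{i-1}(x_1..x_{i-1}) = u(t_i - t_{i-1}, 0), where u solves
   the G-heat equation from phi_i(x_1..x_{i-1}, .); ds is the list of the
   t_i - t_{i-1} and the result is phi_0. *)
Fixpoint Gcyl (R : realType) (slo shi : R) (ds : seq R) (phi : seq R -> R) : R :=
  match ds with
  | [::] => phi [::]
  | d :: ds' =>
      Gheat slo shi (fun y => Gcyl slo shi ds' (fun x => phi (y :: x))) d 0%R
  end.

Definition increments (R : realType) (f : R -> R) (ts : seq R) : seq R :=
  pairmap (fun a b => (f b - f a)%R) 0%R ts.

Definition row_of_seq (R : realType) (m : nat) (s : seq R) : 'rV[R]_m :=
  \row_(i < m) s`_i.

(* v is the value of the G-expectation at X = phi(B_{t_1}, B_{t_2} - B_{t_1}, ...);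
   every element of Lip +oo has such a representation with sorted times. *)
Definition Gexp_Lip (R : realType) (slo shi : R) (X : Omega R -> R) (v : R) :=
  exists m (ts : seq R) (phi : 'rV[R]_m.+1 -> R),
    [/\ bounded_lipschitz phi, size ts = m.+1, path <=%R 0%R ts,
        X = (fun w => phi (row_of_seq m.+1 (increments (path_val w) ts)))
      & v = Gcyl slo shi (increments id ts) (fun s => phi (row_of_seq m.+1 s))].

Definition Pset (R : realType) (slo shi : R) : set (probability (Omega R) R) :=
  [set P | forall X v, Gexp_Lip slo shi X v -> \int[P]_w (X w)%:E <= v%:E].

Definition Ghat (R : realType) (slo shi : R) (X : Omega R -> \bar R) : \bar R :=
  ereal_sup [set \int[P]_w X w | P in Pset slo shi].

Definition capacity (R : realType) (slo shi : R) (A : set (Omega R)) : \bar R :=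
  ereal_sup [set (P : probability (Omega R) R) A | P in Pset slo shi].

Definition qs (R : realType) (slo shi : R) (Q : Omega R -> Prop) :=
  exists A : set (Omega R), [/\ measurable A, capacity slo shi A = 0
    & forall w, ~ A w -> Q w].

Definition L0 (R : realType) : set (Omega R -> \bar R) :=
  [set X | measurable_fun setT X].

(* Random variables are identified when they agree q.s., so the elements of
   L^0(Omega_t) are the Borel maps having a B(Omega_t)-measurable q.s. version. *)
Definition L0_ (R : realType) (slo shi : R) (t : \bar R) :
    set (Omega R -> \bar R) :=
  [set X | L0 X /\ exists2 Y, F_measurable t Y & qs slo shi (fun w => X w = Y w)].

Definition calL (R : realType) (slo shi : R) : set (Omega R -> \bar R) :=
  [set X | L0 X /\ forall P, Pset slo shi P ->
     \int[P]_w X^\+ w < +oo \/ \int[P]_w X^\- w < +oo].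

Definition bbL1 (R : realType) (slo shi : R) (t : \bar R) :
    set (Omega R -> \bar R) :=
  [set X | L0_ slo shi t X /\ Ghat slo shi (fun w => `|X w|) < +oo].

Definition Gnorm (R : realType) (slo shi p : R) (X : Omega R -> \bar R) : \bar R :=
  (Ghat slo shi (fun w => `|X w| `^ p) `^ (p^-1)%R)%E.

(* L^p_G(Omega_t), realized as the closure of Lip(Omega_t) *)
Definition LG (R : realType) (slo shi p : R) (t : \bar R) :
    set (Omega R -> \bar R) :=
  [set X | L0 X /\ exists xi : nat -> Omega R -> R,
     (forall k, Lip t (xi k)) /\
     Gnorm slo shi p (fun w => (xi k w)%:E - X w) @[k --> \oo] --> 0].

Definition LG1s (R : realType) (slo shi : R) (t : \bar R) :
    set (Omega R -> \bar R) :=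
  [set X | bbL1 slo shi t X /\ exists xi : nat -> Omega R -> \bar R,
     (forall k, LG slo shi 1 t (xi k)) /\
     qs slo shi (fun w => (forall k, xi k.+1 w <= xi k w) /\
                          xi k w @[k --> \oo] --> X w)].

Definition LG1ss (R : realType) (slo shi : R) (t : \bar R) :
    set (Omega R -> \bar R) :=
  [set X | bbL1 slo shi t X /\ exists xi : nat -> Omega R -> \bar R,
     (forall k, LG1s slo shi t (xi k)) /\
     qs slo shi (fun w => (forall k, xi k w <= xi k.+1 w) /\
                          xi k w @[k --> \oo] --> X w)].

Definition LG1ss_bar (R : realType) (slo shi : R) (t : \bar R) :
    set (Omega R -> \bar R) :=
  [set X | bbL1 slo shi t X /\ exists xi : nat -> Omega R -> \bar R,
     (forall k, LG1ss slo shi t (xi k)) /\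
     Ghat slo shi (fun w => `|xi k w - X w|) @[k --> \oo] --> 0].

Definition is_condexp (R : realType) (Q : probability (Omega R) R) (t : \bar R)
    (X Z : Omega R -> \bar R) :=
  [/\ F_measurable t Z, Q.-integrable setT X, Q.-integrable setT Z
    & forall A, F_ t A -> \int[Q]_(w in A) Z w = \int[Q]_(w in A) X w].

Definition is_esssup_as (R : realType) (P : probability (Omega R) R)
    (H : set (Omega R -> \bar R)) (Y : Omega R -> \bar R) :=
  [/\ L0 Y, (forall Z, H Z -> {ae P, forall w, Z w <= Y w})
    & forall Y', L0 Y' -> (forall Z, H Z -> {ae P, forall w, Z w <= Y' w}) ->
        {ae P, forall w, Y w <= Y' w}].

Definition Pset_from (R : realType) (slo shi : R) (t : \bar R)
    (P : probability (Omega R) R) : set (probability (Omega R) R) :=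
  [set Q | Pset slo shi Q /\
     forall X, Lip t X -> \int[Q]_w (X w)%:E = \int[P]_w (X w)%:E].

(* The conditional G-expectation extended to \bar L_G^{1^*_*}(Omega), given by its
   characterization under every P in Pset as the P-essential supremum of the
   E^Q[X|F_t] over Q in P(t,P) = Pset_from t P; Y is unique up to q.s. equality. *)
Definition is_Gcond (R : realType) (slo shi : R) (t : \bar R)
    (X Y : Omega R -> \bar R) :=
  [/\ LG1ss_bar slo shi +oo X, L0_ slo shi t Y
    & forall P, Pset slo shi P ->
        is_esssup_as P
          [set Z | exists2 Q, Pset_from slo shi t P Q & is_condexp Q t X Z] Y].

(* An arbitrary version; the default 0 is returned when there is none. *)
Definition Gcond (R : realType) (slo shi : R) (t : \bar R)
    (X : Omega R -> \bar R) : Omega R -> \bar R :=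
  xget (cst 0) [set Y | is_Gcond slo shi t X Y].

Definition Gmartingale_from (R : realType) (slo shi : R) (j : nat)
    (M : nat -> Omega R -> \bar R) :=
  (forall n, (j <= n)%N -> LG1ss_bar slo shi n%:R%:E (M n)) /\
  (forall m n, (j <= m)%N -> (m <= n)%N -> is_Gcond slo shi m%:R%:E (M n) (M m)).

Definition is_qs_esssup (R : realType) (slo shi : R)
    (H : set (Omega R -> \bar R)) (eta : Omega R -> \bar R) :=
  [/\ H `<=` bbL1 slo shi +oo, L0 eta,
      (forall xi, H xi -> qs slo shi (fun w => xi w <= eta w))
    & forall eta', calL slo shi eta' ->
        (forall xi, H xi -> qs slo shi (fun w => xi w <= eta' w)) ->
        qs slo shi (fun w => eta w <= eta' w)].

(* Random times may take the value +oo; the times of interest do so only on a set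
   of capacity zero. *)
Definition Gstopping (R : realType) (slo shi : R) (tau : Omega R -> \bar R) :=
  (forall w, 0 <= tau w) /\
  forall t : R, (0 <= t)%R ->
    LG1s slo shi t%:E (fun w => (\1_[set w | (tau w <= t%:E)%E] w)%:E).

(* T_j; the limit condition forces tau < +oo q.s. *)
Definition Tset (R : realType) (slo shi : R) (j : nat) : set (Omega R -> \bar R) :=
  [set tau | [/\ Gstopping slo shi tau,
     (forall w, tau w = +oo \/ exists2 l, (j <= l)%N & tau w = l%:R%:E)
   & capacity slo shi [set w | N%:R%:E < tau w] @[N --> \oo] --> 0]].

(* X_tau for an integer-valued time tau; the value where tau = +oo is immaterial *)
Definition at_time (R : realType) (X : nat -> Omega R -> \bar R)
    (tau : Omega R -> \bar R) (w : Omega R) : \bar R :=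
  X (Num.truncn (fine (tau w))) w.

(* Vback X N k is \tilde V^N_{N-k} *)
Fixpoint Vback (R : realType) (slo shi : R) (X : nat -> Omega R -> \bar R)
    (N k : nat) : Omega R -> \bar R :=
  match k with
  | 0%N => X N
  | k'.+1 => fun w => maxe (X (N - k)%N w)
      (Gcond slo shi (N - k)%:R%:E (Vback slo shi X N k') w)
  end.

Definition Vtilde (R : realType) (slo shi : R) (X : nat -> Omega R -> \bar R)
    (N n : nat) : Omega R -> \bar R := Vback slo shi X N (N - n).

Definition Vinf (R : realType) (slo shi : R) (X : nat -> Omega R -> \bar R)
    (n : nat) (w : Omega R) : \bar R :=
  limn (fun N => Vtilde slo shi X N n w).

(* The infimum over the empty set is +oo. *)
Definition tau_opt (R : realType) (slo shi : R) (X : nat -> Omega R -> \bar R)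
    (j : nat) (w : Omega R) : \bar R :=
  ereal_inf [set l%:R%:E | l in [set l : nat | (j <= l)%N /\
                                   Vinf slo shi X l w = X l w]].

(* Main.v *)
(* The nonempty representing set of measures provides the nonlinear heat semigroup: its value is the
   supremum of the expectations of the increments, which by uniqueness is the viscosity solution. Backward
   recursion along the semigroup gives the conditional G-expectation of cylinder functionals. By Hahn-Banach
   it is attained, for given P and t, by a positive linear functional on the cylinder functionals that
   extends the expectation under P up to time t; the fourth-moment bound makes this functional tight, so it
   is the expectation under a measure of P(t,P). Hence the essential supremum over P(t,P) is
   characterized by an upper bound under all measures together with near attainment, and this
   characterization survives norm limits, increasing limits and, by compactness of P(t,P), decreasing
   limits of elements of L_G^1.

   The contact indicators 1_{V_n = X_n} are decreasing limits of the functions (1 - N (V_n^N - X_n))^+ of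
   L_G^1, so the first contact time is a G-stopping time. Before contact the value process satisfies
   V_n = E_n[V_{n+1}], so the stopped value process is a G-martingale; uniform integrability lets it run
   to infinity, where it equals X at the contact time. The inequality E_n[V_{n+1}] <= V_n, tested under
   every measure of P(t,P), bounds every other stopping rule. *)
From HB Require Import structures.
Require Import Defs.
From mathcomp Require Import all_boot all_order all_algebra.
From mathcomp Require Import all_classical all_reals all_analysis.
From mathcomp Require Import measurable_realfun.
From mathcomp Require Import ring lra.

Set Implicit Arguments.
Unset Strict Implicit.
Unset Printing Implicit Defensive.

Import Order.TTheory GRing.Theory Num.Theory.
Import numFieldNormedType.Exports.

Local Open Scope classical_set_scope.
Local Open Scope ring_scope.

(** * Viscosity solutions of the G-heat equation *)

Section Calculus.
Context {R : realType}.
Local Notation isd f x d := (is_derive (x : R) (1 : R) (f : R -> R) (d : R)).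

(** Uniqueness for the G-heat equation is not obtained by doubling variables. A bounded subsolution
    is compared with a classical supersolution at a penalized maximum, and viscosity supersolutions
    are mollified into classical ones. Since G is the larger of two linear operators, a
    supersolution U dominates the random walk of either variance started from U; this inequality is
    linear, hence kept by averages over translates, and for smooth functions it turns back into a
    differential inequality. Existence is indirect: without a solution [Gheat] takes its default
    value 0, and some function that is at least 1 would have expectation at most 0. One measure in
    [Pset] is enough for this, and the tail hypothesis supplies it, a supremum over no measures
    being -oo. The q.s. setting has no reference measure, so limits are built pathwise with
    estimates uniform over [Pset], and ultrafilters replace subsequences. Decreasing limits need
    E^Q[x] to depend continuously on Q, which is available for x in L_G^1; this dictates how
    indicators and random variables are multiplied later on. *)

Lemma is_derive_cont (f : R -> R) (x d : R) : isd f x d -> {for x, continuous f}.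
Proof. by move=> [df _]; apply/differentiable_continuous/derivable1_diffP. Qed.

Lemma is_derive_derive1 (f : R -> R) (x d : R) : isd f x d -> derive1 f x = d.
Proof. by move=> [_ <-]; rewrite derive1E. Qed.

Lemma derivable_is_derive1 (f : R -> R) (x : R) : derivable f x 1 -> isd f x (derive1 f x).
Proof. by move=> df; rewrite derive1E; exact: DeriveDef. Qed.

Lemma is_derive_ext (f g : R -> R) (x d e : R) :
  isd f x d -> f =1 g -> d = e -> isd g x e.
Proof. by move=> H /funext <- <-. Qed.

Lemma is_derive_compE (f g : R -> R) (x a b : R) :
  isd f (g x) a -> isd g x b -> isd (fun z => f (g z)) x (a * b).
Proof. by move=> H1 H2; exact: is_derive1_comp. Qed.

Lemma is_derive_addl (f : R -> R) (y x d : R) :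
  isd f (y + x) d -> isd (fun z => f (y + z)) x d.
Proof.
move=> H; rewrite -[d]mulr1; apply: (@is_derive_compE f (fun z => y + z)) => //.
by apply: is_derive_ext (is_derive_shift x 1 y) _ _ => // z; rewrite /= addrC.
Qed.

Lemma mvt_le (f df : R -> R) (a b : R) : a <= b -> (forall x, isd f x (df x)) ->
  exists2 c, a <= c <= b & f b - f a = df c * (b - a).
Proof.
move=> ab H; have [|c] := @MVT_segment R f df a b ab (fun x _ => H x).
  by apply: continuous_subspaceT => x; apply: is_derive_cont (H x).
by rewrite in_itv/= => cab E; exists c.
Qed.

Lemma mvt_norm (f df : R -> R) (M a b : R) : (forall x, isd f x (df x)) ->
  (forall x, `|x - a| <= `|b - a| -> `|df x| <= M) ->
  `|f b - f a| <= M * `|b - a|.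
Proof.
move=> H dM; have [ab|/ltW ba] := leP a b.
  have [c /andP[ac cb] ->] := mvt_le ab H.
  by rewrite normrM ler_wpM2r// dM// !ger0_norm ?subr_ge0//; lra.
have [c /andP[ac cb]] := mvt_le ba H.
move/(congr1 Num.norm); rewrite distrC => ->; rewrite normrM (distrC b).
by rewrite ler_wpM2r// dM// (distrC c) (distrC b) !ger0_norm ?subr_ge0//; lra.
Qed.

Lemma is_derive_nondecr (f df : R -> R) (a b : R) : a <= b ->
  (forall x, isd f x (df x)) ->
  (forall x, a <= x <= b -> 0 <= df x) -> f a <= f b.
Proof.
move=> ab H d0; have [c cab E] := mvt_le ab H.
by rewrite -subr_ge0 E mulr_ge0 ?d0// subr_ge0.
Qed.

(** Three nested mean value estimates, each costing a factor |k|; the constant B instead of B/6 is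
    harmless for the limits taken later. *)
Lemma taylor2 (f f1 f2 f3 : R -> R) (B : R) : (forall x, isd f x (f1 x)) ->
  (forall x, isd f1 x (f2 x)) -> (forall x, isd f2 x (f3 x)) ->
  (forall x, `|f3 x| <= B) -> forall y k,
  `|f (y + k) - f y - k * f1 y - 2^-1 * k ^+ 2 * f2 y| <= B * `|k| ^+ 3.
Proof.
move=> H1 H2 H3 hB y k.
have sh (h h' : R -> R) : (forall x, isd h x (h' x)) ->
    forall x, isd (fun x => h (y + x)) x (h' (y + x)).
  by move=> H x; exact: is_derive_addl.
have E2 x : `|f2 (y + x) - f2 y| <= B * `|x|.
  have := @mvt_norm (fun x => f2 (y + x)) (fun x => f3 (y + x)) B 0 x
    (sh _ _ H3) (fun _ _ => hB _).
  by rewrite addr0 subr0.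
have D1 x : isd (fun x => f1 (y + x) - f1 y - x * f2 y) x    (f2 (y + x) - f2 y).
  have := sh _ _ H2 x => ?.
  by apply: is_derive_eq; rewrite !(scaler0, scale0r, scaler1) /GRing.scale/=; ring.
have E1 x : `|f1 (y + x) - f1 y - x * f2 y| <= B * `|x| * `|x|.
  have := @mvt_norm _ _ (B * `|x|) 0 x D1.
  rewrite addr0 subr0 mul0r subrr !subr0; apply => z.
  rewrite subr0 => zx; apply: le_trans (E2 z) _.
  by rewrite ler_wpM2l// (le_trans _ (hB y)).
have D0 x : isd (fun x => f (y + x) - f y - x * f1 y - 2^-1 * x ^+ 2 * f2 y) x    (f1 (y + x) - f1 y - x * f2 y).
  have := sh _ _ H1 x => ?.
  by apply: is_derive_eq; rewrite !(scaler0, scale0r, scaler1) /GRing.scale/=; field.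
have := @mvt_norm _ _ (B * `|k| * `|k|) 0 k D0.
rewrite addr0 subr0 mul0r subrr expr0n/= mulr0 mul0r !subr0.
rewrite (_ : B * `|k| ^+ 3 = B * `|k| * `|k| * `|k|); last by ring.
apply => z; rewrite subr0 => zk; apply: le_trans (E1 z) _.
have B0 : 0 <= B by rewrite (le_trans _ (hB y)).
by rewrite ler_pM// ?mulr_ge0// ler_wpM2l.
Qed.

Lemma cont_integrable (f : R -> R) (a b : R) : continuous f ->
  (@lebesgue_measure R).-integrable `[a, b] (EFin \o f).
Proof.
move=> cf; apply: continuous_compact_integrable; first exact: segment_compact.
exact: continuous_subspaceT.
Qed.

(** The fundamental theorem gives a primitive on each half-line starting at -n. Two of them differ
    by a constant where both are defined, so after normalization at 0 they agree and glue
    together. *)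
Lemma antiderivative_ex (f : R -> R) : continuous f ->
  exists F : R -> R, forall x, isd F x (f x).
Proof.
move=> cf.
pose G (n : nat) (x : R) : R := (\int[@lebesgue_measure R]_(t in [set` `[- n%:R, x]]) (f t))%R.
have HG n x : - n%:R < x -> isd (G n) x (f x).
  move=> nx; have [] := @continuous_FTC1_closed R f (- n%:R) x (x + 1).
  - lra.
  - exact: cont_integrable.
  - exact: nx.
  - exact: cf.
  by move=> d E; split; [exact: d|rewrite -derive1E].
have GE n m x y : - n%:R < x -> - m%:R < x -> x <= y ->
    G n y - G m y = G n x - G m x.
  move=> nx mx xy; pose H := fun z => G n z - G m z.
  have Hd z : x <= z -> isd H z 0.
    move=> xz; have ? := HG n z (lt_le_trans nx xz).
    have ? := HG m z (lt_le_trans mx xz).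
    by apply: is_derive_eq; rewrite subrr.
  have [|//|c _] := @MVT_segment R H (fun=> 0) x y xy.
  - by move=> z; rewrite in_itv/= => /andP[/ltW xz _]; exact: Hd.
  - apply: derivable_within_continuous => z; rewrite in_itv/= => /andP[xz _].
    by have [] := Hd z xz.
  by rewrite mul0r => /eqP; rewrite subr_eq0 => /eqP.
pose N (x : R) := (Num.truncn `|x|).+2.
have NP (x : R) : - (N x)%:R < x - 1.
  have /andP[_] := truncn_itv (normr_ge0 x); rewrite /N -(natr1 (Num.truncn _).+1).
  have := ler_norm (- x); rewrite normrN; lra.
pose F' x := G (N x) x - G (N x) 0.
have F'E n x : - n%:R < x :> R -> - n%:R < 0 :> R -> F' x = G n x - G n 0.
  move=> nx n0; rewrite /F'.
  have Nx : - (N x)%:R < x by have := NP x; lra.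
  have N0 : - (N x)%:R < 0 :> R by rewrite oppr_lt0 ltr0n.
  have [x0|/ltW x0] := leP x 0.
    by have := GE (N x) n x 0 Nx nx x0; lra.
  by have := GE (N x) n 0 x N0 n0 x0; lra.
exists F' => x.
have Nx := NP x; have N0 : - (N x)%:R < 0 :> R by rewrite oppr_lt0 ltr0n.
apply: (@near_eq_is_derive _ _ _ (fun y => G (N x) y - G (N x) 0)).
  have : \forall y \near x, - (N x)%:R < y.
    by apply: lt_nbhsr; lra.
  by apply: filterS => y Ny; rewrite (@F'E (N x)).
have ? : isd (G (N x)) x (f x) by apply: HG; lra.
by apply: is_derive_eq; rewrite subr0.
Unshelve. all: end_near. Qed.

End Calculus.

(** * Classical test functions and comparison with a smooth supersolution *)

Section Smooth.
Context {R : realType}.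
Local Notation isd f x d := (is_derive (x : R) (1 : R) (f : R -> R) (d : R)).
Local Notation cont2_at f t y :=
  ({for ((t : R), (y : R)), continuous (fun z : R * R => (f : R -> R -> R) z.1 z.2)}).
Local Notation cont2 f := (continuous (fun z : R * R => (f : R -> R -> R) z.1 z.2)).

Lemma cont2_atP (f : R -> R -> R) (t y : R) :
  cont2_at f t y <-> forall e, 0 < e -> exists2 d, 0 < d &
    forall s z, `|s - t| < d -> `|z - y| < d -> `|f s z - f t y| < e.
Proof.
split=> [/cvgrPdist_lt/= H e e0|H].
  have /nbhs_ballP[d d0 dH] := H e e0; exists d => // s z sd zd.
  by rewrite distrC; apply: (dH (s, z)); split => /=; rewrite /ball/= distrC.
apply/cvgrPdist_lt => e e0; have [d d0 dH] := H e e0.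
suff : \forall z \near (t, y), `|f t y - f (z : R * R).1 z.2| < e by [].
apply/nbhs_ballP; exists d => // -[s z] [/= sd zd].
by rewrite distrC; apply: dH; rewrite distrC.
Qed.

Lemma cont_atP (f : R -> R) (t : R) :
  {for t, continuous f} <-> forall e, 0 < e -> exists2 d, 0 < d &
    forall s, `|s - t| < d -> `|f s - f t| < e.
Proof.
split=> [/cvgrPdist_lt/= H e e0|H].
  have /nbhs_ballP[d d0 dH] := H e e0; exists d => // s sd.
  by rewrite distrC; apply: dH; rewrite /ball/= distrC.
apply/cvgrPdist_lt => e e0; have [d d0 dH] := H e e0.
apply/nbhs_ballP; exists d => // s sd.
by rewrite distrC; apply: dH; rewrite distrC.
Qed.

Lemma cont2_x (f : R -> R -> R) (t y : R) : cont2_at f t y -> {for y, continuous (f t)}.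
Proof.
move=> /cont2_atP H; apply/cont_atP => e /H[d d0 dH]; exists d => // s sy.
by apply: dH => //; rewrite subrr normr0.
Qed.

Lemma cont2_t (f : R -> R -> R) (t y : R) :
  cont2_at f t y -> {for t, continuous (fun s => f s y)}.
Proof.
move=> /cont2_atP H; apply/cont_atP => e /H[d d0 dH]; exists d => // s sy.
by apply: dH => //; rewrite subrr normr0.
Qed.

Lemma cont2_fst (g : R -> R) : continuous g -> cont2 (fun t _ => g t).
Proof.
move=> cg z; apply: (@continuous_comp _ _ _ (fun z : R * R => z.1) g).
  exact: cvg_fst.
exact: cg.
Qed.

Lemma cont2_snd (g : R -> R) : continuous g -> cont2 (fun _ y => g y).
Proof.
move=> cg z; apply: (@continuous_comp _ _ _ (fun z : R * R => z.2) g).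
  exact: cvg_snd.
exact: cg.
Qed.

(* The partial derivatives are carried along explicitly, on positive times. *)
Definition smooth (psi pt px pxx : R -> R -> R) := forall t y : R, 0 < t ->
  [/\ isd (fun s => psi s y) t (pt t y), isd (psi t) y (px t y)
    & isd (px t) y (pxx t y)] /\
  [/\ cont2_at pt t y, cont2_at px t y & cont2_at pxx t y].

Lemma near_pos_fst (t y : R) : 0 < t -> \forall z \near (t, y), 0 < (z : R * R).1.
Proof.
move=> t0; apply/nbhs_ballP; exists t => // -[s z] [/= + _].
by rewrite /ball/= => /ltr_distlDr; rewrite ltrBlDl addrC subrr || lra.
Qed.

Lemma smooth_dt psi pt px pxx t y : smooth psi pt px pxx -> 0 < t ->
  [/\ dt psi t y = pt t y, dy psi t y = px t y & dyy psi t y = pxx t y].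
Proof.
move=> H t0; have [[h1 h2 h3] _] := H t y t0; split.
- exact: is_derive_derive1 h1.
- exact: is_derive_derive1 h2.
- rewrite /dyy; have -> : derive1 (psi t) = px t; last exact: is_derive_derive1 h3.
  by apply/funext => z; have [[_ h _] _] := H t z t0; exact: is_derive_derive1 h.
Qed.

Lemma smooth_C12 psi pt px pxx : smooth psi pt px pxx -> C12 psi.
Proof.
move=> H t y t0; have [[h1 h2 h3] [c1 c2 c3]] := H t y t0; split; split.
- by case: h1.
- by case: h2.
- have -> : derive1 (psi t) = px t; last by case: h3.
  by apply/funext => z; have [[_ h _] _] := H t z t0; exact: is_derive_derive1 h.
- suff : dt psi (z : R * R).1 z.2 @[z --> (t, y)] --> dt psi t y by [].
  have [-> _ _] := smooth_dt y H t0.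
  apply: cvg_trans c1; apply: near_eq_cvg; apply: filterS (near_pos_fst y t0).
  by move=> z z0; have [-> _ _] := smooth_dt z.2 H z0.
- suff : dy psi (z : R * R).1 z.2 @[z --> (t, y)] --> dy psi t y by [].
  have [_ -> _] := smooth_dt y H t0.
  apply: cvg_trans c2; apply: near_eq_cvg; apply: filterS (near_pos_fst y t0).
  by move=> z z0; have [_ -> _] := smooth_dt z.2 H z0.
- suff : dyy psi (z : R * R).1 z.2 @[z --> (t, y)] --> dyy psi t y by [].
  have [_ _ ->] := smooth_dt y H t0.
  apply: cvg_trans c3; apply: near_eq_cvg; apply: filterS (near_pos_fst y t0).
  by move=> z z0; have [_ _ ->] := smooth_dt z.2 H z0.
Qed.

Lemma C12_smooth psi : C12 psi -> smooth psi (dt psi) (dy psi) (dyy psi).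
Proof.
move=> H t y t0; have [[h1 h2 h3] [c1 c2 c3]] := H t y t0; split; split.
- exact: (derivable_is_derive1 h1).
- exact: (derivable_is_derive1 h2).
- exact: (derivable_is_derive1 h3).
- exact: c1.
- exact: c2.
- exact: c3.
Qed.

Lemma smoothD p pt px pxx q qt qx qxx : smooth p pt px pxx -> smooth q qt qx qxx ->
  smooth (fun t y => p t y + q t y) (fun t y => pt t y + qt t y)
    (fun t y => px t y + qx t y) (fun t y => pxx t y + qxx t y).
Proof.
move=> H1 H2 t y t0; have [[h1 h2 h3] [c1 c2 c3]] := H1 t y t0.
have [[g1 g2 g3] [d1 d2 d3]] := H2 t y t0; split; split.
- exact: is_deriveD.
- exact: is_deriveD.
- exact: is_deriveD.
- exact: continuousD c1 d1.
- exact: continuousD c2 d2.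
- exact: continuousD c3 d3.
Qed.

Lemma smoothN p pt px pxx : smooth p pt px pxx ->
  smooth (fun t y => - p t y) (fun t y => - pt t y)
    (fun t y => - px t y) (fun t y => - pxx t y).
Proof.
move=> H1 t y t0; have [[h1 h2 h3] [c1 c2 c3]] := H1 t y t0; split; split.
- exact: is_deriveN.
- exact: is_deriveN.
- exact: is_deriveN.
- exact: continuousN c1.
- exact: continuousN c2.
- exact: continuousN c3.
Qed.

Lemma smooth_quad (d K c : R) : smooth (fun t y => d * (y ^+ 2 + K * t) + c)
  (fun _ _ => d * K) (fun _ y => d * (2 * y)) (fun _ _ => 2 * d).
Proof.
move=> t y t0; split; split.
- by apply: is_derive_eq; rewrite /GRing.scale/=; ring.
- by apply: is_derive_eq; rewrite /GRing.scale/=; ring.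
- by apply: is_derive_eq; rewrite /GRing.scale/=; ring.
- exact: cvg_cst.
- apply: (@cont2_snd (fun y => d * (2 * y))) => z.
  by apply: cvgM; [exact: cvg_cst|apply: cvgM; [exact: cvg_cst|exact: cvg_id]].
- exact: cvg_cst.
Qed.

Lemma Gfun_add (slo shi a b : R) : 0 <= slo -> slo <= shi -> 0 <= b ->
  Gfun slo shi (a + b) <= Gfun slo shi a + 2^-1 * shi ^+ 2 * b.
Proof.
move=> s0 ss b0; rewrite /Gfun.
have : slo ^+ 2 <= shi ^+ 2 by rewrite ler_sqr// nnegrE (le_trans s0).
have : 0 <= slo ^+ 2 by exact: sqr_ge0.
move: (slo ^+ 2) (shi ^+ 2) => l h l0 lh.
have [x1|x1] := leP a 0; have [x2|x2] := leP (a + b) 0;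
 have [x3|x3] := leP (- a) 0; have [x4|x4] := leP (- (a + b)) 0; nra.
Qed.

(** If u exceeded W somewhere, u - W - d (y^2 + K t) would have a positive maximum, attained because
    u is bounded above and W below, and attained at a positive time because of the initial ordering.
    There W plus the penalty plus a constant touches u from above, and K > shi^2 contradicts the
    viscosity inequality. *)
Lemma subsol_le_smooth (slo shi : R) (u W pt px pxx : R -> R -> R) (C m : R) :
  0 <= slo -> slo <= shi ->
  visc_subsol slo shi u ->
  cont2 (fun t y => u (Num.max t 0) y) ->
  (forall t y, 0 <= t -> u t y <= C) ->
  smooth W pt px pxx -> cont2 W ->
  (forall t y, 0 <= t -> m <= W t y) ->
  (forall t y, 0 < t -> Gfun slo shi (pxx t y) <= pt t y) ->
  (forall y, u 0 y <= W 0 y) ->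
  forall t y, 0 <= t -> u t y <= W t y.
Proof.
move=> slo0 sloshi usub ucont uC Wsm Wcont Wm Wsup u0 t0 y0 t0ge0.
rewrite leNgt; apply/negP => uW.
pose D := u t0 y0 - W t0 y0; have D0 : 0 < D by rewrite subr_gt0.
pose K := shi ^+ 2 + 1; have K1 : 1 <= K by rewrite lerDr sqr_ge0.
pose E := y0 ^+ 2 + K * t0 + 1.
have E0 : 0 < E by rewrite ltr_wpDl// addr_ge0 ?sqr_ge0// mulr_ge0//; lra.
(* With this [d] the penalty at (t0, y0) is D/2 - d, so more than half of the gap D survives. *)
pose d := D / (2 * E); have d0 : 0 < d by rewrite divr_gt0// mulr_gt0.
pose Z t y := u (Num.max t 0) y - W t y - d * (y ^+ 2 + K * t).
have Zge t y : 0 <= t -> Z t y = u t y - W t y - d * (y ^+ 2 + K * t).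
  by move=> tge0; rewrite /Z (max_l tge0).
have Z0 : 0 < Z t0 y0.
  rewrite Zge// -/D (_ : d * _ = D / 2 - d); first lra.
  by rewrite /d /E; field; rewrite gt_eqF.
have cZ : cont2 Z.
  move=> z; apply: cvgB; first by apply: cvgB; [exact: ucont|exact: Wcont].
  apply: cvgM; first exact: cvg_cst.
  apply: cvgD; first by apply: cvgM; exact: cvg_snd.
  by apply: cvgM; [exact: cvg_cst|exact: cvg_fst].
(* Outside the box of size [r] the penalty exceeds C - m, which bounds u - W from above; so the
   maximum over the box is global, as the test functions require. *)
pose r := (C - m) / d + 1 + `|y0| + t0.
have Cm : 0 <= C - m by have := uC _ y0 t0ge0; have := Wm _ y0 t0ge0; lra.
have Cd : 0 <= (C - m) / d by rewrite divr_ge0// ltW.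
have y0n : 0 <= `|y0| by [].
pose A : set (R * R) := `[0, r] `*` `[- r, r].
have cA : compact A by apply: compact_setX; exact: segment_compact.
have inA : A (t0, y0).
  have := ler_norm y0; have := ler_norm (- y0); rewrite normrN => ? ?.
  by split; rewrite /= in_itv/= /r; apply/andP; split; lra.
have [|[ts ys] /set_mem[/= + +] Hmax] := @compact_EVT_max _ R
   (fun z : R * R => Z z.1 z.2) A (ex_intro _ _ inA) cA.
  exact: continuous_subspaceT.
rewrite !in_itv/= => /andP[ts0 tsr] /andP[ys0 ysr].
have Zs : 0 < Z ts ys by apply: lt_le_trans Z0 _; exact: (Hmax (t0, y0) (mem_set inA)).
have glob t y : 0 <= t -> Z t y <= Z ts ys.
  move=> tge0; have [[tr yr]|out] := pselect (t <= r /\ `|y| <= r).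
    apply: (Hmax (t, y)); apply/mem_set; split; rewrite /= in_itv/= ?tge0//.
    by rewrite -ler_norml.
  apply/ltW/(le_lt_trans _ Zs); rewrite Zge//.
  have : r <= y ^+ 2 + K * t.
    have [tr|rt] := leP t r.
      have : r <= `|y| by rewrite leNgt; apply/negP => /ltW yr; apply: out.
      move=> ry; have : 0 <= K * t by rewrite mulr_ge0//; lra.
      have : `|y| ^+ 2 = y ^+ 2 by rewrite real_normK// num_real.
      by move=> <-; have : 1 <= `|y|; rewrite /r in ry *; nra.
    have := sqr_ge0 y; nra.
  move=> H; have : d * r <= d * (y ^+ 2 + K * t) by rewrite ler_pM2l.
  have : (C - m) / d * d = C - m by rewrite divfK// gt_eqF.
  have := uC t y tge0; have := Wm t y tge0.
  have : (C - m) / d + 1 <= r by rewrite /r; lra.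
  by move=> ? ? ? ? ?; have : d * ((C - m) / d + 1) <= d * r; [rewrite ler_pM2l|lra].
have tspos : 0 < ts.
  rewrite lt_neqAle ts0 andbT eq_sym; apply/negP => /eqP ts00.
  move: Zs; rewrite ts00 Zge// mulr0 addr0.
  have := u0 ys; have : 0 <= d * ys ^+ 2 by rewrite mulr_ge0 ?sqr_ge0// ltW.
  lra.
have sm := smoothD Wsm (smooth_quad d K (Z ts ys)).
have H1 s z : 0 < s -> u s z <= W s z + (d * (z ^+ 2 + K * s) + Z ts ys).
  by move=> s0; have := glob s z (ltW s0); rewrite (Zge s z (ltW s0)); lra.
have H2 : u ts ys = W ts ys + (d * (ys ^+ 2 + K * ts) + Z ts ys).
  by rewrite [in RHS](Zge ts ys ts0); lra.
have := usub ts ys _ tspos (smooth_C12 sm) H1 H2.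
apply/negP; rewrite -ltNge.
have [-> _ ->] := smooth_dt ys sm tspos.
have := @Gfun_add slo shi (pxx ts ys) (2 * d) slo0 sloshi.
have := Wsup ts ys tspos; rewrite /K.
have := sqr_ge0 shi; nra.
Qed.

End Smooth.

(** * Restarting at a later time; the two linear equations behind G *)

Section Restart.
Context {R : realType}.
Local Notation isd f x d := (is_derive (x : R) (1 : R) (f : R -> R) (d : R)).
Local Notation cont2_at f t y :=
  ({for ((t : R), (y : R)), continuous (fun z : R * R => (f : R -> R -> R) z.1 z.2)}).
Local Notation cont2 f := (continuous (fun z : R * R => (f : R -> R -> R) z.1 z.2)).

Lemma is_deriveP (f : R -> R) (x d : R) : isd f x d <->
  forall e, 0 < e -> exists2 r, 0 < r &
    forall h, `|h| < r -> `|f (x + h) - f x - h * d| <= e * `|h|.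
Proof.
split=> [[+ <-] e e0|H].
  move=> /cvgrPdist_le/= /(_ e e0).
  move=> /nbhs_ballP[r r0 rH]; exists r => // h hr.
  have [->|h0] := eqVneq h 0; first by rewrite addr0 subrr mul0r subrr normr0 mulr0.
  have := rH h; rewrite /ball/= sub0r normrN => /(_ hr h0).
  rewrite /GRing.scale/= mulr1 (addrC h) => H.
  rewrite (_ : _ - _ - _ = - (h * ('D_1 f x - h^-1 * (f (x + h) - f x)))); last by field.
  by rewrite normrN normrM mulrC ler_wpM2r.
have cv : (fun h => h^-1 *: (f (h *: (1 : R) + x) - f x)) @ 0^' --> d.
  apply/cvgrPdist_le => e e0; have [r r0 rH] := H e e0.
  apply/nbhs_ballP; exists r => // h; rewrite /ball/= sub0r normrN => hr h0.
  have := rH h hr; rewrite /GRing.scale/= mulr1 (addrC h).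
  rewrite (_ : _ - _ - _ = - (h * (d - h^-1 * (f (x + h) - f x)))); last by field.
  by rewrite normrN normrM (mulrC e) ler_pM2l// normr_gt0.
split; first by apply/cvg_ex; exists d.
exact: cvg_lim cv.
Qed.

Lemma is_derive_quadratic (f : R -> R) (x d M : R) :
  (forall h, `|f (x + h) - f x - h * d| <= M * h ^+ 2) -> isd f x d.
Proof.
move=> H; apply/is_deriveP => e e0; exists (e / (`|M| + 1)).
  by rewrite divr_gt0// ltr_wpDl.
move=> h; rewrite ltr_pdivlMr ?ltr_wpDl// => hr; apply: le_trans (H h) _.
rewrite -real_normK ?num_real// expr2 mulrA ler_wpM2r//.
have := ler_norm M; have := normr_ge0 h; nra.
Qed.

Lemma is_derive_pos2 (x : R) : isd (fun x => Num.max x 0 ^+ 2) x (2 * Num.max x 0).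
Proof.
apply: (@is_derive_quadratic _ _ _ 1) => h; rewrite mul1r ler_norml.
have [x1|x1] := leP x 0; have [x2|x2] := leP (x + h) 0; apply/andP; split; nra.
Qed.

Lemma cont_max0 : continuous (fun x : R => Num.max x 0).
Proof. by move=> x; apply: continuous_max => //; exact: cvg_cst. Qed.

Lemma cont2_at_reparam (f : R -> R -> R) (th : R -> R) (t y : R) :
  cont2_at f (th t) y -> {for t, continuous th} ->
  cont2_at (fun s z => f (th s) z) t y.
Proof.
move=> /cont2_atP cf /cont_atP ct.
apply/(@cont2_atP _ (fun s z => f (th s) z)) => e e0.
have [d d0 dH] := cf e e0; have [r r0 rH] := ct d d0.
exists (Num.min d r); first by rewrite lt_min d0.
by move=> s z; rewrite !lt_min => /andP[_ sr] /andP[zd _]; apply: dH => //; exact: rH.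
Qed.

Lemma smooth_reparam (psi pt px pxx : R -> R -> R) (th dth : R -> R) :
  smooth psi pt px pxx ->
  (forall s, 0 < th s) -> (forall s, isd th s (dth s)) -> continuous dth ->
  smooth (fun s z => psi (th s) z) (fun s z => pt (th s) z * dth s)
         (fun s z => px (th s) z) (fun s z => pxx (th s) z).
Proof.
move=> sm th0 dthP cdth t y t0.
have [[h1 h2 h3] [c1 c2 c3]] := sm (th t) y (th0 t).
have ct : {for t, continuous th} by exact: is_derive_cont (dthP t).
split; split.
- exact: (@is_derive_compE _ (fun s => psi s y) th).
- exact: h2.
- exact: h3.
- apply: continuousM; first exact: (cont2_at_reparam c1).
  exact: (cont2_fst cdth).
- exact: (cont2_at_reparam c2).
- exact: (cont2_at_reparam c3).
Qed.

Lemma smooth_time (p dp : R -> R) : (forall s, isd p s (dp s)) -> continuous dp ->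
  smooth (fun s z => p s) (fun s z => dp s) (fun _ _ => 0) (fun _ _ => 0).
Proof.
move=> H c t y t0; split; split.
- exact: H.
- exact: is_derive_cst.
- exact: is_derive_cst.
- exact: (cont2_fst c).
- exact: cvg_cst.
- exact: cvg_cst.
Qed.

(* The test function touching the restarted function is reparametrized in time,
   so that it is defined for all positive times, and penalized away from the
   touching point. *)
Lemma subsol_restart (slo shi : R) (u : R -> R -> R) (C t0 : R) :
  visc_subsol slo shi u ->
  (forall t y, 0 <= t -> `|u t y| <= C) -> 0 <= t0 ->
  visc_subsol slo shi (fun t y => u (t0 + t) y).
Proof.
move=> usub uC t00 t y psi tpos psiC psiu psie.
have C0 : 0 <= C by apply: le_trans (uC 0 0 (lexx _)).
pose q := t / 4; have q0 : 0 < q by rewrite divr_gt0.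
(* [th] equals s - t0 from time t0 + q on and, by completing the square, stays positive before; so
   the test function can be evaluated at [th s] for every s. *)
pose th s := s - t0 + Num.max (t0 + q - s) 0 ^+ 2 / q.
pose dth s := 1 - 2 * Num.max (t0 + q - s) 0 / q.
have dmax c s : isd (fun s => Num.max (c - s) 0 ^+ 2) s (- (2 * Num.max (c - s) 0)).
  have ? := is_derive_pos2 (c - s).
  rewrite -mulrN1; apply: (@is_derive_compE _ (fun x => Num.max x 0 ^+ 2) (fun s => c - s)) => //.
  by apply: is_derive_eq; ring.
have thd s : isd th s (dth s).
  have ? := dmax (t0 + q) s.
  by apply: is_derive_eq; rewrite /dth /GRing.scale/=; field; rewrite gt_eqF.
have cm c : continuous (fun s : R => Num.max (c - s) 0).
  move=> s; apply: (@continuous_comp _ _ _ (fun s => c - s) (fun x => Num.max x 0)).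
    by apply: cvgB; [exact: cvg_cst|exact: cvg_id].
  exact: cont_max0.
have cdth : continuous dth.
  move=> s; apply: cvgB; first exact: cvg_cst.
  by apply: cvgMr_tmp; apply: cvgMl_tmp; exact: cm.
have thpos s : 0 < th s.
  rewrite /th; have [h|h] := leP (t0 + q - s) 0; first by rewrite expr0n/= mul0r; lra.
  pose x := t0 + q - s.
  rewrite (_ : _ + _ = ((x - q / 2) ^+ 2 + 3 / 4 * q ^+ 2) / q).
    by rewrite divr_gt0// ltr_wpDl ?sqr_ge0// mulr_gt0 ?exprn_gt0//; lra.
  by rewrite /x; field; rewrite gt_eqF.
(* The penalty [p] is at least 2C up to time t0 + q, where the reparametrized test function only
   bounds u at another time, and it vanishes from t0 + 2q on, in particular near the touching time
   t0 + 4q. *)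
pose K := 2 * C / q ^+ 2.
have K0 : 0 <= K by rewrite divr_ge0 ?sqr_ge0// mulr_ge0.
pose p s := K * Num.max (t0 + 2 * q - s) 0 ^+ 2.
pose dp s := K * - (2 * Num.max (t0 + 2 * q - s) 0).
have sp : smooth (fun s z => p s) (fun s z => dp s) (fun _ _ => 0) (fun _ _ => 0).
  have dpP s : isd p s (dp s).
    have ? := dmax (t0 + 2 * q) s.
    have H : isd (fun s => K * Num.max (t0 + 2 * q - s) 0 ^+ 2) s (dp s).
      by apply: is_derive_eq; rewrite /dp /GRing.scale/=; ring.
    exact: H.
  apply: (smooth_time dpP) => s.
  by apply: cvgMl_tmp; apply: cvgN; apply: cvgMl_tmp; exact: cm.
have sm := smoothD (smooth_reparam (C12_smooth psiC) thpos thd cdth) sp.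
have q4 : 4 * q = t by rewrite /q; field.
have m1 : Num.max (t0 + q - (t0 + t)) 0 = 0 by apply/max_idPr; lra.
have m2 : Num.max (t0 + 2 * q - (t0 + t)) 0 = 0 by apply/max_idPr; lra.
have tht : th (t0 + t) = t by rewrite /th m1 expr0n/= mul0r; lra.
have pt0 : p (t0 + t) = 0 by rewrite /p m2 expr0n/= mulr0.
have t0t : 0 < t0 + t by lra.
have H1 s z : 0 < s -> u s z <= psi (th s) z + p s.
  move=> s0; have [h|h] := leP (t0 + q - s) 0.
    have E : th s = s - t0.
      by rewrite /th; move/max_idPr: h => ->; rewrite expr0n/= mul0r addr0.
    rewrite E; have := psiu (s - t0) z; rewrite [t0 + _]addrC subrK => H.
    have /H : 0 < s - t0 by lra.
    have : 0 <= p s by rewrite mulr_ge0// sqr_ge0.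
    lra.
  have := psiu (th s) z (thpos s).
  have := uC s z (ltW s0); have := uC (t0 + th s) z.
  rewrite !ler_norml => /(_ _)/andP[|a1 a2 /andP[a3 a4]].
    by rewrite addr_ge0// ltW.
  suff : 2 * C <= p s by lra.
  rewrite /p (max_l _); last lra.
  have -> : 2 * C = K * q ^+ 2 by rewrite /K divfK// gt_eqF// exprn_gt0.
  by rewrite ler_wpM2l// ler_sqr ?nnegrE; lra.
have H2 : u (t0 + t) y = psi (th (t0 + t)) y + p (t0 + t).
  by rewrite tht pt0 addr0.
have := usub _ _ _ t0t (smooth_C12 sm) H1 H2.
have [-> _ ->] := smooth_dt y sm t0t.
by rewrite tht addr0 /dth m1 /dp m2 mulr0 mul0r subr0 mulr1 oppr0 mulr0 addr0.
Qed.

(** G(a) is at least s^2 a / 2 for both extreme volatilities s, so a supersolution for G is one for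
    both linear heat equations. The formulation through -U is the one that comparison from above can
    use. *)
Lemma supersol_opp (slo shi s : R) (U : R -> R -> R) :
  0 <= slo -> slo <= shi -> s = slo \/ s = shi ->
  visc_supersol slo shi U -> visc_subsol s s (fun t y => - U t y).
Proof.
move=> slo0 sloshi ss Us t y psi t0 psiC psiU psie.
have sm := C12_smooth psiC; have smN := smoothN sm.
have H1 r z : 0 < r -> - psi r z <= U r z by move=> r0; have := psiU r z r0; lra.
have H2 : U t y = - psi t y by lra.
have := Us _ _ _ t0 (smooth_C12 smN) H1 H2.
have [-> _ ->] := smooth_dt y smN t0.
set a := dt psi t y; set b := dyy psi t y; rewrite /Gfun opprK.
have : slo ^+ 2 <= shi ^+ 2 by rewrite ler_sqr ?nnegrE ?(le_trans slo0).
have : 0 <= slo ^+ 2 by exact: sqr_ge0.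
by case: ss => ->; move: (slo ^+ 2) (shi ^+ 2) => l h l0 lh;
  have [x1|x1] := leP b 0; have [x2|x2] := leP (- b) 0; nra.
Qed.

Lemma Gfun_diag (s b : R) : Gfun s s b = 2^-1 * s ^+ 2 * b.
Proof.
by rewrite /Gfun; have [x1|x1] := leP b 0; have [x2|x2] := leP (- b) 0; nra.
Qed.

(** G is the larger of its two linear branches; this is the way back from the two linear equations
    to G. *)
Lemma Gfun_le_diag (slo shi b c : R) :
  2^-1 * slo ^+ 2 * b <= c -> 2^-1 * shi ^+ 2 * b <= c -> Gfun slo shi b <= c.
Proof.
by rewrite /Gfun; have [x1|x1] := leP b 0; have [x2|x2] := leP (- b) 0; nra.
Qed.

End Restart.

(** * Averages over an interval *)

Section Average.
Context {R : realType}.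
Local Notation isd f x d := (is_derive (x : R) (1 : R) (f : R -> R) (d : R)).
Local Notation cont2_at f t y :=
  ({for ((t : R), (y : R)), continuous (fun z : R * R => (f : R -> R -> R) z.1 z.2)}).
Local Notation cont2 f := (continuous (fun z : R * R => (f : R -> R -> R) z.1 z.2)).

Lemma unif_cont2 (f : R -> R -> R) (a e : R) : cont2 f -> 0 < e ->
  exists2 d, 0 < d & forall t s y z, `|t| <= a -> `|y| <= a ->
    `|s - t| < d -> `|z - y| < d -> `|f s z - f t y| < e.
Proof.
move=> cf e0.
pose K : set (R * R) := `[- a, a] `*` `[- a, a].
have cK : compact K by apply: compact_setX; exact: segment_compact.
pose P (d : R) (x : R * R) := forall s z, `|s - x.1| < d -> `|z - x.2| < d ->
   `|f s z - f x.1 x.2| < e.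
have /compact_near_coveringP/(_ R (0^'+) P _) := cK.
case=> [[t y] _|r r0 H].
  have e2 : 0 < e / 2 by rewrite divr_gt0.
  have /cont2_atP/(_ _ e2)[d d0 dH] := cf (t, y).
  have d2 : 0 < d / 2 by rewrite divr_gt0.
  exists (ball (t, y) (d / 2), [set r | r < d / 2]).
    split; first exact: nbhsx_ballx.
    by apply: nbhs_right_lt.
  move=> [[t' y'] r] [/= [+ +] rd] s z; rewrite /ball/= => tt yy sr zr.
  have := dH t' y'; have := dH s z => /=.
  have h1 : `|s - t| < d.
    rewrite (_ : s - t = (s - t') - (t - t')); last by ring.
    by apply: le_lt_trans (ler_normB _ _) _; lra.
  have h2 : `|z - y| < d.
    rewrite (_ : z - y = (z - y') - (y - y')); last by ring.
    by apply: le_lt_trans (ler_normB _ _) _; lra.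
  have h3 : `|t' - t| < d by rewrite distrC; lra.
  have h4 : `|y' - y| < d by rewrite distrC; lra.
  move=> /(_ h1 h2) g1 /(_ h3 h4) g2.
  rewrite (_ : _ - _ = (f s z - f t y) - (f t' y' - f t y)); last by ring.
  by apply: le_lt_trans (ler_normB _ _) _; lra.
exists (r / 2); first by rewrite divr_gt0.
have r20 : 0 < r / 2 by rewrite divr_gt0.
have r2 : (ball_ Num.norm 0 r) (r / 2).
  by rewrite /ball_/= sub0r normrN gtr0_norm//; lra.
move=> t s y z ta ya; apply: (H (r / 2) r2 r20 (t, y)).
by split; rewrite /= in_itv/= -ler_norml.
Qed.

Definition antiderivative (f : R -> R) : R -> R :=
  xget (fun=> 0) [set F : R -> R | forall x, isd F x (f x)].

Lemma antiderivativeP (f : R -> R) : continuous f ->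
  forall x, isd (antiderivative f) x (f x).
Proof.
move=> cf; have [F HF] := antiderivative_ex cf.
exact: (@xgetPex _ (fun=> 0) [set F : R -> R | forall x, isd F x (f x)] (ex_intro _ F HF)).
Qed.

(** The mean of f over [y, y + h]. With primitives in place of the Lebesgue integral, linearity,
    monotonicity and differentiation follow from the rules of calculus and the mean value
    theorem. *)
Definition avg (h : R) (f : R -> R) (y : R) : R :=
  (antiderivative f (y + h) - antiderivative f y) / h.

Section avg.
Variable h : R.
Hypothesis h0 : 0 < h.

Lemma avgE (f F : R -> R) (y : R) : (forall x, isd F x (f x)) ->
  avg h f y = (F (y + h) - F y) / h.
Proof.
move=> HF; have cf : exists F : R -> R, forall x, isd F x (f x) by exists F.
have HA := @xgetPex _ (fun=> 0) [set F : R -> R | forall x, isd F x (f x)] cf.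
rewrite /avg -/(antiderivative f) in HA *; congr (_ / _).
have HD x : isd (fun x => antiderivative f x - F x) x 0.
  by have ? := HA x; have ? := HF x; apply: is_derive_eq; rewrite subrr.
have [|c _] := @mvt_le _ _ _ y (y + h) _ HD; first by rewrite lerDl ltW.
by rewrite mul0r; lra.
Qed.

Lemma avgD (f g : R -> R) (y : R) : continuous f -> continuous g ->
  avg h (fun x => f x + g x) y = avg h f y + avg h g y.
Proof.
move=> /antiderivativeP Hf /antiderivativeP Hg.
rewrite (@avgE _ (fun x => antiderivative f x + antiderivative g x)).
by rewrite /avg; field; rewrite gt_eqF.
Qed.

Lemma avgZ (c : R) (f : R -> R) (y : R) : continuous f ->
  avg h (fun x => c * f x) y = c * avg h f y.
Proof.
move=> /antiderivativeP Hf; rewrite (@avgE _ (fun x => c * antiderivative f x)).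
by rewrite /avg; field; rewrite gt_eqF.
Qed.

Lemma avg_cst (c y : R) : avg h (fun=> c) y = c.
Proof.
have H x : isd (fun x => c * x) x c.
  by apply: is_derive_eq; rewrite /GRing.scale/=; ring.
by rewrite (avgE y H); field; rewrite gt_eqF.
Qed.

Lemma avg_shift (a : R) (f : R -> R) (y : R) : continuous f ->
  avg h (fun x => f (x + a)) y = avg h f (y + a).
Proof.
move=> /antiderivativeP Hf.
have H x : isd (fun x => antiderivative f (x + a)) x (f (x + a)).
  have H : isd (fun x => antiderivative f (a + x)) x (f (a + x)).
    exact: is_derive_addl.
  by apply: is_derive_ext H _ _ => [z|]; rewrite addrC.
by rewrite (avgE y H) /avg addrAC.
Qed.

Lemma avg_derive (f : R -> R) (y : R) : continuous f ->
  isd (avg h f) y ((f (y + h) - f y) / h).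
Proof.
move=> cf; have Hf := antiderivativeP cf.
have Hs : isd (fun x => antiderivative f (x + h)) y (f (y + h)).
  have H : isd (fun x => antiderivative f (h + x)) y (f (h + y)).
    exact: is_derive_addl.
  by apply: is_derive_ext H _ _ => [z|]; rewrite addrC.
have ? := Hf y.
have H : isd (fun x => h^-1 * (antiderivative f (x + h) - antiderivative f x)) y
    (h^-1 * (f (y + h) - f y)).
  by apply: is_derive_eq; rewrite /GRing.scale/=; ring.
by apply: is_derive_ext H _ _ => [z|]; rewrite mulrC.
Qed.

Lemma avg_cont (f : R -> R) : continuous f -> continuous (avg h f).
Proof. by move=> cf y; exact: is_derive_cont (avg_derive y cf). Qed.

Lemma avg_le (f g : R -> R) (y : R) : continuous f -> continuous g ->
  (forall z, y <= z <= y + h -> f z <= g z) -> avg h f y <= avg h g y.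
Proof.
move=> /antiderivativeP Hf /antiderivativeP Hg fg.
rewrite /avg ler_pM2r ?invr_gt0//.
have HD x : isd (fun x => antiderivative g x - antiderivative f x) x (g x - f x).
  by have ? := Hf x; have ? := Hg x; apply: is_derive_eq.
have : y <= y + h by rewrite lerDl ltW.
move=> /is_derive_nondecr/(_ HD); rewrite -subr_ge0 => /(_ _)/=.
have E : forall x, y <= x <= y + h -> 0 <= g x - f x by move=> x /fg; lra.
by move=> /(_ E); lra.
Qed.

Lemma avg_bnd (f : R -> R) (y m M : R) : continuous f ->
  (forall z, y <= z <= y + h -> m <= f z <= M) -> m <= avg h f y <= M.
Proof.
move=> cf H; have cc c : continuous (fun _ : R => c : R) by move=> x; exact: cvg_cst.
apply/andP; split.
  by rewrite -(avg_cst m y); apply: avg_le => // z /H/andP[].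
by rewrite -(avg_cst M y); apply: avg_le => // z /H/andP[].
Qed.

Lemma avg_norm (f : R -> R) (y M : R) : continuous f ->
  (forall z, y <= z <= y + h -> `|f z| <= M) -> `|avg h f y| <= M.
Proof.
by move=> cf H; rewrite ler_norml; apply: avg_bnd => // z zy; rewrite -ler_norml H.
Qed.

Lemma cont2_avg (f : R -> R -> R) : cont2 f -> cont2 (fun t => avg h (f t)).
Proof.
move=> cf; case=> t y; apply/(@cont2_atP _ (fun t => avg h (f t))) => e e0.
have e2 : 0 < e / 2 by rewrite divr_gt0.
have cx s : continuous (f s) by move=> z; exact: cont2_x (cf (s, z)).
have hp := h0.
have [d1 d10 H1] := (cont_atP (avg h (f t)) y).1 (avg_cont (cx t) (x := y)) _ e2.
have [d2 d20 H2] := @unif_cont2 f (`|t| + `|y| + 1 + h) _ cf e2.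
have t0 := normr_ge0 t; have y0 := normr_ge0 y.
exists (Num.min d2 (Num.min d1 1)); first by rewrite !lt_min d20 d10 ltr01.
move=> s z; rewrite !lt_min => /and3P[sd2 _ _] /and3P[_ zd1 z1].
have -> : avg h (f s) z - avg h (f t) y =
   avg h (fun x => f s x + -1 * f t x) z + (avg h (f t) z - avg h (f t) y).
  rewrite avgD ?avgZ//; first ring.
  by move=> x; apply: cvgMl_tmp; exact: cx.
apply: le_lt_trans (ler_normD _ _) _.
suff : `|avg h (fun x => f s x + -1 * f t x) z| <= e / 2 by have := H1 _ zd1; lra.
apply: avg_norm.
  by move=> x; apply: cvgD; [exact: cx|apply: cvgMl_tmp; exact: cx].
move=> x xz; rewrite mulN1r; apply/ltW/H2; rewrite ?subrr ?normr0//; first lra.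
have : `|x| <= `|y| + 1 + h; last lra.
move: z1 xz; rewrite ltr_norml => /andP[? ?] /andP[? ?].
have := ler_norm y; have := ler_norm (- y); rewrite normrN => ? ?.
by rewrite ler_norml; apply/andP; split; lra.
Qed.

(** Differentiation under the average: uniform continuity of [ft] near a compact set makes the
    difference quotients of f converge uniformly over the interval of averaging. *)
Lemma avg_derive_param (f ft : R -> R -> R) : cont2 f -> cont2 ft ->
  (forall t y, isd (fun s => f s y) t (ft t y)) ->
  forall t y, isd (fun s => avg h (f s) y) t (avg h (ft t) y).
Proof.
move=> cf cft H t y; apply/is_deriveP => e e0.
have cx s : continuous (f s) by move=> z; exact: cont2_x (cf (s, z)).
have ctx s : continuous (ft s) by move=> z; exact: cont2_x (cft (s, z)).
have [d d0 Hd] := @unif_cont2 ft (`|t| + `|y| + h) _ cft e0.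
have t0 := normr_ge0 t; have y0 := normr_ge0 y; have hp := h0.
exists d => // r rd.
have -> : avg h (f (t + r)) y - avg h (f t) y - r * avg h (ft t) y =
   avg h (fun x => f (t + r) x + (-1 * f t x + (- r) * ft t x)) y.
  rewrite avgD ?avgD ?avgZ//; first ring; move=> x.
  - by apply: cvgMl_tmp; exact: cx.
  - by apply: cvgMl_tmp; exact: ctx.
  - by apply: cvgD; apply: cvgMl_tmp; [exact: cx|exact: ctx].
apply: avg_norm.
  move=> x; apply: cvgD; first exact: cx.
  by apply: cvgD; apply: cvgMl_tmp; [exact: cx|exact: ctx].
move=> x /andP[yx xy].
have HD s : isd (fun s => f (t + s) x - s * ft t x) s (ft (t + s) x - ft t x).
  have ? : isd (fun s => f (t + s) x) s (ft (t + s) x).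
    exact: (@is_derive_addl _ (fun s => f s x)).
  by apply: is_derive_eq; rewrite /GRing.scale/=; ring.
have := @mvt_norm _ _ _ e 0 r HD.
rewrite !subr0 mul0r subr0 addr0 => /(_ _).
rewrite (_ : f (t + r) x + (_ + _) = f (t + r) x - r * ft t x - f t x); last by ring.
apply=> s; rewrite subr0 => sr; apply/ltW/Hd.
- lra.
- have := ler_norm y; have := ler_norm (- y); rewrite normrN => ? ?.
  by rewrite ler_norml; apply/andP; split; lra.
- by rewrite addrAC subrr add0r; exact: le_lt_trans rd.
- by rewrite subrr normr0.
Qed.

End avg.
End Average.

(** * Random walks as discrete heat flows *)

Section RandomWalk.
Context {R : realType}.
Local Notation isd f x d := (is_derive (x : R) (1 : R) (f : R -> R) (d : R)).
Local Notation cont2_at f t y :=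
  ({for ((t : R), (y : R)), continuous (fun z : R * R => (f : R -> R -> R) z.1 z.2)}).
Local Notation cont2 f := (continuous (fun z : R * R => (f : R -> R -> R) z.1 z.2)).

Definition rw (k : R) (f : R -> R) (y : R) : R := 2^-1 * (f (y + k) + f (y - k)).

Lemma rw_le k f g : (forall y, f y <= g y) -> forall y, rw k f y <= rw k g y.
Proof. by move=> fg y; rewrite /rw ler_wpM2l// ?invr_ge0// lerD. Qed.

Lemma iter_rw_le n k f g : (forall y, f y <= g y) ->
  forall y, iter n (rw k) f y <= iter n (rw k) g y.
Proof. by elim: n => [//|n IH] fg y /=; apply: rw_le => z; exact: IH. Qed.

(** The walk acts exactly on quadratics: n steps of length k add the variance n k^2. This carries a
    quadratic penalty through any number of steps without loss. *)
Lemma iter_rw_quad n k f (d c : R) y :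
  iter n (rw k) (fun x => f x - d * x ^+ 2 - c) y =
  iter n (rw k) f y - d * (y ^+ 2 + n%:R * k ^+ 2) - c.
Proof.
elim: n y => [|n IH] y /=; first by rewrite mul0r addr0.
by rewrite {1}/rw !IH {3}/rw -natr1; field.
Qed.

Lemma iter_rw_cont n k f : continuous f -> continuous (iter n (rw k) f).
Proof.
move=> cf; elim: n => [//|n IH] y /=.
apply: cvgMl_tmp; apply: cvgD.
- apply: (@continuous_comp _ _ _ (fun y => y + k) (iter n (rw k) f)); last exact: IH.
  by apply: cvgD; [exact: cvg_id|exact: cvg_cst].
- apply: (@continuous_comp _ _ _ (fun y => y - k) (iter n (rw k) f)); last exact: IH.
  by apply: cvgB; [exact: cvg_id|exact: cvg_cst].
Qed.

Lemma rw_derive k (f f1 : R -> R) : (forall x, isd f x (f1 x)) ->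
  forall x, isd (rw k f) x (rw k f1 x).
Proof.
move=> H x; have sh a : isd (fun z => f (z + a)) x (f1 (x + a)).
  have H1 : isd (fun x => f (a + x)) x (f1 (a + x)) by exact: is_derive_addl.
  by apply: is_derive_ext H1 _ _ => [z|]; rewrite addrC.
have ? := sh k; have ? := sh (- k).
have H1 : isd (fun z => 2^-1 * (f (z + k) + f (z - k))) x (rw k f1 x).
  by apply: is_derive_eq; rewrite /rw /GRing.scale/=; ring.
exact: H1.
Qed.

(** Four derivatives under a common bound. The walk averages translates, so it preserves this class
    with the same B, and the errors of successive steps merely add up. *)
Definition c4 (B : R) (g g1 g2 g3 g4 : R -> R) :=
  [/\ forall x, isd g x (g1 x), forall x, isd g1 x (g2 x),
      forall x, isd g2 x (g3 x) & forall x, isd g3 x (g4 x)] /\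
  [/\ continuous g4, forall x, `|g x| <= B, forall x, `|g2 x| <= B,
      forall x, `|g3 x| <= B & forall x, `|g4 x| <= B].

Lemma c4_rw B k g g1 g2 g3 g4 : c4 B g g1 g2 g3 g4 ->
  c4 B (rw k g) (rw k g1) (rw k g2) (rw k g3) (rw k g4).
Proof.
move=> [[d1 d2 d3 d4] [c b0 b2 b3 b4]].
have bn (f : R -> R) : (forall x, `|f x| <= B) -> forall x, `|rw k f x| <= B.
  move=> H x; rewrite /rw normrM ger0_norm ?invr_ge0//.
  have := H (x + k); have := H (x - k); have := ler_normD (f (x + k)) (f (x - k)).
  lra.
split; split.
- exact: rw_derive.
- exact: rw_derive.
- exact: rw_derive.
- exact: rw_derive.
- exact: (@iter_rw_cont 1).
- exact: bn.
- exact: bn.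
- exact: bn.
- exact: bn.
Qed.

Lemma c4_rwn B k g g1 g2 g3 g4 n : c4 B g g1 g2 g3 g4 ->
  c4 B (iter n (rw k) g) (iter n (rw k) g1) (iter n (rw k) g2)
       (iter n (rw k) g3) (iter n (rw k) g4).
Proof. by move=> H; elim: n => [//|n IH] /=; exact: c4_rw. Qed.

Lemma rw_taylor B k g g1 g2 g3 g4 y : c4 B g g1 g2 g3 g4 -> 0 <= k ->
  `|rw k g y - g y - 2^-1 * k ^+ 2 * g2 y| <= B * k ^+ 3.
Proof.
move=> [[d1 d2 d3 d4] [c b0 b2 b3 b4]] k0.
have := taylor2 d1 d2 d3 b3 y k; have := taylor2 d1 d2 d3 b3 y (- k).
rewrite normrN (ger0_norm k0) sqrrN => h1 h2.
rewrite (_ : _ - _ - _ = 2^-1 * ((g (y + k) - g y - k * g1 y - 2^-1 * k ^+ 2 * g2 y) +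
   (g (y + - k) - g y - - k * g1 y - 2^-1 * k ^+ 2 * g2 y))); last by rewrite /rw; field.
rewrite normrM ger0_norm ?invr_ge0//.
apply: (@le_trans _ _ (2^-1 * (B * k ^+ 3 + B * k ^+ 3))); last lra.
by rewrite ler_wpM2l ?invr_ge0// (le_trans (ler_normD _ _))// lerD.
Qed.

Lemma c4_contx B g g1 g2 g3 g4 : c4 B g g1 g2 g3 g4 ->
  [/\ continuous g, continuous g1, continuous g2 & continuous g3].
Proof.
move=> [[d1 d2 d3 d4] _]; split=> x.
- exact: is_derive_cont (d1 x).
- exact: is_derive_cont (d2 x).
- exact: is_derive_cont (d3 x).
- exact: is_derive_cont (d4 x).
Qed.

Section heat.
Variables (s : R) (U : R -> R -> R) (C : R).
Let a := 2^-1 * s ^+ 2.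
Hypothesis s0 : 0 <= s.
Hypothesis HU : visc_subsol s s (fun t y => - U t y).
Hypothesis UC : forall t y, 0 <= t -> `|U t y| <= C.
Hypothesis Ucont : cont2 (fun t y => U (Num.max t 0) y).

(* [g + a t g'' - M t^2] is a subsolution of the heat equation for [M] large. *)
Lemma heat_step_smooth B g g1 g2 g3 g4 t0 d c r : c4 B g g1 g2 g3 g4 ->
  0 <= t0 -> 0 <= d -> 0 <= r ->
  (forall y, g y - d * y ^+ 2 - c <= U t0 y) ->
  forall y, g y + a * r * g2 y - (a ^+ 2 * B + 1) * r ^+ 2
     - d * (y ^+ 2 + 2 * a * r) - c <= U (t0 + r) y.
Proof.
move=> Hg t00 d0 r0 gU.
have [cg cg1 cg2 cg3] := c4_contx Hg.
have [[d1 d2 d3 d4] [cg4 b0 b2 b3 b4]] := Hg.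
have a0 : 0 <= a by rewrite mulr_ge0 ?invr_ge0// sqr_ge0.
have B0 : 0 <= B by apply: le_trans (b0 0).
pose M := a ^+ 2 * B + 1.
have M1 : 1 <= M by rewrite lerDr mulr_ge0// sqr_ge0.
pose W (t y : R) := - (g y + a * t * g2 y - M * t ^+ 2 - d * (y ^+ 2 + 2 * a * t) - c).
pose Wt (t y : R) := - (a * g2 y - 2 * M * t - 2 * a * d).
pose Wx (t y : R) := - (g1 y + a * t * g3 y - 2 * d * y).
pose Wxx (t y : R) := - (g2 y + a * t * g4 y - 2 * d).
have cs2 (h : R -> R) : continuous h -> forall z : R * R, (fun z : R * R => h z.2) x @[x --> z] --> h z.2.
  by move=> /cont2_snd H z; exact: H.
have f1 (z : R * R) : (fun z : R * R => z.1) x @[x --> z] --> z.1 by exact: cvg_fst.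
have f2 (z : R * R) : (fun z : R * R => z.2) x @[x --> z] --> z.2 by exact: cvg_snd.
have ct (b : R) : forall z : R * R, (fun z : R * R => b) x @[x --> z] --> b.
  by move=> z; exact: cvg_cst.
have cW : cont2 W.
  move=> z; apply: cvgN; apply: cvgB (ct _ _); apply: cvgB; last first.
    apply: cvgM (ct _ _) _; apply: cvgD; first by apply: cvgM; exact: f2.
    by apply: cvgM (ct _ _) (f1 _).
  apply: cvgB; last by apply: cvgM (ct _ _) _; apply: cvgM; exact: f1.
  apply: cvgD; first exact: cs2.
  by apply: cvgM; [apply: cvgM (ct _ _) (f1 _)|exact: cs2].
have cWt : cont2 Wt.
  move=> z; apply: cvgN; apply: cvgB (ct _ _); apply: cvgB.
    by apply: cvgM (ct _ _) _; exact: cs2.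
  by apply: cvgM (ct _ _) (f1 _).
have cWx : cont2 Wx.
  move=> z; apply: cvgN; apply: cvgB; last by apply: cvgM (ct _ _) (f2 _).
  apply: cvgD; first exact: cs2.
  by apply: cvgM; [apply: cvgM (ct _ _) (f1 _)|exact: cs2].
have cWxx : cont2 Wxx.
  move=> z; apply: cvgN; apply: cvgB (ct _ _).
  apply: cvgD; first exact: cs2.
  by apply: cvgM; [apply: cvgM (ct _ _) (f1 _)|exact: cs2].
have Wsm : smooth W Wt Wx Wxx.
  move=> t y t0'; split; split; last 3 first.
  - exact: cWt.
  - exact: cWx.
  - exact: cWxx.
  - have H : isd (fun t => - (g y + a * t * g2 y - M * t ^+ 2 - d * (y ^+ 2 + 2 * a * t) - c)) t (Wt t y).
      by apply: is_derive_eq; rewrite /Wt /GRing.scale/=; ring.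
    exact: H.
  - have ? := d1 y; have ? := d3 y.
    have H : isd (fun y => - (g y + a * t * g2 y - M * t ^+ 2 - d * (y ^+ 2 + 2 * a * t) - c)) y (Wx t y).
      by apply: is_derive_eq; rewrite /Wx /GRing.scale/=; ring.
    exact: H.
  - have ? := d2 y; have ? := d4 y.
    have H : isd (fun y => - (g1 y + a * t * g3 y - 2 * d * y)) y (Wxx t y).
      by apply: is_derive_eq; rewrite /Wxx /GRing.scale/=; ring.
    exact: H.
have restart := subsol_restart HU (C := C) _ t00.
have ucont : cont2 (fun t y => - U (t0 + Num.max t 0) y).
  move=> [t y]; apply: cvgN.
  have H0 : cont2_at (fun t y => U (Num.max t 0) y) (t0 + Num.max t 0) y.
    exact: Ucont.
  have := @cont2_at_reparam _ (fun t y => U (Num.max t 0) y)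
    (fun t => t0 + Num.max t 0) t y H0.
  have -> : (fun z : R * R => U (Num.max (t0 + Num.max z.1 0) 0) z.2) =
    (fun z : R * R => U (t0 + Num.max z.1 0) z.2).
    apply/funext => q; rewrite (max_l (_ : 0 <= t0 + _))//.
    by rewrite addr_ge0// le_max lexx orbT.
  apply; apply: cvgD; first exact: cvg_cst.
  exact: cont_max0.
have HH := @subsol_le_smooth _ s s (fun t y => - U (t0 + t) y) W Wt Wx Wxx C
  (- B - (a * B) ^+ 2 + c) s0 (lexx _).
move=> y; rewrite -/M -lerN2; apply: HH => //.
- by apply: restart => t z t1; rewrite normrN UC.
- move=> t z t1; have := UC z (addr_ge0 t00 t1).
  by rewrite ler_norml => /andP[? _]; lra.
- move=> t z t1; rewrite /W.
  have := b0 z; have := b2 z; rewrite !ler_norml => /andP[p1 p2] /andP[p3 p4].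
  have : 0 <= d * (z ^+ 2 + 2 * a * t).
    by rewrite mulr_ge0// addr_ge0 ?sqr_ge0// !mulr_ge0.
  have : a * t * g2 z <= a * t * B by rewrite ler_wpM2l// mulr_ge0.
  have : 0 <= (t - a * B / 2) ^+ 2 by exact: sqr_ge0.
  have : t ^+ 2 <= M * t ^+ 2 by rewrite ler_peMl// sqr_ge0.
  have : 0 <= (a * B) ^+ 2 by exact: sqr_ge0.
  nra.
- move=> t z t1; rewrite Gfun_diag -/a /Wt /Wxx.
  have := b4 z; rewrite ler_norml => /andP[p1 p2].
  have : 0 <= a ^+ 2 * t * (B + g4 z) by rewrite !mulr_ge0 ?sqr_ge0 ?(ltW t1)//; lra.
  have : 0 <= a ^+ 2 * t * B by rewrite !mulr_ge0 ?sqr_ge0 ?(ltW t1).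
  rewrite /M; lra.
- move=> z; rewrite addr0 /W lerN2 expr0n/= !mulr0 mul0r !addr0 subr0; exact: gU.
Qed.

(** The variance k^2 = s^2 r of one walk step matches the time step r, so the step agrees with the
    explicit subsolution up to order k^3. *)
Lemma heat_step B g g1 g2 g3 g4 t0 d c r k : c4 B g g1 g2 g3 g4 ->
  0 <= t0 -> 0 <= d -> 0 <= r -> 0 <= k -> k ^+ 2 = 2 * a * r ->
  (forall y, g y - d * y ^+ 2 - c <= U t0 y) ->
  forall y, rw k g y - d * y ^+ 2 - (c + d * k ^+ 2 + B * k ^+ 3
     + (a ^+ 2 * B + 1) * r ^+ 2) <= U (t0 + r) y.
Proof.
move=> Hg t00 d0 r0 k0 kr gU y.
apply: le_trans (heat_step_smooth Hg t00 d0 r0 gU y).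
have := rw_taylor y Hg k0; rewrite ler_norml kr => /andP[_ ?].
rewrite -!kr in gU *; lra.
Qed.

Lemma heat_steps B g g1 g2 g3 g4 t0 d c r k n : c4 B g g1 g2 g3 g4 ->
  0 <= t0 -> 0 <= d -> 0 <= r -> 0 <= k -> k ^+ 2 = 2 * a * r ->
  (forall y, g y - d * y ^+ 2 - c <= U t0 y) ->
  forall y, iter n (rw k) g y - d * y ^+ 2 - (c + n%:R * (d * k ^+ 2 + B * k ^+ 3
     + (a ^+ 2 * B + 1) * r ^+ 2)) <= U (t0 + n%:R * r) y.
Proof.
move=> Hg t00 d0 r0 k0 kr gU; elim: n => [|n IH] y.
  by rewrite !mul0r !addr0; exact: gU.
have t0n : 0 <= t0 + n%:R * r by rewrite addr_ge0// mulr_ge0.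
have := heat_step (c4_rwn k n Hg) t0n d0 r0 k0 kr IH y.
rewrite (_ : t0 + n.+1%:R * r = t0 + n%:R * r + r); last by rewrite -natr1; ring.
by apply: le_trans; rewrite -natr1 /=; lra.
Qed.

End heat.
End RandomWalk.

(** * Mollification and the random walk inequality *)

Section Mollify.
Context {R : realType}.
Local Notation isd f x d := (is_derive (x : R) (1 : R) (f : R -> R) (d : R)).
Local Notation cont2_at f t y :=
  ({for ((t : R), (y : R)), continuous (fun z : R * R => (f : R -> R -> R) z.1 z.2)}).
Local Notation cont2 f := (continuous (fun z : R * R => (f : R -> R -> R) z.1 z.2)).

Definition dq (h : R) (f : R -> R) (y : R) : R := (f (y + h) - f y) / h.

Lemma dq_derive h (f f1 : R -> R) : (forall x, isd f x (f1 x)) ->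
  forall x, isd (dq h f) x (dq h f1 x).
Proof.
move=> H x; have ? : isd (fun z => f (z + h)) x (f1 (x + h)).
  have H1 : isd (fun x => f (h + x)) x (f1 (h + x)) by exact: is_derive_addl.
  by apply: is_derive_ext H1 _ _ => [z|]; rewrite addrC.
have ? := H x.
have H1 : isd (fun z => h^-1 * (f (z + h) - f z)) x (h^-1 * (f1 (x + h) - f1 x)).
  by apply: is_derive_eq; rewrite /GRing.scale/=; ring.
by apply: is_derive_ext H1 _ _ => [z|]; rewrite /dq mulrC.
Qed.

Lemma dq_norm h (f : R -> R) K : 0 < h -> (forall x, `|f x| <= K) ->
  forall x, `|dq h f x| <= K * (2 / h).
Proof.
move=> h0 H x; have hi : 0 <= h^-1 by rewrite invr_ge0 ltW.
rewrite /dq normrM (ger0_norm hi) mulrA ler_wpM2r//.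
by apply: le_trans (ler_normB _ _) _; have := H x; have := H (x + h); lra.
Qed.

Lemma dq_cont h (f : R -> R) : continuous f -> continuous (dq h f).
Proof.
move=> cf x; apply: cvgMr_tmp; apply: cvgB; last exact: cf.
apply: (@continuous_comp _ _ _ (fun y => y + h) f); last exact: cf.
by apply: cvgD; [exact: cvg_id|exact: cvg_cst].
Qed.

(** Each average gains one derivative, namely a difference quotient, at the price of a factor 2/h;
    four of them lead into [c4]. *)
Lemma avg4_c4 h (f : R -> R) K : 0 < h -> continuous f -> (forall x, `|f x| <= K) ->
  c4 (K * (1 + 2 / h) ^+ 4) (iter 4 (avg h) f) (dq h (iter 3 (avg h) f))
    (dq h (dq h (iter 2 (avg h) f))) (dq h (dq h (dq h (avg h f))))
    (dq h (dq h (dq h (dq h f)))).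
Proof.
move=> h0 cf fK; have K0 : 0 <= K by apply: le_trans (fK 0).
have ca n : continuous (iter n (avg h) f) by elim: n => //= n IH; exact: avg_cont.
have na n x : `|iter n (avg h) f x| <= K.
  by elim: n x => //= n IH x; apply: avg_norm => // z _; exact: IH.
have D g : continuous g -> forall x, isd (avg h g) x (dq h g x).
  by move=> cg x; exact: avg_derive.
pose q := 2 / h; have q0 : 0 <= q by rewrite divr_ge0// ltW.
have bq j x : (j <= 4)%N -> x <= K * q ^+ j -> x <= K * (1 + q) ^+ 4.
  move=> j4 /le_trans; apply; rewrite ler_wpM2l//.
  apply: (@le_trans _ _ ((1 + q) ^+ j)).
    by rewrite lerXn2r ?nnegrE//; lra.
  by rewrite ler_weXn2l//; lra.
split; split.
- by apply: D; exact: (ca 3).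
- by apply: dq_derive; apply: D; exact: (ca 2).
- by do 2 apply: dq_derive; apply: D; exact: (ca 1).
- by do 3 apply: dq_derive; apply: D; exact: (ca 0).
- by do 4 apply: dq_cont.
- by move=> x; apply: (@bq 0) => //; rewrite mulr1; exact: (na 4).
- move=> x; apply: (@bq 2) => //; rewrite (_ : K * q ^+ 2 = K * q * q); last by ring.
  by do 2 apply: dq_norm => //; exact: (na 2).
- move=> x; apply: (@bq 3) => //; rewrite (_ : K * q ^+ 3 = K * q * q * q); last by ring.
  by do 3 apply: dq_norm => //; exact: (na 1).
- move=> x; apply: (@bq 4) => //; rewrite (_ : K * q ^+ 4 = K * q * q * q * q); last by ring.
  by do 4 apply: dq_norm => //.
Qed.

Lemma iter_avg_bnd n h (f : R -> R) (y m M : R) : 0 < h -> continuous f ->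
  (forall z, y <= z <= y + n%:R * h -> m <= f z <= M) ->
  m <= iter n (avg h) f y <= M.
Proof.
move=> h0 cf; elim: n y => [|n IH] y H /=.
  by apply: H; rewrite mul0r addr0 lexx.
apply: avg_bnd => //.
  by move: (n); elim=> //= ? ?; exact: avg_cont.
move=> z /andP[yz zy]; apply: IH => w /andP[zw wz]; apply: H.
by rewrite -natr1 (le_trans yz)//=; lra.
Qed.

Lemma avg_iter_rw h n k (f : R -> R) y : 0 < h -> continuous f ->
  avg h (iter n (rw k) f) y = iter n (rw k) (avg h f) y.
Proof.
move=> h0 cf; elim: n y => //= n IH y.
have cn := @iter_rw_cont _ n k f cf.
have cs c : continuous (fun x => iter n (rw k) f (x + c)).
  move=> x; apply: (@continuous_comp _ _ _ (fun y => y + c) (iter n (rw k) f)); last exact: cn.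
  by apply: cvgD; [exact: cvg_id|exact: cvg_cst].
rewrite [LHS](@avgZ _ h h0 2^-1 (fun x => iter n (rw k) f (x + k) + iter n (rw k) f (x - k))).
  by rewrite avgD// !avg_shift// !IH.
by move=> x; apply: cvgD; exact: cs.
Qed.

Lemma avg_iter_rw_t h n k (f : R -> R -> R) t y : 0 < h -> cont2 f ->
  avg h (fun s => iter n (rw k) (f s) y) t =
  iter n (rw k) (fun y => avg h (fun s => f s y) t) y.
Proof.
move=> h0 cf; elim: n y => //= n IH y.
have cn z : continuous (fun s => iter n (rw k) (f s) z).
  elim: n z {IH} => [|n IH] z /=.
    by move=> s; exact: cont2_t (cf (s, z)).
  by move=> s; apply: cvgMl_tmp; apply: cvgD; exact: IH.
rewrite [LHS](@avgZ _ h h0 2^-1 (fun s => iter n (rw k) (f s) (y + k) + iter n (rw k) (f s) (y - k))).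
  by rewrite avgD// !IH.
by move=> x; apply: cvgD; exact: cn.
Qed.

(** The step length for which n steps carry the variance s^2 h of the heat flow over time h. *)
Definition kn (s h : R) (n : nat) : R := Num.sqrt (s ^+ 2 * h / n%:R).

Lemma sqr_kn s h n : 0 <= h -> kn s h n ^+ 2 = s ^+ 2 * h / n%:R.
Proof. by move=> h0; rewrite sqr_sqrtr// divr_ge0// mulr_ge0// sqr_ge0. Qed.

(** Discrete form of f(t + h) >= P_h f(t), with P the heat semigroup of volatility s, locally
    uniform and up to an error that vanishes as n grows. Unlike the viscosity inequality it is
    linear and translation invariant, so averages of f inherit it. *)
Definition rw_super (s h : R) (f : R -> R -> R) := forall T r e, 0 < e ->
  exists N, forall n t y, (N < n)%N -> 0 <= t -> t <= T -> `|y| <= r ->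
    iter n (rw (kn s h n)) (f t) y - e <= f (t + h) y.

Lemma cont2_swap (f : R -> R -> R) : cont2 f -> cont2 (fun t y => f y t).
Proof.
move=> cf [t y]; apply/(@cont2_atP _ (fun t y => f y t)) => e e0.
have H0 : cont2_at f y t by exact: cf.
have [d d0 dH] := (cont2_atP f y t).1 H0 e e0.
by exists d => // s z sd zd; exact: dH.
Qed.

Lemma rw_super_avg s h q f : 0 < q -> cont2 f -> rw_super s h f ->
  rw_super s h (fun t => avg q (f t)).
Proof.
move=> q0 cf H T r e e0; have [N HN] := H T (r + q) e e0.
have cx t : continuous (f t) by move=> z; exact: cont2_x (cf (t, z)).
have ci n k t : continuous (iter n (rw k) (f t)) by exact: iter_rw_cont.
exists N => n t y Nn t0 tT yr; rewrite -avg_iter_rw//.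
rewrite -[X in _ - X](avg_cst q0 e y) -mulN1r -avgZ//; last by move=> x; exact: cvg_cst.
have cc (c : R) : continuous (fun _ : R => c) by move=> x; exact: cvg_cst.
rewrite -avgD//; apply: avg_le => // [x|z /andP[yz zy]].
  by apply: cvgD; [exact: ci|exact: cc].
rewrite mulN1r; apply: HN => //.
move: yr; rewrite !ler_norml => /andP[? ?]; apply/andP; split; lra.
Qed.

Lemma rw_super_avg_t s h q f : 0 < q -> 0 <= h -> cont2 f -> rw_super s h f ->
  rw_super s h (fun t y => avg q (fun s => f s y) t).
Proof.
move=> q0 h0 cf H T r e e0; have [N HN] := H (T + q) r e e0.
have ct y : continuous (fun t => f t y) by move=> z; exact: cont2_t (cf (z, y)).
have ci n k y : continuous (fun t => iter n (rw k) (f t) y).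
  elim: n y => [|n IH] y /=; first exact: ct.
  by move=> t; apply: cvgMl_tmp; apply: cvgD; exact: IH.
exists N => n t y Nn t0 tT yr; rewrite -avg_iter_rw_t//.
have cc (c : R) : continuous (fun _ : R => c) by move=> x; exact: cvg_cst.
rewrite -[X in _ - X](avg_cst q0 e t) -mulN1r -avgZ//.
rewrite -avgD// -avg_shift//; apply: avg_le => // [x|x|z /andP[yz zy]].
- by apply: cvgD; [exact: ci|exact: cc].
- apply: (@continuous_comp _ _ _ (fun x => x + h) (fun t => f t y)); last exact: ct.
  by apply: cvgD; [exact: cvg_id|exact: cvg_cst].
- by rewrite mulN1r; apply: HN => //; lra.
Qed.

(** For fixed h, letting the number of steps grow gives f(t + h) >= f + h s^2 f''/2 - O(h^2);
    dividing by h and letting h tend to 0 gives the heat inequality. *)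
Lemma rw_super_heat s (f : R -> R -> R) ft B g1 g2 g3 g4 t y : 0 <= s -> 0 <= t ->
  (forall h, 0 < h -> rw_super s h f) ->
  isd (fun t => f t y) t ft -> c4 B (f t) g1 g2 g3 g4 ->
  2^-1 * s ^+ 2 * g2 y <= ft.
Proof.
move=> s0 t0 sup fd fc.
have [[d1 d2 d3 d4] [cg4 b0 b2 b3 b4]] := fc.
have B0 : 0 <= B by apply: le_trans (b0 0).
have main h : 0 < h -> f t y + 2^-1 * s ^+ 2 * h * g2 y - (s ^+ 2 * h) ^+ 2 * B <= f (t + h) y.
  move=> h0; apply/ler_addgt0Pr => e e0.
  have e2 : 0 < e / 2 by rewrite divr_gt0.
  have [N HN] := sup h h0 t `|y| _ e2.
  pose P := s ^+ 2 * h * B; have P0 : 0 <= P by rewrite !mulr_ge0 ?sqr_ge0// ltW.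
  have [n Nn nk] : exists2 n, (N < n)%N & P * kn s h n <= e / 2.
    pose x := (P ^+ 2 * (s ^+ 2 * h)) / (e / 2) ^+ 2.
    have x0 : 0 <= x by rewrite divr_ge0 ?sqr_ge0// mulr_ge0 ?sqr_ge0// mulr_ge0 ?sqr_ge0// ltW.
    exists (maxn N (Num.truncn x)).+1; first by rewrite ltnS leq_maxl.
    set n := _.+1; have xn : x < n%:R.
      apply: lt_le_trans (truncnS_gt _) _; by rewrite ler_nat ltnS leq_maxr.
    have n0 : 0 < n%:R :> R by rewrite ltr0n.
    have kn0 : 0 <= kn s h n by exact: sqrtr_ge0.
    have Pk : 0 <= P * kn s h n by exact: mulr_ge0.
    rewrite -(@ler_pXn2r _ 2) ?nnegrE ?Pk ?(ltW e2)//.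
    have xe : x * (e / 2) ^+ 2 = P ^+ 2 * (s ^+ 2 * h).
      by rewrite /x divfK// gt_eqF// exprn_gt0.
    rewrite exprMn (sqr_kn s n (ltW h0)) mulrA ler_pdivrMr//.
    have e20 : 0 < (e / 2) ^+ 2 by exact: exprn_gt0.
    by rewrite -xe mulrC ler_pM2l//; exact: ltW xn.
  have {HN} := HN n t y Nn t0 (lexx _) (lexx _).
  set k := kn s h n in nk *.
  have k0 : 0 <= k by exact: sqrtr_ge0.
  have n0 : 0 < n%:R :> R by rewrite ltr0n; apply: leq_ltn_trans Nn.
  have nk2 : n%:R * k ^+ 2 = s ^+ 2 * h by rewrite (sqr_kn s n (ltW h0)) mulrC divfK// gt_eqF.
  (* [D] is the gain of one step. Its mean along the walk changes by at most k^4 B per step, so n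
     steps gain at least n (D - n k^4 B), and n k^2 = s^2 h makes the loss of order h^2. *)
  pose D x := rw k (f t) x - f t x.
  pose D2 x := rw k g2 x - g2 x.
  have D2b x : `|rw k D x - D x| <= k ^+ 4 * B.
    (* both are averages of second differences *)
    have E1 : forall x, isd D x (rw k g1 x - g1 x).
      by move=> z; have ? := rw_derive k d1 z; have ? := d1 z; apply: is_derive_eq.
    have E2 : forall x, isd (fun x => rw k g1 x - g1 x) x (rw k g2 x - g2 x).
      by move=> z; have ? := rw_derive k d2 z; have ? := d2 z; apply: is_derive_eq.
    have second (F F1 F2 : R -> R) M : (forall x, isd F x (F1 x)) ->
        (forall x, isd F1 x (F2 x)) -> (forall x, `|F2 x| <= M) ->
        forall x, `|rw k F x - F x| <= k ^+ 2 * M.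
      move=> H1 H2 HM z.
      have dz (r : R) : isd (fun r => 2^-1 * (F (z + r) + F (z - r)) - F z) r
           (2^-1 * (F1 (z + r) - F1 (z - r))).
        have ? : isd (fun r => F (z + r)) r (F1 (z + r)) by exact: is_derive_addl.
        have ? : isd (fun r => F (z - r)) r (F1 (z - r) * -1).
          have ? : isd (fun r => z - r) r (-1) by apply: is_derive_eq; ring.
          exact: (@is_derive_compE _ F (fun r => z - r)).
        by apply: is_derive_eq; rewrite /GRing.scale/=; ring.
      have bz (r : R) : `|2^-1 * (F1 (z + r) - F1 (z - r))| <= M * `|r|.
        have := @mvt_norm _ _ _ M (z - r) (z + r) H2 (fun x _ => HM x).
        rewrite (_ : z + r - (z - r) = 2 * r); last by ring.
        rewrite (normrM 2) (normrM 2^-1) normfV normr_nat; lra.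
      have := @mvt_norm _ _ _ (M * k) 0 k dz.
      rewrite addr0 !subr0 (_ : 2^-1 * (F z + F z) - F z = 0) ?subr0; last by field.
      rewrite (ger0_norm k0) => H; rewrite /rw (_ : k ^+ 2 * M = M * k * k); last by ring.
      apply: H => r; rewrite subr0 => rk; apply: le_trans (bz r) _.
      by rewrite ler_wpM2l// (le_trans _ (HM 0)).
    have H2 z : `|rw k g2 z - g2 z| <= k ^+ 2 * B by exact: second d3 d4 b4 z.
    have := second _ _ _ _ E1 E2 H2 x.
    by rewrite (_ : k ^+ 2 * (k ^+ 2 * B) = k ^+ 4 * B); last by ring.
  have iterD i : forall x, D x - i%:R * (k ^+ 4 * B) <= iter i (rw k) D x.
    elim: i => [|i IH] x /=; first by rewrite mul0r subr0.
    have := @rw_le _ k _ _ IH x.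
    have -> : rw k (fun y => D y - i%:R * (k ^+ 4 * B)) x = rw k D x - i%:R * (k ^+ 4 * B).
      by rewrite /rw; field.
    have := D2b x; rewrite ler_norml -natr1 => /andP[? ?]; lra.
  have iterF i : f t y + i%:R * (D y - i%:R * (k ^+ 4 * B)) <= iter i (rw k) (f t) y.
    elim: i => [|i IH]; first by rewrite mul0r addr0.
    have E : iter i.+1 (rw k) (f t) y = iter i (rw k) (f t) y + iter i (rw k) D y.
      have : forall z, iter i.+1 (rw k) (f t) z = iter i (rw k) (f t) z + iter i (rw k) D z.
        elim: (i) => [|j IHj] z; first by rewrite /= /D; ring.
        have EE (G : R -> R) m : iter m.+1 (rw k) G z =
          2^-1 * (iter m (rw k) G (z + k) + iter m (rw k) G (z - k)) by [].
        by rewrite (EE (f t) j.+1) (IHj (z + k)) (IHj (z - k)) (EE (f t) j) (EE D j); ring.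
      exact.
    rewrite E; have := iterD i y; rewrite -natr1.
    have x0 : 0 <= k ^+ 4 * B by rewrite mulr_ge0// exprn_ge0.
    have : 0 <= i%:R * (k ^+ 4 * B) by rewrite mulr_ge0.
    move: (k ^+ 4 * B) x0 IH => x x0 IH; lra.
  have := iterF n.
  have := rw_taylor y fc k0; rewrite ler_norml -/(D y) => /andP[Dl _] HI HU.
  have n2 : n%:R * (D y - n%:R * (k ^+ 4 * B)) =
     n%:R * D y - (s ^+ 2 * h) ^+ 2 * B by rewrite -nk2; ring.
  rewrite n2 in HI.
  have : n%:R * (2^-1 * k ^+ 2 * g2 y - B * k ^+ 3) <= n%:R * D y.
    by rewrite ler_pM2l//; lra.
  rewrite (_ : n%:R * (2^-1 * k ^+ 2 * g2 y - B * k ^+ 3) =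
    2^-1 * (n%:R * k ^+ 2) * g2 y - (n%:R * k ^+ 2 * B) * k); last by ring.
  by rewrite nk2 -/P; lra.
apply/ler_addgt0Pr => e e0.
have e2 : 0 < e / 2 by rewrite divr_gt0.
have [r r0 Hr] := (is_deriveP _ _ _).1 fd _ e2.
pose Q := s ^+ 4 * B; have Q0 : 0 <= Q by rewrite mulr_ge0// exprn_ge0.
pose h := Num.min (r / 2) (e / 2 / (Q + 1)).
have h0 : 0 < h by rewrite lt_min !divr_gt0// ltr_wpDl.
have hr : h < r by rewrite gt_min; apply/orP; left; lra.
have hQ : h * Q <= e / 2.
  have : h <= e / 2 / (Q + 1) by rewrite ge_min lexx orbT.
  rewrite ler_pdivlMr ?ltr_wpDl// mulrDr; have := ltW h0; lra.
have := Hr h; rewrite (gtr0_norm h0) => /(_ hr); rewrite ler_norml => /andP[_ H].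
have := main h h0.
rewrite (_ : (s ^+ 2 * h) ^+ 2 * B = h * (h * Q)); last by rewrite /Q; ring.
have : h * (h * Q) <= h * (e / 2) by rewrite ler_pM2l.
move=> h1 h2; rewrite -(ler_pM2l h0); lra.
Qed.

End Mollify.

(** * Classical supersolutions from viscosity supersolutions *)

Section Supersolution.
Context {R : realType}.
Local Notation isd f x d := (is_derive (x : R) (1 : R) (f : R -> R) (d : R)).
Local Notation cont2_at f t y :=
  ({for ((t : R), (y : R)), continuous (fun z : R * R => (f : R -> R -> R) z.1 z.2)}).
Local Notation cont2 f := (continuous (fun z : R * R => (f : R -> R -> R) z.1 z.2)).

Lemma archi_gt (x : R) : exists N, forall n, (N < n)%N -> x < n%:R.
Proof.
exists (Num.truncn x) => n Nn; apply: lt_le_trans (truncnS_gt x) _.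
by rewrite ler_nat.
Qed.

(* Extending by the initial value gives a function that is continuous on the whole plane. *)
Definition ext0 (U : R -> R -> R) (t y : R) : R := U (Num.max t 0) y.

Section super.
Variables (s : R) (U : R -> R -> R) (C : R).
Hypothesis s0 : 0 <= s.
Hypothesis HU : visc_subsol s s (fun t y => - U t y).
Hypothesis UC : forall t y, 0 <= t -> `|U t y| <= C.
Hypothesis Ucont : cont2 (ext0 U).

(** The slices of U are only continuous, so the walk is run on their fourfold averages, which lie
    below U up to d y^2 + d. The quadratic term absorbs the lack of uniform continuity at
    infinity. *)
Lemma supersol_rw_super h : 0 < h -> rw_super s h (ext0 U).
Proof.
move=> h0 T r e e0; have s0' := s0.
pose a := 2^-1 * s ^+ 2; pose V := ext0 U.
have VC t y : `|V t y| <= C by rewrite /V /ext0; apply: UC; rewrite le_max lexx orbT.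
have C0 : 0 <= C by apply: le_trans (VC 0 0).
pose S := s ^+ 2 * h; have S0 : 0 <= S by rewrite mulr_ge0 ?sqr_ge0// ltW.
pose Q := 1 + r ^+ 2 + S; have Q0 : 0 < Q by have := sqr_ge0 r; rewrite /Q; lra.
pose d := e / (4 * Q); have d0 : 0 < d by rewrite divr_gt0// mulr_gt0.
have dQ : 2 * d * Q = e / 2 by rewrite /d; field; rewrite gt_eqF.
(* Beyond [r1] the penalty d y^2 is at least 2C, the largest possible distance between V and its
   averages. *)
pose r1 := 2 * C / d + 1; have r11 : 1 <= r1 by rewrite lerDr; apply: divr_ge0; [rewrite mulr_ge0|exact: ltW].
have dr1 : 2 * C <= d * r1.
  by rewrite /r1 mulrDr mulr1 [d * _]mulrC divfK ?gt_eqF//; lra.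
have [q q0 Hq] := unif_cont2 (`|T| + r1) Ucont d0.
(* Four averages move the argument by at most 4 h1 = q/2 < q. *)
pose h1 := q / 8; have h10 : 0 < h1 by rewrite divr_gt0.
have cV t : continuous (V t) by move=> z; exact: (@cont2_x _ (ext0 U) t z (@Ucont (t, z))).
have close t y : 0 <= t -> t <= T -> `|iter 4 (avg h1) (V t) y - V t y| <= d * y ^+ 2 + d.
  move=> t0 tT; have [yr|yr] := leP `|y| r1.
    have : V t y - d <= iter 4 (avg h1) (V t) y <= V t y + d.
      apply: iter_avg_bnd => // z /andP[yz zy].
      have : `|V t z - V t y| < d.
        apply: Hq.
        - by rewrite ger0_norm//; have := ler_norm T; lra.
        - by have := normr_ge0 T; lra.
        - by rewrite subrr normr0.
        - by rewrite ger0_norm ?subr_ge0//; rewrite /h1 in zy; lra.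
      by rewrite ltr_norml => /andP[? ?]; apply/andP; split; lra.
    have := sqr_ge0 y; have := ltW d0 => ? ? /andP[? ?].
    have : 0 <= d * y ^+ 2 by rewrite mulr_ge0.
    by move=> ?; rewrite ler_norml; apply/andP; split; lra.
  have : - C <= iter 4 (avg h1) (V t) y <= C.
    by apply: iter_avg_bnd => // z _; rewrite -ler_norml.
  have := VC t y; rewrite ler_norml => /andP[? ?] /andP[? ?].
  have : d * r1 <= d * y ^+ 2.
    rewrite ler_pM2l// -real_normK ?num_real//; nra.
  by move=> ?; rewrite ler_norml; apply/andP; split; lra.
pose B := C * (1 + 2 / h1) ^+ 4.
have B0 : 0 <= B by rewrite mulr_ge0// exprn_ge0// addr_ge0// divr_ge0// ltW.
pose M := a ^+ 2 * B + 1; have M0 : 0 <= M by rewrite addr_ge0// mulr_ge0// sqr_ge0.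
have [N1 HN1] := archi_gt (((B * S) ^+ 2 * S) / (e / 4) ^+ 2).
have [N2 HN2] := archi_gt ((M * h ^+ 2) / (e / 4)).
exists (maxn N1 N2) => n t y Nn t0 tT yr.
have n1 : (B * S) ^+ 2 * S / (e / 4) ^+ 2 < n%:R.
  by apply: HN1; apply: leq_ltn_trans Nn; exact: leq_maxl.
have n2 : M * h ^+ 2 / (e / 4) < n%:R.
  by apply: HN2; apply: leq_ltn_trans Nn; exact: leq_maxr.
have n0 : 0 < n%:R :> R by rewrite ltr0n; apply: leq_ltn_trans Nn.
set k := kn s h n; have k0 : 0 <= k by exact: sqrtr_ge0.
pose w := h / n%:R; have w0 : 0 <= w by rewrite divr_ge0// ltW.
have nw : n%:R * w = h by rewrite /w mulrC divfK// gt_eqF.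
have kw : k ^+ 2 = 2 * a * w.
  by rewrite (sqr_kn s n (ltW h0)) /a /w; field; rewrite gt_eqF.
have nk : n%:R * k ^+ 2 = S by rewrite kw mulrCA nw /a /S; field.
have gU z : iter 4 (avg h1) (V t) z - d * z ^+ 2 - d <= U t z.
  have := close t z t0 tT; rewrite ler_norml /V /ext0 (max_l t0) => /andP[_ ?]; lra.
have := heat_steps s0 HU UC Ucont n (avg4_c4 h10 (cV t) (VC t)) t0 (ltW d0) w0 k0 kw gU y.
rewrite -/B -/M nw [X in _ -> _ <= X]/ext0 (max_l (_ : 0 <= t + h)); last by rewrite addr_ge0// ltW.
apply: le_trans.
have low : iter n (rw k) (V t) y - d * (y ^+ 2 + n%:R * k ^+ 2) - d <=
    iter n (rw k) (iter 4 (avg h1) (V t)) y.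
  rewrite -iter_rw_quad; apply: iter_rw_le => z.
  have := close t z t0 tT; rewrite ler_norml => /andP[? _]; lra.
rewrite nk in low.
have E : n%:R * (d * k ^+ 2 + B * k ^+ 3 + M * w ^+ 2) = d * S + (B * S) * k + M * h ^+ 2 / n%:R.
  by rewrite -nk /w; field; rewrite gt_eqF.
rewrite E.
have e4 : 0 < e / 4 by rewrite divr_gt0.
have H2 : M * h ^+ 2 / n%:R <= e / 4.
  by rewrite ler_pdivrMr// [X in _ <= X]mulrC -ler_pdivrMr//; exact: ltW.
have H1 : B * S * k <= e / 4.
  have bk : 0 <= B * S * k by apply: mulr_ge0 => //; exact: mulr_ge0.
  rewrite -(@ler_pXn2r _ 2) ?nnegrE ?(ltW e4)// exprMn.
  rewrite (_ : k ^+ 2 = S / n%:R); last by rewrite -nk mulrC mulKf// gt_eqF.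
  by rewrite mulrA ler_pdivrMr// [X in _ <= X]mulrC -ler_pdivrMr ?exprn_gt0//; exact: ltW.
have yr2 : y ^+ 2 <= r ^+ 2.
  by rewrite -real_normK ?num_real// lerXn2r ?nnegrE// (le_trans _ yr).
have : d * y ^+ 2 <= d * r ^+ 2 by rewrite ler_pM2l.
have : 2 * d * Q = 2 * d + 2 * (d * r ^+ 2) + 2 * (d * S) by rewrite /Q; ring.
rewrite -/(V t) in low *; lra.
Qed.

End super.

Lemma iter_avg_cont2 q n (f : R -> R -> R) : 0 < q -> cont2 f ->
  cont2 (fun t => iter n (avg q) (f t)).
Proof. move=> q0 cf; elim: n => [|n IH]; first exact: cf.
exact: (@cont2_avg _ q q0 (fun t => iter n (avg q) (f t)) IH). Qed.

Lemma dq_cont2 q (f : R -> R -> R) : cont2 f -> cont2 (fun t => dq q (f t)).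
Proof.
move=> cf.
have sh : cont2 (fun t y => f t (y + q)).
  apply: (@cont2_swap _ (fun y t => f t (y + q))) => -[y t].
  have H0 : cont2_at (fun y t => f t y) (y + q) t by exact: (cont2_swap cf).
  apply: (@cont2_at_reparam _ (fun y t => f t y) (fun y => y + q) y t H0).
  by apply: cvgD; [exact: cvg_id|exact: cvg_cst].
by move=> z; apply: cvgMr_tmp; apply: cvgB; [exact: sh|exact: cf].
Qed.

Section mollify.
Variables (slo shi : R) (U : R -> R -> R) (C : R).
Hypotheses (slo0 : 0 <= slo) (sloshi : slo <= shi).
Hypothesis HU : visc_supersol slo shi U.
Hypothesis UC : forall t y, 0 <= t -> `|U t y| <= C.
Hypothesis Ucont : cont2 (ext0 U).
Variable q : R.
Hypothesis q0 : 0 < q.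

Definition tavg t y := avg q (fun s => ext0 U s y) t.
(** One average in time produces a continuous time derivative, four in space the bounds of [c4]. *)
Definition molli t := iter 4 (avg q) (tavg t).

Lemma molli_cV : cont2 tavg.
Proof. exact: cont2_swap (cont2_avg q0 (cont2_swap Ucont)). Qed.

Lemma molli_cUt y : continuous (fun s : R => ext0 U s y : R).
Proof. by move=> t; exact: (@cont2_t _ (ext0 U) t y (@Ucont (t, y))). Qed.

Lemma molli_VC t y : `|tavg t y| <= C.
Proof. by apply: avg_norm => //; [exact: molli_cUt|move=> z _; rewrite /ext0; apply: UC; rewrite le_max lexx orbT]. Qed.

Lemma molli_cont : cont2 molli.
Proof. exact: (@iter_avg_cont2 q 4 tavg q0 (@molli_cV)). Qed.

Lemma molli_norm t y : `|molli t y| <= C.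
Proof.
rewrite ler_norml; apply: iter_avg_bnd => // [z|z _]; last by rewrite -ler_norml molli_VC.
exact: (@cont2_x _ tavg t z (@molli_cV (t, z))).
Qed.

Lemma molli_bnd t y m M :
  (forall s z, t <= s <= t + q -> y <= z <= y + 4 * q -> m <= ext0 U s z <= M) ->
  m <= molli t y <= M.
Proof.
move=> H; apply: iter_avg_bnd => // [z|z zy]; first exact: (@cont2_x _ tavg t z (@molli_cV (t, z))).
by apply: avg_bnd => // [|w wt]; [exact: molli_cUt|exact: H].
Qed.

(** The random walk inequalities for both volatilities survive the averages and become heat
    inequalities for the smooth function; together they make it a supersolution for G. *)
Lemma molli_supersol : exists pt px pxx, smooth molli pt px pxx /\
  forall t y, 0 < t -> Gfun slo shi (pxx t y) <= pt t y.
Proof.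
pose dU t y := dq q (fun s => ext0 U s y) t.
pose pt t := iter 4 (avg q) (dU t).
pose px t := dq q (iter 3 (avg q) (tavg t)).
pose pxx t := dq q (dq q (iter 2 (avg q) (tavg t))).
have cdU : cont2 dU.
  exact: (@cont2_swap _ (fun y => dq q (fun s => ext0 U s y))
     (dq_cont2 (cont2_swap Ucont))).
have Vt t y : isd (fun s => tavg s y) t (dU t y) by have := avg_derive q t (@molli_cUt y).
have ptP : forall t y, isd (fun s => molli s y) t (pt t y).
  rewrite /molli /pt; elim: 4%N => [//|n IH] t y /=.
  refine (@avg_derive_param _ q q0 (fun t => iter n (avg q) (tavg t))
    (fun t => iter n (avg q) (dU t)) (iter_avg_cont2 (n:=n) q0 (@molli_cV)) (iter_avg_cont2 (n:=n) q0 cdU) IH t y).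
have c4P t := avg4_c4 q0 (fun y => @cont2_x _ tavg t y (@molli_cV (t, y))) (molli_VC t).
exists pt, px, pxx; split.
  move=> t y t0; have [[d1 d2 d3 d4] _] := c4P t; split; split.
  - exact: ptP.
  - exact: d1.
  - exact: d2.
  - exact: (iter_avg_cont2 (n:=4) q0 cdU).
  - exact: (dq_cont2 (iter_avg_cont2 (n:=3) q0 (@molli_cV))).
  - exact: (dq_cont2 (dq_cont2 (iter_avg_cont2 (n:=2) q0 (@molli_cV)))).
have shi0 : 0 <= shi by exact: le_trans sloshi.
have super s : 0 <= s -> visc_subsol s s (fun t y => - U t y) ->
    forall t y, 0 < t -> 2^-1 * s ^+ 2 * pxx t y <= pt t y.
  move=> s0 Us t y t0; apply: (rw_super_heat s0 (ltW t0) _ (ptP t y) (c4P t)) => h h0.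
  have cA n := iter_avg_cont2 (n:=n) q0 molli_cV.
  have H0 : rw_super s h tavg.
    apply: (rw_super_avg_t q0 (ltW h0) Ucont).
    exact: supersol_rw_super s0 Us UC Ucont _ h0.
  rewrite /molli; elim: 4%N => [//|n IH] /=.
  exact: rw_super_avg.
move=> t y t0; apply: Gfun_le_diag; apply: super => //.
- by apply: (supersol_opp slo0 sloshi _ HU); left.
- by apply: (supersol_opp slo0 sloshi _ HU); right.
Qed.

End mollify.

Definition smooth_supersol (slo shi : R) (W : R -> R -> R) :=
  exists pt px pxx, [/\ smooth W pt px pxx, cont2 W,
    (exists m, forall t y, 0 <= t -> m <= W t y) &
    forall t y, 0 < t -> Gfun slo shi (pxx t y) <= pt t y].

(** The mollified U is close to U at (t, y), but at time 0 it averages U over times in [0, q], where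
    U might have dropped below phi. A subsolution grown from a smoothed phi bounds U from below
    there, and adding e/2 restores the initial ordering. *)
Lemma supersol_smooth (slo shi : R) (U : R -> R -> R) (C L : R) (phi : R -> R) :
  0 <= slo -> slo <= shi -> visc_supersol slo shi U ->
  (forall t y, 0 <= t -> `|U t y| <= C) ->
  cont2 (ext0 U) ->
  0 <= L -> (forall x y, `|phi x - phi y| <= L * `|x - y|) ->
  (forall y, phi y <= U 0 y) -> (exists K, forall y, `|phi y| <= K) ->
  forall t y e, 0 <= t -> 0 < e -> exists W,
    [/\ smooth_supersol slo shi W, (forall z, phi z <= W 0 z) & W t y <= U t y + e].
Proof.
move=> slo0 sloshi HU UC Ucont L0 philip phiU [K phiK] t y e t0 e0.
have K0 : 0 <= K by apply: le_trans (phiK 0).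
have cphi : continuous phi.
  move=> x; apply/cont_atP => r r0; exists (r / (L + 1)); first by rewrite divr_gt0//; lra.
  move=> z; rewrite ltr_pdivlMr ?ltr_wpDl// => zr; apply: le_lt_trans (philip _ _) _.
  by have := normr_ge0 (z - x); lra.
have e2 : 0 < e / 2 by rewrite divr_gt0.
have H0 : cont2_at (ext0 U) t y by exact: Ucont.
have [d d0 Hd] := (cont2_atP _ _ _).1 H0 _ e2.
pose h := e / (64 * (L + 1)); have h0 : 0 < h by rewrite divr_gt0//; lra.
have Lh : 64 * L * h <= e.
  by rewrite /h mulrA ler_pdivrMr; [nra|lra].
pose B := K * (1 + 2 / h) ^+ 4.
have B0 : 0 <= B by rewrite mulr_ge0// exprn_ge0// addr_ge0// divr_ge0// ltW.
pose a := 2^-1 * slo ^+ 2; have a0 : 0 <= a by rewrite mulr_ge0// sqr_ge0.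
pose M := a ^+ 2 * B + 1; have M0 : 0 <= M by rewrite addr_ge0// mulr_ge0// sqr_ge0.
pose F := a * B + M; have F0 : 0 <= F by rewrite addr_ge0// mulr_ge0.
pose q := Num.min (Num.min 1 (d / 8)) (Num.min (e / (32 * (L + 1))) (e / (8 * (F + 1)))).
have q0 : 0 < q by rewrite !lt_min ltr01 !divr_gt0//=; lra.
have : [/\ q <= 1, q <= d / 8, q <= e / (32 * (L + 1)) & q <= e / (8 * (F + 1))].
  by rewrite /q !ge_min !lexx ?orbT.
case=> q1 qd; rewrite !ler_pdivlMr; [|lra..] => qL qF.
have [pt [px [pxx [sm sup]]]] := molli_supersol slo0 sloshi HU UC Ucont q0.
pose W t y := molli U q t y + e / 2.
have phi4 z : `|iter 4 (avg h) phi z - phi z| <= 4 * L * h.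
  have : phi z - 4 * L * h <= iter 4 (avg h) phi z <= phi z + 4 * L * h.
    apply: iter_avg_bnd => // x /andP[zx xz].
    have := philip x z; rewrite (ger0_norm (_ : 0 <= x - z)) ?subr_ge0// ler_norml.
    have : L * (x - z) <= L * (4 * h) by rewrite ler_wpM2l//; lra.
    by move=> ? /andP[? ?]; apply/andP; split; lra.
  by move=> /andP[? ?]; rewrite ler_norml; apply/andP; split; lra.
have U0 r z : 0 <= r -> r <= q -> phi z - e / 4 <= U r z.
  move=> r0 rq.
  have gU x : iter 4 (avg h) phi x - 0 * x ^+ 2 - 4 * L * h <= U 0 x.
    by have := phi4 x; have := phiU x; rewrite ler_norml => ? /andP[? ?]; lra.
  have c4P := avg4_c4 h0 cphi phiK.
  have := heat_step_smooth slo0 (supersol_opp slo0 sloshi (or_introl erefl) HU)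
    UC Ucont c4P (lexx 0) (lexx 0) r0 gU z.
  rewrite add0r; apply: le_trans.
  have [_ [_ _ /(_ z) + _ _]] := c4P; rewrite -/B -/a -/M ler_norml => /andP[g1 _].
  have := phi4 z; rewrite ler_norml => /andP[g2 _].
  set G := dq _ _ z in g1 *.
  have : - (a * r * B) <= a * r * G by rewrite -mulrN ler_wpM2l// mulr_ge0.
  have : a * r * B <= a * B * q by rewrite mulrAC ler_wpM2l// mulr_ge0.
  have : M * r ^+ 2 <= M * q.
    rewrite ler_wpM2l//; apply: (le_trans _ rq); rewrite expr2 ler_piMl//; exact: (le_trans rq q1).
  have : q * F <= e / 8 by lra.
  rewrite /F; lra.
exists W; split.
- exists (fun t y => pt t y + 0 * 0), (fun t y => px t y + 0 * (2 * y)), (fun t y => pxx t y + 2 * 0).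
  split.
  + have E : W = fun t y => molli U q t y + (0 * (y ^+ 2 + 0 * t) + e / 2).
      by apply/funext => ?; apply/funext => ?; rewrite /W mul0r add0r.
    rewrite E; exact: smoothD sm (smooth_quad 0 0 (e / 2)).
  + by move=> z; apply: cvgD; [exact: molli_cont|exact: cvg_cst].
  + exists (- C + e / 2) => s z _; have := molli_norm UC Ucont q0 s z.
    by rewrite ler_norml /W => /andP[? _]; lra.
  + by move=> s z sp; rewrite !mulr0 !addr0; exact: sup.
- move=> z; have [|] := andP (molli_bnd Ucont q0 (t:=0) (y:=z) (m:=phi z - e / 2) (M:=C) _); last first.
    by move=> ? _; rewrite /W; lra.
  move=> s x /andP[s0 sq] /andP[zx xz]; rewrite /ext0 (max_l s0); apply/andP; split; last first.
    by have := UC s x s0; rewrite ler_norml => /andP[].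
  have := U0 s x s0; rewrite add0r in sq => /(_ sq).
  have := philip x z; rewrite (ger0_norm (_ : 0 <= x - z)) ?subr_ge0// ler_norml.
  have : L * (x - z) <= L * (4 * q) by rewrite ler_wpM2l//; lra.
  have : q * (32 * L) <= e by lra.
  by move=> ? ? /andP[? ?] ?; lra.
- have [|_] := andP (molli_bnd Ucont q0 (t:=t) (y:=y) (m:=- C) (M:=U t y + e / 2) _); last first.
    by rewrite /W; lra.
  move=> s x /andP[s0 sq] /andP[zx xz]; apply/andP; split.
    have : 0 <= Num.max s 0 by rewrite le_max lexx orbT.
    by move=> /(UC _ x); rewrite /ext0 ler_norml => /andP[].
  have h1 : `|s - t| < d by rewrite ger0_norm ?subr_ge0//; lra.
  have h2 : `|x - y| < d by rewrite ger0_norm ?subr_ge0//; lra.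
  by have := Hd s x h1 h2; rewrite /ext0 (max_l t0) ltr_norml => /andP[_ ?]; lra.
Qed.

End Supersolution.

(** * Comparison, uniqueness and invariances of the G-heat equation *)

Section Gheat.
Context {R : realType}.
Local Notation isd f x d := (is_derive (x : R) (1 : R) (f : R -> R) (d : R)).
Local Notation cont2_at f t y :=
  ({for ((t : R), (y : R)), continuous (fun z : R * R => (f : R -> R -> R) z.1 z.2)}).
Local Notation cont2 f := (continuous (fun z : R * R => (f : R -> R -> R) z.1 z.2)).

Lemma within_contP (u : R -> R -> R) :
  {within [set z : R * R | 0 <= z.1], continuous (fun z : R * R => u z.1 z.2)} <->
  cont2 (ext0 u).
Proof.
split=> [/subspace_continuousP H [t y]|H].
  apply/(@cont2_atP _ (ext0 u)) => e e0.
  have p0 : [set z : R * R | 0 <= z.1] (Num.max t 0, y).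
    by rewrite /= le_max lexx orbT.
  have /cvgrPdist_lt/(_ _ e0) := H _ p0.
  rewrite near_withinE => /nbhs_ballP[d d0 dH]; exists d => // s z sd zd.
  rewrite /ext0 distrC; apply: (dH (Num.max s 0, z)) => /=; last first.
    by rewrite le_max lexx orbT.
  split; rewrite /ball/= distrC//; apply: le_lt_trans sd.
  rewrite ler_norml; have := ler_norm (s - t); have := ler_norm (- (s - t)).
  rewrite normrN => ? ?; have := normr_ge0 (s - t) => ?.
  have [s1|s1] := leP s 0; have [t1|t1] := leP t 0; apply/andP; split; lra.
apply/subspace_continuousP => -[t y] /= t0.
apply/cvgrPdist_lt => e e0; rewrite near_withinE.
have H0 : cont2_at (ext0 u) t y by exact: H.
have [d d0 dH] := (cont2_atP _ _ _).1 H0 e e0.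
apply/nbhs_ballP; exists d => // -[s z] [/=]; rewrite /ball/= => sd zd s0.
have := dH s z; rewrite distrC => /(_ sd); rewrite distrC => /(_ zd).
by rewrite distrC /ext0 !max_l.
Qed.

Definition BL (f : R -> R) := (exists K, forall x, `|f x| <= K) /\
  (exists2 L, 0 <= L & forall x y, `|f x - f y| <= L * `|x - y|).

Lemma Gfun_subadd (slo shi a b : R) : 0 <= slo -> slo <= shi ->
  Gfun slo shi (a + b) <= Gfun slo shi a + Gfun slo shi b.
Proof.
move=> s0 ss; rewrite /Gfun.
have : slo ^+ 2 <= shi ^+ 2 by rewrite ler_sqr// nnegrE (le_trans s0).
have : 0 <= slo ^+ 2 by exact: sqr_ge0.
move: (slo ^+ 2) (shi ^+ 2) => l h l0 lh; rewrite opprD.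
have [x1|x1] := leP a 0; have [x2|x2] := leP b 0; have [y1|y1] := leP (- a) 0;
 have [y2|y2] := leP (- b) 0;
 have [x3|x3] := leP (a + b) 0; have [x4|x4] := leP (- a - b) 0; nra.
Qed.

Lemma GfunZ (slo shi c a : R) : 0 <= c -> Gfun slo shi (c * a) = c * Gfun slo shi a.
Proof.
move=> c0; have E x : Num.max (c * x) 0 = c * Num.max x 0.
  by rewrite maxr_pMr// mulr0.
by rewrite /Gfun (_ : - (c * a) = c * - a) ?E; ring.
Qed.

(** Exchanging the volatilities turns G(a) into -G(-a). Transformations proved for subsolutions with
    an arbitrary pair of volatilities thus cover supersolutions too. *)
Lemma supersol_opp_subsol (slo shi : R) (U : R -> R -> R) :
  visc_supersol slo shi U <-> visc_subsol shi slo (fun t y => - U t y).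
Proof.
have G b : Gfun shi slo (- b) = - Gfun slo shi b.
  by rewrite /Gfun opprK; ring.
split=> H t y psi t0 psiC psiU psie.
  have sm := C12_smooth psiC; have smN := smoothN sm.
  have H1 r z : 0 < r -> - psi r z <= U r z by move=> r0; have := psiU r z r0; lra.
  have H2 : U t y = - psi t y by lra.
  have := H _ _ _ t0 (smooth_C12 smN) H1 H2.
  have [-> _ ->] := smooth_dt y smN t0.
  by have := G (- dyy psi t y); rewrite opprK => ->; lra.
have sm := C12_smooth psiC; have smN := smoothN sm.
have H1 r z : 0 < r -> - U r z <= - psi r z by move=> r0; have := psiU r z r0; lra.
have H2 : - U t y = - psi t y by lra.
have := H _ _ _ t0 (smooth_C12 smN) H1 H2.
have [-> _ ->] := smooth_dt y smN t0.
by rewrite G; lra.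
Qed.

Section sol.
Variables (slo shi : R).
Hypotheses (slo0 : 0 <= slo) (sloshi : slo <= shi).
Local Notation sol := (Gheat_sol slo shi).

Lemma sol_cont phi u : sol phi u -> cont2 (ext0 u).
Proof. by case=> /within_contP. Qed.

Lemma sol_le_smooth phi u W : sol phi u -> smooth_supersol slo shi W ->
  (forall y, phi y <= W 0 y) -> forall t y, 0 <= t -> u t y <= W t y.
Proof.
move=> us [pt [px [pxx [sm cW [m Wm] Wsup]]]] H t y t0.
have cu := sol_cont us; have [_ [C uC] u0 sub _] := us.
apply: (@subsol_le_smooth _ slo shi u W pt px pxx C m) => //.
- by move=> s z s0; have := uC s z s0; rewrite ler_norml => /andP[].
- by move=> z; rewrite u0.
Qed.

Lemma sol_super_smooth phi u : sol phi u -> BL phi ->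
  forall t y e, 0 <= t -> 0 < e -> exists W,
    [/\ smooth_supersol slo shi W, (forall z, phi z <= W 0 z) & W t y <= u t y + e].
Proof.
move=> us [phiK [L L0 phiL]] t y e t0 e0.
have cu := sol_cont us; have [_ [C uC] u0 _ sup] := us.
by apply: (supersol_smooth slo0 sloshi sup uC cu L0 phiL _ phiK) => // z; rewrite u0.
Qed.

Lemma smooth_supersolD V W : smooth_supersol slo shi V -> smooth_supersol slo shi W ->
  smooth_supersol slo shi (fun t y => V t y + W t y).
Proof.
move=> [pt [px [pxx [sm c [m Wm] sup]]]] [qt [qx [qxx [sm' c' [m' Wm'] sup']]]].
exists (fun t y => pt t y + qt t y), (fun t y => px t y + qx t y),
  (fun t y => pxx t y + qxx t y); split.
- exact: smoothD.
- by move=> z; apply: cvgD; [exact: c|exact: c'].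
- by exists (m + m') => t y t0; rewrite lerD ?Wm ?Wm'.
- move=> t y t0; apply: le_trans (Gfun_subadd _ _ slo0 sloshi) _.
  by rewrite lerD ?sup ?sup'.
Qed.

(** At a given point each solution on the right is approached from above by a classical
    supersolution; since G is subadditive, the sum of two of these is again one, and u is compared
    with it. *)
Lemma sol_le2 phi phi1 phi2 u u1 u2 : sol phi u -> sol phi1 u1 -> sol phi2 u2 ->
  BL phi1 -> BL phi2 -> (forall y, phi y <= phi1 y + phi2 y) ->
  forall t y, 0 <= t -> u t y <= u1 t y + u2 t y.
Proof.
move=> us us1 us2 b1 b2 H t y t0; apply/ler_addgt0Pr => e e0.
have e2 : 0 < e / 2 by rewrite divr_gt0.
have [V [Vs V0 Ve]] := sol_super_smooth us1 b1 y t0 e2.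
have [W [Ws W0 We]] := sol_super_smooth us2 b2 y t0 e2.
have := sol_le_smooth us (smooth_supersolD Vs Ws) _ y t0.
have H0 z : phi z <= V 0 z + W 0 z by apply: le_trans (H z) _; rewrite lerD.
by move=> /(_ H0); lra.
Qed.

Lemma sol_le1 phi phi1 u u1 : sol phi u -> sol phi1 u1 -> BL phi1 ->
  (forall y, phi y <= phi1 y) -> forall t y, 0 <= t -> u t y <= u1 t y.
Proof.
move=> us us1 b1 H t y t0; apply/ler_addgt0Pr => e e0.
have [V [Vs V0 Ve]] := sol_super_smooth us1 b1 y t0 e0.
apply: le_trans Ve; apply: (sol_le_smooth us Vs) => // z.
exact: le_trans (V0 z).
Qed.

Lemma sol_uniq phi u v : sol phi u -> sol phi v -> BL phi ->
  forall t y, 0 <= t -> u t y = v t y.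
Proof.
move=> us vs b t y t0; apply/le_anti/andP; split.
  exact: (sol_le1 us vs b).
exact: (sol_le1 vs us b).
Qed.

Lemma subsol_affine (lo hi c b a : R) (u : R -> R -> R) : 0 < c ->
  visc_subsol lo hi u -> visc_subsol lo hi (fun t y => c * u t (y + a) + b).
Proof.
move=> c0 us t y psi t0 psiC psiU psie.
have ci : 0 < c^-1 by rewrite invr_gt0.
pose psi' t y := c^-1 * (psi t (y - a) - b).
have sm := C12_smooth psiC.
have sm' : smooth psi' (fun t y => c^-1 * dt psi t (y - a)) (fun t y => c^-1 * dy psi t (y - a))
    (fun t y => c^-1 * dyy psi t (y - a)).
  move=> s z s0; have [[h1 h2 h3] [c1 c2 c3]] := sm s (z - a) s0.
  have sh (f : R -> R) d : isd f (z - a) d -> isd (fun z => f (z - a)) z d.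
    move=> H; have H1 : isd (fun z => f (- a + z)) z d.
      by apply: is_derive_addl; rewrite addrC.
    by apply: is_derive_ext H1 _ _ => // w; rewrite addrC.
  have cs (f : R -> R -> R) : cont2_at f s (z - a) -> cont2_at (fun s z => c^-1 * f s (z - a)) s z.
    move=> /cont2_atP cf; apply/(@cont2_atP _ (fun s z => c^-1 * f s (z - a))) => e e0.
    have [|d d0 dH] := cf (c * e); first by rewrite mulr_gt0.
    exists d => // s' z' sd zd; rewrite -mulrBr normrM gtr0_norm//.
    rewrite mulrC ltr_pdivrMr// mulrC; apply: dH => //.
    by rewrite opprB addrA subrK.
  have ? := h1; have ? := sh _ _ h2; have ? := sh _ _ h3.
  split; split.
  - have H : isd (fun s => c^-1 * (psi s (z - a) - b)) s (c^-1 * dt psi s (z - a)).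
      by apply: is_derive_eq; rewrite /GRing.scale/=; ring.
    exact: H.
  - have H : isd (fun z => c^-1 * (psi s (z - a) - b)) z (c^-1 * dy psi s (z - a)).
      by apply: is_derive_eq; rewrite /GRing.scale/=; ring.
    exact: H.
  - have H : isd (fun z => c^-1 * (dy psi s (z - a))) z (c^-1 * dyy psi s (z - a)).
      by apply: is_derive_eq; rewrite /GRing.scale/=; ring.
    exact: H.
  - exact: cs c1.
  - exact: cs c2.
  - exact: cs c3.
have H1 s z : 0 < s -> u s z <= psi' s z.
  move=> s0; have := psiU s (z - a) s0; rewrite subrK /psi' => H.
  by rewrite mulrC ler_pdivlMr// mulrC; lra.
have H2 : u t (y + a) = psi' t (y + a).
  by rewrite /psi' addrK -psie addrK mulKf// gt_eqF.
have := us _ _ _ t0 (smooth_C12 sm') H1 H2.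
have [-> _ ->] := smooth_dt (y + a) sm' t0.
rewrite addrK GfunZ ?(ltW ci)// -mulrBr.
by rewrite pmulr_rle0.
Qed.

Lemma sol_affine phi u c b a : 0 < c -> sol phi u ->
  sol (fun y => c * phi (y + a) + b) (fun t y => c * u t (y + a) + b).
Proof.
move=> c0 us; have cu := sol_cont us; have [_ [C uC] u0 sub sup] := us; split.
- apply: (within_contP (fun t y => c * u t (y + a) + b)).2 => -[t y].
  have H0 : cont2_at (ext0 u) t (y + a) by exact: cu.
  apply/(@cont2_atP _ (ext0 (fun t y => c * u t (y + a) + b))) => e e0.
  have [|d d0 dH] := (cont2_atP _ _ _).1 H0 (c^-1 * e).
    by rewrite mulr_gt0// invr_gt0.
  exists d => // s z sd zd; rewrite /ext0 opprD addrACA subrr addr0 -mulrBr normrM gtr0_norm//.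
  rewrite -ltr_pdivlMl//; apply: dH => //.
  by rewrite opprD addrACA subrr addr0.
- exists (c * C + `|b|) => t y t0; apply: le_trans (ler_normD _ _) _.
  by rewrite lerD2r normrM gtr0_norm// ler_pM2l// uC.
- by apply/funext => y; rewrite u0.
- exact: subsol_affine.
- apply/supersol_opp_subsol; have /supersol_opp_subsol H := sup.
  have := @subsol_affine shi slo c (- b) a _ c0 H.
  by congr visc_subsol; apply/funext => t; apply/funext => y; ring.
Qed.

Lemma sol_restart phi u t0 : 0 <= t0 -> sol phi u -> sol (u t0) (fun t => u (t0 + t)).
Proof.
move=> t00 us; have cu := sol_cont us; have [_ [C uC] u0 sub sup] := us; split.
- apply: (within_contP (fun t => u (t0 + t))).2 => -[t y].
  have H0 : cont2_at (ext0 u) (t0 + Num.max t 0) y by exact: cu.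
  have := @cont2_at_reparam _ (ext0 u) (fun t => t0 + Num.max t 0) t y H0.
  have -> : (fun z : R * R => ext0 u (t0 + Num.max z.1 0) z.2) =
    (fun z : R * R => ext0 (fun t => u (t0 + t)) z.1 z.2).
    apply/funext => q; rewrite /ext0 (max_l (_ : 0 <= t0 + _))//.
    by rewrite addr_ge0// le_max lexx orbT.
  apply; apply: cvgD; first exact: cvg_cst.
  exact: cont_max0.
- by exists C => t y t1; apply: uC; rewrite addr_ge0.
- by rewrite addr0.
- exact: (subsol_restart sub uC).
- apply/supersol_opp_subsol; have /supersol_opp_subsol H := sup.
  apply: (subsol_restart H (C := C)) => // t y t1; by rewrite normrN uC.
Qed.

(** Constants are classical solutions. The lower bound is the same comparison for -u, seen as a
    subsolution of the linear equation of volatility slo. *)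
Lemma sol_bounds phi u m M : sol phi u -> (forall y, m <= phi y <= M) ->
  forall t y, 0 <= t -> m <= u t y <= M.
Proof.
move=> us H t y t0; have cu := sol_cont us; have [_ [C uC] u0 sub sup] := us.
have sc c : smooth (fun t y => 0 * (y ^+ 2 + 0 * t) + c) (fun _ _ => 0 * 0)
  (fun _ y => 0 * (2 * y)) (fun _ _ => 2 * 0 :> R) by exact: smooth_quad.
have cc c : cont2 (fun t y : R => 0 * (y ^+ 2 + 0 * t) + c : R).
  have -> : (fun z : R * R => 0 * (z.2 ^+ 2 + 0 * z.1) + c) = fun=> c.
    by apply/funext => z; rewrite mul0r add0r.
  by move=> z; exact: cvg_cst.
have G0 lo hi : Gfun lo hi (2 * 0) <= 0 * 0 :> R.
  by rewrite /Gfun !mulr0 oppr0 maxxx !mulr0 subr0 mulr0.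
apply/andP; split.
  have HU := supersol_opp slo0 sloshi (or_introl erefl) sup.
  rewrite -lerN2 -[X in _ <= X](add0r (- m)) -[X in _ <= X + _](mul0r (y ^+ 2 + 0 * t)).
  apply: (@subsol_le_smooth _ slo slo (fun t y => - u t y) _ _ _ _ C (- m) slo0 (lexx _) HU _ _ (sc (- m)) (cc _)) => //.
  - by move=> z; apply: cvgN; exact: cu.
  - by move=> s z s0; have := uC s z s0; rewrite ler_norml => /andP[? _]; lra.
  - by move=> s z s0; rewrite mul0r add0r.
  - by move=> z; rewrite mul0r add0r u0 lerN2; case/andP: (H z).
rewrite -[X in _ <= X](add0r M) -[X in _ <= X + _](mul0r (y ^+ 2 + 0 * t)).
apply: (@subsol_le_smooth _ slo shi u _ _ _ _ C M slo0 sloshi sub cu _ (sc M) (cc _)) => //.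
- by move=> s z s0; have := uC s z s0; rewrite ler_norml => /andP[].
- by move=> s z s0; rewrite mul0r add0r.
- by move=> z; rewrite mul0r add0r u0; case/andP: (H z).
Qed.

(* [y^4 + 6 s^2 t y^2 + 3 s^4 t^2] solves the heat equation with initial datum [y^4]. *)
Lemma sol_fourth phi u A a : sol phi u -> 0 <= A ->
  (forall y, phi y <= A * (y - a) ^+ 4) ->
  forall t, 0 <= t -> u t a <= A * (3 * shi ^+ 4 * t ^+ 2).
Proof.
move=> us A0 H t t0.
pose W (t y : R) := A * ((y - a) ^+ 4 + 6 * shi ^+ 2 * t * (y - a) ^+ 2 + 3 * shi ^+ 4 * t ^+ 2).
pose Wt (t y : R) := A * (6 * shi ^+ 2 * (y - a) ^+ 2 + 6 * shi ^+ 4 * t).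
pose Wx (t y : R) := A * (4 * (y - a) ^+ 3 + 12 * shi ^+ 2 * t * (y - a)).
pose Wxx (t y : R) := A * (12 * (y - a) ^+ 2 + 12 * shi ^+ 2 * t).
have f1 (z : R * R) : (fun z : R * R => z.1) x @[x --> z] --> z.1 by exact: cvg_fst.
have fa n (z : R * R) : (fun z : R * R => (z.2 - a) ^+ n) x @[x --> z] --> (z.2 - a) ^+ n.
  elim: n => [|n IH]; first by under eq_fun do rewrite expr0; exact: cvg_cst.
  under eq_fun do rewrite exprS; rewrite exprS; apply: cvgM => //.
  by apply: cvgB; [exact: cvg_snd|exact: cvg_cst].
have ct (b : R) : forall z : R * R, (fun z : R * R => b) x @[x --> z] --> b.
  by move=> z; exact: cvg_cst.
have cW : cont2 W.
  move=> z; apply: cvgM (ct _ _) _; apply: cvgD; last first.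
    by apply: cvgM (ct _ _) _; apply: cvgM; exact: f1.
  by apply: cvgD (fa _ _) _; apply: cvgM (fa _ _); apply: cvgM (ct _ _) (f1 _).
have WS : smooth_supersol slo shi W.
  exists Wt, Wx, Wxx; split.
  - move=> s y s0; split; split.
    + have H0 : isd (fun t => A * ((y - a) ^+ 4 + 6 * shi ^+ 2 * t * (y - a) ^+ 2 + 3 * shi ^+ 4 * t ^+ 2)) s (Wt s y).
        by apply: is_derive_eq; rewrite /Wt /GRing.scale/=; ring.
      exact: H0.
    + have H0 : isd (fun y => A * ((y - a) ^+ 4 + 6 * shi ^+ 2 * s * (y - a) ^+ 2 + 3 * shi ^+ 4 * s ^+ 2)) y (Wx s y).
        by apply: is_derive_eq; rewrite /Wx /GRing.scale/=; ring.
      exact: H0.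
    + have H0 : isd (fun y => A * (4 * (y - a) ^+ 3 + 12 * shi ^+ 2 * s * (y - a))) y (Wxx s y).
        by apply: is_derive_eq; rewrite /Wxx /GRing.scale/=; ring.
      exact: H0.
    + apply: cvgM (ct _ _) _; apply: cvgD; first by apply: cvgM (ct _ _) (fa _ _).
      by apply: cvgM (ct _ _) (f1 _).
    + apply: cvgM (ct _ _) _; apply: cvgD; first by apply: cvgM (ct _ _) (fa _ _).
      by apply: cvgM (fa 1%N _); apply: cvgM (ct _ _) (f1 _).
    + apply: cvgM (ct _ _) _; apply: cvgD; first by apply: cvgM (ct _ _) (fa _ _).
      by apply: cvgM (ct _ _) (f1 _).
  - exact: cW.
  - exists 0 => s y s0; rewrite /W.
    have := sqr_ge0 (y - a); have := @exprn_even_ge0 _ 4 (y - a) erefl.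
    have := sqr_ge0 shi; have := @exprn_even_ge0 _ 4 shi erefl; have := sqr_ge0 s.
    move: (shi ^+ 2) (shi ^+ 4) ((y - a) ^+ 2) ((y - a) ^+ 4) (s ^+ 2) => p2 p4 q2 q4 s2 *.
    by rewrite mulr_ge0// !addr_ge0// !mulr_ge0.
  - move=> s y s0; have p : 0 <= Wxx s y.
      have := sqr_ge0 (y - a); have := sqr_ge0 shi; have := ltW s0; rewrite /Wxx.
      move: (shi ^+ 2) ((y - a) ^+ 2) => p2 q2 *.
      by rewrite mulr_ge0// !addr_ge0// !mulr_ge0.
    rewrite /Gfun (max_l p) (max_r (_ : - Wxx s y <= 0)) ?oppr_le0//.
    by rewrite mulr0 subr0 /Wxx /Wt le_eqVlt; apply/orP; left; apply/eqP; field.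
have H0 y : phi y <= W 0 y.
  by apply: le_trans (H y) _; rewrite /W expr0n/= !mulr0 mul0r !addr0.
have := sol_le_smooth us WS H0 a t0.
by rewrite /W subrr !expr0n/= !mulr0 !add0r.
Qed.

End sol.
End Gheat.

(** * The nonlinear semigroup and its axioms *)

Section Semigroup.
Context {R : realType}.

Definition lipb (K L : R) (f : R -> R) :=
  [/\ 0 <= L, forall x, `|f x| <= K & forall x y, `|f x - f y| <= L * `|x - y|].

Lemma lipb_BL K L f : lipb K L f -> BL f.
Proof. by move=> [L0 H1 H2]; split; [exists K|exists L]. Qed.

(** What the backward recursion retains of the equation. [sg_affine] combines positive homogeneity,
    translation in space and addition of constants; [sg_lipb] preserves both constants, so iterating
    never leaves the bounded Lipschitz functions. *)
Record semigroup (S : R -> (R -> R) -> R -> R) : Prop := Semigroup {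
  sg_id : forall phi, BL phi -> S 0 phi = phi;
  sg_lipb : forall d phi K L, 0 <= d -> lipb K L phi -> lipb K L (S d phi);
  sg_le : forall d phi psi, 0 <= d -> BL phi -> BL psi -> (forall y, phi y <= psi y) ->
    forall y, S d phi y <= S d psi y;
  sg_add : forall d phi psi, 0 <= d -> BL phi -> BL psi ->
    forall y, S d (fun y => phi y + psi y) y <= S d phi y + S d psi y;
  sg_affine : forall d phi c b a y, 0 <= d -> BL phi -> 0 <= c ->
    S d (fun y => c * phi (y + a) + b) y = c * S d phi (y + a) + b;
  sg_comp : forall d e phi y, 0 <= d -> 0 <= e -> BL phi -> S d (S e phi) y = S (d + e) phi y
}.

Lemma BLD (f g : R -> R) : BL f -> BL g -> BL (fun x => f x + g x).
Proof.
move=> [[K HK] [L L0 HL]] [[K' HK'] [L' L0' HL']]; split.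
  by exists (K + K') => x; rewrite (le_trans (ler_normD _ _))// lerD.
exists (L + L'); first by rewrite addr_ge0.
move=> x y; rewrite opprD addrACA mulrDl.
by rewrite (le_trans (ler_normD _ _))// lerD.
Qed.

Lemma BL_affine (f : R -> R) (c b a : R) : BL f -> BL (fun x => c * f (x + a) + b).
Proof.
move=> [[K HK] [L L0 HL]]; split.
  exists (`|c| * K + `|b|) => x; rewrite (le_trans (ler_normD _ _))// lerD2r.
  by rewrite normrM ler_wpM2l.
exists (`|c| * L); first by rewrite mulr_ge0.
move=> x y; rewrite opprD addrACA subrr addr0 -mulrBr normrM -mulrA ler_wpM2l//.
by rewrite (le_trans (HL _ _))// opprD addrACA subrr addr0.
Qed.

Lemma BL_cst (b : R) : BL (fun=> b : R).
Proof.
split; first by exists `|b|.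
by exists 0 => // x y; rewrite subrr normr0 mul0r.
Qed.

Section heat_semigroup.
Variables (slo shi : R).
Hypotheses (slo0 : 0 <= slo) (sloshi : slo <= shi).
Hypothesis Ex : forall phi, BL phi -> exists u, Gheat_sol slo shi phi u.

Lemma Gheat_solP phi : BL phi -> Gheat_sol slo shi phi (Gheat slo shi phi).
Proof. by move=> /Ex [u us]; exact: (@xgetPex _ _ [set u | Gheat_sol slo shi phi u] (ex_intro _ u us)). Qed.

Lemma Gheat_uniq phi u d y : BL phi -> Gheat_sol slo shi phi u -> 0 <= d ->
  Gheat slo shi phi d y = u d y.
Proof.
move=> b us d0; exact: (sol_uniq slo0 sloshi (Gheat_solP b) us b).
Qed.

Lemma Gheat_semigroup : semigroup (fun d phi => Gheat slo shi phi d).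
Proof.
have aff d phi c b a y : 0 <= d -> BL phi -> 0 <= c ->
    Gheat slo shi (fun y => c * phi (y + a) + b) d y = c * Gheat slo shi phi d (y + a) + b.
  move=> d0 bp; rewrite le_eqVlt => /orP[/eqP <-|c0].
    (* [sol_affine] is stated for c > 0; for c = 0 the datum is the constant b and [sol_bounds]
       determines the solution. *)
    rewrite mul0r add0r.
    have := sol_bounds (m := b) (M := b) slo0 sloshi (Gheat_solP (BL_affine 0 b a bp)) _ y d0.
    rewrite -eq_le => /(_ _)/eqP <- // z.
    by rewrite mul0r add0r lexx.
  exact: (Gheat_uniq y (BL_affine c b a bp) (sol_affine b a c0 (Gheat_solP bp)) d0).
have lip d phi K L : 0 <= d -> lipb K L phi -> lipb K L (Gheat slo shi phi d).
  move=> d0 lp; have bp := lipb_BL lp; case: lp => L0 HK HL; split=> // [x|x y].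
    rewrite ler_norml; apply: (sol_bounds slo0 sloshi (Gheat_solP bp)) => // z.
    by rewrite -ler_norml.
  have main a z : Gheat slo shi phi d (z + a) <= Gheat slo shi phi d z + L * `|a|.
    have H1 := sol_affine 0 a ltr01 (Gheat_solP bp).
    have H2 := sol_affine (L * `|a|) 0 ltr01 (Gheat_solP bp).
    have := sol_le1 slo0 sloshi H1 H2 (BL_affine _ _ _ bp) _ z d0.
    rewrite !mul1r !addr0; apply => w; rewrite !mul1r !addr0.
    have := HL (w + a) w; rewrite addrAC subrr add0r; have := ler_norm (phi (w + a) - phi w); lra.
  have h1 := main (x - y) y; have h2 := main (y - x) x.
  rewrite ler_norml; apply/andP; split.
    by move: h2; rewrite subrKC distrC; lra.
  by move: h1; rewrite subrKC; lra.
split=> //.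
- by move=> phi bp; have [] := Gheat_solP bp.
- move=> d phi psi d0 b1 b2 H y.
  exact: (sol_le1 slo0 sloshi (Gheat_solP b1) (Gheat_solP b2) b2 H).
- move=> d phi psi d0 b1 b2 y.
  exact: (sol_le2 slo0 sloshi (Gheat_solP (BLD b1 b2)) (Gheat_solP b1) (Gheat_solP b2) b1 b2).
- move=> d e phi y d0 e0 bp.
  have [[K HK] [L L0 HL]] := bp.
  have l : lipb K L phi by [].
  have be := lipb_BL (lip e phi K L e0 l).
  rewrite (Gheat_uniq y be (sol_restart e0 (Gheat_solP bp)) d0).
  by rewrite addrC.
Qed.

Lemma Gheat_fourth phi A a d : BL phi -> 0 <= A ->
  (forall y, phi y <= A * (y - a) ^+ 4) -> 0 <= d ->
  Gheat slo shi phi d a <= A * (3 * shi ^+ 4 * d ^+ 2).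
Proof. by move=> bp A0 H d0; exact: (sol_fourth slo0 sloshi (Gheat_solP bp)). Qed.

End heat_semigroup.
End Semigroup.

(** * Bounded Lipschitz functionals of finitely many path values *)

Section Functional.
Context {R : realType}.
Implicit Types (g h : R -> R) (Phi : (R -> R) -> R) (T : seq R).

(** A cylinder variable is encoded as a functional of arbitrary real functions, Lipschitz in the
    values at the times of T. Values can then be replaced one at a time, and no function of several
    variables has to be named. *)
Definition FL (T : seq R) (Phi : (R -> R) -> R) (K L : R) :=
  [/\ 0 <= L, forall g, `|Phi g| <= K
    & forall g h, `|Phi g - Phi h| <= L * \sum_(s <- T) `|g s - h s|].

Definition FLip T Phi := exists K L, FL T Phi K L.

Lemma sum_norm_ge0 T g h : 0 <= \sum_(s <- T) `|g s - h s|.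
Proof. by apply: sumr_ge0. Qed.

Lemma sum_norm_sub T T' g h : {subset T <= T'} ->
  \sum_(s <- T) `|g s - h s| <= (size T)%:R * \sum_(s <- T') `|g s - h s|.
Proof.
elim: T => [|t T IH] H; first by rewrite big_nil mul0r.
rewrite big_cons /= -natr1 mulrDl mul1r addrC lerD ?IH//.
  by move=> s sT; rewrite H// inE sT orbT.
have tT' : t \in T' by rewrite H// mem_head.
rewrite (big_rem t)//= lerDl; exact: sumr_ge0.
Qed.

Lemma FLip_sub T T' Phi : {subset T <= T'} -> FLip T Phi -> FLip T' Phi.
Proof.
move=> H [K [L [L0 HK HL]]]; exists K, (L * (size T)%:R); split=> [||g h].
- by rewrite mulr_ge0.
- exact: HK.
- by rewrite (le_trans (HL g h))// -mulrA ler_wpM2l// sum_norm_sub.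
Qed.

Lemma FLip_ext T Phi g h : FLip T Phi -> {in T, g =1 h} -> Phi g = Phi h.
Proof.
move=> [K [L [_ _ H]]] gh; apply/eqP; rewrite -subr_eq0 -normr_le0.
apply: le_trans (H g h) _; rewrite big_seq big1 ?mulr0// => s sT.
by rewrite gh// subrr normr0.
Qed.

Lemma FLip_cst T c : FLip T (fun=> c).
Proof.
exists `|c|, 0; split=> // g h.
by rewrite subrr normr0 mul0r.
Qed.

Lemma FLipD T Phi Psi : FLip T Phi -> FLip T Psi -> FLip T (fun g => Phi g + Psi g).
Proof.
move=> [K [L [L0 HK HL]]] [K' [L' [L0' HK' HL']]].
exists (K + K'), (L + L'); split=> [|g|g h]; first exact: addr_ge0.
  by rewrite (le_trans (ler_normD _ _))// lerD.
rewrite opprD addrACA mulrDl.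
by rewrite (le_trans (ler_normD _ _))// lerD.
Qed.

Lemma FLipM T Phi Psi : FLip T Phi -> FLip T Psi -> FLip T (fun g => Phi g * Psi g).
Proof.
move=> [K [L [L0 HK HL]]] [K' [L' [L0' HK' HL']]].
have K0 : 0 <= K by apply: le_trans (HK (fun=> 0)).
have K0' : 0 <= K' by apply: le_trans (HK' (fun=> 0)).
exists (K * K'), (K * L' + K' * L); split=> [|g|g h].
- by rewrite addr_ge0// mulr_ge0.
- by rewrite normrM ler_pM.
rewrite (_ : _ - _ = Phi g * (Psi g - Psi h) + Psi h * (Phi g - Phi h)); last by ring.
rewrite (le_trans (ler_normD _ _))// mulrDl lerD// normrM -mulrA ler_pM//.
Qed.

Lemma FLip_comp T Phi (f : R -> R) L1 : 0 <= L1 ->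
  (forall x y, `|f x - f y| <= L1 * `|x - y|) -> FLip T Phi -> FLip T (fun g => f (Phi g)).
Proof.
move=> L10 Hf [K [L [L0 HK HL]]].
exists (`|f 0| + L1 * K), (L1 * L); split=> [|g|g h]; first exact: mulr_ge0.
  rewrite -[f _](subrK (f 0)) addrC (le_trans (ler_normD _ _))// lerD2l.
  by rewrite (le_trans (Hf _ _))// subr0 ler_wpM2l.
by rewrite (le_trans (Hf _ _))// -mulrA ler_wpM2l.
Qed.

Lemma FLipZ T c Phi : FLip T Phi -> FLip T (fun g => c * Phi g).
Proof. by move=> H; apply: FLipM => //; exact: FLip_cst. Qed.

Lemma FLipN T Phi : FLip T Phi -> FLip T (fun g => - Phi g).
Proof.
by move=> H; have := FLipZ (-1) H; congr FLip; apply/funext => g; rewrite mulN1r.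
Qed.

Lemma FLipB T Phi Psi : FLip T Phi -> FLip T Psi -> FLip T (fun g => Phi g - Psi g).
Proof. by move=> H1 /FLipN H2; exact: FLipD. Qed.

Lemma FLip_max T Phi c : FLip T Phi -> FLip T (fun g => Num.max (Phi g) c).
Proof.
apply: (@FLip_comp _ _ (fun x => Num.max x c) 1) => // x y; rewrite mul1r ler_norml.
have := ler_norm (x - y); have := ler_norm (- (x - y)); rewrite normrN => ? ?.
by have [x1|x1] := leP x c; have [x2|x2] := leP y c; apply/andP; split; lra.
Qed.

Lemma FLip_min T Phi c : FLip T Phi -> FLip T (fun g => Num.min (Phi g) c).
Proof.
apply: (@FLip_comp _ _ (fun x => Num.min x c) 1) => // x y; rewrite mul1r ler_norml.
have := ler_norm (x - y); have := ler_norm (- (x - y)); rewrite normrN => ? ?.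
by have [x1|x1] := leP x c; have [x2|x2] := leP y c; apply/andP; split; lra.
Qed.

Lemma FLip_eval (T : seq R) (s : R) (f : R -> R) : s \in T -> BL f -> FLip T (fun g => f (g s)).
Proof.
move=> sT [[K HK] [L L0 HL]]; exists K, L; split=> // g h.
rewrite (le_trans (HL _ _))// ler_wpM2l// (big_rem s)//= lerDl; exact: sumr_ge0.
Qed.

Lemma FLip_incr (T : seq R) (s t : R) (f : R -> R) : s \in T -> t \in T -> BL f ->
  FLip T (fun g => f (g t - g s)).
Proof.
move=> sT tT [[K HK] [L L0 HL]]; exists K, (L + L); split=> [|//|g h].
  by rewrite addr_ge0.
have le r : r \in T -> `|g r - h r| <= \sum_(s <- T) `|g s - h s|.
  by move=> rT; rewrite (big_rem r)//= lerDl; exact: sumr_ge0.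
rewrite (le_trans (HL _ _))// mulrDl -mulrDr ler_wpM2l//.
rewrite (_ : _ - _ - _ = (g t - h t) - (g s - h s)); last by ring.
by rewrite (le_trans (ler_normB _ _))// lerD// le.
Qed.

End Functional.

(** * Conditional expectations of cylinder functionals *)

Section Backward.
Context {R : realType}.
Implicit Types (g h : R -> R) (Phi Psi : (R -> R) -> R) (T ts : seq R) (s t y : R).

Definition upd g t y : R -> R := fun s => if s == t then y else g s.

Variable S : R -> (R -> R) -> R -> R.
Hypothesis HS : semigroup S.

(** Conditional expectation at time s of Phi along the later times ts: the value at the last time is
    integrated out first, each step applying the semigroup over the elapsed time at the value
    already reached. *)
Fixpoint back ts s g Phi : R :=
  match ts with
  | [::] => Phi g
  | t :: ts' => S (t - s) (fun y => back ts' t (upd g t y) Phi) (g s)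
  end.

Lemma updE g t y : upd g t y t = y.
Proof. by rewrite /upd eqxx. Qed.

Lemma path_last_ge s q t : path <=%R s q -> t \in s :: q -> t <= last s q.
Proof.
elim: q s t => [|a q IH] s t /=; first by rewrite inE => _ /eqP ->.
move=> /andP[sa p]; rewrite inE => /orP[/eqP ->|]; last exact: IH.
by apply: le_trans sa _; apply: IH; rewrite ?mem_head.
Qed.

Lemma sum_upd T g h t y z : \sum_(s <- T) `|upd g t y s - upd h t z s| <=
  \sum_(s <- T) `|g s - h s| + (size T)%:R * `|y - z|.
Proof.
elim: T => [|r T IH]; first by rewrite !big_nil mul0r addr0.
rewrite !big_cons /= -natr1 mulrDl mul1r.
have H : `|upd g t y r - upd h t z r| <= `|g r - h r| + `|y - z|.
  by rewrite /upd; case: eqP => [_|_]; rewrite ?lerDl// lerDr.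
lra.
Qed.

Lemma sg_contract d phi psi M y : 0 <= d -> BL phi -> BL psi ->
  (forall y, `|phi y - psi y| <= M) -> `|S d phi y - S d psi y| <= M.
Proof.
move=> d0 b1 b2 H.
have aux f1 f2 : BL f1 -> BL f2 -> (forall y, `|f1 y - f2 y| <= M) -> S d f1 y <= S d f2 y + M.
  move=> c1 c2 HH; have := sg_affine HS M 0 y d0 c2 ler01.
  rewrite mul1r addr0 => <-; apply: (sg_le HS) => //; first exact: BL_affine.
  by move=> z; rewrite mul1r addr0; have := HH z; have := ler_norm (f1 z - f2 z); lra.
rewrite ler_norml; have := aux _ _ b1 b2 H; have := aux _ _ b2 b1.
have H2 z : `|psi z - phi z| <= M by rewrite distrC.
by move=> /(_ H2) ? ?; apply/andP; split; lra.
Qed.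

(** The value at s enters the seminorm even if s is not in T, because the outermost semigroup is
    evaluated at g s. *)
Lemma back_FL ts s T Phi K L : path <=%R s ts -> FL T Phi K L ->
  exists2 L', 0 <= L' & (forall g, `|back ts s g Phi| <= K) /\
  (forall g h, `|back ts s g Phi - back ts s h Phi| <=
     L' * (\sum_(s <- T) `|g s - h s| + `|g s - h s|)).
Proof.
elim: ts s => [|t ts IH] s /=.
  move=> _ [L0 HK HL]; exists L => //; split=> // g h.
  by rewrite (le_trans (HL g h))// ler_wpM2l// lerDl.
move=> /andP[st /IH{}IH] /IH[L' L0 [HK HL]].
have st0 : 0 <= t - s by rewrite subr_ge0.
pose L1 := L' * ((size T)%:R + 1).
have L10 : 0 <= L1 by rewrite mulr_ge0// addr_ge0.
have lp g : lipb K L1 (fun y => back ts t (upd g t y) Phi).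
  split=> // y z.
  apply: le_trans (HL _ _) _; rewrite /L1 -mulrA ler_wpM2l// mulrDl mul1r.
  rewrite lerD//; last by rewrite /upd eqxx.
  by rewrite (le_trans (sum_upd _ _ _ _ _ _))// big1 ?add0r// => r _; rewrite subrr normr0.
exists L1 => //; split=> [g|g h].
  by have [_ H _] := sg_lipb HS st0 (lp g).
rewrite -(subrK (S (t - s) (fun y => back ts t (upd h t y) Phi) (g s)) (S _ _ (g s))) -addrA.
apply: le_trans (ler_normD _ _) _; rewrite mulrDr lerD//; last first.
  by have [_ _ H] := sg_lipb HS st0 (lp h).
apply: (@le_trans _ _ (L' * \sum_(s <- T) `|g s - h s|)); last first.
  by rewrite ler_wpM2r ?sum_norm_ge0// /L1 ler_peMr// lerDr.
apply: sg_contract => //; [exact: lipb_BL (lp g)|exact: lipb_BL (lp h)|move=> y].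
apply: le_trans (HL _ _) _; rewrite ler_wpM2l//.
rewrite !updE subrr normr0 addr0 (le_trans (sum_upd _ _ _ _ _ _))//.
by rewrite subrr normr0 mulr0 addr0.
Qed.

Lemma back_BL ts t T Phi g : path <=%R t ts -> FLip T Phi ->
  BL (fun y => back ts t (upd g t y) Phi).
Proof.
move=> pt [K [L /(back_FL pt)[L' L0 [HK HL]]]]; split.
  by exists K => y; exact: HK.
exists (L' * ((size T)%:R + 1)); first by rewrite mulr_ge0// addr_ge0.
move=> y z; apply: le_trans (HL _ _) _; rewrite -mulrA ler_wpM2l// mulrDl mul1r.
rewrite lerD//; last by rewrite /upd eqxx.
by rewrite (le_trans (sum_upd _ _ _ _ _ _))// big1 ?add0r// => r _; rewrite subrr normr0.
Qed.

Lemma back_FLip ts s T Phi : path <=%R s ts -> FLip T Phi ->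
  FLip (s :: T) (fun g => back ts s g Phi).
Proof.
move=> pt [K [L /(back_FL pt)[L' L0 [HK HL]]]]; exists K, L'; split=> // g h.
by rewrite big_cons [X in _ * X]addrC.
Qed.

Lemma back_le ts s T g Phi Psi : path <=%R s ts -> FLip T Phi -> FLip T Psi ->
  (forall h, (forall r, r \notin ts -> h r = g r) -> Phi h <= Psi h) ->
  back ts s g Phi <= back ts s g Psi.
Proof.
move=> + H1 H2; elim: ts s g => [|t ts IH] s g /= => [_ H|/andP[st pt] H]; first exact: H.
apply: (sg_le HS); rewrite ?subr_ge0//.
- exact: back_BL pt H1.
- exact: back_BL pt H2.
move=> y; apply: IH => // h hg; apply: H => r; rewrite inE negb_or => /andP[rt rts].
by rewrite hg// /upd (negbTE rt).
Qed.

Lemma back_add ts s T g Phi Psi : path <=%R s ts -> FLip T Phi -> FLip T Psi ->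
  back ts s g (fun g => Phi g + Psi g) <= back ts s g Phi + back ts s g Psi.
Proof.
move=> + H1 H2; elim: ts s g => [//|t ts IH] s g /= /andP[st pt].
have b1 := back_BL g pt H1; have b2 := back_BL g pt H2.
have b3 := back_BL g pt (FLipD H1 H2).
have d0 : 0 <= t - s by rewrite subr_ge0.
apply: le_trans (sg_add HS d0 b1 b2 _); apply: (sg_le HS) => //; first exact: BLD.
by move=> y; exact: IH.
Qed.

(* [c] and [b] may depend on the values of the function at times outside [ts]. *)
Lemma back_affine ts s T g Phi (c b : (R -> R) -> R) : path <=%R s ts -> FLip T Phi ->
  (forall g, 0 <= c g) ->
  (forall g h, (forall r, r \notin ts -> h r = g r) -> c h = c g /\ b h = b g) ->
  back ts s g (fun g => c g * Phi g + b g) = c g * back ts s g Phi + b g.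
Proof.
move=> + H1 c0; elim: ts s g => [//|t ts IH] s g /= /andP[st pt] H.
have d0 : 0 <= t - s by rewrite subr_ge0.
have b1 := back_BL g pt H1.
have := sg_affine HS (b g) 0 (g s) d0 b1 (c0 g); rewrite addr0 => <-.
congr (S _ _ _); apply/funext => y; rewrite addr0 IH//; last first.
  move=> g' h gh; apply: H => r; rewrite inE negb_or => /andP[_]; exact: gh.
have [|-> ->//] := H g (upd g t y).
by move=> r; rewrite inE negb_or => /andP[/negbTE rt _]; rewrite /upd rt.
Qed.

Lemma back_const ts s g (b : (R -> R) -> R) : path <=%R s ts ->
  (forall g h, (forall r, r \notin ts -> h r = g r) -> b h = b g) ->
  back ts s g b = b g.
Proof.
move=> p H; transitivity (0 * back ts s g (fun=> 0) + b g); last by rewrite mul0r add0r.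
rewrite -(@back_affine ts s [::] g (fun=> 0) (fun=> 0) b p (FLip_cst _ 0) (fun=> lexx _)).
  by congr (back _ _ _ _); apply/funext => h; rewrite mul0r add0r.
by move=> g' h gh; split=> //; exact: H.
Qed.

Lemma back_ext ts s T g h Phi : FLip T Phi -> g s = h s ->
  (forall r, r \in T -> r \notin ts -> g r = h r) -> back ts s g Phi = back ts s h Phi.
Proof.
move=> H1; elim: ts s g h => [|t ts IH] s g h /= gs H.
  by apply: (FLip_ext H1) => r rT; apply: H.
rewrite gs; congr (S _ _ _); apply/funext => y; apply: IH; first by rewrite /upd eqxx.
move=> r rT rts; rewrite /upd; case: eqP => // /eqP rt.
by apply: H => //; rewrite inE negb_or rt.
Qed.

Lemma back_cat ts1 ts2 s g Phi : back (ts1 ++ ts2) s g Phi =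
  back ts1 s g (fun g => back ts2 (last s ts1) g Phi).
Proof.
elim: ts1 s g => [//|t ts IH] s g /=.
by congr (S _ _ _); apply/funext => y; rewrite IH.
Qed.

Lemma upd_id g t : upd g t (g t) = g.
Proof. by apply/funext => r; rewrite /upd; case: eqP => [->|]. Qed.

Lemma back_dup ts s T g Phi : path <=%R s ts -> FLip T Phi ->
  back (s :: ts) s g Phi = back ts s g Phi.
Proof.
move=> pt H1; rewrite /= subrr (sg_id HS); last exact: back_BL pt H1.
by rewrite upd_id.
Qed.

(** A time at which Phi does not look can be skipped: between two times by the semigroup law, at the
    end because constants are invariant. Hence the conditional expectation does not depend on the
    list of times. *)
Lemma back_drop ts1 r ts2 s T g Phi : path <%R s (ts1 ++ r :: ts2) -> FLip T Phi ->
  r \notin T -> back (ts1 ++ r :: ts2) s g Phi = back (ts1 ++ ts2) s g Phi.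
Proof.
move=> + H1 rT; elim: ts1 s g => [|t ts1 IH] s g /=; last first.
  by move=> /andP[st pt]; congr (S _ _ _); apply/funext => y; exact: IH.
move=> /andP[sr]; have d0 : 0 <= r - s by rewrite subr_ge0 ltW.
case: ts2 => [_|t ts2 /= /andP[rt pt]] /=.
  have -> : (fun y => Phi (upd g r y)) = fun y => 1 * (fun=> 0) (y + 0) + Phi g.
    apply/funext => y; rewrite mulr0 add0r; apply: (FLip_ext H1) => q qT.
    by rewrite /upd; case: eqP => // qr; rewrite qr (negbTE rT) in qT.
  have b0 := BL_cst (0 : R).
  rewrite (sg_affine HS _ 0 _ d0 b0 ler01) mul1r.
  have /(sg_lipb HS d0)[_ H _] : lipb 0 0 (fun=> 0 : R).
    by split=> // *; rewrite ?subrr ?normr0 ?mul0r.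
  by have := H (g s + 0); rewrite normr_le0 => /eqP ->; rewrite add0r.
have pt' : path <=%R t ts2 by apply: sub_path pt => ? ? /ltW.
have b1 := back_BL g pt' H1.
have E : (fun y => S (t - r) (fun y0 => back ts2 t (upd (upd g r y) t y0) Phi) (upd g r y r)) =
   S (t - r) (fun y0 => back ts2 t (upd g t y0) Phi).
  apply/funext => y; rewrite updE; congr (S _ _ _); apply/funext => z.
  apply: (back_ext H1); first by rewrite /upd eqxx.
  move=> q qT _; rewrite /upd; case: eqP => // _; case: eqP => // qr.
  by rewrite qr (negbTE rT) in qT.
rewrite E (sg_comp HS) ?subr_ge0 ?(ltW rt) ?(ltW sr)//.
by rewrite addrC addrA subrK.
Qed.

Lemma back_subseq ts ts' s T g Phi : path <%R s ts' -> FLip T Phi -> subseq ts ts' ->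
  (forall r, r \in T -> r \in ts' -> r \in ts) -> back ts' s g Phi = back ts s g Phi.
Proof.
move=> + H1; elim: ts' ts s g => [|r ts' IH] ts s g /=.
  by move=> _ /eqP ->.
move=> /andP[sr pt]; case: ts => [|t ts].
  move=> _ H; have rT : r \notin T by apply/negP => /H; rewrite mem_head => /(_ isT).
  have := @back_drop [::] r ts' s T g Phi; rewrite /= sr => ->//.
  apply: (IH [::]); last by move=> q qT qts; have := H q qT; rewrite inE qts orbT => /(_ isT).
    by apply: (path_le (@lt_trans _ _)) sr pt.
  by rewrite sub0seq.
case: eqP => [->|tr].
  move=> st H /=; congr (S _ _ _); apply/funext => y; apply: IH => // q qT qts.
  have := H q qT; rewrite inE qts orbT => /(_ isT); rewrite inE => /orP[/eqP qr|//].
  have : all (> r) ts' by apply: (order_path_min (@lt_trans _ _)).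
  by move=> /allP/(_ q qts); rewrite qr ltxx.
move=> st H; have rts : r \notin t :: ts.
  apply/negP => /(mem_subseq st) rts'.
  have : all (> r) ts' by apply: (order_path_min (@lt_trans _ _)).
  by move=> /allP/(_ r rts'); rewrite ltxx.
have rT : r \notin T by apply/negP => /H; rewrite mem_head => /(_ isT) rr; rewrite rr in rts.
have := @back_drop [::] r ts' s T g Phi; rewrite /= sr => ->//.
apply: (IH (t :: ts)) => //; last by move=> q qT qts; have := H q qT; rewrite inE qts orbT => /(_ isT).
by apply: (path_le (@lt_trans _ _)) sr pt.
Qed.

Definition grid t T : seq R := sort <=%R (undup [seq r <- T | t < r]).

Lemma mem_grid t T r : (r \in grid t T) = (r \in T) && (t < r).
Proof. by rewrite mem_sort mem_undup mem_filter andbC. Qed.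

Lemma grid_path t T : path <%R t (grid t T).
Proof.
rewrite path_min_sorted; last by apply/allP => r; rewrite mem_grid => /andP[].
by rewrite /grid sort_lt_sorted undup_uniq.
Qed.

Lemma grid_path_le t T : path <=%R t (grid t T).
Proof. by apply: sub_path (grid_path t T) => ? ? /ltW. Qed.

Lemma sorted_path_eq t ts ts' : path <%R t ts -> path <%R t ts' -> ts =i ts' -> ts = ts'.
Proof.
move=> p1 p2; apply: (irr_sorted_eq (@lt_trans _ _) (@lt_irreflexive _ _)).
  exact: path_sorted p1.
exact: path_sorted p2.
Qed.

Definition cond t T Phi g : R := back (grid t T) t g Phi.

Lemma cond_sub t T T' Phi g : FLip T Phi -> {subset T <= T'} -> cond t T' Phi g = cond t T Phi g.
Proof.
move=> H sT; apply: (back_subseq _ (grid_path t T') H); last first.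
  by move=> r rT; rewrite !mem_grid rT /= => /andP[].
have -> : grid t T = [seq r <- grid t T' | r \in T].
  apply: (@sorted_path_eq t); first exact: grid_path.
    by apply: path_filter (grid_path t T') => ?; exact: lt_trans.
  move=> r; rewrite mem_filter !mem_grid; case rT : (r \in T) => //=.
  by rewrite (sT _ rT).
exact: filter_subseq.
Qed.

Lemma cond_any t ts T Phi g : path <%R t ts -> FLip T Phi ->
  (forall r, r \in T -> t < r -> r \in ts) -> back ts t g Phi = cond t T Phi g.
Proof.
move=> p H sub; apply: (back_subseq _ p H).
  have -> : grid t T = [seq r <- ts | r \in T].
    apply: (@sorted_path_eq t); first exact: grid_path.
      by apply: path_filter p => ?; exact: lt_trans.
    move=> r; rewrite mem_filter !mem_grid; case rT : (r \in T) => //=.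
    apply/idP/idP => [tr|rts]; first exact: sub.
    by have /allP/(_ r rts) := order_path_min (@lt_trans _ _) p.
  exact: filter_subseq.
move=> r rT rts; rewrite mem_grid rT.
by have /allP/(_ r rts) := order_path_min (@lt_trans _ _) p.
Qed.

Lemma cond_FLip t T Phi : FLip T Phi -> FLip (t :: [seq r <- T | r <= t]) (cond t T Phi).
Proof.
move=> H; have [K [L [L0 HK HL]]] := back_FLip (grid_path_le t T) H.
exists K, (L * (size (t :: T))%:R); split=> [|g|g h]; rewrite ?mulr_ge0//.
  exact: HK.
pose T' := t :: [seq r <- T | r <= t].
(* [h'] has the values of h only at t and at the times of T up to t. The conditional expectation
   cannot tell it from h, which removes the later times from the Lipschitz bound. *)
pose h' r := if r \in T' then h r else g r.
have -> : cond t T Phi h = cond t T Phi h'.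
  apply: (back_ext H); first by rewrite /h' mem_head.
  move=> r rT; rewrite mem_grid rT /= -leNgt => rt; rewrite /h' inE mem_filter rT rt.
  by rewrite orbT.
apply: le_trans (HL _ _) _; rewrite -mulrA ler_wpM2l//.
have le r : r \in t :: T -> `|g r - h' r| <= \sum_(s <- T') `|g s - h s|.
  move=> _; rewrite /h'; case: ifPn => rT'; last by rewrite subrr normr0 sum_norm_ge0.
  by rewrite (big_rem r)//= lerDl; exact: sumr_ge0.
elim: (t :: T) le => [|r q IH] le; first by rewrite big_nil mul0r.
rewrite big_cons -natr1 mulrDl mul1r addrC lerD ?le ?mem_head//.
by apply: IH => z zq; apply: le; rewrite inE zq orbT.
Qed.

(** With t among the times, the grid after s splits at t and the two recursions concatenate. *)
Lemma cond_tower s t T Phi g : s <= t -> FLip T Phi -> t \in T ->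
  cond s T (cond t T Phi) g = cond s T Phi g.
Proof.
rewrite le_eqVlt => /orP[/eqP <-|st] H tT.
  have Hc := cond_FLip s H.
  apply: back_const (grid_path_le _ _) _ => g' h gh; apply: (FLip_ext Hc) => r rT; apply: gh.
  rewrite mem_grid negb_and -leNgt; apply/orP; right.
  by move: rT; rewrite inE mem_filter => /orP[/eqP ->//|/andP[]].
have Hc := cond_FLip t H.
pose ts1 := sort <=%R (undup [seq r <- T | s < r & r <= t]).
have m1 r : (r \in ts1) = [&& r \in T, s < r & r <= t].
  by rewrite mem_sort mem_undup mem_filter andbC.
have p1 : path <%R s ts1.
  rewrite path_min_sorted; last by apply/allP => r; rewrite m1 => /and3P[].
  by rewrite /ts1 sort_lt_sorted undup_uniq.
have ts1t : t \in ts1 by rewrite m1 tT st lexx.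
have l1 : last s ts1 = t.
  apply/le_anti/andP; split.
    have : last s ts1 \in s :: ts1 by exact: mem_last.
    by rewrite inE => /orP[/eqP ->|]; [exact: ltW|rewrite m1 => /and3P[]].
  have : t \in s :: ts1 by rewrite inE ts1t orbT.
  have ps : path <=%R s ts1 by apply: sub_path p1 => ? ? /ltW.
  by move=> /(path_last_ge ps).
have E : grid s T = ts1 ++ grid t T.
  apply: (@sorted_path_eq s); first exact: grid_path.
    by rewrite cat_path p1 l1 grid_path.
  move=> r; rewrite mem_cat m1 !mem_grid; case: (r \in T) => //=.
  by have [rt|tr] := leP r t; rewrite ?andbT ?orbF//= andbF orFb (lt_trans st tr).
rewrite [RHS]/cond E back_cat l1.
have sub : {subset t :: [seq r <- T | r <= t] <= T}.
  by move=> r; rewrite inE mem_filter => /orP[/eqP ->|/andP[]].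
rewrite (cond_sub _ _ Hc sub); apply/esym/cond_any => // r.
by rewrite m1 inE mem_filter => /orP[/eqP -> ->|/andP[-> ->] ->]; rewrite ?tT ?lexx.
Qed.

Lemma cond_le t T g Phi Psi : FLip T Phi -> FLip T Psi ->
  (forall h, (forall r, r <= t -> h r = g r) -> Phi h <= Psi h) ->
  cond t T Phi g <= cond t T Psi g.
Proof.
move=> H1 H2 H.
pose T' := [seq r <- T | t < r].
apply: (back_le (grid_path_le t T) H1 H2) => h hg; apply: H => r rt.
by apply: hg; rewrite mem_grid negb_and -leNgt rt orbT.
Qed.

Lemma condD t T g Phi Psi : FLip T Phi -> FLip T Psi ->
  cond t T (fun g => Phi g + Psi g) g <= cond t T Phi g + cond t T Psi g.
Proof. by move=> H1 H2; exact: (back_add _ (grid_path_le t T) H1 H2). Qed.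

Lemma cond_affine t T g Phi (c b : (R -> R) -> R) : FLip T Phi -> (forall g, 0 <= c g) ->
  (forall g h, (forall r, r <= t -> h r = g r) -> c h = c g /\ b h = b g) ->
  cond t T (fun g => c g * Phi g + b g) g = c g * cond t T Phi g + b g.
Proof.
move=> H c0 cb; apply: (back_affine _ (grid_path_le t T) H c0) => g' h gh.
by apply: cb => r rt; apply: gh; rewrite mem_grid negb_and -leNgt rt orbT.
Qed.

Lemma cond_cst t T g c : cond t T (fun=> c) g = c.
Proof.
exact: back_const (grid_path_le _ _) _.
Qed.

End Backward.

(** * Bounded Lipschitz functions of rows and of increments *)

Section BoundedLipschitz.
Context {R : realType}.

Lemma bounded_lipschitzP m (phi : 'rV[R]_m.+1 -> R) : bounded_lipschitz phi <->
  (exists K, forall x, `|phi x| <= K) /\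
  (exists2 L, 0 <= L & forall x y, `|phi x - phi y| <= L * `|x - y|).
Proof.
split=> [[[M [Mr HM]] [N [Nr HN]]]|[[K HK] [L L0 HL]]].
  split.
    by exists (M + 1) => x; apply: (HM (M + 1)) => //; rewrite ltrDl.
  exists (`|N| + 1); first by rewrite addr_ge0.
  move=> x y; apply: (HN (`|N| + 1) _ (x, y)) => //=.
  by rewrite (le_lt_trans (ler_norm N))// ltrDl.
split.
  exists K; split; first exact: num_real.
  by move=> M KM x _ /=; exact: le_trans (HK x) (ltW KM).
exists L; split; first exact: num_real.
move=> M LM [x y] _ /=; apply: le_trans (HL x y) _.
by rewrite ler_wpM2r// ltW.
Qed.

Lemma row_norm_le m (x : 'rV[R]_m) : `|x| <= \sum_(i < m) `|x 0 i|.
Proof.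
rewrite [leLHS]/Num.norm /= mx_normrE; apply: bigmax_le => [|[i j] _]; first exact: sumr_ge0.
by rewrite [i]ord1 /= (bigD1 j)//= lerDl; exact: sumr_ge0.
Qed.

Lemma row_coord_le m (x : 'rV[R]_m) i : `|x 0 i| <= `|x|.
Proof.
rewrite [leRHS]/Num.norm /= mx_normrE; apply/bigmax_geP; right => /=.
by exists (0, i).
Qed.

Lemma nth_increments (f : R -> R) ts i : (i < size ts)%N ->
  (increments f ts)`_i = f (0 :: ts)`_i.+1 - f (0 :: ts)`_i.
Proof. by move=> ilt; rewrite /increments (nth_pairmap 0). Qed.

Definition BLseq n (f : seq R -> R) := exists K L, [/\ 0 <= L, forall x, `|f x| <= K &
  forall x y, `|f x - f y| <= L * \sum_(i < n) `|x`_i - y`_i|].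

Lemma BLseq_row m (phi : 'rV[R]_m.+1 -> R) : bounded_lipschitz phi ->
  BLseq m.+1 (fun s => phi (row_of_seq m.+1 s)).
Proof.
move=> /bounded_lipschitzP[[K HK] [L L0 HL]]; exists K, L; split=> // x y.
apply: le_trans (HL _ _) _; rewrite ler_wpM2l//; apply: le_trans (row_norm_le _) _.
by apply: ler_sum => i _; rewrite !mxE.
Qed.

Lemma BLseq_cons n f y : BLseq n.+1 f -> BLseq n (fun x => f (y :: x)).
Proof.
move=> [K [L [L0 HK HL]]]; exists K, L; split=> // x z.
apply: le_trans (HL _ _) _; rewrite ler_wpM2l// big_ord_recl /= subrr normr0 add0r.
by apply: ler_sum => i _.
Qed.

Lemma BLseq_FLip ts s f : BLseq (size ts) f ->
  FLip (s :: ts) (fun h => f (pairmap (fun a b => h b - h a) s ts)).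
Proof.
move=> [K [L [L0 HK HL]]]; exists K, (L * ((size ts)%:R * 2)); split=> // [|g h].
  by rewrite !mulr_ge0.
apply: le_trans (HL _ _) _; rewrite -mulrA ler_wpM2l//.
set D := \sum_(r <- s :: ts) `|g r - h r|.
have le r : r \in s :: ts -> `|g r - h r| <= D.
  by move=> rT; rewrite /D (perm_big _ (perm_to_rem rT)) big_cons lerDl; exact: sumr_ge0.
have -> : (size ts)%:R * 2 * D = \sum_(i < size ts) (2 * D).
  by rewrite sumr_const card_ord -[RHS]mulr_natl mulrA.
apply: ler_sum => i _; rewrite !(nth_pairmap s)//.
set a := nth s (s :: ts) i; set b := nth s ts i.
rewrite (_ : _ - _ - _ = (g b - h b) - (g a - h a)); last by ring.
apply: le_trans (ler_normB _ _) _; rewrite mulr_natl mulr2n.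
have am : a \in s :: ts by rewrite mem_nth//= ltnS ltnW.
have bm : b \in s :: ts by rewrite inE mem_nth ?orbT.
by rewrite lerD ?le.
Qed.

Lemma FLip_curve T Phi (G : R -> R -> R) : FLip T Phi ->
  (forall r y z, `|G y r - G z r| <= `|y - z|) -> BL (fun y => Phi (G y)).
Proof.
move=> [K [L [L0 HK HL]]] HG; split; first by exists K.
exists (L * (size T)%:R); first by rewrite mulr_ge0.
move=> y z; apply: le_trans (HL _ _) _; rewrite -mulrA ler_wpM2l//.
elim: T {HL} => [|t T IH]; first by rewrite big_nil mul0r.
by rewrite big_cons /= -natr1 mulrDl mul1r addrC lerD.
Qed.

(* The function recovered from its increments along [ts]. *)
Definition from_row m (ts : seq R) (x : 'rV[R]_m) (s : R) : R :=
  if s \in ts then \sum_(i < m | (i <= index s ts)%N) x 0 i else 0.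

Lemma from_rowK m (ts : seq R) (g : R -> R) : size ts = m -> g 0 = 0 ->
  forall s, s \in 0 :: ts -> 0 \notin ts -> from_row ts (row_of_seq m (increments g ts)) s = g s.
Proof.
move=> sz g0 s; rewrite inE /from_row => sts ts0; case: ifPn => [{}sts|sn]; last first.
  by move: sts; rewrite (negbTE sn) orbF => /eqP ->.
have ilt : (index s ts < m)%N by rewrite -sz index_mem.
under eq_bigr => i _ do rewrite mxE nth_increments ?sz//.
rewrite -(big_mkord (fun i => (i <= index s ts)%N) (fun i => g (0 :: ts)`_i.+1 - g (0 :: ts)`_i)).
rewrite (big_cat_nat _ _ (n := (index s ts).+1))//= [X in _ + X]big1_seq ?addr0; last first.
  by move=> i /andP[+ ]; rewrite mem_index_iota => h1 /andP[h2 _]; rewrite leqNgt h2 in h1.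
rewrite big_nat_cond.
rewrite (eq_bigl (fun i => (0 <= i < (index s ts).+1)%N && true)); last first.
  by move=> i /=; rewrite ltnS andbT; case: leqP.
rewrite -big_nat_cond telescope_sumr// /= nth_index// g0 subr0.
by [].
Qed.

Lemma FLip_row m ts (T : seq R) Phi : FLip T Phi -> size ts = m.+1 ->
  bounded_lipschitz (fun x : 'rV[R]_m.+1 => Phi (from_row ts x)).
Proof.
move=> [K [L [L0 HK HL]]] sz; apply/bounded_lipschitzP; split; first by exists K.
exists (L * ((size T)%:R * (m.+1)%:R)); first by rewrite !mulr_ge0.
move=> x y; apply: le_trans (HL _ _) _; rewrite -mulrA ler_wpM2l//.
have le s : `|from_row ts x s - from_row ts y s| <= (m.+1)%:R * `|x - y|.
  rewrite /from_row; case: ifP => _; last by rewrite subrr normr0 mulr_ge0.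
  rewrite -sumrB; apply: le_trans (ler_norm_sum _ _ _) _.
  have -> : m.+1%:R * `|x - y| = \sum_(i < m.+1) `|x - y|.
    by rewrite sumr_const card_ord mulr_natl.
  rewrite [leRHS](bigID (fun i : 'I_m.+1 => (i <= index s ts)%N))/=.
  apply: ler_wpDr; first exact: sumr_ge0.
  by apply: ler_sum => i _; rewrite -[X in `|X|](_ : (x - y) 0 i = _) ?row_coord_le// !mxE.
elim: T {HL} => [|t T IH]; first by rewrite big_nil !mul0r.
by rewrite big_cons /= -natr1 [in leRHS]mulrDl mulrDl mul1r addrC lerD.
Qed.

End BoundedLipschitz.

(** * The recursion [Gcyl] in terms of path values *)

Section Gcyl.
Context {R : realType}.
Variables (slo shi : R).
Local Notation S := (fun d phi => Gheat slo shi phi d).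
Hypothesis HS : @semigroup R S.

Lemma back_congr ts s T g Phi Psi : path <=%R s ts -> FLip T Phi -> FLip T Psi ->
  (forall h, h s = g s -> (forall r, r \notin ts -> h r = g r) -> Phi h = Psi h) ->
  back S ts s g Phi = back S ts s g Psi.
Proof.
move=> + H1 H2; elim: ts s g => [|t ts IH] s g /= => [_ H|/andP[st pt] H].
  by apply: H.
have [ts_eq|ts_ne] := eqVneq t s.
  have b1 := back_BL HS g pt H1; have b2 := back_BL HS g pt H2.
  rewrite ts_eq subrr in b1 b2 *; rewrite (sg_id HS b1) (sg_id HS b2) upd_id -ts_eq.
  apply: IH => //; rewrite ts_eq => h hs hr; apply: H => // r.
  by rewrite inE negb_or => /andP[_]; exact: hr.
congr Gheat; apply/funext => y; apply: IH => // h ht hr; apply: H; last first.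
  by move=> r; rewrite inE negb_or => /andP[/negbTE rt rts]; rewrite hr// /upd rt.
rewrite hr; first by rewrite /upd eq_sym (negbTE ts_ne).
have lt_st : s < t by rewrite lt_neqAle eq_sym ts_ne.
apply/negP => sts; have /allP/(_ s sts) := order_path_min le_trans pt.
by rewrite leNgt lt_st.
Qed.

Lemma back_grid ts s T g Phi : path <=%R s ts -> FLip T Phi ->
  back S ts s g Phi = back S (grid s ts) s g Phi.
Proof.
move=> + H1; elim: ts s g => [//|t ts IH] s g /andP[st pt].
have [ts_eq|ts_ne] := eqVneq t s.
  rewrite ts_eq in pt *; rewrite (back_dup HS g pt H1) IH//.
  congr back; apply: (@sorted_path_eq _ s); [exact: grid_path..|].
  by move=> r; rewrite !mem_grid inE; have [->|] := eqVneq r s; rewrite ?ltxx ?andbF.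
have lt_st : s < t by rewrite lt_neqAle eq_sym ts_ne.
have -> : grid s (t :: ts) = t :: grid t ts.
  apply: (@sorted_path_eq _ s); first exact: grid_path.
    by rewrite /= lt_st grid_path.
  move=> r; rewrite !mem_grid !inE mem_grid; have [->|rt] := eqVneq r t; first by rewrite lt_st.
  rewrite !orFb; case rts : (r \in ts) => //=.
  have /allP/(_ r rts) := order_path_min le_trans pt => tr.
  have tr' : t < r by rewrite lt_neqAle eq_sym rt.
  by rewrite tr' (lt_trans lt_st).
by rewrite /=; congr Gheat; apply/funext => y; exact: IH.
Qed.

(** [Gcyl] recurses on increments and [back] on values; a translation of the space variable by g s
    relates them. A repeated time t = s is treated apart, since updating the value at t then changes
    the value at s as well. *)
Lemma Gcyl_back ts s g (f : seq R -> R) : path <=%R s ts -> BLseq (size ts) f ->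
  Gcyl slo shi (pairmap (fun a b => b - a) s ts) f =
  back S ts s g (fun h => f (pairmap (fun a b => h b - h a) s ts)).
Proof.
elim: ts s g f => [//|t ts IH] s g f /= /andP[st pt] bf.
have d0 : 0 <= t - s by rewrite subr_ge0.
pose Phi y h := f (y :: pairmap (fun a b => h b - h a) t ts).
pose Psi h := f (h t - h s :: pairmap (fun a b => h b - h a) t ts).
pose G y := back S ts t (upd g t (y + g s)) (Phi y).
have FPhi y : FLip (t :: ts) (Phi y) by exact: (@BLseq_FLip _ ts t (fun x => f (y :: x)) (BLseq_cons y bf)).
have FPsi : FLip (s :: t :: ts) Psi by exact: (@BLseq_FLip _ (t :: ts) s f bf).
have -> : (fun y => Gcyl slo shi (pairmap (fun a b => b - a) t ts) (fun x => f (y :: x))) = G.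
  by apply/funext => y; apply: IH => //; exact: BLseq_cons.
have bPsi := back_BL HS g pt FPsi.
have sub y : FLip (s :: t :: ts) (Phi y).
  by apply: FLip_sub (FPhi y) => r rT; rewrite inE rT orbT.
have [ts_eq|ts_ne] := eqVneq t s; last first.
  have lt_st : s < t by rewrite lt_neqAle eq_sym ts_ne.
  have := sg_affine HS 0 (g s) 0 d0 bPsi ler01; rewrite mul1r addr0 add0r => <-.
  congr Gheat; apply/funext => y; rewrite mul1r addr0.
  apply: (back_congr pt (sub y) FPsi) => h ht hr; rewrite /Phi /Psi ht updE hr.
    by rewrite /upd (eq_sym s) (negbTE ts_ne) addrK.
  apply/negP => sts; have /allP/(_ s sts) := order_path_min le_trans pt.
  by rewrite leNgt lt_st.
have bG : BL G.
  (* A fictitious time before s carries the increment y, so that Lipschitz dependence on y becomes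
     an instance of dependence on path values. *)
  pose r0 := s - 1.
  have r0s r : r \in s :: t :: ts -> r0 != r.
    have ps : path <=%R s (t :: ts) by rewrite /= st.
    rewrite inE => /orP[/eqP ->|]; first by rewrite /r0 lt_eqF// gtrDl oppr_lt0.
    have /allP H := order_path_min le_trans ps.
    by move=> /H sr; rewrite lt_eqF// (lt_le_trans _ sr)// gtrDl oppr_lt0.
  pose Xi h := f (h r0 :: pairmap (fun a b => h b - h a) t ts).
  have FXi : FLip (r0 :: t :: ts) Xi.
    have [K [L [L0 HK HL]]] := bf.
    have [K' [L' [L0' _ HL']]] := BLseq_FLip t (BLseq_cons 0 bf).
    exists K, (L + L * ((size ts)%:R * 2)); split=> [||g1 h1].
    - by rewrite addr_ge0// !mulr_ge0.
    - by move=> h1; exact: HK.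
    apply: le_trans (HL _ _) _; rewrite big_ord_recl /= mulrDr big_cons mulrDl.
    set D := \sum_(j <- t :: ts) _; have D0 : 0 <= D by exact: sumr_ge0.
    rewrite lerD//; first by rewrite ler_wpM2l// lerDl.
    rewrite -mulrA ler_wpM2l//.
    have le r : r \in t :: ts -> `|g1 r - h1 r| <= D.
      by move=> rT; rewrite /D (perm_big _ (perm_to_rem rT)) big_cons lerDl; exact: sumr_ge0.
    apply: (@le_trans _ _ ((size ts)%:R * 2 * D)); last by rewrite ler_wpM2l// lerDr.
    have -> : (size ts)%:R * 2 * D = \sum_(i < size ts) (2 * D).
      by rewrite sumr_const card_ord -[RHS]mulr_natl mulrA.
    apply: ler_sum => i _; rewrite add0n !(nth_pairmap t)//.
    set a := nth t (t :: ts) i; set b := nth t ts i.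
    rewrite (_ : _ - _ - _ = (g1 b - h1 b) - (g1 a - h1 a)); last by ring.
    apply: le_trans (ler_normB _ _) _; rewrite mulr_natl mulr2n.
    have am : a \in t :: ts by rewrite mem_nth//= ltnS ltnW.
    have bm : b \in t :: ts by rewrite inE mem_nth ?orbT.
    by rewrite lerD ?le.
  have -> : G = fun y => back S ts t (upd (upd g t (y + g s)) r0 y) Xi.
    apply/funext => y; rewrite /G.
    have -> : back S ts t (upd g t (y + g s)) (Phi y) =
       back S ts t (upd (upd g t (y + g s)) r0 y) (Phi y).
      apply: (back_ext S (FPhi y)); first by rewrite updE [RHS]/upd (eq_sym t) (negbTE (r0s t _)) ?updE// !inE eqxx orbT.
      move=> r rT _; rewrite [RHS]/upd (eq_sym r) (negbTE (r0s r _))// inE.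
      by rewrite rT orbT.
    apply: (back_congr pt (T := r0 :: t :: ts) _ FXi) => [|h _ hr].
      by apply: FLip_sub (FPhi y) => r rT; rewrite inE rT orbT.
    rewrite /Phi /Xi hr; first by rewrite updE.
    by apply/negP => r0ts; have := r0s r0; rewrite !inE r0ts !orbT eqxx => /(_ isT).
  apply: (FLip_curve (back_FLip HS pt FXi)) => r y z.
  rewrite /upd; case: eqP => // _; case: eqP => _; last by rewrite subrr normr0.
  by rewrite opprD addrACA subrr addr0.
have dd : t - s = 0 by rewrite ts_eq subrr.
have -> : Gheat slo shi G (t - s) 0 = G 0 by rewrite dd (sg_id HS bG).
have -> : Gheat slo shi (fun y => back S ts t (upd g t y) Psi) (t - s) (g s) =
    back S ts t (upd g t (g s)) Psi by rewrite dd (sg_id HS bPsi).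
rewrite /G add0r; apply: (back_congr pt (sub 0) FPsi) => h hs _.
by rewrite /Phi /Psi ts_eq subrr.
Qed.

End Gcyl.

(** * Cylinder functionals up to a horizon, their conditional and total G-expectation *)

Section Cylinder.
Context {R : realType}.
Implicit Types (g h : R -> R) (Phi Psi : (R -> R) -> R) (T : seq R) (t : \bar R).

Definition cyl t Phi := exists2 T, FLip T Phi & forall r, r \in T -> (r%:E <= t)%E.

Lemma cyl_le t t' Phi : (t <= t')%E -> cyl t Phi -> cyl t' Phi.
Proof. by move=> tt [T H HT]; exists T => // r rT; exact: le_trans (HT r rT) tt. Qed.

Lemma cyl_pinfty t Phi : cyl t Phi -> cyl +oo Phi.
Proof. by apply: cyl_le; rewrite leey. Qed.

Lemma cyl_cst t c : cyl t (fun=> c).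
Proof. by exists [::] => //; exact: FLip_cst. Qed.

Lemma cyl2 t (F : ((R -> R) -> R) -> ((R -> R) -> R) -> (R -> R) -> R) Phi Psi :
  (forall T Phi Psi, FLip T Phi -> FLip T Psi -> FLip T (F Phi Psi)) ->
  cyl t Phi -> cyl t Psi -> cyl t (F Phi Psi).
Proof.
move=> HF [T1 H1 T1t] [T2 H2 T2t]; exists (T1 ++ T2).
  apply: HF; [apply: FLip_sub H1|apply: FLip_sub H2] => r rT; rewrite mem_cat rT ?orbT//.
by move=> r; rewrite mem_cat => /orP[/T1t|/T2t].
Qed.

Lemma cylD t Phi Psi : cyl t Phi -> cyl t Psi -> cyl t (fun g => Phi g + Psi g).
Proof. exact: (cyl2 (@FLipD R)). Qed.

Lemma cylB t Phi Psi : cyl t Phi -> cyl t Psi -> cyl t (fun g => Phi g - Psi g).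
Proof. exact: (cyl2 (@FLipB R)). Qed.

Lemma cylM t Phi Psi : cyl t Phi -> cyl t Psi -> cyl t (fun g => Phi g * Psi g).
Proof. exact: (cyl2 (@FLipM R)). Qed.

Lemma cylZ t c Phi : cyl t Phi -> cyl t (fun g => c * Phi g).
Proof. by move=> [T H Tt]; exists T => //; exact: FLipZ. Qed.

Lemma cylN t Phi : cyl t Phi -> cyl t (fun g => - Phi g).
Proof. by move=> [T H Tt]; exists T => //; exact: FLipN. Qed.

Lemma cyl_maxc t Phi c : cyl t Phi -> cyl t (fun g => Num.max (Phi g) c).
Proof. by move=> [T H Tt]; exists T => //; exact: FLip_max. Qed.

Lemma cyl_minc t Phi c : cyl t Phi -> cyl t (fun g => Num.min (Phi g) c).
Proof. by move=> [T H Tt]; exists T => //; exact: FLip_min. Qed.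

Lemma cyl_max t Phi Psi : cyl t Phi -> cyl t Psi -> cyl t (fun g => Num.max (Phi g) (Psi g)).
Proof.
move=> H1 H2; have := cylD (cyl_maxc 0 (cylB H1 H2)) H2; congr cyl; apply/funext => g.
by rewrite /Num.max subr_lt0; case: ltP; rewrite ?add0r ?subrK.
Qed.

Lemma cyl_min t Phi Psi : cyl t Phi -> cyl t Psi -> cyl t (fun g => Num.min (Phi g) (Psi g)).
Proof.
move=> H1 H2; have := cylD (cyl_minc 0 (cylB H1 H2)) H2; congr cyl; apply/funext => g.
by rewrite /Num.min subr_lt0; case: ltP; rewrite ?add0r ?subrK.
Qed.

Lemma cyl_sum t n (F : nat -> (R -> R) -> R) : (forall i, cyl t (F i)) ->
  cyl t (fun g => \sum_(i < n) F i g).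
Proof.
move=> H; elim: n => [|n IH].
  by under eq_fun do rewrite big_ord0; exact: cyl_cst.
by under eq_fun do rewrite big_ord_recr; exact: cylD.
Qed.

Lemma cyl_bounded t Phi : cyl t Phi -> exists2 K, 0 <= K & forall g, `|Phi g| <= K.
Proof.
move=> [T [K [L [_ HK _]]] _]; exists K => //.
exact: le_trans (normr_ge0 _) (HK (fun=> 0)).
Qed.

Lemma cyl_ext t Phi g h : cyl t Phi -> (forall r, (r%:E <= t)%E -> g r = h r) -> Phi g = Phi h.
Proof. by move=> [T H Tt] gh; apply: (FLip_ext H) => r rT; apply: gh; exact: Tt. Qed.

Lemma cyl_eval t (s : R) (f : R -> R) : (s%:E <= t)%E -> BL f -> cyl t (fun g => f (g s)).
Proof.
move=> st bf; exists [:: s]; first by apply: FLip_eval; rewrite ?mem_head.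
by move=> r; rewrite inE => /eqP ->.
Qed.

Lemma FLip_param (V : Type) (d : V -> V -> R) T Phi (G : V -> R -> R) C : FLip T Phi -> 0 <= C ->
  (forall r y z, `|G y r - G z r| <= C * d y z) ->
  (exists K, forall y, `|Phi (G y)| <= K) /\
  (exists2 L, 0 <= L & forall y z, `|Phi (G y) - Phi (G z)| <= L * d y z).
Proof.
move=> [K [L [L0 HK HL]]] C0 HG; split; first by exists K.
exists (L * ((size T)%:R * C)); first by rewrite !mulr_ge0.
move=> x y; apply: le_trans (HL _ _) _; rewrite -mulrA ler_wpM2l//.
elim: T {HL} => [|t T IH]; first by rewrite big_nil !mul0r.
by rewrite big_cons /= -natr1 [in leRHS]mulrDl mulrDl mul1r addrC lerD.
Qed.

Lemma LipP t (X : Omega R -> R) : (0 <= t)%E ->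
  Lip t X <-> exists2 Phi, cyl t Phi & X = Phi \o @path_val R.
Proof.
move=> t0; split=> [[m [ts [phi [bl H ->]]]]|[Phi [T HPhi Tt] ->]].
  exists (fun g => phi (\row_i g (ts i))) => //.
  exists [seq ts i | i <- enum 'I_m.+1]; last by move=> r /mapP[i _ ->]; have [] := H i.
  have /bounded_lipschitzP[[K HK] [L L0 HL]] := bl.
  exists K, L; split=> // g h; apply: le_trans (HL _ _) _; rewrite ler_wpM2l//.
  apply: le_trans (row_norm_le _) _.
  by rewrite big_map big_enum /=; apply: ler_sum => i _; rewrite !mxE.
(* Paths vanish at times up to 0, so only positive times are kept; the leading 0 makes the list
   nonempty. *)
pose l := 0 :: [seq r <- T | 0 < r].
exists (size l).-1, (fun i => l`_i).
exists (fun x => Phi (fun s => if s \in l then x 0 (inord (index s l)) else 0)); split.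
- apply/bounded_lipschitzP.
  pose G (x : 'rV[R]_(size l).-1.+1) (s : R) := if s \in l then x 0 (inord (index s l)) else 0.
  have HG r y z : `|G y r - G z r| <= 1 * `|y - z|.
    rewrite mul1r /G; case: ifP => _; last by rewrite subrr normr0.
    by rewrite -[X in `|X|](_ : (y - z) 0 (inord (index r l)) = _) ?row_coord_le// !mxE.
  exact: (FLip_param HPhi ler01 HG).
- move=> i; have : l`_i \in l by rewrite mem_nth.
  rewrite /l inE mem_filter => /orP[/eqP ->|/andP[r0 /Tt]]; first by rewrite lexx.
  by rewrite (ltW r0).
apply/funext => w /=; apply: (FLip_ext HPhi) => s sT; case: ifPn => [sl|].
  rewrite mxE inordK; last by rewrite -index_mem in sl.
  by rewrite /canon nth_index.
rewrite inE mem_filter sT andbT negb_or -leNgt => /andP[_ s0].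
by case: w => w [cw w0]; rewrite /path_val /= w0.
Qed.

Lemma Lip_cyl t Phi : (0 <= t)%E -> cyl t Phi -> Lip t (Phi \o @path_val R).
Proof. by move=> t0 H; apply/LipP => //; exists Phi. Qed.

(** Some admissible list of times; by [cexpE] every other one gives the same conditional
    expectation. *)
Definition supp Phi : seq R := xget [::] [set T | FLip T Phi].

Lemma suppP t Phi : cyl t Phi -> FLip (supp Phi) Phi.
Proof. by move=> [T H _]; exact: (@xgetPex _ _ [set T | FLip T Phi] (ex_intro _ T H)). Qed.

Variable S : R -> (R -> R) -> R -> R.
Hypothesis HS : semigroup S.

Definition cexp (t : R) Phi g : R := cond S t (supp Phi) Phi g.
Definition gexp Phi : R := cexp 0 Phi (fun=> 0).

Lemma cexpE (t : R) T Phi : FLip T Phi -> cexp t Phi = cond S t T Phi.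
Proof.
move=> H; have H' : FLip (supp Phi) Phi by apply: (@suppP +oo%E); exists T => // *; exact: leey.
apply/funext => g; rewrite /cexp -(cond_sub HS t (T' := supp Phi ++ T) g H'); last first.
  by move=> r rT; rewrite mem_cat rT.
by rewrite (cond_sub HS t g H)// => r rT; rewrite mem_cat rT orbT.
Qed.

Lemma cexp_cyl (t : R) Phi : cyl +oo Phi -> cyl t%:E (cexp t Phi).
Proof.
move=> [T H _]; rewrite (cexpE t H); exists (t :: [seq r <- T | r <= t]).
  exact: cond_FLip.
by move=> r; rewrite inE mem_filter lee_fin => /orP[/eqP ->|/andP[]].
Qed.

Lemma cexp_le (t : R) Phi Psi g : cyl +oo Phi -> cyl +oo Psi ->
  (forall h, (forall r, r <= t -> h r = g r) -> Phi h <= Psi h) -> cexp t Phi g <= cexp t Psi g.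
Proof.
move=> [T1 H1 _] [T2 H2 _] H.
have H1' : FLip (T1 ++ T2) Phi by apply: FLip_sub H1 => r rT; rewrite mem_cat rT.
have H2' : FLip (T1 ++ T2) Psi by apply: FLip_sub H2 => r rT; rewrite mem_cat rT orbT.
by rewrite (cexpE t H1') (cexpE t H2'); exact: cond_le.
Qed.

Lemma cexpD (t : R) Phi Psi g : cyl +oo Phi -> cyl +oo Psi ->
  cexp t (fun g => Phi g + Psi g) g <= cexp t Phi g + cexp t Psi g.
Proof.
move=> [T1 H1 _] [T2 H2 _].
have H1' : FLip (T1 ++ T2) Phi by apply: FLip_sub H1 => r rT; rewrite mem_cat rT.
have H2' : FLip (T1 ++ T2) Psi by apply: FLip_sub H2 => r rT; rewrite mem_cat rT orbT.
by rewrite (cexpE t H1') (cexpE t H2') (cexpE t (FLipD H1' H2')); exact: condD.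
Qed.

Lemma cexp_affine (t : R) Phi (c b : (R -> R) -> R) g : cyl +oo Phi ->
  cyl t%:E c -> cyl t%:E b -> (forall g, 0 <= c g) ->
  cexp t (fun g => c g * Phi g + b g) g = c g * cexp t Phi g + b g.
Proof.
move=> [T H _] [T1 H1 T1t] [T2 H2 T2t] c0.
pose T' := T ++ T1 ++ T2.
have H' : FLip T' Phi by apply: FLip_sub H => r rT; rewrite mem_cat rT.
have H1' : FLip T' c by apply: FLip_sub H1 => r rT; rewrite !mem_cat rT orbT.
have H2' : FLip T' b by apply: FLip_sub H2 => r rT; rewrite !mem_cat rT !orbT.
rewrite (cexpE t (FLipD (FLipM H1' H') H2')) (cexpE t H').
apply: (cond_affine HS g H' c0) => g' h gh; split.
  by apply: (FLip_ext H1) => r /T1t; rewrite lee_fin; exact: gh.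
by apply: (FLip_ext H2) => r /T2t; rewrite lee_fin; exact: gh.
Qed.

Lemma cexp_id (t : R) Phi : cyl t%:E Phi -> cexp t Phi = Phi.
Proof.
move=> H; apply/funext => g.
have := @cexp_affine t (fun=> 0) (fun=> 0) Phi g (cyl_cst _ 0) (cyl_cst _ 0) H (fun=> lexx _).
rewrite !mul0r !add0r => <-; congr cexp.
by apply/funext => h; rewrite add0r.
Qed.

Lemma cexp_tower (s t : R) Phi : s <= t -> cyl +oo Phi -> cexp s (cexp t Phi) = cexp s Phi.
Proof.
move=> st [T H _].
have H' : FLip (t :: T) Phi by apply: FLip_sub H => r rT; rewrite inE rT orbT.
have Hc := cond_FLip HS t H'.
apply/funext => g; rewrite (cexpE t H') (cexpE s Hc) (cexpE s H').
rewrite -(cond_tower HS g st H')//; last exact: mem_head.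
by rewrite -(cond_sub HS s (T' := t :: T) g Hc)// => r; rewrite !inE mem_filter inE => /orP[->//|/andP[_]].
Qed.

Lemma gexp_cexp (t : R) Phi : 0 <= t -> cyl +oo Phi -> gexp (cexp t Phi) = gexp Phi.
Proof. by move=> t0 H; rewrite /gexp cexp_tower. Qed.

Lemma gexp_le Phi Psi : cyl +oo Phi -> cyl +oo Psi ->
  (forall h, (forall r, r <= 0 -> h r = 0) -> Phi h <= Psi h) -> gexp Phi <= gexp Psi.
Proof. by move=> H1 H2 H; apply: cexp_le. Qed.

Lemma gexpD Phi Psi : cyl +oo Phi -> cyl +oo Psi ->
  gexp (fun g => Phi g + Psi g) <= gexp Phi + gexp Psi.
Proof. exact: cexpD. Qed.

Lemma gexp_cst c : gexp (fun=> c) = c.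
Proof. by rewrite /gexp cexp_id//; exact: cyl_cst. Qed.

Lemma gexpZ Phi c : cyl +oo Phi -> 0 <= c -> gexp (fun g => c * Phi g) = c * gexp Phi.
Proof.
move=> H c0; have := @cexp_affine 0 Phi (fun=> c) (fun=> 0) (fun=> 0) H (cyl_cst _ _) (cyl_cst _ _) (fun=> c0).
by rewrite addr0 => <-; congr cexp; apply/funext => h; rewrite addr0.
Qed.

Lemma gexp_sum n (F : nat -> (R -> R) -> R) : (forall i, cyl +oo (F i)) ->
  gexp (fun g => \sum_(i < n) F i g) <= \sum_(i < n) gexp (F i).
Proof.
move=> H; elim: n => [|n IH].
  by under eq_fun do rewrite big_ord0; rewrite gexp_cst big_ord0.
under eq_fun do rewrite big_ord_recr; rewrite big_ord_recr /=.
by apply: le_trans (gexpD (cyl_sum _ H) (H n)) _; rewrite lerD2r.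
Qed.

End Cylinder.

(** * Cylinder functionals and the relation [Gexp_Lip] *)

Section GexpLip.
Context {R : realType}.
Variables (slo shi : R).
Local Notation S := (fun d phi => Gheat slo shi phi d).
Hypothesis HS : @semigroup R S.

Lemma Gexp_Lip_cyl X v : Gexp_Lip slo shi X v ->
  exists Phi, [/\ cyl +oo Phi, X = Phi \o @path_val R & v = gexp S Phi].
Proof.
move=> [m [ts [phi [bl sz p -> ->]]]].
have bf : BLseq (size ts) (fun s => phi (row_of_seq m.+1 s)) by rewrite sz; exact: BLseq_row.
pose f s := phi (row_of_seq m.+1 s).
have H := BLseq_FLip 0 bf.
exists (fun h => f (increments h ts)); split=> //.
  by exists (0 :: ts) => // r _; exact: leey.
rewrite /gexp (cexpE HS 0 H).
apply: etrans (Gcyl_back HS (fun=> 0) p bf) _; apply: etrans (back_grid HS _ p H) _.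
by rewrite /cond /grid /= ltxx.
Qed.

Lemma cyl_Gexp_Lip Phi : cyl +oo Phi -> Gexp_Lip slo shi (Phi \o @path_val R) (gexp S Phi).
Proof.
(* The time 1 is added to make the list of positive times nonempty. *)
move=> [T H _]; pose ts := grid 0 (1 :: T).
have H1 : FLip (1 :: T) Phi by apply: FLip_sub H => r rT; rewrite inE rT orbT.
have p : path <=%R 0 ts by exact: grid_path_le.
have sz : size ts = (size ts).-1.+1.
  by rewrite prednK// lt0n size_eq0; apply/eqP => ts0; have := mem_grid 0 (1 :: T) 1; rewrite -/ts ts0 mem_head ltr01.
have ts0 : 0 \notin ts by rewrite mem_grid ltxx andbF.
have rec (g : R -> R) : (forall r, r <= 0 -> g r = 0) ->
    Phi (from_row ts (row_of_seq (size ts).-1.+1 (increments g ts))) = Phi g.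
  move=> g0; apply: (FLip_ext H) => s sT; have [s0|s0] := leP s 0.
    by rewrite /from_row mem_grid ltNge s0 andbF g0.
  by rewrite (from_rowK (esym (esym sz)))// ?g0// inE mem_grid inE sT s0 !orbT.
exists (size ts).-1, ts, (fun x => Phi (from_row ts x)); split=> //.
- exact: (FLip_row H).
- by apply/funext => w; rewrite rec//; case: w => w [] /=.
rewrite /gexp (cexpE HS 0 H1) /cond -/ts.
have bl := FLip_row H sz.
have bf : BLseq (size ts) (fun s => Phi (from_row ts (row_of_seq (size ts).-1.+1 s))).
  by rewrite [X in BLseq X]sz; exact: (BLseq_row bl).
apply: etrans (esym (Gcyl_back HS (fun=> 0) p bf)).
have H2 := BLseq_FLip 0 bf.
have H2' : FLip (0 :: ts ++ T) (fun h => Phi (from_row ts (row_of_seq (size ts).-1.+1 (increments h ts)))).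
  by apply: FLip_sub H2 => r; rewrite !inE mem_cat => /orP[->|->]; rewrite ?orbT.
have H' : FLip (0 :: ts ++ T) Phi by apply: FLip_sub H => r rT; rewrite inE mem_cat rT !orbT.
apply/esym/(back_congr HS p H2' H') => h h0 hr.
rewrite rec// => r r0; have [->|rn] := eqVneq r 0; first exact: h0.
by rewrite hr// mem_grid ltNge r0 andbF.
Qed.

End GexpLip.

(** * Path space and tightness *)

Section PathSpace.
Context {R : realType}.
Local Notation pv := (@path_val R).

Lemma pv_cont (w : Omega R) : continuous (pv w).
Proof. by case: w => w []. Qed.

Lemma pv_le0 (w : Omega R) s : s <= 0 -> pv w s = 0.
Proof. by case: w => w cw; exact: (proj2 cw s). Qed.

(** Every compact set of the line lies in some [-n, n], so the tubes of radius 1/(n + 1) over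
    [-n, n] generate a filter finer than the neighbourhoods of the path. *)
Lemma path_top_nbhs (w : path_top R) (U : set (path_top R)) : open U -> U w ->
  exists n : nat, forall w' : path_top R,
    (forall y, `|y| <= n%:R -> `|pv w y - pv w' y| < n.+1%:R^-1) -> U w'.
Proof.
move=> [B oB <-] Bw.
pose tube (n : nat) := [set g : R -> R | forall y, `|y| <= n%:R -> `|pv w y - g y| < n.+1%:R^-1].
have tubeS i j : (i <= j)%N -> tube j `<=` tube i.
  move=> ij g gj y yi; apply: (lt_le_trans (gj y _)); first by rewrite (le_trans yi)// ler_nat.
  by rewrite lef_pV2 ?posrE// ler_nat.
have FF : Filter (filter_from setT tube).
  apply: filter_from_filter; first by exists 0%N.
  move=> i j _ _; exists (maxn i j) => // g gij.
  by split; apply: tubeS gij; rewrite ?leq_maxl ?leq_maxr.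
have : {family compact, (filter_from setT tube) --> pv w}.
  apply/fam_cvgP => A cA P /uniform_nbhs[E [entE EP]].
  have [M [_ HM]] := compact_bounded cA.
  have [e /= e0 eE] : exists2 e : R, 0 < e & [set xy : R * R | ball xy.1 e xy.2] `<=` E.
    by move: entE; rewrite -entourage_ballE => -[e /= e0 H]; exists e.
  have [n nM] := archi_gt (M + 1); have [m me] := archi_gt e^-1.
  exists (maxn n m).+1 => // g gt; apply: EP => y Ay; apply: eE; rewrite /ball /= /ball_.
  apply: (lt_trans (gt y _)).
    apply: le_trans (HM (M + 1) _ y Ay) _; first by rewrite ltrDl.
    by rewrite ltW// nM// ltnS leq_maxl.
  rewrite -[e]invrK ltf_pV2 ?posrE ?invr_gt0//.
  by rewrite me// ltnS leqW// leq_maxr.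
move=> /(_ B) [|n _ nB]; first exact: open_nbhs_nbhs.
by exists n => w' Hw'; exact: nB.
Qed.

Lemma path_eval_nbhs (w : path_top R) s e : 0 < e ->
  nbhs w [set w' : path_top R | `|pv w s - pv w' s| < e].
Proof.
move=> e0; have := @initial_continuous _ _ (pv : path_top R -> {family compact, R -> R}) w.
have entE : entourage [set xy : R * R | ball xy.1 e xy.2] by rewrite -entourage_ballE; exists e.
move=> /(_ _ (@fam_nbhs _ _ compact [set s] _ (pv w) entE (@compact_set1 _ s))).
move=> H; have {}H : nbhs w (pv @^-1` [set g : R -> R | forall y, [set s] y -> ball (pv w y) e (g y)]) := H.
by apply: filterS H => w' /(_ s erefl).
Qed.

Lemma path_evals_nbhs (w : path_top R) (T : seq R) e : 0 < e ->
  nbhs w [set w' : path_top R | forall s, s \in T -> `|pv w s - pv w' s| < e].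
Proof.
move=> e0; elim: T => [|t T IH]; first by apply: filterS filterT => ? _ ?; rewrite in_nil.
apply: filterS2 IH (path_eval_nbhs w t e0) => w' H1 H2 s.
by rewrite inE => /orP[/eqP ->|]; [exact: H2|exact: H1].
Qed.

Lemma cyl_open t Phi c : cyl t Phi -> open [set w : path_top R | c < Phi (pv w)].
Proof.
move=> [T [K [L [L0 _ HL]]] _]; rewrite openE => w /= cw.
pose e := (Phi (pv w) - c) / (L * (size T)%:R + 1).
have d0 : 0 < L * (size T)%:R + 1 by rewrite ltr_wpDl// mulr_ge0.
have e0 : 0 < e by rewrite divr_gt0// subr_gt0.
apply: filterS (path_evals_nbhs w T e0) => w' /= H.
have : \sum_(s <- T) `|pv w s - pv w' s| <= (size T)%:R * e.
  rewrite big_seq; elim: T {HL d0 e0 e} (e) H => [|t' T IH] e H; first by rewrite big_pred0// mul0r.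
  rewrite -big_seq big_cons /= -natr1 mulrDl mul1r addrC lerD//; last by rewrite ltW// H ?mem_head.
  by rewrite big_seq; apply: IH => s sT; apply: H; rewrite inE sT orbT.
move=> /(ler_wpM2l L0)/(le_trans (HL _ _)); rewrite mulrA => h.
have : L * (size T)%:R * e < Phi (pv w) - c.
  have -> : Phi (pv w) - c = (L * (size T)%:R + 1) * e by rewrite /e mulrC divfK// gt_eqF.
  by rewrite mulrDl mul1r ltrDl.
by have := ler_norm (Phi (pv w) - Phi (pv w')); lra.
Qed.

Lemma eval_open s c : open [set w : path_top R | c < pv w s].
Proof.
rewrite openE => w /= cw; have := @path_eval_nbhs w s (pv w s - c).
rewrite subr_gt0 => /(_ cw); apply: filterS => w' /=.
by have := ler_norm (pv w s - pv w' s); lra.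
Qed.

Lemma measurable_rays d (T : measurableType d) (f : T -> R) :
  (forall c, measurable [set x | c < f x]) -> measurable_fun setT f.
Proof.
move=> H; apply: (measurability _ (RGenOInfty.measurableE R)) => _ [_ [c ->] <-].
rewrite setTI (_ : _ @^-1` _ = [set x | c < f x])//.
by apply/seteqP; split=> x /=; rewrite in_itv/= andbT.
Qed.

Lemma rays_measurable d (T : measurableType d) (f : T -> R) (c : R) :
  measurable_fun setT f -> measurable [set x | c < f x].
Proof.
move=> mf; have -> : [set x | c < f x] = f @^-1` `]c, +oo[%classic.
  by apply/seteqP; split=> x /=; rewrite in_itv/= andbT.
by rewrite -[X in measurable X]setTI; apply: mf.
Qed.

Lemma cyl_measurable t Phi : cyl t Phi -> measurable_fun setT (fun w : Omega R => Phi (pv w)).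
Proof.
by move=> H; apply: measurable_rays => c; apply: sub_sigma_algebra; exact: (cyl_open c H).
Qed.

Lemma eval_measurable s : measurable_fun setT (fun w : Omega R => pv w s).
Proof. by apply: measurable_rays => c; apply: sub_sigma_algebra; exact: eval_open. Qed.

(* Every open set of paths is a countable union of rational tubes. *)
Lemma measurable_coord (C : set (set (Omega R))) : sigma_algebra setT C ->
  (forall s c, C [set w | c < pv w s]) -> measurable `<=` C.
Proof.
move=> sC HC; apply: smallest_sub => // U oU.
pose T' := g_sigma_algebraType C.
have mT (A : set T') : measurable A = C A by rewrite /measurable/= sigma_algebra_id.
(* A tube prescribes rational values on a mesh of [0, n + 1] of width 1/(m + 1) and keeps the path
   near the value at the mesh point to the left, at rational times only. Rational times and finite
   lists of rationals are countable. The upper bound is a negated strict inequality because C is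
   only known to contain the sets {c < w(s)}. *)
pose tube (d : nat * nat * seq rat) : set (Omega R) := \bigcap_(s in [set: rat])
  [set w | 0 <= ratr s :> R -> ratr s <= d.1.1.+1%:R :> R ->
     ratr (nth 0 d.2 (Num.truncn (ratr s * d.1.2.+1%:R : R))) - (4 * d.1.1.+1%:R)^-1 < pv w (ratr s) /\
     ~ (ratr (nth 0 d.2 (Num.truncn (ratr s * d.1.2.+1%:R : R))) + (4 * d.1.1.+1%:R)^-1 < pv w (ratr s))].
have mtube d : C (tube d).
  rewrite -(mT (tube d)); rewrite /tube -[X in measurable X]setCK setC_bigcap.
  apply: measurableC; apply: countable_bigcupT_measurable => [|s]; first exact: countableP.
  apply: measurableC; set q := ratr (nth _ _ _); set e := _^-1.
  have [s0|s0] := boolP (0 <= ratr s :> R); last first.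
    rewrite [X in measurable X](_ : _ = setT); last by apply/seteqP; split.
    exact: measurableT.
  have [s1|s1] := boolP (ratr s <= d.1.1.+1%:R :> R); last first.
    rewrite [X in measurable X](_ : _ = setT); last by apply/seteqP; split.
    exact: measurableT.
  rewrite [X in measurable X](_ : _ = [set w | q - e < pv w (ratr s)] `&` ~` [set w | q + e < pv w (ratr s)]); last first.
    by apply/seteqP; split=> w /=; [move=> /(_ isT isT)|].
  apply: measurableI; first by rewrite mT; exact: HC.
  by apply: measurableC; rewrite mT; exact: HC.
have -> : U = \bigcup_(d in [set d | tube d `<=` U]) tube d.
  apply/seteqP; split; last by move=> w [d /= dU dw]; exact: dU.
  move=> w Uw; have [n Hn] := path_top_nbhs oU Uw.
  (* Two paths of one tube differ by at most 2e at rational times, hence by continuity at all times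
     in [0, n], and 2e < 4e = 1/(n + 1). *)
  pose e : R := (4 * n.+1%:R)^-1; have e0 : 0 < e by rewrite invr_gt0 mulr_gt0.
  have e2 : 0 < e / 2 by rewrite divr_gt0.
  have cw : continuous (fun z : R * R => (fun s _ : R => pv w s) z.1 z.2).
    by move=> z; apply: (continuous_comp (@cvg_fst _ _ _ _ _)); exact: pv_cont.
  have [d d0 Hd] := @unif_cont2 R (fun s _ => pv w s) n.+2%:R _ cw e2.
  have [m /(_ m.+1 (ltnSn m)) md] := archi_gt d^-1.
  have md' : m.+1%:R^-1 < d by rewrite -[d]invrK ltf_pV2 ?posrE ?invr_gt0.
  have [q Hq] : exists q : nat -> rat, forall i, ratr (q i) \in `](pv w (i%:R / m.+1%:R) - e / 2), (pv w (i%:R / m.+1%:R) + e / 2)[.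
    have H i : exists q : rat, ratr q \in `](pv w (i%:R / m.+1%:R) - e / 2), (pv w (i%:R / m.+1%:R) + e / 2)[.
      by apply: rat_in_itvoo; lra.
    by exists (fun i => projT1 (cid (H i))) => i; case: cid.
  pose D := (n, m, mkseq q (n.+1 * m.+1).+1).
  have near (s : rat) : 0 <= ratr s :> R -> ratr s <= n.+1%:R :> R ->
      `|pv w (ratr s) - ratr (nth 0 D.2 (Num.truncn (ratr s * m.+1%:R : R)))| < e.
    move=> s0 s1; have sm0 : 0 <= ratr s * m.+1%:R :> R by rewrite mulr_ge0.
    have /andP[t1 t2] := truncn_itv sm0; set k := Num.truncn _ in t1 t2 *.
    have kb : (k < (n.+1 * m.+1).+1)%N.
      rewrite ltnS -(ler_nat R) natrM (le_trans t1)// ler_wpM2r//.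
    rewrite nth_mkseq//.
    have m0 : 0 < m.+1%:R :> R by [].
    have h1 : `|pv w (ratr s) - pv w (k%:R / m.+1%:R)| < e / 2.
      apply: (Hd (k%:R / m.+1%:R) (ratr s) 0 0).
      - rewrite ger0_norm ?divr_ge0// ler_pdivrMr// (le_trans t1)// ler_wpM2r//.
        by rewrite (le_trans s1)// ler_nat.
      - by rewrite normr0.
      - apply: le_lt_trans md'; rewrite -[ratr s](mulfK (lt0r_neq0 m0)) -mulrBl.
        rewrite normrM [X in _ * X]ger0_norm ?invr_ge0// -[leRHS]mul1r ler_wpM2r ?invr_ge0//.
        by rewrite ger0_norm ?subr_ge0//; move: t2; rewrite -natr1; lra.
      - by rewrite subrr normr0.
    have := Hq k; rewrite in_itv/= => /andP[q1 q2].
    move: h1; rewrite !ltr_norml => /andP[h1 h2]; apply/andP; split; lra.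
  exists D; last first.
    move=> s _ /= s0 s1; have := near s s0 s1; rewrite ltr_norml -/e => /andP[h1 h2].
    by split; [|apply/negP; rewrite -leNgt]; lra.
  move=> w' /= Hw'; apply: Hn => y yn.
  have [y0|y0] := leP y 0.
    by rewrite !pv_le0// subrr normr0.
  have n2e : 2 * e < n.+1%:R^-1.
    have -> : n.+1%:R^-1 = 4 * e by rewrite /e invfM mulrA mulfV ?mul1r.
    lra.
  apply: le_lt_trans n2e; rewrite leNgt; apply/negP => H.
  pose f (x : R) := `|pv w x - pv w' x|.
  have cf : {for y, continuous f}.
    by apply: cvg_norm; apply: cvgB; exact: pv_cont.
  have : \forall x \near y, 2 * e < f x by exact: (cvgr_gt _ cf _ H).
  move=> [d' /= d'0 Hd'].
  have [s] : exists s : rat, ratr s \in `]y, (y + Num.min d' 1)[.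
    by apply: rat_in_itvoo; rewrite ltrDl lt_min d'0 ltr01.
  rewrite in_itv/= => /andP[ys sy].
  have s0 : 0 <= ratr s :> R by rewrite ltW// (lt_trans y0).
  have s1 : ratr s <= n.+1%:R :> R.
    rewrite (le_trans (ltW sy))// -natr1 lerD ?ge_min ?lexx ?orbT//.
    by rewrite (le_trans (ler_norm _)).
  have := Hd' (ratr s); rewrite /= /ball_/= => /(_ _).
  have -> : `|y - ratr s| < d'.
    rewrite distrC gtr0_norm ?subr_gt0//; move: sy; rewrite -ltrBlDl lt_min => /andP[//].
  move=> /(_ isT); rewrite /f.
  have := near s s0 s1; have [h1 /negP] := Hw' s Logic.I s0 s1; rewrite -leNgt -/e in h1 * => h2.
  rewrite ltr_norml => /andP[h3 h4].
  by apply/negP; rewrite -leNgt ler_norml; apply/andP; split; lra.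
rewrite -(mT (\bigcup_(d in _) _)) bigcup_mkcond.
apply: countable_bigcupT_measurable => [|d]; first exact: countableP.
by case: ifP => _; [rewrite mT|exact: measurable0].
Qed.

End PathSpace.

(** * Limits along an ultrafilter *)

Section UltraLimit.
Context {R : realType} (U : set_system nat).
Hypotheses (UU : UltraFilter U) (Uoo : \oo `<=` U).

(** Along an ultrafilter finer than the filter at infinity every bounded sequence converges, and
    limits respect sums and inequalities; no subsequence has to be extracted. *)
Definition ulim (u : nat -> R) : R := xget 0 [set l : R | u @ U --> l].

Lemma ulimP (u : nat -> R) M : (\forall n \near \oo, `|u n| <= M) -> u @ U --> ulim u.
Proof.
move=> /Uoo HM; have PU := @ultra_proper _ U UU.
have cM : compact `[-M, M]%classic by exact: segment_compact.
have HM' : U (u @^-1` `[-M, M]%classic).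
  by apply: filterS HM => n nM; rewrite /= in_itv/= -ler_norml.
have [|p [_ pc]] := cM (u @ U) _; first exact: HM'.
have ex : exists l, [set l : R | u @ U --> l] l.
  exists p => A pA; have [//|UA] := in_ultra_setVsetC (u @^-1` A) UU.
  have [x [nAx Ax]] := pc (~` A) A UA pA.
  by exfalso; exact: nAx.
exact: (xgetPex _ ex).
Qed.

Lemma ulim_unique (u : nat -> R) l : u @ U --> l -> ulim u = l.
Proof.
move=> H; have PU := @ultra_proper _ U UU.
have H2 : u @ U --> ulim u by exact: (@xgetPex _ _ [set l : R | u @ U --> l] (ex_intro _ l H)).
exact: (cvg_unique _ H2 H).
Qed.

Lemma ulim_dist (u v : nat -> R) l l' e : u @ U --> l -> v @ U --> l' ->
  (\forall n \near \oo, `|u n - v n| <= e) -> `|l - l'| <= e.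
Proof.
move=> ul vl /Uoo H; have PU := @ultra_proper _ U UU.
have H2 : (fun n => `|u n - v n|) @ U --> `|l - l'| by apply: cvg_norm; exact: cvgB.
by apply: (closed_cvg (fun x : R => x <= e)) H2 => //; exact: closed_le.
Qed.

End UltraLimit.

(** * Kolmogorov's continuity criterion for the sublinear expectation *)

Section Daniell.
Context {R : realType}.
Local Notation pv := (@path_val R).
Variable S : R -> (R -> R) -> R -> R.
Hypothesis HS : semigroup S.
Variable C : R.
Hypothesis C0 : 0 <= C.
Hypothesis H4 : forall phi A a d, BL phi -> 0 <= A -> (forall y, phi y <= A * (y - a) ^+ 4) ->
  0 <= d -> S d phi a <= A * (C * d ^+ 2).

(** The fourth power cut at 1: bounded and Lipschitz, hence admissible in cylinder functionals;
    below x^4, hence under the moment bound; and less than 1 only when |x| < 1. *)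
Definition rho (x : R) := Num.min 1 `|x| ^+ 4.

Lemma rho_ge0 x : 0 <= rho x.
Proof. by rewrite exprn_ge0// le_min ler01 normr_ge0. Qed.

Lemma rho_le x : rho x <= x ^+ 4.
Proof.
have -> : x ^+ 4 = `|x| ^+ 4 by rewrite -normrX ger0_norm// exprn_even_ge0.
by rewrite lerXn2r ?nnegrE ?le_min ?ler01 ?normr_ge0// ge_min lexx orbT.
Qed.

Lemma rho_lt1 x : rho x < 1 -> `|x| < 1.
Proof. by apply: contraTT; rewrite -!leNgt /rho => x1; rewrite min_l// expr1n. Qed.

Lemma rho_lip x y : `|rho x - rho y| <= 4 * `|x - y|.
Proof.
set a := Num.min 1 `|x|; set b := Num.min 1 `|y|.
have ab : `|a - b| <= `|x - y|.
  have := ler_dist_dist x y; rewrite /a /b ler_norml => /andP[h1 h2].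
  have h3 := le_trans (normr_ge0 _) (ler_dist_dist x y).
  by rewrite ler_norml /Num.min; case: ltP => ?; case: ltP => ?; apply/andP; split; lra.
have a0 : 0 <= a by rewrite le_min ler01 normr_ge0.
have b0 : 0 <= b by rewrite le_min ler01 normr_ge0.
have a1 : a <= 1 by rewrite ge_min lexx.
have b1 : b <= 1 by rewrite ge_min lexx.
rewrite /rho -/a -/b (_ : _ - _ = (a - b) * ((a + b) * (a ^+ 2 + b ^+ 2))); last by ring.
rewrite normrM mulrC ler_pM// ger0_norm ?mulr_ge0 ?addr_ge0 ?exprn_ge0//.
have -> : 4 = (1 + 1) * (1 ^+ 2 + 1 ^+ 2) :> R by rewrite expr1n; lra.
by rewrite ler_pM ?addr_ge0 ?exprn_ge0// lerD// lerXn2r ?nnegrE.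
Qed.

Lemma BL_rho : BL rho.
Proof.
split; last by exists 4 => // x y; exact: rho_lip.
by exists 1 => x; rewrite ger0_norm ?rho_ge0// exprn_ile1 ?le_min ?ler01 ?normr_ge0// ge_min lexx.
Qed.

Lemma cyl_incr (a b l : R) : cyl +oo (fun g => rho ((g b - g a) / l)).
Proof.
exists [:: a; b]; last by move=> *; exact: leey.
apply: (@FLip_incr _ _ a b (fun x => rho (x / l))); rewrite ?inE ?eqxx ?orbT//.
have [[K HK] [L L0 HL]] := BL_rho; split; first by exists K.
exists (L * `|l^-1|); first by rewrite mulr_ge0.
by move=> x y; rewrite (le_trans (HL _ _))// -mulrBl normrM -mulrA (mulrC `|l^-1|).
Qed.

Lemma gexp_incr (a b l : R) : 0 <= a -> a <= b -> 0 < l ->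
  gexp S (fun g => rho ((g b - g a) / l)) <= (l ^+ 4)^-1 * (C * (b - a) ^+ 2).
Proof.
move=> a0 ab l0; set Phi := fun g : R -> R => _.
have cPhi : cyl +oo Phi by exact: cyl_incr.
have l4 : 0 <= (l ^+ 4)^-1 by rewrite invr_ge0 exprn_ge0// ltW.
have B0 : 0 <= (l ^+ 4)^-1 * (C * (b - a) ^+ 2) by rewrite mulr_ge0// mulr_ge0// sqr_ge0.
rewrite -(gexp_cexp HS a0 cPhi) -[leRHS](gexp_cst HS).
apply: gexp_le => //; first by apply: cyl_pinfty (cexp_cyl HS a cPhi).
  exact: cyl_cst.
move=> h _.
have [bl [T FT _]] := (BL_rho, cPhi).
have FPhi : FLip [:: a; b] Phi.
  apply: (@FLip_incr _ _ a b (fun x => rho (x / l))); rewrite ?inE ?eqxx ?orbT//.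
  have [[K HK] [L L0 HL]] := BL_rho; split; first by exists K.
  exists (L * `|l^-1|); first by rewrite mulr_ge0.
  by move=> x y; rewrite (le_trans (HL _ _))// -mulrBl normrM -mulrA (mulrC `|l^-1|).
rewrite (cexpE HS a FPhi).
move: ab; rewrite le_eqVlt => /orP[/eqP ab|ab].
  have -> : Phi = fun=> 0.
    by apply/funext => g; rewrite /Phi ab subrr mul0r /rho normr0 min_r// expr0n.
  by rewrite cond_cst.
rewrite -(cond_any HS h (ts := [:: b]) _ FPhi) /= ?ab//; last first.
  by move=> r; rewrite !inE => /orP[/eqP ->|//]; rewrite ltxx.
apply: H4 => //.
- exact: (@back_BL _ _ HS [::] b _ Phi h isT FPhi).
- move=> y; rewrite /Phi updE /upd (lt_eqF ab); apply: le_trans (rho_le _) _.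
  by rewrite expr_div_n mulrC.
- by rewrite subr_ge0 ltW.
Qed.

Definition dya (k : nat) (s : R) : R := (Num.truncn (Num.max s 0 * 2 ^+ k))%:R / 2 ^+ k.

(** At level k there are about k 2^k increments with fourth moment of order 4^(-k), and measuring
    them in units of lam^k costs lam^(-4k). The sum is governed by 1/(2 lam^4) = 5000/6561 < 1. *)
Definition lam : R := 9 / 10.

(* Penalizes large increments between adjacent dyadics of level [k], and between
   the first [k] terms of [s] and their approximations. *)
Definition pen (s : nat -> R) (k : nat) (g : R -> R) : R :=
  \sum_(j < k * 2 ^ k) rho ((g (j.+1%:R / 2 ^+ k) - g (j%:R / 2 ^+ k)) / lam ^+ k) +
  \sum_(i < k) rho ((g (Num.max (s i) 0) - g (dya k (s i))) / lam ^+ k).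

Lemma pen_cyl s k : cyl +oo (pen s k).
Proof.
apply: cylD.
  exact: (@cyl_sum _ _ _ (fun j g => rho ((g (j.+1%:R / 2 ^+ k) - g (j%:R / 2 ^+ k)) / lam ^+ k)) (fun j => cyl_incr _ _ _)).
exact: (@cyl_sum _ _ _ (fun i g => rho ((g (Num.max (s i) 0) - g (dya k (s i))) / lam ^+ k)) (fun j => cyl_incr _ _ _)).
Qed.

Lemma dya_le k (s : R) : 0 <= dya k s <= Num.max s 0 /\ Num.max s 0 < dya k s + (2 ^+ k)^-1.
Proof.
have p0 : 0 < 2 ^+ k :> R by rewrite exprn_gt0.
have s0 : 0 <= Num.max s 0 * 2 ^+ k by rewrite mulr_ge0// ?le_max ?lexx ?orbT// ltW.
have /andP[t1 t2] := truncn_itv s0; rewrite /dya; split.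
  by rewrite ler_pdivrMr// t1 andbT divr_ge0// ltW.
by rewrite -[X in _ + X]mul1r -mulrDl ltr_pdivlMr// natr1.
Qed.

Lemma natr_le_expr n : n%:R <= 10 * (11 / 10) ^+ n :> R.
Proof.
elim: n => [|n IH]; first by rewrite expr0 mulr1.
rewrite -natr1 exprS; have : 1 <= (11 / 10) ^+ n :> R by rewrite exprn_ege1//; lra.
lra.
Qed.

Lemma natr_expr_le (b c : R) n : 0 <= b -> 11 / 10 * b <= c -> n%:R * b ^+ n <= 10 * c ^+ n.
Proof.
move=> b0 bc; apply: le_trans (ler_wpM2r (exprn_ge0 n b0) (natr_le_expr n)) _.
rewrite -mulrA ler_wpM2l// -exprMn lerXn2r ?nnegrE//; last by apply: le_trans bc; lra.
lra.
Qed.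

(** The factor k is absorbed by k <= 10 (11/10)^k, and 11/10 times 5000/6561 is less than 21/25. *)
Lemma gexp_pen s k : gexp S (pen s k) <= 20 * C * (21 / 25) ^+ k.
Proof.
have p0 : 0 < 2 ^+ k :> R by rewrite exprn_gt0.
have l0 : 0 < lam ^+ k by rewrite exprn_gt0// /lam; lra.
pose B : R := ((lam ^+ k) ^+ 4)^-1 * (C * ((2 ^+ k)^-1) ^+ 2).
have l4 : 0 <= ((lam ^+ k) ^+ 4)^-1 by rewrite invr_ge0 exprn_ge0// ltW.
have B0 : 0 <= B by rewrite mulr_ge0// mulr_ge0// sqr_ge0.
have c1 j : cyl +oo (fun g => rho ((g (j.+1%:R / 2 ^+ k) - g (j%:R / 2 ^+ k)) / lam ^+ k)) by exact: cyl_incr.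
have c2 i : cyl +oo (fun g => rho ((g (Num.max (s i) 0) - g (dya k (s i))) / lam ^+ k)) by exact: cyl_incr.
have h1 : gexp S (pen s k) <= (k * 2 ^ k)%:R * B + k%:R * B.
  apply: le_trans (gexpD HS (cyl_sum _ c1) (cyl_sum _ c2)) _; apply: lerD.
    apply: le_trans (gexp_sum HS _ c1) _; rewrite mulr_natl.
    have -> : B *+ (k * 2 ^ k) = \sum_(i < k * 2 ^ k) B by rewrite sumr_const card_ord.
    apply: ler_sum => j _.
    apply: le_trans (gexp_incr _ _ l0) _.
    - by rewrite divr_ge0// (ltW p0).
    - by rewrite ler_wpM2r ?invr_ge0 ?(ltW p0)// ler_nat.
    by rewrite -mulrBl -natr1 addrAC subrr add0r mul1r.
  apply: le_trans (gexp_sum HS _ c2) _; rewrite mulr_natl.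
  have -> : B *+ k = \sum_(i < k) B by rewrite sumr_const card_ord.
  apply: ler_sum => i _.
  have [/andP[d0 d1] d2] := dya_le k (s i).
  apply: le_trans (gexp_incr _ _ l0) _ => //.
  rewrite ler_wpM2l// ler_wpM2l// lerXn2r ?nnegrE ?subr_ge0 ?invr_ge0 ?(ltW p0)//; lra.
apply: le_trans h1 _.
have k1 : k%:R * B <= (k * 2 ^ k)%:R * B.
  by rewrite ler_wpM2r// ler_nat leq_pmulr// expn_gt0.
apply: (@le_trans _ _ (2 * ((k * 2 ^ k)%:R * B))); first lra.
have -> : 2 * ((k * 2 ^ k)%:R * B) = 2 * C * (k%:R * (5000 / 6561) ^+ k).
  rewrite /B natrM natrX.
  have -> : (5000 / 6561) ^+ k = ((lam ^+ k) ^+ 4)^-1 * (2 ^+ k)^-1 :> R.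
    by rewrite -exprM mulnC exprM -!exprVn -exprMn; congr (_ ^+ k); rewrite /lam; field.
  rewrite expr2; set a := _^-1; have : 2 ^+ k * (2 ^+ k)^-1 = 1 :> R by rewrite mulfV// gt_eqF.
  set b := (2 ^+ k)^-1; set c := 2 ^+ k => cb.
  rewrite (_ : _ * _ = 2 * C * (k%:R * (a * b)) * (c * b)); last by ring.
  by rewrite cb mulr1.
rewrite (_ : 20 * C * (21 / 25) ^+ k = 2 * C * (10 * (21 / 25) ^+ k)); last by ring.
rewrite ler_wpM2l ?mulr_ge0//.
apply: natr_expr_le; lra.
Qed.

(** Geometric series of ratio 21/25: the constant is 125 = 20 times 25/4. *)
Lemma gexp_pens s k0 N : gexp S (fun g => \sum_(i < N) pen s (k0 + i) g) <=
  125 * C * (21 / 25) ^+ k0.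
Proof.
have c i : cyl +oo (pen s (k0 + i)) by exact: pen_cyl.
apply: le_trans (gexp_sum HS N c) _.
apply: (@le_trans _ _ (\sum_(i < N) (20 * C * (21 / 25) ^+ k0) * (21 / 25) ^+ i)).
  by apply: ler_sum => i _; rewrite -mulrA -exprD; exact: gexp_pen.
rewrite -mulr_sumr (_ : 125 * C * _ = 20 * C * (21 / 25) ^+ k0 * (25 / 4)); last by field.
have q0 : 0 <= 21 / 25 :> R by lra.
rewrite ler_wpM2l ?mulr_ge0 ?exprn_ge0//.
have := subrX1 (21 / 25 : R) N; have : 0 <= (21 / 25) ^+ N :> R by rewrite exprn_ge0//; lra.
by lra.
Qed.

Lemma expr_small (q e : R) k1 : 0 <= q < 1 -> 0 < e -> exists2 k, (k1 <= k)%N & q ^+ k < e.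
Proof.
move=> /andP[q0 q1] e0; have q1' : `|q| < 1 by rewrite ger0_norm.
have /cvgr0Pnorm_lt/(_ e e0)[k2 _ H] := cvg_expr q1'.
exists (maxn k1 k2); first exact: leq_maxl.
by have := H (maxn k1 k2) (leq_maxr _ _); rewrite /= ger0_norm// exprn_ge0.
Qed.

(** * A continuous limit for functions with small total penalty *)

Section Limit.
Variables (s : nat -> R) (k0 : nat) (hN : nat -> R -> R).
Hypothesis hN0 : forall N r, r <= 0 -> hN N r = 0.
Hypothesis hN1 : forall N, \sum_(i < N) pen s (k0 + i) (hN N) < 1.

Let dyd (k j : nat) : R := j%:R / 2 ^+ k.

Lemma lam0 k : 0 < lam ^+ k.
Proof. by rewrite exprn_gt0// /lam; lra. Qed.

Lemma lam1 k : lam ^+ k <= 1.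
Proof. by rewrite exprn_ile1// /lam; lra. Qed.

Lemma pen_ge0 k g : 0 <= pen s k g.
Proof. by rewrite addr_ge0//; apply: sumr_ge0 => i _; exact: rho_ge0. Qed.

Lemma pen_lt1 k N : (k0 <= k)%N -> (k < N)%N -> pen s k (hN N) < 1.
Proof.
move=> k0k kN; apply: le_lt_trans (hN1 N).
have ikN : (k - k0 < N)%N by rewrite (leq_ltn_trans (leq_subr _ _)).
rewrite (bigD1 (Ordinal ikN))//= subnKC// lerDl.
by apply: sumr_ge0 => i _; exact: pen_ge0.
Qed.

(** A total penalty below 1 keeps each single [rho] below 1, so every increment recorded at a level
    k between k0 and N is at most lam^k. *)
Lemma hN_adj k N j : (k0 <= k)%N -> (k < N)%N -> (j < k * 2 ^ k)%N ->
  `|hN N (dyd k j.+1) - hN N (dyd k j)| <= lam ^+ k.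
Proof.
move=> k0k kN jk; have := pen_lt1 k0k kN; rewrite /pen (bigD1 (Ordinal jk))//= => H.
have : rho ((hN N (dyd k j.+1) - hN N (dyd k j)) / lam ^+ k) < 1.
  apply: le_lt_trans H; rewrite -addrA lerDl addr_ge0//; apply: sumr_ge0 => i _; exact: rho_ge0.
move=> /rho_lt1; rewrite normrM normfV [X in _ / X]gtr0_norm ?lam0//.
by rewrite ltr_pdivrMr ?lam0// mul1r => /ltW.
Qed.

Lemma hN_time k N i : (k0 <= k)%N -> (k < N)%N -> (i < k)%N ->
  `|hN N (Num.max (s i) 0) - hN N (dya k (s i))| <= lam ^+ k.
Proof.
move=> k0k kN jk; have := pen_lt1 k0k kN; rewrite /pen [X in _ + X](bigD1 (Ordinal jk))//= => H.
have : rho ((hN N (Num.max (s i) 0) - hN N (dya k (s i))) / lam ^+ k) < 1.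
  apply: le_lt_trans H; rewrite addrCA lerDl addr_ge0//; apply: sumr_ge0 => i' _; exact: rho_ge0.
move=> /rho_lt1; rewrite normrM normfV [X in _ / X]gtr0_norm ?lam0//.
by rewrite ltr_pdivrMr ?lam0// mul1r => /ltW.
Qed.

Lemma hN_dyd k N j : (k0 <= k)%N -> (k < N)%N -> (j <= k * 2 ^ k)%N ->
  `|hN N (dyd k j)| <= j%:R.
Proof.
move=> k0k kN; elim: j => [|j IH] jk; first by rewrite /dyd mul0r hN0// normr0.
have := hN_adj k0k kN jk; have := IH (ltnW jk); have := lam1 k.
have := ler_normD (hN N (dyd k j.+1) - hN N (dyd k j)) (hN N (dyd k j)).
by rewrite subrK -natr1; lra.
Qed.

Variable U : set_system nat.
Hypotheses (UU : UltraFilter U) (Uoo : \oo `<=` U).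

Let h r := ulim U (fun N => hN N r).

Lemma near_gt k : \forall N \near \oo, (k < N)%N.
Proof. by exists k.+1. Qed.

Lemma h_dyd k j : (k0 <= k)%N -> (j <= k * 2 ^ k)%N -> hN N (dyd k j) @[N --> U] --> h (dyd k j).
Proof.
move=> k0k jk; apply: (ulimP UU Uoo (M := j%:R)).
by apply: filterS (near_gt k) => N kN; exact: hN_dyd.
Qed.

Lemma h_le0 r : r <= 0 -> hN N r @[N --> U] --> 0.
Proof.
move=> r0; have PU := @ultra_proper _ U UU.
by under eq_fun do rewrite hN0//; exact: cvg_cst.
Qed.

Lemma h0 r : r <= 0 -> h r = 0.
Proof. by move=> /h_le0 H; rewrite /h; exact: (ulim_unique UU H). Qed.

Lemma dya_dyd k (x : R) : x <= k%:R -> exists2 j, dya k x = dyd k j & (j <= k * 2 ^ k)%N.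
Proof.
move=> xk; exists (Num.truncn (Num.max x 0 * 2 ^+ k)) => //.
have p0 : 0 < 2 ^+ k :> R by rewrite exprn_gt0.
have x0 : 0 <= Num.max x 0 * 2 ^+ k by rewrite mulr_ge0 ?(ltW p0)// le_max lexx orbT.
have /andP[t1 _] := truncn_itv x0.
rewrite -(ler_nat R) (le_trans t1)// natrM natrX ler_wpM2r ?(ltW p0)//.
by rewrite ge_max xk ler0n.
Qed.

Lemma h_time i : hN N (Num.max (s i) 0) @[N --> U] --> h (Num.max (s i) 0).
Proof.
have [n sn] := archi_gt (s i).
pose k := maxn k0 (maxn i n).+1.
have k0k : (k0 <= k)%N by rewrite leq_maxl.
have ik : (i < k)%N by rewrite leq_max ltnS leq_maxl orbT.
have nk : s i <= k%:R by rewrite ltW// sn// leq_max ltnS leq_maxr orbT.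
have [j dE jk] := dya_dyd nk.
apply: (ulimP UU Uoo (M := 1 + j%:R)).
apply: filterS (near_gt k) => N kN.
have := hN_time k0k kN ik; have := hN_dyd k0k kN jk; rewrite -dE; have := lam1 k.
have := ler_normD (hN N (Num.max (s i) 0) - hN N (dya k (s i))) (hN N (dya k (s i))).
by rewrite subrK; lra.
Qed.

Let ph k x := h (dya k x).

Lemma ph_adj k j : (k0 <= k)%N -> (j < k * 2 ^ k)%N -> `|h (dyd k j.+1) - h (dyd k j)| <= lam ^+ k.
Proof.
move=> k0k jk; apply: (ulim_dist UU Uoo (h_dyd k0k jk) (h_dyd k0k (ltnW jk))).
by apply: filterS (near_gt k) => N kN; exact: hN_adj.
Qed.

Lemma ph_time k i : (k0 <= k)%N -> (i < k)%N -> s i <= k%:R ->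
  `|h (Num.max (s i) 0) - ph k (s i)| <= lam ^+ k.
Proof.
move=> k0k ik sk; have [j dE jk] := dya_dyd sk.
rewrite /ph dE; have := ulim_dist UU Uoo (@h_time i) (h_dyd k0k jk).
apply.
by apply: filterS (near_gt k) => N kN; rewrite -dE; exact: hN_time.
Qed.

(** Refining the level keeps the dyadic approximation or moves it to its right neighbour on the
    finer grid. *)
Lemma ph_next k x : (k0 <= k)%N -> x <= k%:R -> `|ph k.+1 x - ph k x| <= lam ^+ k.+1.
Proof.
move=> k0k xk; rewrite /ph /dya; set x' := Num.max x 0.
have x'0 : 0 <= x' by rewrite le_max lexx orbT.
have x'k : x' <= k%:R by rewrite ge_max xk ler0n.
have p0 n : 0 < 2 ^+ n :> R by rewrite exprn_gt0.
have /andP[t1 t2] := truncn_itv (mulr_ge0 x'0 (ltW (p0 k))).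
have /andP[u1 u2] := truncn_itv (mulr_ge0 x'0 (ltW (p0 k.+1))).
set j := Num.truncn (x' * 2 ^+ k) in t1 t2 *; set i := Num.truncn _ in u1 u2 *.
have jE : j%:R / 2 ^+ k = dyd k.+1 (2 * j)%N.
  by rewrite /dyd natrM exprS invfM mulrACA mulfV ?mul1r.
have lo : (2 * j < i.+1)%N.
  rewrite -(ltr_nat R) natrM; apply: le_lt_trans u2.
  by rewrite exprS mulrCA ler_wpM2l.
have hi : (i < (2 * j).+2)%N.
  rewrite -(ltr_nat R); apply: le_lt_trans u1 _.
  have -> : (2 * j).+2%:R = 2 * j.+1%:R :> R by rewrite -!natr1 natrM; ring.
  by rewrite exprS mulrCA ltr_pM2l.
have b : (2 * j < k.+1 * 2 ^ k.+1)%N.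
  have : (j <= k * 2 ^ k)%N.
    by rewrite -(ler_nat R) (le_trans t1)// natrM natrX ler_wpM2r// ltW.
  rewrite -(leq_pmul2l (ltn0Sn 1)) => /leq_ltn_trans -> //.
  by rewrite mulnCA -expnS ltn_pmul2r// expn_gt0.
rewrite jE -/(dyd k.+1 i); have [->|ne] := eqVneq i (2 * j)%N.
  by rewrite subrr normr0 ltW// lam0.
have -> : i = (2 * j).+1 by apply/eqP; rewrite eqn_leq -ltnS hi ltn_neqAle eq_sym ne -ltnS lo.
by apply: ph_adj => //; exact: leq_trans k0k _.
Qed.

(** The factor is 10 = 1/(1 - lam), and subtracting the term of level k + m makes the induction
    close. *)
Lemma ph_far k m x : (k0 <= k)%N -> x <= k%:R -> `|ph (k + m) x - ph k x| <= 10 * lam ^+ k - 10 * lam ^+ (k + m).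
Proof.
move=> k0k xk; elim: m => [|m IH]; first by rewrite addn0 !subrr normr0.
have k1 : (k0 <= k + m)%N by rewrite (leq_trans k0k)// leq_addr.
have x1 : x <= (k + m)%:R by rewrite (le_trans xk)// ler_nat leq_addr.
have := ph_next k1 x1; rewrite addnS.
have := ler_normD (ph (k + m).+1 x - ph (k + m) x) (ph (k + m) x - ph k x).
have -> : lam ^+ (k + m).+1 = 9 / 10 * lam ^+ (k + m) by rewrite exprS.
by rewrite addrA subrK; have := lam0 (k + m); lra.
Qed.

(** The limit h over N is known to exist only at the dyadics and at the times s i; a second limit,
    over the dyadic level, gives a function on the whole line. *)
Let om x := ulim U (fun k => ph k x).

Lemma om_cvg k x : (k0 <= k)%N -> x <= k%:R -> `|om x - ph k x| <= 10 * lam ^+ k.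
Proof.
move=> k0k xk.
have bnd n : (k < n)%N -> `|ph n x - ph k x| <= 10 * lam ^+ k.
  move=> /ltnW/subnKC <-; have := ph_far (n - k) k0k xk.
  by have := lam0 (k + (n - k)); lra.
have H : ph n x @[n --> U] --> om x.
  apply: (ulimP UU Uoo (M := 10 * lam ^+ k + `|ph k x|)).
  apply: filterS (near_gt k) => n /bnd.
  by have := ler_normD (ph n x - ph k x) (ph k x); rewrite subrK; lra.
have PU := @ultra_proper _ U UU.
apply: (ulim_dist UU Uoo H (cvg_cst (ph k x))).
by apply: filterS (near_gt k) => n; exact: bnd.
Qed.

Lemma ph_close k x y : (k0 <= k)%N -> x <= k%:R -> y <= k%:R -> `|x - y| < (2 ^+ k)^-1 ->
  `|ph k x - ph k y| <= lam ^+ k.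
Proof.
wlog xy : x y / x <= y => [hw|] k0k xk yk dxy.
  have [xy|/ltW xy] := leP x y; first exact: hw.
  by rewrite distrC; apply: hw => //; rewrite distrC.
rewrite /ph /dya; set x' := Num.max x 0; set y' := Num.max y 0.
have x'0 : 0 <= x' by rewrite le_max lexx orbT.
have y'0 : 0 <= y' by rewrite le_max lexx orbT.
have x'k : x' <= k%:R by rewrite ge_max xk ler0n.
have y'k : y' <= k%:R by rewrite ge_max yk ler0n.
have xy' : x' <= y' by rewrite ge_max !le_max xy lexx !orbT.
have dxy' : y' - x' < (2 ^+ k)^-1.
  have i0 : 0 < (2 ^+ k)^-1 :> R by rewrite invr_gt0 exprn_gt0.
  move: dxy; rewrite distrC ger0_norm ?subr_ge0// /x' /y'.
  by have [?|?] := leP x 0; have [?|?] := leP y 0; lra.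
have p0 : 0 < 2 ^+ k :> R by rewrite exprn_gt0.
have /andP[t1 t2] := truncn_itv (mulr_ge0 x'0 (ltW p0)).
have /andP[u1 u2] := truncn_itv (mulr_ge0 y'0 (ltW p0)).
set j := Num.truncn _ in t1 t2 *; set i := Num.truncn _ in u1 u2 *.
have lo : (j < i.+1)%N.
  by rewrite -(ltr_nat R); apply: le_lt_trans t1 (le_lt_trans _ u2); rewrite ler_wpM2r// ltW.
have hi : (i < j.+2)%N.
  rewrite -(ltr_nat R); apply: le_lt_trans u1 _.
  have : (y' - x') * 2 ^+ k < 1 by rewrite -ltr_pdivlMr// div1r.
  by rewrite mulrBl -[j.+2%:R]natr1; lra.
have b : (i <= k * 2 ^ k)%N.
  by rewrite -(ler_nat R) (le_trans u1)// natrM natrX ler_wpM2r// ltW.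
rewrite -/(dyd k i) -/(dyd k j); have [->|ne] := eqVneq i j.
  by rewrite subrr normr0 ltW// lam0.
have ij : i = j.+1 by apply/eqP; rewrite eqn_leq -ltnS hi ltn_neqAle eq_sym ne -ltnS lo.
by rewrite ij distrC; apply: ph_adj => //; rewrite -ij.
Qed.

Lemma om_path : exists w : cpath R, pv w = om.
Proof.
suff H : continuous om /\ forall x, x <= 0 -> om x = 0 by exists (exist _ om H).
have PU := @ultra_proper _ U UU.
split; last first.
  move=> x x0; apply: (ulim_unique UU); rewrite /ph /dya.
  have -> : (fun n : nat => h ((Num.truncn (Num.max x 0 * 2 ^+ n))%:R / 2 ^+ n)) = cst 0.
    apply/funext => n /=; rewrite max_r// mul0r.
    by rewrite truncn0 mul0r h0.
  exact: cvg_cst.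
move=> x; apply/cvgrPdist_lt => e e0.
have [n xn] := archi_gt (x + 1).
(* Two tails of size 10 lam^k and one increment of size lam^k add up to 21 lam^k < e. *)
have e25 : 0 < e / 25 by rewrite divr_gt0.
have l1 : (0 : R) <= lam < 1 by rewrite /lam; lra.
have [k nk ke] := expr_small (maxn k0 n.+1) l1 e25.
have k0k : (k0 <= k)%N by rewrite (leq_trans _ nk)// leq_maxl.
have x1k : x + 1 <= k%:R by rewrite ltW// xn// (leq_trans _ nk)// leq_maxr.
exists (2 ^+ k)^-1 => /=; first by rewrite invr_gt0 exprn_gt0.
move=> y /= xy.
have y1 : y <= k%:R.
  have : (2 ^+ k)^-1 <= 1 :> R by rewrite invf_le1 ?exprn_gt0// exprn_ege1//; lra.
  by move: xy; rewrite ltr_norml => /andP[]; lra.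
have xk : x <= k%:R by lra.
have := om_cvg k0k xk; have := om_cvg k0k y1; have := ph_close k0k xk y1 xy.
have := ler_normD (om x - ph k x) (ph k x - ph k y); have := ler_normD (om x - ph k y) (ph k y - om y).
by rewrite !addrA !subrK (distrC (ph k y)); lra.
Qed.

(** The second sum in [pen] ties each time s i to its dyadic approximations, so the limit path takes
    the limiting values also at times that are not dyadic. *)
Lemma om_time i : om (Num.max (s i) 0) = h (Num.max (s i) 0).
Proof.
apply/eqP; rewrite -subr_eq0 -normr_le0; apply/ler_addgt0Pr => e e0; rewrite add0r.
have [n xn] := archi_gt (s i).
have l1 : (0 : R) <= lam < 1 by rewrite /lam; lra.
have e20 : 0 < e / 20 by rewrite divr_gt0.
have [k nk ke] := expr_small (maxn k0 (maxn i n).+1) l1 e20.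
have k0k : (k0 <= k)%N by rewrite (leq_trans _ nk)// leq_maxl.
have ik : (i < k)%N by rewrite (leq_trans _ nk)// leq_max ltnS leq_maxl orbT.
have sk : s i <= k%:R by rewrite ltW// xn// (leq_trans _ nk)// leq_max ltnS leq_maxr orbT.
have mk : Num.max (s i) 0 <= k%:R by rewrite ge_max sk ler0n.
have mm : ph k (Num.max (s i) 0) = ph k (s i).
  by rewrite /ph /dya; congr (h (_ / _)); congr ((Num.truncn (_ * _))%:R); rewrite max_l// le_max lexx orbT.
have := om_cvg k0k mk; rewrite mm; have := ph_time k0k ik sk.
have := ler_normD (om (Num.max (s i) 0) - ph k (s i)) (ph k (s i) - h (Num.max (s i) 0)).
by rewrite addrA subrK (distrC (ph k _)); lra.
Qed.

End Limit.

(* Daniell's condition: the moment bound [H4] makes the near-maximizers tight. *)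
Lemma gexp_daniell (f : nat -> (R -> R) -> R) e : (forall n, cyl +oo (f n)) ->
  (forall n g, f n.+1 g <= f n g) -> (forall w, exists n, f n (pv w) <= 0) -> 0 < e ->
  exists n, gexp S (f n) < e.
Proof.
move=> cf decr f0 e0; apply: contrapT => nH.
have {}nH n : e <= gexp S (f n) by rewrite leNgt; apply/negP => h; apply: nH; exists n.
have mono m n g : (m <= n)%N -> f n g <= f m g.
  by move=> /subnKC <-; elim: (n - m)%N => [|i IH]; rewrite ?addn0// addnS (le_trans (decr _ _)).
have [K K0 HK] := cyl_bounded (cf 0%N).
(* A single sequence lists the times used by all the functionals f n. *)
have [s Hs] : exists s : nat -> R, forall n r, r \in supp (f n) -> exists i, s i = r.
  exists (fun i => if unpickle i is Some (n, m) then nth 0 (supp (f n)) m else 0) => n r rn.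
  by exists (pickle (n, index r (supp (f n)))); rewrite pickleK nth_index.
have q01 : 0 <= (21 / 25 : R) < 1 by apply/andP; split; lra.
(* f N is at most K, so a penalty weighted by [K1] > K that stays below f N is less than 1 in
   total. *)
pose K1 := K + 1; have K10 : 0 < K1 by rewrite ltr_wpDl.
have e1 : 0 < e / 2 / (K1 * (125 * C) + 1).
  by rewrite divr_gt0// ?divr_gt0// ltr_wpDl// !mulr_ge0// ltW.
have [k0 _ Hk0] := expr_small 0 q01 e1.
have small : K1 * (125 * C * (21 / 25) ^+ k0) < e / 2.
  have D0 : 0 < K1 * (125 * C) + 1 by rewrite ltr_wpDl// !mulr_ge0// ltW.
  move: Hk0; rewrite ltr_pdivlMr//; set q := _ ^+ k0 => Hq.
  have q0 : 0 <= q by rewrite exprn_ge0//; lra.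
  by rewrite mulrA; lra.
(* Otherwise f N would be at most e/2 plus [K1] times the penalties, and its G-expectation would be
   less than e. *)
have ex N : exists h : R -> R, (forall r, r <= 0 -> h r = 0) /\
    e / 2 + K1 * \sum_(i < N) pen s (k0 + i) h < f N h.
  apply: contrapT => nex; have := nH N; rewrite leNgt => /negP; apply.
  pose Xi (g : R -> R) := \sum_(i < N) pen s (k0 + i) g.
  have cXi : cyl +oo Xi by apply: (@cyl_sum _ _ N (fun i => pen s (k0 + i))) => i; exact: pen_cyl.
  have cB : cyl +oo (fun g => e / 2 + K1 * Xi g) by apply: cylD; [exact: cyl_cst|exact: cylZ].
  apply: le_lt_trans (gexp_le HS (cf N) cB _) _.
    by move=> h hr; rewrite leNgt; apply/negP => hh; apply: nex; exists h.
  apply: le_lt_trans (gexpD HS (cyl_cst _ _) (cylZ K1 cXi)) _.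
  rewrite (gexp_cst HS) (gexpZ HS cXi (ltW K10)).
  have := ler_wpM2l (ltW K10) (gexp_pens s k0 N); rewrite -/Xi; lra.
pose hN N := projT1 (cid (ex N)).
have hNP N : (forall r, r <= 0 -> hN N r = 0) /\
    e / 2 + K1 * \sum_(i < N) pen s (k0 + i) (hN N) < f N (hN N).
  by rewrite /hN; case: cid.
have hN0 N r : r <= 0 -> hN N r = 0 by exact: (hNP N).1.
have hN1 N : \sum_(i < N) pen s (k0 + i) (hN N) < 1.
  have := (hNP N).2; have := mono 0%N N (hN N) (leq0n _).
  have := ler_norm (f 0%N (hN N)); have := HK (hN N) => h1 h2 h3 h4.
  have : K1 * \sum_(i < N) pen s (k0 + i) (hN N) < K1 * 1 by rewrite mulr1; apply: (@lt_le_trans _ _ K); [lra|rewrite lerDl].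
  by rewrite ltr_pM2l.
have [U [UU Uoo]] := ultraFilterLemma (@eventually_filter).
have PU := @ultra_proper _ U UU.
have [w wE] := om_path hN0 hN1 UU Uoo.
have [n fn] := f0 w.
have cvr r : r \in supp (f n) -> hN N r @[N --> U] --> pv w r.
  move=> rn; have [r0|r0] := leP r 0.
    by rewrite pv_le0//; exact: h_le0.
  have [i si] := Hs n r rn.
  have H : hN N (Num.max (s i) 0) @[N --> U] --> ulim U (hN^~ (Num.max (s i) 0)).
    exact: (h_time hN0 hN1 UU Uoo).
  by have := om_time hN0 hN1 UU Uoo i; move: H; rewrite si (max_l (ltW r0)) wE => H ->.
have [K' [L [L0 _ HL]]] := suppP (cf n).
have lim : \sum_(r <- supp (f n)) `|hN N r - pv w r| @[N --> U] --> 0.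
  elim: (supp (f n)) cvr => [|r T IH] cvr.
    by under eq_fun do rewrite big_nil; exact: cvg_cst.
  have h1 : (fun N => `|hN N r - pv w r|) @ U --> `|pv w r - pv w r|.
    by apply: cvg_norm; apply: cvgB; [apply: cvr; exact: mem_head|exact: cvg_cst].
  have h2 : (fun N => \sum_(r <- T) `|hN N r - pv w r|) @ U --> (0 : R).
    by apply: IH => r' r'T; apply: cvr; rewrite inE r'T orbT.
  rewrite subrr normr0 in h1; have := cvgD h1 h2 _; rewrite addr0.
  rewrite (_ : _ + _ = fun N => \sum_(r0 <- r :: T) `|hN N r0 - pv w r0|); first exact.
  by apply/funext => N; rewrite big_cons.
have lim2 : L * \sum_(r <- supp (f n)) `|hN N r - pv w r| @[N --> U] --> 0.
  have := @cvgMr _ _ _ _ _ L _ lim; rewrite mulr0; exact.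
have : U [set N | L * \sum_(r <- supp (f n)) `|hN N r - pv w r| < e / 2].
  by apply: (cvgr_lt _ lim2); rewrite divr_gt0.
move=> /(filterI (Uoo _ (near_gt n))) /filter_ex[N [nN /= HN]].
have := HL (hN N) (pv w); have := mono _ _ (hN N) (ltnW nN); have := (hNP N).2.
have : 0 <= K1 * \sum_(i < N) pen s (k0 + i) (hN N).
  by rewrite mulr_ge0 ?(ltW K10)//; apply: sumr_ge0 => i _; exact: pen_ge0.
have := ler_norm (f n (hN N) - f n (pv w)); lra.
Qed.

End Daniell.

Lemma maxr_lip {R : realDomainType} (x y c : R) : `|Num.max x c - Num.max y c| <= `|x - y|.
Proof.
rewrite ler_norml.
have := ler_norm (x - y); have := ler_norm (- (x - y)); rewrite normrN => ? ?.
by have [x1|x1] := leP x c; have [x2|x2] := leP y c; apply/andP; split; lra.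
Qed.

Lemma minr_lip {R : realDomainType} (x y c : R) : `|Num.min x c - Num.min y c| <= `|x - y|.
Proof.
rewrite ler_norml.
have := ler_norm (x - y); have := ler_norm (- (x - y)); rewrite normrN => ? ?.
by have [x1|x1] := leP x c; have [x2|x2] := leP y c; apply/andP; split; lra.
Qed.

(** * Real-valued expectations under one probability *)

Section Expectation.
Context d {T : measurableType d} {R : realType}.
Variable P : probability T R.

Definition Ex (f : T -> R) : R := Rintegral P setT f.

Definition itg (f : T -> R) := P.-integrable setT (EFin \o f).

Lemma itg_bounded (f : T -> R) K : measurable_fun setT f -> (forall x, `|f x| <= K) -> itg f.
Proof.
move=> mf fK; apply: measurable_bounded_integrable => //.
  rewrite [X in (X < _)%E](_ : _ = 1%E) ?ltry//; exact: probability_setT.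
exists K; split; first exact: num_real.
by move=> M KM x _; exact: le_trans (fK x) (ltW KM).
Qed.

Lemma ExE f : itg f -> (\int[P]_w (f w)%:E)%E = (Ex f)%:E.
Proof. by move=> fi; rewrite fineK//; exact: integrable_fin_num. Qed.

Lemma itgD f g : itg f -> itg g -> itg (fun x => f x + g x).
Proof. by move=> fi gi; apply: eq_integrable (integrableD measurableT fi gi). Qed.

Lemma itgB f g : itg f -> itg g -> itg (fun x => f x - g x).
Proof. by move=> fi gi; apply: eq_integrable (integrableB measurableT fi gi). Qed.

Lemma itgZ c f : itg f -> itg (fun x => c * f x).
Proof. by move=> fi; apply: eq_integrable (integrableZl measurableT c fi). Qed.

Lemma itg_cst c : itg (fun=> c).
Proof. by apply: (@itg_bounded _ `|c|). Qed.

Lemma ExD f g : itg f -> itg g -> Ex (fun x => f x + g x) = Ex f + Ex g.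
Proof. by move=> fi gi; exact: RintegralD. Qed.

Lemma ExB f g : itg f -> itg g -> Ex (fun x => f x - g x) = Ex f - Ex g.
Proof. by move=> fi gi; exact: RintegralB. Qed.

Lemma ExZ c f : itg f -> Ex (fun x => c * f x) = c * Ex f.
Proof. by move=> fi; exact: RintegralZl. Qed.

Lemma Ex_cst c : Ex (fun=> c) = c.
Proof.
rewrite /Ex Rintegral_cst// [X in fine X](_ : _ = 1%E) ?mulr1//; exact: probability_setT.
Qed.

Lemma Ex_le f g : itg f -> itg g -> (forall x, f x <= g x) -> Ex f <= Ex g.
Proof. by move=> fi gi fg; apply: le_Rintegral => // x _. Qed.

Lemma Ex_sum n (f : nat -> T -> R) : (forall i, itg (f i)) ->
  itg (fun x => \sum_(i < n) f i x) /\ Ex (fun x => \sum_(i < n) f i x) = \sum_(i < n) Ex (f i).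
Proof.
move=> fi; elim: n => [|n [IH1 IH2]].
  by under eq_fun do rewrite big_ord0; rewrite Ex_cst big_ord0; split; first exact: itg_cst.
under eq_fun do rewrite big_ord_recr; rewrite big_ord_recr /= ExD// IH2; split => //.
exact: itgD.
Qed.

End Expectation.

(** * Measures from positive functionals *)

Section Representation.
Context {R : realType}.
Local Notation pv := (@path_val R).
Variable S : R -> (R -> R) -> R -> R.
Hypothesis HS : semigroup S.
Variable C : R.
Hypothesis C0 : 0 <= C.
Hypothesis H4 : forall phi A a d, BL phi -> 0 <= A -> (forall y, phi y <= A * (y - a) ^+ 4) ->
  0 <= d -> S d phi a <= A * (C * d ^+ 2).

Variable L : ((R -> R) -> R) -> R.
Hypothesis LD : forall Phi Psi, cyl +oo Phi -> cyl +oo Psi ->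
  L (fun g => Phi g + Psi g) = L Phi + L Psi.
Hypothesis LZ : forall c Phi, cyl +oo Phi -> L (fun g => c * Phi g) = c * L Phi.
Hypothesis Lgexp : forall Phi, cyl +oo Phi -> L Phi <= gexp S Phi.

Lemma LB Phi Psi : cyl +oo Phi -> cyl +oo Psi -> L (fun g => Phi g - Psi g) = L Phi - L Psi.
Proof.
move=> H1 H2; rewrite -[- L Psi]mulN1r -LZ// -LD//; last exact: cylZ.
by congr L; apply/funext => g; rewrite mulN1r.
Qed.

Lemma L_le Phi Psi : cyl +oo Phi -> cyl +oo Psi -> (forall g, Phi g <= Psi g) -> L Phi <= L Psi.
Proof.
move=> H1 H2 H; rewrite -subr_le0 -LB//; apply: le_trans (Lgexp (cylB H1 H2)) _.
rewrite -(gexp_cst HS 0); apply: gexp_le => //; [exact: cylB|exact: cyl_cst|].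
by move=> h _; rewrite subr_le0.
Qed.

Lemma L_cst c : L (fun=> c) = c.
Proof.
have up b : L (fun=> b) <= b by rewrite -[leRHS](gexp_cst HS); apply: Lgexp; exact: cyl_cst.
apply: le_anti; rewrite up /= -lerN2 -mulN1r -LZ; last exact: cyl_cst.
by apply: le_trans (up (- c)); rewrite mulN1r.
Qed.

Lemma L_ge0 Phi : cyl +oo Phi -> (forall g, 0 <= Phi g) -> 0 <= L Phi.
Proof. by move=> H P0; rewrite -(L_cst 0); apply: L_le => //; exact: cyl_cst. Qed.

Lemma L_sum n (F : nat -> (R -> R) -> R) : (forall i, cyl +oo (F i)) ->
  L (fun g => \sum_(i < n) F i g) = \sum_(i < n) L (F i).
Proof.
move=> H; elim: n => [|n IH].
  by under eq_fun do rewrite big_ord0; rewrite L_cst big_ord0.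
under eq_fun do rewrite big_ord_recr; rewrite big_ord_recr /=.
by rewrite LD// ?IH//; exact: cyl_sum.
Qed.

(** Daniell's outer measure: a set is measured from outside by increasing sequences of nonnegative
    cylinder functionals that reach 1 at each of its points. *)
Definition cover (A : set (Omega R)) (y : R) := exists g : nat -> (R -> R) -> R,
  [/\ forall n, cyl +oo (g n), forall n h, 0 <= g n h, forall n h, g n h <= g n.+1 h,
      forall w, A w -> exists n, 1 <= g n (pv w)
    & forall n, L (g n) <= y].

Definition mu_ (A : set (Omega R)) : \bar R := ereal_inf [set y%:E | y in cover A].

Lemma incr_le (g : nat -> (R -> R) -> R) m n h : (forall n h, g n h <= g n.+1 h) ->
  (m <= n)%N -> g m h <= g n h.
Proof.
by move=> H /subnKC <-; elim: (n - m)%N => [|k IH]; rewrite ?addn0// addnS (le_trans IH).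
Qed.

Lemma mu_le A y : cover A y -> (mu_ A <= y%:E)%E.
Proof. by move=> H; apply: ereal_inf_lbound; exists y. Qed.

Lemma mu_ge0 A : (0 <= mu_ A)%E.
Proof.
apply: le_ereal_inf_tmp => _ [y [g [c g0 _ _ Ly]] <-].
by rewrite lee_fin (le_trans _ (Ly 0%N))//; exact: L_ge0.
Qed.

Lemma mu_le1 A : (mu_ A <= 1)%E.
Proof.
apply: mu_le; exists (fun _ _ => 1); split=> // [n|w _|n]; first exact: cyl_cst.
  by exists 0%N.
by rewrite L_cst.
Qed.

Lemma mu_fin A : mu_ A \is a fin_num.
Proof. by rewrite ge0_fin_numE ?mu_ge0// (le_lt_trans (mu_le1 A))// ltry. Qed.

Lemma mu_near A e : 0 < e -> exists2 y, cover A y & (y%:E <= mu_ A + e%:E)%E.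
Proof.
move=> e0; have [_ [y Hy <-] H] := lb_ereal_inf_adherent e0 (mu_fin A).
by exists y => //; exact: ltW.
Qed.

Lemma mu_set0 : mu_ set0 = 0%E.
Proof.
apply/eqP; rewrite eq_le mu_ge0 andbT; apply: mu_le.
by exists (fun _ _ => 0); split=> // n; [exact: cyl_cst|rewrite L_cst].
Qed.

Lemma mu_mono : {homo mu_ : A B / A `<=` B >-> (A <= B)%E}.
Proof.
move=> A B AB; apply: le_ereal_inf_tmp => _ [y [g [c g0 gi gB Ly]] <-].
by apply: mu_le; exists g; split=> // w /AB; exact: gB.
Qed.

(** The n-th term of the joint cover adds up the n-th terms of the first n covers, so it remains a
    cylinder functional. *)
Lemma mu_subadd : sigma_subadditive mu_.
Proof.
move=> A; apply/lee_addgt0Pr => e e0.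
apply: le_trans (epsilon_trick xpredT (fun n => mu_ge0 (A n)) (ltW e0)).
set T := (X in (_ <= X)%E).
have en n : 0 < e / (2 ^ n.+1)%:R by rewrite divr_gt0// ltr0n expn_gt0.
have [y Hy] : exists y : nat -> R, forall n, cover (A n) (y n) /\
    ((y n)%:E <= mu_ (A n) + (e / (2 ^ n.+1)%:R)%:E)%E.
  exists (fun n => projT1 (cid2 (mu_near (A n) (en n)))) => n.
  by case: cid2.
have [g Hg] : exists g : nat -> nat -> (R -> R) -> R, forall i,
   [/\ forall n, cyl +oo (g i n), forall n h, 0 <= g i n h, forall n h, g i n h <= g i n.+1 h,
      forall w, A i w -> exists n, 1 <= g i n (pv w)
    & forall n, L (g i n) <= y i].
  by exists (fun i => projT1 (cid (Hy i).1)) => i; case: cid.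
have yT n : ((\sum_(i < n) y i)%:E <= T)%E.
  rewrite -sumEFin; apply: (@le_trans _ _ (\sum_(0 <= i < n) (mu_ (A i) + (e / (2 ^ i.+1)%:R)%:E))%E).
    by rewrite big_mkord; apply: lee_sum => i _; exact: (Hy i).2.
  by apply: nneseries_lim_ge => i _ _; rewrite adde_ge0 ?mu_ge0// lee_fin ltW.
have T0 : (0 <= T)%E by rewrite (le_trans _ (yT 0%N))// big_ord0.
case: T T0 yT => [t| |//] _ yT; last by rewrite leey.
apply: mu_le; exists (fun n h => \sum_(i < n) g i n h); split.
- move=> n; apply: (@cyl_sum _ _ n (fun i => g i n)) => i; by have [] := Hg i.
- by move=> n h; apply: sumr_ge0 => i _; have [] := Hg i.
- move=> n h; rewrite big_ord_recr /= ler_wpDr//; first by have [] := Hg n.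
  by apply: ler_sum => i _; have [] := Hg i.
- move=> w [i _ Aiw]; have [ci gi0 gii gc _] := Hg i; have [n gn] := gc w Aiw.
  exists (maxn i.+1 n); apply: (le_trans gn).
  apply: (le_trans (incr_le (pv w) gii (leq_maxr i.+1 n))).
  rewrite (bigD1 (Ordinal (leq_maxl i.+1 n)))//= lerDl.
  by apply: sumr_ge0 => k _; have [] := Hg k.
- move=> n; rewrite (L_sum n (F := fun i => g i n)); last by move=> i; have [] := Hg i.
  rewrite -lee_fin; apply: le_trans (yT n); rewrite lee_fin.
  by apply: ler_sum => i _; have [] := Hg i.
Qed.

Definition omu : {outer_measure set (Omega R) -> \bar R} :=
  HB.pack mu_ (isOuterMeasure.Build R (Omega R) mu_ mu_set0 mu_ge0 mu_mono mu_subadd).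

(** The ramps [em] increase to the indicator of the set. Cutting a cover g of A by them covers the
    part of A inside; subtracting one fixed cut covers the part outside. The expectations of the
    cuts increase to a supremum, so the two costs add up to that of g within e/2. *)
Lemma cyl_caratheodory Phi c : cyl +oo Phi -> omu.-caratheodory [set w | c < Phi (pv w)].
Proof.
move=> cPhi; apply: le_caratheodory_measurable => A /=; apply/lee_addgt0Pr => e e0.
have e2 : 0 < e / 2 by rewrite divr_gt0.
have [y [g [cg g0 gi gA Ly]] yA] := mu_near A e2.
pose em (m : nat) (h : R -> R) := Num.min (m%:R * Num.max (Phi h - c) 0) 1.
have cem m : cyl +oo (em m).
  by apply/cyl_minc/cylZ/cyl_maxc/cylB => //; exact: cyl_cst.
have em0 m h : 0 <= em m h by rewrite le_min ler01 mulr_ge0// le_max lexx orbT.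
have emi m h : em m h <= em m.+1 h.
  rewrite le_min ge_min ler_wpM2r ?le_max ?lexx ?orbT// ?ler_nat//=.
  by rewrite ge_min lexx orbT.
pose k n h := Num.min (g n h) (em n h).
have ck n : cyl +oo (k n) by exact: cyl_min.
have ki n h : k n h <= k n.+1 h by rewrite le_min; apply/andP; split; rewrite ge_min ?gi ?emi ?orbT.
have k0 n h : 0 <= k n h by rewrite le_min g0 em0.
have Lk n : L (k n) <= y.
  by apply: le_trans (Ly n); apply: L_le => // h; rewrite ge_min lexx.
have supk : has_sup (range (fun n => L (k n))).
  by split; [exists (L (k 0%N)), 0%N|exists y => _ [n _ <-]].
pose s := sup (range (fun n => L (k n))).
have ks n : L (k n) <= s by apply: ub_le_sup; [exact: supk.2|exists n].
have h1 : (mu_ (A `&` [set w | (c < Phi (pv w))%R]) <= s%:E)%E.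
  apply: mu_le; exists k; split=> // w [Aw /= cw].
  have [n gn] := gA w Aw.
  have d0 : 0 < Phi (pv w) - c by rewrite subr_gt0.
  have [m md] := archi_gt (Phi (pv w) - c)^-1.
  pose N := maxn n m.+1; exists N; rewrite le_min (le_trans gn) /=; last first.
    exact: incr_le gi (leq_maxl _ _).
  rewrite le_min lexx andbT (max_l (ltW d0)) -ler_pdivrMr// mul1r ltW// md//.
  by rewrite /N leq_maxr.
have [_ [m _ <-] sm] := sup_adherent e2 supk.
have h2 : (mu_ (A `&` ~` [set w | (c < Phi (pv w))%R]) <= (y - L (k m))%:E)%E.
  apply: mu_le; exists (fun n h => g n h - Num.min (g n h) (em m h)); split.
  - by move=> n; apply: cylB => //; exact: cyl_min.
  - by move=> n h; rewrite subr_ge0 ge_min lexx.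
  - move=> n h; have := gi n h; rewrite /Num.min.
    by case: ltP => ?; case: ltP => ?; lra.
  - move=> w [Aw /= /negP]; rewrite -leNgt => cw; have [n gn] := gA w Aw; exists n.
    have -> : em m (pv w) = 0 by rewrite /em max_r ?subr_le0// mulr0 min_l.
    by rewrite min_r ?subr0.
  - move=> n; have cm i : cyl +oo (fun h => Num.min (g i h) (em m h)) by exact: cyl_min.
    pose N := maxn n m.
    have cN : cyl +oo (fun h => g N h - Num.min (g N h) (em m h)) by exact: cylB.
    apply: (@le_trans _ _ (L (fun h => g N h - Num.min (g N h) (em m h)))).
      apply: L_le => //; first exact: cylB.
      move=> h; have := incr_le h gi (leq_maxl n m); rewrite -/N /Num.min.
      by case: ltP => ?; case: ltP => ?; lra.
    rewrite LB// lerB//; apply: L_le => // h; rewrite /k le_min.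
    apply/andP; split; rewrite ge_min ?lexx ?orbT//.
    by rewrite (incr_le h gi (leq_maxr n m)).
apply: (le_trans (leeD h1 h2)); rewrite -EFinD.
have : ((y + e / 2)%:E <= mu_ A + e%:E)%E.
  by rewrite EFinD [X in (_ <= _ + X)%E](_ : _ = (e / 2)%:E + (e / 2)%:E)%E ?addeA ?leeD2r// -EFinD -splitr.
have sm' : s - e / 2 < L (k m) := sm.
by apply: le_trans; rewrite lee_fin; lra.
Qed.

Lemma mu_sigma_algebra : sigma_algebra setT omu.-caratheodory.
Proof.
split; first exact: caratheodory_measurable_set0.
  by move=> A HA; rewrite setTD; exact: caratheodory_measurable_setC.
by move=> A HA; exact: caratheodory_measurable_bigcup.
Qed.

Lemma omega_caratheodory (A : set (Omega R)) : measurable A -> omu.-caratheodory A.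
Proof.
apply: (measurable_coord mu_sigma_algebra) => s c.
pose Phi (g : R -> R) := Num.max (Num.min (g s) (c + 1)) (c - 1).
have cPhi : cyl +oo Phi.
  apply: (@cyl_eval R +oo%E s (fun x => Num.max (Num.min x (c + 1)) (c - 1))); first exact: leey.
  split.
    exists (`|c| + 1) => x; set v := Num.max _ _.
    have v1 : c - 1 <= v by rewrite le_max lexx orbT.
    have v2 : v <= c + 1 by rewrite ge_max ge_min lexx orbT /=; lra.
    have := ler_norm c; have := ler_norm (- c); rewrite normrN ler_norml => ? ?.
    by apply/andP; split; lra.
  exists 1 => // x y; rewrite mul1r; exact: le_trans (maxr_lip _ _ _) (minr_lip _ _ _).
have -> : [set w : Omega R | c < pv w s] = [set w | c < Phi (pv w)].
  apply/seteqP; split=> w /=; rewrite /Phi lt_max lt_min; first by move=> ->; rewrite ltrDl ltr01.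
  by move=> /orP[/andP[]//|]; lra.
exact: cyl_caratheodory.
Qed.

(** Tightness enters here: for a cover g of A the functionals (Phi - g n)^+ decrease and reach 0
    along every path, so [gexp_daniell] makes their expectation small. *)
Lemma L_le_mu (A : set (Omega R)) Phi : cyl +oo Phi ->
  (forall g, Phi g <= 1) -> (forall w, ~ A w -> Phi (pv w) <= 0) -> ((L Phi)%:E <= mu_ A)%E.
Proof.
move=> cPhi P1 PA; apply/lee_addgt0Pr => e e0.
have e2 : 0 < e / 2 by rewrite divr_gt0.
have [y [g [cg g0 gi gA Ly]] yA] := mu_near A e2.
pose f n h := Num.max (Phi h - g n h) 0.
have cf n : cyl +oo (f n) by apply/cyl_maxc/cylB.
have fd n h : f n.+1 h <= f n h.
  by rewrite ge_max !le_max lexx orbT andbT lerB.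
have f0 w : exists n, f n (pv w) <= 0.
  have [Aw|nAw] := pselect (A w).
    by have [n gn] := gA w Aw; exists n; rewrite ge_max lexx andbT subr_le0 (le_trans (P1 _)).
  by exists 0%N; rewrite ge_max lexx andbT subr_le0 (le_trans (PA w nAw)).
have [n fn] := gexp_daniell HS C0 H4 cf fd f0 e2.
have : L Phi <= L (f n) + L (g n).
  rewrite -LD//; apply: L_le => //; first exact: cylD.
  by move=> h; rewrite -lerBlDr le_max lexx.
move=> h1; have h2 := Lgexp (cf n); have h3 := Ly n.
have : ((y + e / 2)%:E <= mu_ A + e%:E)%E.
  by rewrite EFinD [X in (_ <= _ + X)%E](_ : _ = (e / 2)%:E + (e / 2)%:E)%E ?addeA ?leeD2r// -EFinD -splitr.
by apply: le_trans; rewrite lee_fin; lra.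
Qed.

Lemma mu_setT : mu_ setT = 1%E.
Proof.
apply/eqP; rewrite eq_le mu_le1 /=.
by have := @L_le_mu setT (fun=> 1) (cyl_cst _ 1) (fun=> lexx 1) (fun w h => False_ind _ (h I)); rewrite L_cst.
Qed.

Lemma mu_sigma_additive : semi_sigma_additive (mu_ : set (Omega R) -> _).
Proof.
move=> A mA tA mbA; have mA' n := omega_caratheodory (mA n).
exact: (@caratheodory_measure_sigma_additive R _ omu A mA' tA (omega_caratheodory mbA)).
Qed.

Theorem representation : exists P : probability (Omega R) R,
  forall Phi, cyl +oo Phi -> Ex P (fun w => Phi (pv w)) = L Phi.
Proof.
pose m : {measure set (Omega R) -> \bar R} :=
  HB.pack mu_ (isMeasure.Build _ (Omega R) R mu_ mu_set0 mu_ge0 mu_sigma_additive).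
pose P : probability (Omega R) R :=
  HB.pack mu_ (isMeasure.Build _ (Omega R) R mu_ mu_set0 mu_ge0 mu_sigma_additive)
    (Measure_isProbability.Build _ (Omega R) R m mu_setT).
exists P.
have cyl_itg Phi : cyl +oo Phi -> itg P (fun w => Phi (pv w)).
  move=> cPhi; have [K _ HK] := cyl_bounded cPhi.
  by apply: (itg_bounded P (cyl_measurable cPhi)) => w; exact: HK.
have main Phi : cyl +oo Phi -> (forall g, 0 <= Phi g <= 1) -> L Phi <= Ex P (fun w => Phi (pv w)).
  move=> cPhi P01; apply/ler_addgt0Pr => e e0.
  have [N Ne] := archi_gt e^-1; have {}Ne := Ne N.+1 (ltnSn N).
  have N0 : 0 < N.+1%:R :> R by [].
  have Ne' : N.+1%:R^-1 < e by rewrite -[e]invrK ltf_pV2 ?posrE ?invr_gt0.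
  (* Slices of height 1/(N + 1), rescaled: their sum is (N + 1) Phi, and slice k + 1 is carried by
     the set where slice k equals 1. Comparing L of one with E^P of the other costs at most one
     slice. *)
  pose phi (k : nat) h := Num.min (Num.max (N.+1%:R * Phi h - k%:R) 0) 1.
  have cphi k : cyl +oo (phi k).
    by apply/cyl_minc/cyl_maxc/cylB; [exact: cylZ|exact: cyl_cst].
  have phi0 k h : 0 <= phi k h by rewrite le_min ler01 le_max lexx orbT.
  have phi1 k h : phi k h <= 1 by rewrite ge_min lexx orbT.
  have sumphi n h : \sum_(k < n) phi k h = Num.min (N.+1%:R * Phi h) n%:R.
    have x0 : 0 <= N.+1%:R * Phi h by rewrite mulr_ge0//; case/andP: (P01 h).
    elim: n => [|n IH]; first by rewrite big_ord0 min_r.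
    rewrite big_ord_recr /= IH /phi -[n.+1%:R]natr1; move: (N.+1%:R * _) x0 => x x0.
    have [h1|h1] := leP x n%:R; last have [h2|h2] := leP x (n%:R + 1).
    - by rewrite max_r ?subr_le0// (min_l ler01) addr0 min_l// (le_trans h1)// lerDl.
    - rewrite max_l ?subr_ge0 ?(ltW h1)// min_l ?subrKC//.
      by rewrite lerBlDl.
    - rewrite max_l ?subr_ge0 ?(ltW h1)// min_r//.
      by rewrite lerBrDl ltW.
  have sumPhi h : \sum_(k < N.+1) phi k h = N.+1%:R * Phi h.
    by rewrite sumphi min_l// -[leRHS]mulr1 ler_wpM2l//; case/andP: (P01 h).
  pose B (k : nat) := [set w : Omega R | k%:R < N.+1%:R * Phi (pv w)].
  have mB k : measurable (B k) by exact: (rays_measurable k%:R (cyl_measurable (cylZ N.+1%:R cPhi))).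
  have LB' k : ((L (phi k))%:E <= P (B k))%E.
    apply: L_le_mu => // w /negP; rewrite -leNgt => wk.
    by rewrite /phi max_r ?subr_le0// min_l.
  have BE k : (P (B k.+1) <= (Ex P (fun w => phi k (pv w)))%:E)%E.
    rewrite -[B k.+1]setIT -integral_indic// -ExE; last exact: cyl_itg.
    apply: ge0_le_integral => //.
    - by apply/measurable_EFinP; exact: measurable_indic.
    - by apply/measurable_EFinP; exact: (cyl_measurable (cphi k)).
    move=> w _; rewrite lee_fin indicE; case: (boolP (w \in B k.+1)) => //=.
    rewrite inE /B /= => wk; rewrite /phi le_min lexx andbT le_max lerBrDr.
    by rewrite addrC natr1 ltW.
  have key k : L (phi k.+1) <= Ex P (fun w => phi k (pv w)).
    by rewrite -lee_fin (le_trans (LB' _))// BE.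
  have e1 : N.+1%:R * L Phi = \sum_(k < N.+1) L (phi k).
    by rewrite -L_sum// -LZ//; congr L; apply/funext => h; rewrite sumPhi.
  have e2 : N.+1%:R * Ex P (fun w => Phi (pv w)) = \sum_(k < N.+1) Ex P (fun w => phi k (pv w)).
    have [_ <-] := @Ex_sum _ _ _ P N.+1 (fun k w => phi k (pv w)) (fun k => cyl_itg _ (cphi k)).
    by rewrite -ExZ ?cyl_itg//; congr Ex; apply/funext => w; rewrite sumPhi.
  have : N.+1%:R * L Phi <= 1 + N.+1%:R * Ex P (fun w => Phi (pv w)).
    rewrite e1 e2 big_ord_recl /= [in leRHS]big_ord_recr /= addrA.
    have h0 : L (phi 0%N) <= 1 by rewrite -[leRHS]L_cst; apply: L_le => //; exact: cyl_cst.
    have hN : 0 <= Ex P (fun w => phi N (pv w)).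
      by rewrite -(Ex_cst P 0); apply: Ex_le; [exact: itg_cst|exact: cyl_itg|move=> w].
    apply: ler_wpDr => //; apply: lerD => //; apply: ler_sum => k _.
    exact: key.
  rewrite mulrC -ler_pdivlMr// mulrDl mul1r mulrAC mulfV ?mul1r//.
  by move=> /le_trans; apply; rewrite addrC lerD2l ltW.
have aff Phi a b : cyl +oo Phi ->
    [/\ cyl +oo (fun g => a * Phi g + b),
       L (fun g => a * Phi g + b) = a * L Phi + b &
       Ex P (fun w => a * Phi (pv w) + b) = a * Ex P (fun w => Phi (pv w)) + b].
  move=> cPhi; have c1 := cylZ a cPhi; have c2 : cyl +oo (fun _ : R -> R => b) by exact: cyl_cst.
  split; first exact: cylD.
    by rewrite LD// LZ// L_cst.
  rewrite ExD; [|exact: (cyl_itg _ c1)|exact: itg_cst].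
  by rewrite ExZ ?cyl_itg// Ex_cst.
move=> Phi cPhi; have [K K0 HK] := cyl_bounded cPhi.
have K1 : 0 < (2 * (K + 1))^-1 by rewrite invr_gt0 mulr_gt0// ltr_wpDl.
(* Rescaling into [0, 1] with either sign turns the one-sided bound into an equality. *)
have bd a : `|a| = (2 * (K + 1))^-1 -> L (fun g => a * Phi g + 2^-1) <= Ex P (fun w => a * Phi (pv w) + 2^-1).
  move=> aE; have [c _ _] := aff Phi a 2^-1 cPhi; apply: (main _ c) => g.
  have : `|a * Phi g| <= 2^-1.
    rewrite normrM aE invfM -mulrA -[leRHS]mulr1 ler_wpM2l// mulrC ler_pdivrMr ?ltr_wpDl//.
    by rewrite mul1r (le_trans (HK g))// lerDl.
  by rewrite ler_norml => /andP[]; lra.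
have := bd (2 * (K + 1))^-1 (gtr0_norm K1); have := bd (- (2 * (K + 1))^-1).
rewrite normrN => /(_ (gtr0_norm K1)).
have [_ -> ->] := aff Phi (2 * (K + 1))^-1 2^-1 cPhi.
have [_ -> ->] := aff Phi (- (2 * (K + 1))^-1) 2^-1 cPhi.
rewrite !lerD2r !mulNr lerN2 !ler_pM2l// => h1 h2.
by apply: le_anti; rewrite h1 h2.
Qed.

End Representation.

(** * The Hahn-Banach theorem on a subspace *)

Section HahnBanach.
Context {R : realType} {V : lmodType R}.
Variable D : set V.
Hypothesis DD : forall x y, D x -> D y -> D (x + y).
Hypothesis DZ : forall c x, D x -> D (c *: x).

Definition sublinear_on (p : V -> R) :=
  (forall x y, D x -> D y -> p (x + y) <= p x + p y) /\
  (forall c x, D x -> 0 <= c -> p (c *: x) <= c * p x).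

Lemma DN x : D x -> D (- x).
Proof. by rewrite -scaleN1r; exact: DZ. Qed.

Lemma sublin0 p x : sublinear_on p -> D x -> p 0 = 0.
Proof.
move=> [pD pZ] Dx; have D0 : D 0 by rewrite -(scale0r x); exact: DZ.
apply: le_anti; have := pZ 0 0 D0 (lexx _); rewrite scale0r mul0r => ->/=.
by have := pD 0 0 D0 D0; rewrite addr0 lerDl.
Qed.

Lemma sublinN p x : sublinear_on p -> D x -> - p (- x) <= p x.
Proof.
move=> sp Dx; have := sp.1 x (- x) Dx (DN Dx); rewrite subrr (sublin0 sp Dx).
by rewrite lerNl -[- p x]add0r lerBlDl.
Qed.

(** The classical lowering of a sublinear functional in direction x0. A functional that no [tilt]
    lowers is odd, hence linear. *)
Definition tilt (p : V -> R) (x0 x : V) : R :=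
  inf [set p (x + t *: x0) - t * p x0 | t in [set t | 0 <= t]].

Lemma tiltP p x0 : sublinear_on p -> D x0 ->
  [/\ sublinear_on (tilt p x0), forall x, D x -> tilt p x0 x <= p x & tilt p x0 (- x0) <= - p x0].
Proof.
move=> sp D0; have [pD pZ] := sp.
have lb x : D x -> lbound [set p (x + t *: x0) - t * p x0 | t in [set t | 0 <= t]] (- p (- x)).
  move=> Dx _ [t /= t0 <-].
  have := pD (- x) (x + t *: x0) (DN Dx) (DD Dx (DZ t D0)); rewrite addKr.
  have := sublinN sp (DZ t D0).
  have := pZ t (- x0) (DN D0) t0; rewrite scalerN.
  have : t * p x0 <= p (t *: x0).
    move: t0; rewrite le_eqVlt => /orP[/eqP <-|t0]; first by rewrite mul0r scale0r (sublin0 sp D0).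
    rewrite -(ler_pM2l (_ : 0 < t^-1)) ?invr_gt0// mulKf ?gt_eqF//.
    have := pZ t^-1 _ (DZ t D0); rewrite scalerA mulVf ?gt_eqF// scale1r; apply.
    by rewrite invr_ge0 ltW.
  lra.
have hi x : D x -> has_inf [set p (x + t *: x0) - t * p x0 | t in [set t | 0 <= t]].
  move=> Dx; split; last by exists (- p (- x)); exact: lb.
  by exists (p (x + 0 *: x0) - 0 * p x0), 0 => /=.
have le x t : D x -> 0 <= t -> tilt p x0 x <= p (x + t *: x0) - t * p x0.
  by move=> Dx t0; apply: ge_inf; [exact: (hi x Dx).2|exists t].
have ge x y : D x -> (forall t, 0 <= t -> y <= p (x + t *: x0) - t * p x0) -> y <= tilt p x0 x.
  by move=> Dx H; apply: lb_le_inf; [exact: (hi x Dx).1|move=> _ [t t0 <-]; exact: H].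
split; last 2 first.
- by move=> x Dx; have := le x 0 Dx (lexx _); rewrite scale0r addr0 mul0r subr0.
- by have := le (- x0) 1 (DN D0) ler01; rewrite scale1r addNr (sublin0 sp D0) mul1r sub0r.
split=> [x y Dx Dy|c x Dx c0].
  rewrite -lerBlDr; apply: (ge x) => // s s0; rewrite lerBlDl -lerBlDr; apply: (ge y) => // t t0.
  rewrite lerBlDl; apply: le_trans (le _ (s + t) (DD Dx Dy) (addr_ge0 s0 t0)) _.
  have := pD (x + s *: x0) (y + t *: x0) (DD Dx (DZ s D0)) (DD Dy (DZ t D0)).
  by rewrite addrACA -scalerDl mulrDl; lra.
move: c0; rewrite le_eqVlt => /orP[/eqP <-|c0].
  rewrite scale0r mul0r; have := le 0 0 (_ : D 0) (lexx _).
  by rewrite scale0r mul0r addr0 subr0 (sublin0 sp Dx); apply; rewrite -(scale0r x); exact: DZ.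
rewrite -ler_pdivrMl//; apply: (ge x) => // t t0; rewrite ler_pdivrMl//.
apply: le_trans (le _ (c * t) (DZ c Dx) (mulr_ge0 (ltW c0) t0)) _.
have := pZ c (x + t *: x0) (DD Dx (DZ t D0)) (ltW c0).
by rewrite scalerDr scalerA; lra.
Qed.

Lemma minimal_sublinear p x0 : sublinear_on p -> D x0 -> exists q, [/\ sublinear_on q,
  forall x, D x -> q x <= p x &
  forall q', sublinear_on q' -> (forall x, D x -> q' x <= q x) -> forall x, D x -> q' x = q x].
Proof.
move=> sp Dx0.
(* Values off D are fixed at 0, so that the order by values on D is antisymmetric, as Zorn's lemma
   requires. *)
pose good (q : V -> R) := [/\ sublinear_on q, forall x, D x -> q x <= p x & forall x, ~ D x -> q x = 0].
pose T := {q : V -> R | good q}.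
pose Rel (s t : T) := `[< forall x, D x -> sval t x <= sval s x >].
have restr q : sublinear_on q -> (forall x, D x -> q x <= p x) ->
    good (fun x => if `[< D x >] then q x else 0).
  move=> sq qp; split.
  - split=> [x y Dx Dy|c x Dx c0]; rewrite !asboolT//; [exact: sq.1|exact: DD|exact: sq.2|exact: DZ].
  - by move=> x Dx; rewrite asboolT//; exact: qp.
  - by move=> x nD; rewrite asboolF.
have [||||t tmax] := @Zorn T Rel.
- by move=> t; apply/asboolP.
- by move=> r s t /asboolP rs /asboolP st; apply/asboolP => x Dx; rewrite (le_trans (st x Dx)) ?rs.
- move=> [s gs] [t gt] /asboolP /= st /asboolP /= ts; apply: eq_exist => /=.
  apply/funext => x; have [Dx|nD] := pselect (D x).
    by apply: le_anti; rewrite ts// st.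
  by have [_ _ ->] := gs => //; have [_ _ ->] := gt.
- move=> A totA; have [[a0 Aa0]|nA] := pselect (exists a, A a); last first.
    exists (exist _ _ (restr p sp (fun x _ => lexx _))) => s As.
    by exfalso; apply: nA; exists s.
  pose q x := inf [set sval a x | a in A].
  have hi x : D x -> has_inf [set sval a x | a in A].
    move=> Dx; split; first by exists (sval a0 x), a0.
    exists (- p (- x)) => _ [a Aa <-] /=; have [sa ap _] := svalP a.
    have := sublinN sa Dx; have := ap (- x) (DN Dx); lra.
  have le a x : A a -> D x -> q x <= sval a x.
    by move=> Aa Dx; apply: ge_inf; [exact: (hi x Dx).2|exists a].
  have ge x y : D x -> (forall a, A a -> y <= sval a x) -> y <= q x.
    by move=> Dx H; apply: lb_le_inf; [exact: (hi x Dx).1|move=> _ [a Aa <-]; exact: H].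
  have sq : sublinear_on q.
    split=> [x y Dx Dy|c x Dx c0].
      rewrite -lerBlDr; apply: (ge x) => // a Aa; rewrite lerBlDl -lerBlDr; apply: (ge y) => // b Ab.
      rewrite lerBlDl.
      have [r [Ar ra rb]] : exists r, [/\ A r, forall z, D z -> sval r z <= sval a z &
          forall z, D z -> sval r z <= sval b z].
        have [/asboolP ab|/asboolP ba] := totA a b Aa Ab; first by exists b.
        by exists a.
      apply: le_trans (le r _ Ar (DD Dx Dy)) _; have [[sr _] _ _] := svalP r.
      by apply: le_trans (sr x y Dx Dy) _; rewrite lerD ?ra ?rb.
    move: c0; rewrite le_eqVlt => /orP[/eqP <-|c0].
      rewrite scale0r mul0r; have [s0 _ _] := svalP a0.
      rewrite -(sublin0 s0 Dx); apply: le => //; rewrite -(scale0r x); exact: DZ.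
    rewrite -ler_pdivrMl//; apply: (ge x) => // a Aa; rewrite ler_pdivrMl//.
    apply: le_trans (le a _ Aa (DZ c Dx)) _; have [[_ sa] _ _] := svalP a.
    exact: sa (ltW c0).
  have qp x : D x -> q x <= p x.
    by move=> Dx; have [_ ap _] := svalP a0; exact: le_trans (le a0 x Aa0 Dx) (ap x Dx).
  exists (exist _ _ (restr q sq qp)) => a Aa; apply/asboolP => x Dx /=.
  by rewrite asboolT//; exact: le.
have [st tp _] := svalP t.
exists (sval t); split=> // q' sq' q't x Dx.
have qp y : D y -> q' y <= p y by move=> Dy; exact: le_trans (q't y Dy) (tp y Dy).
have := tmax (exist _ _ (restr q' sq' qp)) (_ : Rel _ _) => <- /=; first by rewrite asboolT.
by apply/asboolP => y Dy /=; rewrite asboolT//; exact: q't.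
Qed.

(** A minimal sublinear functional is linear because [tilt] cannot lower it; minimizing below the
    tilt at x0 forces L x0 = p x0. *)
Theorem hahn_banach p x0 : sublinear_on p -> D x0 -> exists L : V -> R,
  [/\ forall x y, D x -> D y -> L (x + y) = L x + L y, forall c x, D x -> L (c *: x) = c * L x,
      forall x, D x -> L x <= p x & L x0 = p x0].
Proof.
move=> sp D0; have [sp' p'p p'x0] := tiltP sp D0.
have [L [sL Lp' Lmin]] := minimal_sublinear sp' D0.
have LN x : D x -> L (- x) = - L x.
  move=> Dx; have [st tL tN] := tiltP sL Dx.
  have := Lmin _ st tL (- x) (DN Dx) => e; rewrite e in tN.
  by apply: le_anti; rewrite tN /= lerNl; exact: sublinN.
have LD' x y : D x -> D y -> L (x + y) = L x + L y.
  move=> Dx Dy; apply: le_anti; rewrite sL.1//=.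
  have := sL.1 _ _ (DN Dx) (DN Dy); rewrite -opprD !LN//; last exact: DD.
  by rewrite -opprD lerN2.
have LZ' c x : D x -> 0 <= c -> L (c *: x) = c * L x.
  move=> Dx c0; apply: le_anti; rewrite sL.2//=.
  have := sL.2 c _ (DN Dx) c0; rewrite scalerN !LN//; last exact: DZ.
  by rewrite mulrN lerN2.
exists L; split=> //.
- move=> c x Dx; have [c0|c0] := leP 0 c; first exact: LZ'.
  by rewrite -[c]opprK scaleNr LN ?LZ' ?mulNr ?oppr_ge0 ?(ltW c0)//; exact: DZ.
- by move=> x Dx; exact: le_trans (Lp' x Dx) (p'p x Dx).
apply: le_anti; rewrite (le_trans (Lp' x0 D0) (p'p x0 D0))/=.
by have := le_trans (Lp' _ (DN D0)) p'x0; rewrite LN// lerN2.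
Qed.

End HahnBanach.

(** * Stopped paths, and approximation of past events by cylinder functionals *)

Section Stopping.
Context {R : realType}.
Local Notation pv := (@path_val R).
Implicit Types (P Q : probability (Omega R) R) (t : \bar R).

Lemma pv_stop t (w : Omega R) s : pv (stop t w) s = pv w (fine (mine s%:E t)).
Proof. by []. Qed.

Lemma cpath_eq (w w' : cpath R) : pv w = pv w' -> w = w'.
Proof. by case: w => w hw; case: w' => w' hw'; rewrite /path_val /= => e; apply: eq_exist. Qed.

Lemma stop_pinfty (w : Omega R) : stop +oo w = w.
Proof. by apply: cpath_eq; apply/funext => s; rewrite pv_stop min_l ?leey. Qed.

Lemma stop_stop t t' (w : Omega R) : (0 <= t)%E -> (t <= t')%E -> stop t (stop t' w) = stop t w.
Proof.
move=> t0 tt; apply: cpath_eq; apply/funext => s; rewrite !pv_stop.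
case: t t0 tt => [t| |] //= t0; last by case: t' => //= _; rewrite !min_l ?leey.
case: t' => [t'| |] // tt; last by rewrite [X in fine X]min_l ?leey.
rewrite -!EFin_min /= lee_fin in tt *.
by congr (pv w); rewrite min_l// ge_min tt orbT.
Qed.

Lemma measurable_stop t : measurable_fun setT (@stop R t).
Proof.
move=> _ A mA; rewrite setTI.
apply: (measurable_coord (C := [set A | measurable (@stop R t @^-1` A)])) mA.
  split=> /=.
  - by rewrite preimage_set0.
  - by move=> B mB; rewrite setTD preimage_setC; exact: measurableC.
  - by move=> B mB; rewrite preimage_bigcup; exact: bigcup_measurable.
move=> s c /=; apply: (rays_measurable c (eval_measurable (fine (mine s%:E t)))).
Qed.

Lemma F_P t A : F_ t A <-> exists2 B, measurable B & A = @stop R t @^-1` B.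
Proof.
by split=> [[B mB <-]|[B mB ->]]; exists B => //; rewrite setTI.
Qed.

Lemma F_measurableP t (X : Omega R -> \bar R) : (0 <= t)%E ->
  F_measurable t X <-> exists2 f, measurable_fun setT f & X = f \o @stop R t.
Proof.
move=> t0; split=> [FX|[f mf ->] A mA]; last first.
  by apply/F_P; exists (f @^-1` A) => //; rewrite -[X in measurable X]setTI; exact: mf.
exists X.
  move=> _ A mA; rewrite setTI; have /F_P[B mB ->] := FX A mA.
  by rewrite -[X in measurable X]setTI; exact: measurable_stop.
apply/funext => w /=.
have /F_P[B mB e] := FX [set X w] (emeasurable_set1 _).
have Bw : (@stop R t @^-1` B) w by rewrite -e.
have : (@stop R t @^-1` B) (stop t w) by rewrite /= (stop_stop w t0 (lexx t)).
by rewrite -e => /= ->.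
Qed.

Lemma cyl_itg P t Phi : cyl t Phi -> itg P (fun w => Phi (pv w)).
Proof.
move=> cPhi; have [K _ HK] := cyl_bounded cPhi.
by apply: (itg_bounded P (cyl_measurable cPhi)) => w; exact: HK.
Qed.

Lemma itg_measurable P f : itg P f -> measurable_fun setT f.
Proof. by move=> /(measurable_int P)/measurable_EFinP. Qed.

Lemma itg_norm P f : itg P f -> itg P (fun w => `|f w|).
Proof. by move=> fi; apply: eq_integrable (integrable_abse fi). Qed.

Lemma itg_indic P (A : set (Omega R)) : measurable A -> itg P (\1_A).
Proof.
move=> mA; apply: (@itg_bounded _ _ _ _ _ 1); first exact: measurable_indic.
by move=> w; rewrite indicE ger0_norm// lern1 leq_b1.
Qed.

Lemma Ex_indic P (A : set (Omega R)) : measurable A -> Ex P (\1_A) = fine (P A).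
Proof. by move=> mA; rewrite /Ex /Rintegral integral_indic// setIT. Qed.

Section Density.
Variables (PP : bool -> probability (Omega R) R) (t : \bar R).
Hypothesis t0 : (0 <= t)%E.
Local Notation st := (@stop R t).

(* Two probabilities at once, so that it serves both for uniqueness and for conditioning. *)
Definition cyl_approx (A : set (Omega R)) := measurable A /\ forall e, 0 < e -> exists Phi,
  [/\ cyl t Phi, forall g, 0 <= Phi g <= 1 &
   forall b, Ex (PP b) (fun w => `|\1_A (st w) - Phi (pv w)|) <= e].

Lemma preim_stop (A : set (Omega R)) : measurable A -> measurable (st @^-1` A).
Proof. by move=> mA; rewrite -[X in measurable X]setTI; exact: measurable_stop. Qed.

Lemma itg_stop P (A : set (Omega R)) : measurable A -> itg P (fun w => \1_A (st w)).
Proof. by move=> mA; exact: itg_indic (preim_stop mA). Qed.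

Lemma itg_dist P (A : set (Omega R)) Phi : measurable A -> cyl t Phi ->
  itg P (fun w => `|\1_A (st w) - Phi (pv w)|).
Proof. by move=> mA cP; apply/itg_norm/itgB; [exact: itg_stop|exact: cyl_itg cP]. Qed.

Lemma cyl_approx0 : cyl_approx set0.
Proof.
split=> // e e0; exists (fun=> 0); split=> [|g|b]; first exact: cyl_cst.
  by rewrite lexx ler01.
under [X in Ex _ X]eq_fun do rewrite indicE in_set0 subrr normr0.
by rewrite Ex_cst ltW.
Qed.

Lemma cyl_approxC A : cyl_approx A -> cyl_approx (~` A).
Proof.
move=> [mA okA]; split=> [|e e0]; first exact: measurableC.
have [Phi [c1 b1 P1]] := okA _ e0; exists (fun g => 1 - Phi g); split.
- by apply: cylB => //; exact: cyl_cst.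
- by move=> g; have /andP[? ?] := b1 g; apply/andP; split; lra.
move=> b; apply: le_trans (P1 b); rewrite le_eqVlt; apply/orP; left; apply/eqP; congr Ex.
apply/funext => w; rewrite !indicE in_setC -normrN; case: (_ \in A) => /=; congr `|_|; ring.
Qed.

Lemma cyl_approxU A A' : cyl_approx A -> cyl_approx A' -> cyl_approx (A `|` A').
Proof.
move=> [mA okA] [mA' okA']; have mU : measurable (A `|` A') by exact: measurableU.
split=> // e e0; have e2 : 0 < e / 2 by rewrite divr_gt0.
have [Phi [c1 b1 P1]] := okA _ e2; have [Psi [c2 b2 P2]] := okA' _ e2.
have cM : cyl t (fun g => Num.max (Phi g) (Psi g)) by exact: cyl_max.
exists (fun g => Num.max (Phi g) (Psi g)); split=> // [g|b].
  have /andP[p0 p1] := b1 g; have /andP[q0 q1] := b2 g.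
  by rewrite le_max ge_max p0 p1 q1.
apply: (@le_trans _ _ (e / 2 + e / 2)); last by rewrite -splitr.
apply: le_trans (lerD (P1 b) (P2 b)); rewrite -ExD; [|exact: itg_dist..].
apply: Ex_le; [exact: (itg_dist _ mU cM)|by apply: itgD; exact: itg_dist|move=> w].
set p := Phi _; set q := Psi _.
have -> : \1_(A `|` A') (st w) = Num.max (\1_A (st w)) (\1_A' (st w)) :> R.
  rewrite !indicE in_setU; case: (_ \in A); case: (_ \in A') => /=.
  - by rewrite max_l.
  - by rewrite max_l.
  - by rewrite max_r.
  - by rewrite max_l.
apply: le_trans (ler_distD (Num.max p (\1_A' (st w))) _ _) _; apply: lerD; first exact: maxr_lip.
by rewrite !(maxC p); exact: maxr_lip.
Qed.

(** The sets F n have to agree with A only off events whose probability vanishes under both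
    measures; this gives countable unions. *)
Lemma cyl_approx_lim A (F : nat -> set (Omega R)) (N : nat -> set (Omega R)) : measurable A ->
  (forall n, measurable (N n)) -> (forall b, PP b (N n) @[n --> \oo] --> 0%E) ->
  (forall n, cyl_approx (F n)) -> (forall n w, ~ N n w -> F n (st w) <-> A (st w)) -> cyl_approx A.
Proof.
move=> mA mN limN aF FA; split=> // e e0; have e2 : 0 < e / 2 by rewrite divr_gt0.
have small b : \forall n \near \oo, fine (PP b (N n)) < e / 2.
  have : fine (PP b (N n)) @[n --> \oo] --> (0 : R) by apply: fine_cvg; exact: limN.
  by move/cvgr_lt; apply.
have [n _ Hn] := filterI (small true) (small false); have [nP nQ] := Hn n (leqnn n).
have [mF okF] := aF n; have [Phi [c1 b1 P1]] := okF _ e2; exists Phi; split=> // b.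
apply: (@le_trans _ _ (e / 2 + e / 2)); last by rewrite -splitr.
have Nb : Ex (PP b) (\1_(N n)) <= e / 2 by rewrite Ex_indic// ltW//; case: b {P1}.
apply: le_trans (lerD Nb (P1 b)); rewrite -ExD; [|exact: itg_indic|exact: itg_dist].
apply: Ex_le; [exact: itg_dist|by apply: itgD; [exact: itg_indic|exact: itg_dist]|move=> w].
apply: le_trans (ler_distD (\1_(F n) (st w)) _ _) _; rewrite lerD2r !indicE.
have [Nw|nNw] := pselect (N n w).
  rewrite (mem_set Nw); case: (_ \in A); case: (_ \in F n); rewrite /= ?subrr ?normr0//.
    by rewrite subr0 normr1.
  by rewrite sub0r normrN normr1.
suff -> : (st w \in A) = (st w \in F n) by rewrite subrr normr0.
by apply/idP/idP; rewrite !inE; have [] := FA n w nNw.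
Qed.

Lemma cyl_approx_ray s c : cyl_approx [set w | c < pv w s].
Proof.
set r := fine (mine s%:E t).
have rt : (r%:E <= t)%E.
  rewrite /r; case: t t0 => [t'| |]// _; last by rewrite leey.
  by rewrite -EFin_min/= lee_fin ge_min lexx orbT.
split=> [|e e0]; first exact: (rays_measurable c (eval_measurable s)).
pose f n (x : R) := Num.min (Num.max (n%:R * (x - c)) 0) 1.
have f0 n x : 0 <= f n x by rewrite le_min ler01 le_max lexx orbT.
have f1 n x : f n x <= 1 by rewrite ge_min lexx orbT.
have Bf n : BL (f n).
  split; first by exists 1 => x; rewrite ger0_norm.
  exists n%:R => // x y; apply: le_trans (minr_lip _ _ _) _; apply: le_trans (maxr_lip _ _ _) _.
  by rewrite -mulrBr normrM ger0_norm// opprB addrA subrK.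
pose A n := [set w : Omega R | c < pv w r] `\` [set w | c + n.+1%:R^-1 < pv w r].
have mr c' : measurable [set w : Omega R | c' < pv w r] by exact: (rays_measurable c' (eval_measurable r)).
have mA n : measurable (A n) by exact: measurableD.
have lim P : P (A n) @[n --> \oo] --> 0%E.
  have I0 : \bigcap_n A n = set0.
    apply/seteqP; split=> // w Aw; have [/= cw _] := Aw 0%N I.
    have [n nc] := archi_gt (pv w r - c)^-1.
    have [_ h] := Aw n I; apply: h; rewrite /= -ltrBrDl.
    by rewrite -[X in _ < X]invrK ltf_pV2 ?posrE ?invr_gt0 ?subr_gt0// nc.
  rewrite -(measure0 P) -I0; apply: nonincreasing_cvg_mu => //.
  - by rewrite (le_lt_trans (probability_le1 P (mA 0%N)))// ltry.
  - exact: bigcap_measurableType.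
  - move=> m n mn; apply/subsetPset => w [cw h]; split=> // h'; apply: h; apply: le_lt_trans h'.
    by rewrite lerD2l lef_pV2 ?posrE// ler_nat.
have small b : \forall n \near \oo, fine (PP b (A n)) < e.
  have : fine (PP b (A n)) @[n --> \oo] --> (0 : R) by apply: fine_cvg; exact: lim.
  by move/cvgr_lt; apply.
have [n _ Hn] := filterI (small true) (small false); have [nP nQ] := Hn n (leqnn n).
exists (fun g => f n.+1 (g r)); split=> // [|g|b]; [exact: cyl_eval|by rewrite f0 f1|].
have Ab : Ex (PP b) (\1_(A n)) <= e by rewrite Ex_indic// ltW//; case: b.
apply: le_trans Ab; apply: Ex_le.
- exact: (itg_dist _ (rays_measurable c (eval_measurable s)) (cyl_eval rt (Bf n.+1))).
- exact: itg_indic.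
move=> w; rewrite !indicE.
have -> : (st w \in [set w : Omega R | c < pv w s]) = (c < pv w r).
  by apply/idP/idP; rewrite inE.
have [cr|cr] := ltP c (pv w r); last by rewrite /f max_r ?min_l// ?subrr ?normr0// pmulr_rle0// subr_le0.
have [cn|cn] := ltP (c + n.+1%:R^-1) (pv w r).
  rewrite /f min_r ?subrr ?normr0//.
  by rewrite le_max; apply/orP; left; rewrite -ler_pdivrMl// mulr1 lerBrDl ltW.
have -> : w \in A n by rewrite inE; split=> //=; apply/negP; rewrite -leNgt.
by rewrite ger0_norm ?subr_ge0// gerBl.
Qed.

Lemma cyl_approx_measurable : measurable `<=` cyl_approx.
Proof.
apply: measurable_coord; last exact: cyl_approx_ray.
split; first exact: cyl_approx0.
  by move=> A; rewrite setTD; exact: cyl_approxC.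
move=> A okA; pose F n := \big[setU/set0]_(i < n) A i.
have okF n : cyl_approx (F n).
  rewrite /F; elim: n => [|n IH]; first by rewrite big_ord0; exact: cyl_approx0.
  by rewrite big_ord_recr; exact: cyl_approxU.
have mU : measurable (\bigcup_k A k) by apply: bigcup_measurable => k _; exact: (okA k).1.
pose N n := st @^-1` (\bigcup_k A k) `\` st @^-1` F n.
have mN n : measurable (N n) by apply: measurableD; apply: preim_stop => //; exact: (okF n).1.
apply: (@cyl_approx_lim _ F N) => //.
- move=> b; rewrite -(measure0 (PP b)) -(_ : \bigcap_n N n = set0); last first.
    apply/seteqP; split=> // w Nw; have [[k _ Akw] _] := Nw 0%N I.
    by have [_] := Nw k.+1 I; apply; rewrite /F /= big_ord_recr; right.
  apply: nonincreasing_cvg_mu => //.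
  + by rewrite (le_lt_trans (probability_le1 (PP b) (mN 0%N)))// ltry.
  + exact: bigcap_measurableType.
  + move=> m n mn; apply/subsetPset => w [Uw h]; split=> // h'; apply: h.
    by apply: (subset_bigsetU mn).
- move=> n w nN; split=> [|Aw]; first exact: bigsetU_bigcup.
  by apply: contrapT => nF; apply: nN.
Qed.

End Density.

Lemma cyl_dense P Q t (B : set (Omega R)) e : (0 <= t)%E -> measurable B -> 0 < e ->
  exists Phi, [/\ cyl t Phi, forall g, 0 <= Phi g <= 1,
    Ex P (fun w => `|\1_B (stop t w) - Phi (pv w)|) <= e &
    Ex Q (fun w => `|\1_B (stop t w) - Phi (pv w)|) <= e].
Proof.
move=> t0 mB e0; have [_ /(_ e e0)[Phi [c b H]]] :=
  cyl_approx_measurable (fun b => if b then P else Q) t0 mB.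
by exists Phi; split=> //; [exact: (H true)|exact: (H false)].
Qed.

End Stopping.

(** * Properties of the representing measures *)

Section PsetFacts.
Context {R : realType}.
Local Notation pv := (@path_val R).
Variables (slo shi : R).
Hypotheses (slo0 : 0 <= slo) (sloshi : slo <= shi).
Local Notation S := (fun d phi => Gheat slo shi phi d).
Local Notation PS := (@Pset R slo shi).

(** If phi had no solution, neither would phi + K + 1, and [Gheat] would be its default 0 for this
    function, which is at least 1. Then 0 would be an admissible G-expectation of its value at B_1,
    contradicting that P lies in [Pset]. *)
Lemma Pset_Gheat_ex (P : probability (Omega R) R) phi : PS P -> BL phi ->
  exists u, Gheat_sol slo shi phi u.
Proof.
move=> PP bp; apply: contrapT => nex.
have [[K HK] _] := bp.
pose psi (y : R) := phi y + (K + 1).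
have bpsi : BL psi.
  have := BL_affine 1 (K + 1) 0 bp; congr BL; apply/funext => x.
  by rewrite mul1r addr0.
have dflt : Gheat slo shi psi = fun _ _ => 0.
  rewrite /Gheat; apply: xgetPN => u us; apply: nex.
  exists (fun t y => 1 * u t (y + 0) + - (K + 1)).
  have := sol_affine (- (K + 1)) 0 ltr01 us; congr (Gheat_sol _ _ _ _).
  by apply/funext => y; rewrite mul1r addr0 /psi addrK.
have := PP (fun w => psi (row_of_seq 1 (increments (pv w) [:: 1]) 0 0)) 0.
have G : Gexp_Lip slo shi (fun w => psi (row_of_seq 1 (increments (pv w) [:: 1]) 0 0)) 0.
  exists 0%N, [:: 1], (fun x => psi (x 0 0)); split=> //.
  - apply/bounded_lipschitzP; have [[K' HK'] [L L0 HL]] := bpsi; split; first by exists K'.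
    exists L => // x y; apply: le_trans (HL _ _) _; rewrite ler_wpM2l//.
    by have := row_coord_le (x - y) 0; rewrite !mxE.
  - by rewrite /= ler01.
  - by rewrite /= (_ : (fun y : R => _) = psi) ?dflt//; apply/funext => y; rewrite mxE.
move=> /(_ G); apply/negP; rewrite -ltNge.
have m : measurable_fun setT (fun w : Omega R => psi (row_of_seq 1 (increments (pv w) [:: 1]) 0 0)).
  have c : cyl +oo (fun g => psi (g 1 - g 0)).
    exists [:: 0; 1]; last by move=> *; exact: leey.
    by apply: (@FLip_incr _ _ 0 1 psi); rewrite ?inE ?eqxx ?orbT.
  have := cyl_measurable c; congr measurable_fun; apply/funext => w.
  by rewrite mxE.
apply: (@lt_le_trans _ _ 1%E); first exact: lte01.
have <- : (\int[P]_w (cst 1 w) = 1 :> \bar R)%E.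
  by rewrite integral_cst// [X in (_ * X)%E](_ : _ = 1%E) ?mule1//; exact: probability_setT.
apply: ge0_le_integral => //; first by apply/measurable_EFinP.
move=> w _; rewrite lee_fin /psi; set x := phi _.
by have := HK (row_of_seq 1 (increments (pv w) [:: 1]) 0 0); rewrite -/x ler_norml => /andP[]; lra.
Qed.

Lemma Pset_semigroup (P : probability (Omega R) R) : PS P -> @semigroup R S.
Proof. by move=> PP; apply: Gheat_semigroup => // phi; exact: Pset_Gheat_ex PP. Qed.

Hypothesis HS : @semigroup R S.

Lemma PsetP (P : probability (Omega R) R) : PS P <->
  forall Phi, cyl +oo Phi -> Ex P (fun w => Phi (pv w)) <= gexp S Phi.
Proof.
split=> [PP Phi cPhi|H X v /(Gexp_Lip_cyl HS)[Phi [cPhi -> ->]]].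
  rewrite -lee_fin -ExE; last exact: cyl_itg cPhi.
  by apply: PP; exact: cyl_Gexp_Lip.
by rewrite ExE ?lee_fin; [exact: H|exact: cyl_itg cPhi].
Qed.

Lemma Pset_fromP t (P Q : probability (Omega R) R) : (0 <= t)%E -> Pset_from slo shi t P Q <->
  PS Q /\ forall Phi, cyl t Phi -> Ex Q (fun w => Phi (pv w)) = Ex P (fun w => Phi (pv w)).
Proof.
move=> t0; split=> [[PQ H]|[PQ H]]; split=> //.
  move=> Phi cPhi; apply: EFin_inj; rewrite -!ExE; [|exact: cyl_itg cPhi..].
  by apply: H; exact: Lip_cyl.
move=> X /(LipP _ t0)[Phi cPhi ->].
by rewrite !ExE; [rewrite H|exact: cyl_itg cPhi..].
Qed.

(** Agreement on cylinder functionals up to t extends to all events of F_t, since one cylinder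
    functional approximates such an event under both measures. *)
Lemma Pset_from_preim t (P Q : probability (Omega R) R) (B : set (Omega R)) : (0 <= t)%E ->
  Pset_from slo shi t P Q -> measurable B -> Q (@stop R t @^-1` B) = P (@stop R t @^-1` B).
Proof.
move=> t0 /(Pset_fromP _ _ t0)[_ H] mB.
have mp := preim_stop t mB.
suff E : Ex Q (\1_(@stop R t @^-1` B)) = Ex P (\1_(@stop R t @^-1` B)).
  rewrite !Ex_indic// in E; rewrite -[LHS]fineK ?fin_num_measure// E fineK//.
  exact: fin_num_measure.
apply/eqP; rewrite -subr_eq0 -normr_le0; apply/ler_addgt0Pr => e e0; rewrite add0r.
have e2 : 0 < e / 2 by rewrite divr_gt0.
have [Phi [c _ HQ HP]] := cyl_dense Q P t0 mB e2.
have close P' : Ex P' (fun w => `|\1_B (stop t w) - Phi (pv w)|) <= e / 2 ->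
    `|Ex P' (\1_(@stop R t @^-1` B)) - Ex P' (fun w => Phi (pv w))| <= e / 2.
  apply: le_trans; rewrite -ExB; [|exact: itg_indic|exact: cyl_itg c].
  by apply: le_normr_Rintegral => //; apply: itgB; [exact: itg_indic|exact: cyl_itg c].
have := close _ HQ; rewrite (H _ c) => h1; have h2 := close _ HP.
apply: le_trans (ler_distD (Ex P (fun w => Phi (pv w))) _ _) _.
by rewrite [leRHS]splitr lerD// distrC.
Qed.

Lemma Pset_from_int t (P Q : probability (Omega R) R) (f : Omega R -> R) : (0 <= t)%E ->
  Pset_from slo shi t P Q -> measurable_fun setT f ->
  itg P (fun w => f (stop t w)) -> itg Q (fun w => f (stop t w)) ->
  Ex Q (fun w => f (stop t w)) = Ex P (fun w => f (stop t w)).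
Proof.
move=> t0 PQ mf iP iQ; apply: EFin_inj; rewrite -!ExE//.
have push P' : itg P' (fun w => f (stop t w)) ->
    (\int[P']_w (f (stop t w))%:E = \int[pushforward P' (@stop R t)]_w (f w)%:E)%E.
  move=> iP'; rewrite integral_pushforward//; first exact: measurable_stop.
  by apply/measurable_EFinP.
rewrite push// push//; have ms := measurable_stop t.
apply: eq_measure_integral => //.
by move=> A mA _; exact: (Pset_from_preim t0 PQ mA).
Qed.

Lemma Gheat_moment phi A a d : (forall phi, BL phi -> exists u, Gheat_sol slo shi phi u) ->
  BL phi -> 0 <= A -> (forall y, phi y <= A * (y - a) ^+ 4) ->
  0 <= d -> Gheat slo shi phi d a <= A * (3 * shi ^+ 4 * d ^+ 2).
Proof. move=> Hex; exact: Gheat_fourth. Qed.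

End PsetFacts.

Lemma cvgn_le (R : realType) (u : nat -> R) l b : u n @[n --> \oo] --> l ->
  (\forall n \near \oo, u n <= b) -> l <= b.
Proof. by move=> ul; rewrite -(cvg_lim _ ul)//; apply: limr_le; apply/cvg_ex; exists l. Qed.

Lemma cvgn_ge (R : realType) (u : nat -> R) l b : u n @[n --> \oo] --> l ->
  (\forall n \near \oo, b <= u n) -> b <= l.
Proof. by move=> ul; rewrite -(cvg_lim _ ul)//; apply: limr_ge; apply/cvg_ex; exists l. Qed.

(** * Quasi-sure calculus and conditional G-expectations *)

Section QuasiSure.
Context {R : realType}.
Local Notation pv := (@path_val R).
Variables (slo shi : R) (P0 : probability (Omega R) R).
Local Notation PS := (@Pset R slo shi).
Local Notation qs := (@qs R slo shi).
Hypothesis PS0 : PS P0.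

(** The direction from null sets to capacity uses P0: over an empty set of measures the supremum
    would be -oo instead of 0. *)
Lemma capacity0P (A : set (Omega R)) : capacity slo shi A = 0%E <-> forall P, PS P -> P A = 0%E.
Proof.
split=> [H P PP|H].
  apply/eqP; rewrite eq_le measure_ge0 andbT -H.
  by apply: ereal_sup_ubound; exists P.
rewrite /capacity (_ : [set _ | _ in _] = [set 0%E]) ?ereal_sup1//.
by apply/seteqP; split=> [_ [P PP <-]|_ ->]; [exact: H|exists P0 => //; exact: H].
Qed.

Lemma qsP Q : qs Q <-> exists A : set (Omega R),
  [/\ measurable A, forall P, PS P -> P A = 0%E & forall w, ~ A w -> Q w].
Proof. by split=> -[A [mA cA QA]]; exists A; split=> //; exact/capacity0P. Qed.

Lemma qs_forall (Q : nat -> Omega R -> Prop) : (forall n, qs (Q n)) -> qs (fun w => forall n, Q n w).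
Proof.
move=> H.
have [A HA] : exists A : nat -> set (Omega R), forall n,
    [/\ measurable (A n), forall P, PS P -> P (A n) = 0%E & forall w, ~ A n w -> Q n w].
  by exists (fun n => projT1 (cid ((qsP _).1 (H n)))) => n; case: cid.
apply/qsP; exists (\bigcup_n A n); split.
- by apply: bigcup_measurable => n _; have [] := HA n.
- move=> P PP; apply/eqP; rewrite eq_le measure_ge0 andbT.
  have mA n : measurable (A n) by have [] := HA n.
  suff /negligibleP : P.-negligible (\bigcup_n A n).
    by move=> ->//; exact: bigcupT_measurable.
  apply: negligible_bigcup => n; exists (A n); split=> //.
  by have [_ H0 _] := HA n; exact: H0.
- move=> w nA n; have [_ _] := HA n; apply => Aw; apply: nA.
  by exists n.
Qed.

(** As a filter, q.s. properties are combined by the same tools as almost sure ones. *)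
Lemma qs_filter : Filter qs.
Proof.
split.
- by apply/qsP; exists set0; split=> // P _; exact: measure0.
- move=> A B HA HB; have := qs_forall (Q := fun n => if n is 0%N then A else B).
  case=> [[|n]//|N [mN N0 HN]]; exists N; split=> // w Nw; split; first exact: (HN w Nw 0%N).
  exact: (HN w Nw 1%N).
- by move=> A B AB [N [mN N0 HN]]; exists N; split=> // w Nw; apply: AB; exact: HN.
Qed.

#[local] Existing Instance qs_filter.

Lemma qs_ae (P : probability (Omega R) R) Q : PS P -> qs Q -> {ae P, forall w, Q w}.
Proof.
move=> PP /qsP[A [mA A0 HA]]; exists A; split=> //; first exact: A0.
by move=> w /= nQ; apply: contrapT => nA; apply: nQ; exact: HA.
Qed.

Lemma qs_null (A : set (Omega R)) : measurable A -> (forall P, PS P -> P A = 0%E) ->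
  qs (fun w => ~ A w).
Proof. by move=> mA HA; apply/qsP; exists A. Qed.

Lemma qs_all Q : (forall w, Q w) -> qs Q.
Proof. by move=> H; apply: filterS filterT => w _. Qed.

Implicit Types (x y z : Omega R -> R) (P Q : probability (Omega R) R).

Lemma itg_le P x y : measurable_fun setT x -> itg P y -> {ae P, forall w, `|x w| <= `|y w|} -> itg P x.
Proof.
move=> mx iy xy; apply/integrableP; split; first exact/measurable_EFinP.
have /integrableP[my] := iy; apply: le_lt_trans; apply: ae_ge0_le_integral => //.
- by apply: measurableT_comp => //; exact/measurable_EFinP.
- exact: measurableT_comp.
by apply: filterS xy => w xy _; rewrite /= lee_fin.
Qed.

Lemma Ex_le_ae P x y : itg P x -> itg P y -> {ae P, forall w, x w <= y w} -> Ex P x <= Ex P y.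
Proof.
move=> ix iy xy; rewrite -subr_ge0 -ExB//.
have iB := itgB iy ix.
have iN := itg_norm iB.
have -> : Ex P (fun w => y w - x w) = Ex P (fun w => `|y w - x w|).
  apply: EFin_inj; rewrite -!ExE//; apply: ae_eq_integral => //.
  - exact: measurable_int iB.
  - exact: measurable_int iN.
  by apply: filterS xy => w xy _; rewrite /= ger0_norm// subr_ge0.
by rewrite -(Ex_cst P 0); apply: Ex_le => //; exact: itg_cst.
Qed.

(** Real representatives of integrable random variables: integrable under every P, with a common
    bound. Extended values return only when the spaces of the statement are reached. *)
Definition rv x := measurable_fun setT x /\
  exists c, forall P, PS P -> itg P x /\ Ex P (fun w => `|x w|) <= c.

Definition nle x (c : R) := forall P, PS P -> Ex P (fun w => `|x w|) <= c.

Lemma rv_itg x P : rv x -> PS P -> itg P x.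
Proof. by move=> [_ [c H]] /H[]. Qed.

Lemma rv_meas x : rv x -> measurable_fun setT x.
Proof. by case. Qed.

Lemma rv_bound x : rv x -> exists2 c, 0 <= c & nle x c.
Proof.
move=> [_ [c H]]; exists c; last by move=> P /H[].
have [i0] := H P0 PS0; apply: le_trans; rewrite -(Ex_cst P0 0).
by apply: Ex_le; [exact: itg_cst|exact: itg_norm|].
Qed.

Lemma rv_dom x y : measurable_fun setT x -> rv y -> qs (fun w => `|x w| <= `|y w|) -> rv x.
Proof.
move=> mx [my [c H]] xy; split=> //; exists c => P PP; have [iy yc] := H P PP.
have a := qs_ae PP xy; have ix := itg_le mx iy a; split=> //.
by apply: le_trans yc; apply: Ex_le_ae => //; exact: itg_norm.
Qed.

Lemma rv_norm x : rv x -> rv (fun w => `|x w|).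
Proof.
move=> rx; apply: (rv_dom _ rx); first exact: measurableT_comp (rv_meas rx).
by apply: qs_all => w; rewrite normr_id.
Qed.

Lemma rvD x y : rv x -> rv y -> rv (fun w => x w + y w).
Proof.
move=> [mx [c Hx]] [my [d Hy]]; split; first exact: measurable_funD.
exists (c + d) => P PP; have [ix xc] := Hx P PP; have [iy yd] := Hy P PP.
split; first exact: itgD.
apply: le_trans (lerD xc yd); rewrite -ExD; [|exact: itg_norm..].
apply: Ex_le; [exact/itg_norm/itgD|by apply: itgD; exact: itg_norm|].
by move=> w; exact: ler_normD.
Qed.

Lemma rvZ c x : rv x -> rv (fun w => c * x w).
Proof.
move=> [mx [d Hx]]; split; first exact: measurable_funM.
exists (`|c| * d) => P PP; have [ix xd] := Hx P PP; split; first exact: itgZ.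
under [X in Ex _ X]eq_fun do rewrite normrM.
by rewrite ExZ ?ler_wpM2l//; exact: itg_norm.
Qed.

Lemma rvN x : rv x -> rv (fun w => - x w).
Proof. by move=> /(rvZ (-1)); under eq_fun do rewrite mulN1r. Qed.

Lemma rvB x y : rv x -> rv y -> rv (fun w => x w - y w).
Proof. by move=> rx /rvN; exact: rvD. Qed.

Lemma rv_bounded x K : measurable_fun setT x -> (forall w, `|x w| <= K) -> rv x.
Proof.
move=> mx xK; split=> //; exists K => P PP; have ix := itg_bounded P mx xK; split=> //.
by rewrite -[leRHS](Ex_cst P); apply: Ex_le => //; [exact: itg_norm|exact: itg_cst].
Qed.

Lemma rv_cst c : rv (fun=> c).
Proof. exact: (@rv_bounded _ `|c|). Qed.

Lemma rv_mul x y K : rv x -> measurable_fun setT y -> (forall w, `|y w| <= K) -> rv (fun w => y w * x w).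
Proof.
move=> rx my yK; apply: (@rv_dom _ (fun w => K * x w)).
- by apply: measurable_funM => //; exact: rv_meas.
- exact: rvZ.
- apply: qs_all => w; rewrite !normrM ler_wpM2r// (le_trans (yK w))//.
  exact: ler_norm.
Qed.

Lemma rv_ind x (A : set (Omega R)) : rv x -> measurable A -> rv (fun w => \1_A w * x w).
Proof.
move=> rx mA; apply: (rv_mul (K := 1) rx); first exact: measurable_indic.
by move=> w; rewrite indicE ger0_norm// lern1 leq_b1.
Qed.

Lemma rv_max x y : rv x -> rv y -> rv (fun w => Num.max (x w) (y w)).
Proof.
move=> rx ry; apply: (rv_dom _ (rvD (rv_norm rx) (rv_norm ry))).
  by apply: measurable_maxr; exact: rv_meas.
apply: qs_all => w; rewrite [leRHS]ger0_norm ?addr_ge0//.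
by have [h|h] := leP (x w) (y w); rewrite ?lerDl ?lerDr.
Qed.

Lemma rv_cyl t Phi : cyl t Phi -> rv (fun w => Phi (pv w)).
Proof.
move=> c; have [K _ HK] := cyl_bounded c.
by apply: (rv_bounded (cyl_measurable c)) => w; exact: HK.
Qed.

Lemma E_le P x y : PS P -> rv x -> rv y -> qs (fun w => x w <= y w) -> Ex P x <= Ex P y.
Proof. by move=> PP rx ry xy; apply: Ex_le_ae (qs_ae PP xy); exact: rv_itg. Qed.

Lemma E_eq P x y : PS P -> rv x -> rv y -> qs (fun w => x w = y w) -> Ex P x = Ex P y.
Proof.
move=> PP rx ry xy; apply: le_anti; apply/andP; split; apply: E_le => //.
  by apply: filterS xy => w ->.
by apply: filterS xy => w ->.
Qed.

Lemma E_D P x y : PS P -> rv x -> rv y -> Ex P (fun w => x w + y w) = Ex P x + Ex P y.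
Proof. by move=> PP rx ry; apply: ExD; exact: rv_itg. Qed.

Lemma E_B P x y : PS P -> rv x -> rv y -> Ex P (fun w => x w - y w) = Ex P x - Ex P y.
Proof. by move=> PP rx ry; apply: ExB; exact: rv_itg. Qed.

Lemma E_abs P x : PS P -> rv x -> `|Ex P x| <= Ex P (fun w => `|x w|).
Proof. by move=> PP rx; apply: le_normr_Rintegral => //; exact: rv_itg rx PP. Qed.

Lemma rv_eq x y : rv x -> measurable_fun setT y -> qs (fun w => x w = y w) -> rv y.
Proof. by move=> rx my xy; apply: (rv_dom my rx); apply: filterS xy => w ->. Qed.

Lemma nle_le x y c : rv x -> rv y -> qs (fun w => `|x w| <= `|y w|) -> nle y c -> nle x c.
Proof.
move=> rx ry xy yc P PP; apply: le_trans (yc P PP).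
by apply: E_le => //; exact: rv_norm.
Qed.

Lemma nleD x y c d : rv x -> rv y -> nle x c -> nle y d -> nle (fun w => x w + y w) (c + d).
Proof.
move=> rx ry xc yd P PP; apply: le_trans (lerD (xc P PP) (yd P PP)).
rewrite -E_D//; [|exact: rv_norm..].
apply: E_le => //; [exact/rv_norm/rvD|apply: rvD; exact: rv_norm|].
by apply: qs_all => w; exact: ler_normD.
Qed.

Lemma nle_tri x y z c d : rv x -> rv y -> rv z -> nle (fun w => x w - y w) c ->
  nle (fun w => y w - z w) d -> nle (fun w => x w - z w) (c + d).
Proof.
move=> rx ry rz h1 h2; have := nleD (rvB rx ry) (rvB ry rz) h1 h2.
by under eq_fun do rewrite addrA subrK.
Qed.

Lemma nle_sym x y c : nle (fun w => x w - y w) c -> nle (fun w => y w - x w) c.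
Proof. by move=> H P PP; have := H P PP; under [in X in X -> _]eq_fun do rewrite distrC. Qed.

Lemma dct P (x : nat -> Omega R -> R) y g : PS P -> (forall n, rv (x n)) -> rv y -> rv g ->
  qs (fun w => forall n, `|x n w| <= g w) -> qs (fun w => x n w @[n --> \oo] --> y w) ->
  Ex P (x n) @[n --> \oo] --> Ex P y.
Proof.
move=> PP rx ry rg xg xy.
have [|||||_ _] := @dominated_convergence _ _ _ P setT measurableT (fun n => EFin \o x n) (EFin \o y) (EFin \o g).
- by move=> n; apply/measurable_EFinP; exact: rv_meas.
- by apply/measurable_EFinP; exact: rv_meas.
- by apply: filterS (qs_ae PP xy) => w H _; apply: cvg_EFin => //; exact: nearW.
- exact: rv_itg.
- by apply: filterS (qs_ae PP xg) => w H n _; rewrite /= lee_fin.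
move=> H; have {}H : (\int[P]_w (x n w)%:E)%E @[n --> \oo] --> (Ex P y)%:E.
  by rewrite -ExE//; exact: rv_itg.
exact: (fine_cvg H).
Qed.

(** Monotone convergence under all measures at once: the limit is formed pathwise, and the common
    bound on the expectations makes it finite q.s. *)
Lemma monotone_limit (x : nat -> Omega R -> R) c : (forall n, rv (x n)) ->
  qs (fun w => forall n, x n w <= x n.+1 w) -> (forall P n, PS P -> Ex P (x n) <= c) ->
  exists y, [/\ rv y, qs (fun w => x n w @[n --> \oo] --> y w) &
    qs (fun w => forall n, x n w <= y w)].
Proof.
move=> rx /qsP[N [mN N0 HN]] xc.
have [c0 c00 x0c] := rv_bound (rx 0%N).
(* Setting the differences to 0 on the exceptional set makes them monotone everywhere. *)
pose v n w : R := \1_(~` N) w * (x n w - x 0%N w).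
have v_in n w : ~ N w -> v n w = x n w - x 0%N w.
  by move=> nN; rewrite /v indicE mem_set ?mul1r.
have v_out n w : N w -> v n w = 0.
  by move=> Nw; rewrite /v indicE (memNset (_ : ~ (~` N) w)) ?mul0r//; apply.
have xmono w m n : ~ N w -> (m <= n)%N -> x m w <= x n w.
  by move=> nN /subnKC <-; elim: (n - m)%N => [|k IH]; rewrite ?addn0// addnS (le_trans IH)// HN.
have v0 n w : 0 <= v n w.
  by have [Nw|nN] := pselect (N w); [rewrite v_out|rewrite v_in// subr_ge0 xmono].
have vmono w : {homo v^~ w : m n / (m <= n)%N >-> m <= n}.
  move=> m n mn; have [Nw|nN] := pselect (N w); first by rewrite !v_out.
  by rewrite !v_in// lerD2r xmono.
have rvv n : rv (v n) by apply: rv_ind (measurableC mN); exact: rvB.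
pose z w : \bar R := ereal_sup (range (fun n => (v n w)%:E)).
have zlim w : (v n w)%:E @[n --> \oo] --> z w.
  by apply: ereal_nondecreasing_cvgn => m n mn; rewrite lee_fin vmono.
have mv n : measurable_fun setT (fun w => (v n w)%:E).
  by apply/measurable_EFinP; exact: rv_meas.
have mz : measurable_fun setT z by apply: (emeasurable_fun_cvg _ _ mv) => w _; exact: zlim.
have z0 w : (0 <= z w)%E.
  have : ((v 0%N w)%:E <= z w)%E by apply: ereal_sup_ubound; exists 0%N.
  by apply: le_trans; rewrite lee_fin.
have zc P : PS P -> (\int[P]_w z w <= (c + c0)%:E)%E.
  move=> PP; have := @cvg_monotone_convergence _ _ _ P _ measurableT _ mv (fun n w _ => _) (fun w _ => _).
  have -> : (fun w => limn (fun n => (v n w)%:E)) = z.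
    by apply/funext => w; apply/cvg_lim => //; exact: zlim.
  move=> H; have h1 n w : (0 <= (v n w)%:E)%E by rewrite lee_fin.
  have h2 w : {homo (fun n => (v n w)%:E) : m n / (m <= n)%N >-> (m <= n)%E}.
    by move=> m n mn; rewrite lee_fin vmono.
  apply: (cvge_le _ (H h1 h2)) => //; apply: nearW => n; rewrite ExE ?lee_fin; last exact: rv_itg.
  have -> : Ex P (v n) = Ex P (fun w => x n w - x 0%N w).
    apply: E_eq => //; first exact: rvB.
    by apply/qsP; exists N; split=> // w; exact: v_in.
  rewrite E_B// lerD ?xc//; apply: le_trans (x0c P PP).
  by have := E_abs PP (rx 0%N); rewrite ler_norml => /andP[]; lra.
have zint P : PS P -> P.-integrable setT z.
  move=> PP; apply/integrableP; split=> //.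
  under eq_integral do rewrite gee0_abs//.
  by rewrite (le_lt_trans (zc P PP))// ltry.
pose u w := fine (z w).
have mu : measurable_fun setT u by exact: measurableT_comp.
have zfin : qs (fun w => z w \is a fin_num).
  have m : measurable (z @^-1` [set +oo%E]).
    by rewrite -[X in measurable X]setTI; apply: (mz measurableT); exact: emeasurable_set1.
  suff H P : PS P -> P (z @^-1` [set +oo%E]) = 0%E.
    by apply: filterS (qs_null m H) => w /= h; rewrite ge0_fin_numE// ltey; apply/eqP.
  move=> PP; have [M [mM M0 HM]] := integrable_ae measurableT (zint P PP).
  apply/eqP; rewrite eq_le measure_ge0 andbT -M0; apply: le_measure; rewrite ?inE//.
  by move=> w /= zw; apply: HM => /= /(_ I); rewrite zw.
have ru : rv u.
  split=> //; exists (c + c0) => P PP.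
  have iu : itg P u.
    apply: le_integrable (zint P PP) => //; first exact/measurable_EFinP.
    by move=> w _ /=; rewrite /u; case: (z w) (z0 w) => [r| |]//= _; rewrite ?normr0 ?leey.
  split=> //; rewrite -lee_fin -ExE; last exact: itg_norm.
  apply: le_trans (zc P PP); apply: ge0_le_integral => //.
  - by apply/measurable_EFinP; exact: measurableT_comp.
  - by move=> w _; rewrite /u; case: (z w) (z0 w) => [r| |]//=; rewrite ?normr0 ?leey// !lee_fin => r0; rewrite ger0_norm.
exists (fun w => x 0%N w + u w).
have nN : qs (fun w => ~ N w) by exact: qs_null.
split; first exact: rvD.
  apply: filterS2 zfin nN => w zw Nw.
  have H : v n w @[n --> \oo] --> u w.
    have h : (v n w)%:E @[n --> \oo] --> (u w)%:E by rewrite fineK//; exact: zlim.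
    exact: (fine_cvg h).
  have := cvgD (cvg_cst (x 0%N w)) H.
  rewrite (_ : _ + _ = x^~ w); first exact.
  by apply/funext => n; rewrite /cst /= !fctE v_in// subrKC.
apply: filterS2 zfin nN => w zw Nw n; rewrite -lerBlDl -v_in// -lee_fin fineK//.
by apply: ereal_sup_ubound; exists n.
Qed.

(** Measurability with respect to F_t up to q.s. equality, expressed as factorization through the
    stopped path. *)
Definition adp (t : \bar R) x :=
  exists2 f, measurable_fun setT f & qs (fun w => x w = f (stop t w)).

Lemma adp_eq t x y : adp t x -> qs (fun w => x w = y w) -> adp t y.
Proof. by move=> [f mf xf] xy; exists f => //; apply: filterS2 xf xy => w -> ->. Qed.

Lemma adp2 (op : R -> R -> R) t x y :
  (forall f g : Omega R -> R, measurable_fun setT f -> measurable_fun setT g ->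
     measurable_fun setT (fun w => op (f w) (g w))) ->
  adp t x -> adp t y -> adp t (fun w => op (x w) (y w)).
Proof.
move=> Hop [f mf xf] [g mg yg]; exists (fun w => op (f w) (g w)); first exact: Hop.
by apply: filterS2 xf yg => w -> ->.
Qed.

Lemma adpD t x y : adp t x -> adp t y -> adp t (fun w => x w + y w).
Proof. by apply: (@adp2 (fun a b => a + b)) => f g; exact: measurable_funD. Qed.

Lemma adpM t x y : adp t x -> adp t y -> adp t (fun w => x w * y w).
Proof. by apply: (@adp2 (fun a b => a * b)) => f g; exact: measurable_funM. Qed.

Lemma adp_cst t c : adp t (fun=> c).
Proof. by exists (fun=> c) => //; exact: qs_all. Qed.

Lemma adp_cyl t Phi : (0 <= t)%E -> cyl t Phi -> adp t (fun w => Phi (pv w)).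
Proof.
move=> t0 c; exists (fun w => Phi (pv w)); first exact: cyl_measurable c.
apply: qs_all => // w; apply: (cyl_ext c) => r rt; rewrite pv_stop.
by case: t t0 rt {c} => [t| |]//= t0 rt; rewrite min_l ?leey//.
Qed.

Lemma adp_pinfty x : measurable_fun setT x -> adp +oo x.
Proof. by move=> mx; exists x => //; apply: qs_all => // w; rewrite stop_pinfty. Qed.

Lemma adp_lim t (x : nat -> Omega R -> R) y : (forall n, adp t (x n)) ->
  qs (fun w => x n w @[n --> \oo] --> y w) -> adp t y.
Proof.
move=> ax xy.
have [f Hf] : exists f : nat -> Omega R -> R, forall n, measurable_fun setT (f n) /\
    qs (fun w => x n w = f n (stop t w)).
  exists (fun n => projT1 (cid2 (ax n))) => n; by case: cid2.
(* The upper limit of the versions is measurable without any convergence, and after composition with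
   stopping it is q.s. the limit. *)
exists (fun w => fine (limn_esup (fun n => (f n w)%:E))).
  apply: measurableT_comp => //; apply: measurable_fun_limn_esup => n.
  by apply/measurable_EFinP; exact: (Hf n).1.
have h := qs_forall (fun n => (Hf n).2).
apply: filterS2 h xy => w h1 h2.
have h3 : (f n (stop t w))%:E @[n --> \oo] --> (y w)%:E.
  apply: cvg_EFin; first exact: nearW.
  by apply: cvg_trans h2; apply: near_eq_cvg; apply: nearW => n; rewrite h1.
by have [_ ->] := cvg_limn_einf_sup h3.
Qed.

Lemma qs_zero z : rv z -> (forall w, 0 <= z w) -> (forall P e, PS P -> 0 < e -> Ex P z <= e) ->
  qs (fun w => z w = 0).
Proof.
move=> rz z0 H.
have mz : measurable (z @^-1` (~` [set 0])).
  rewrite -[X in measurable X]setTI; apply: (rv_meas rz measurableT).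
  by apply: measurableC; exact: measurable_set1.
suff N0 P : PS P -> P (z @^-1` (~` [set 0])) = 0%E.
  by apply: filterS (qs_null mz N0) => w /= /contrapT.
move=> PP; have iz := rv_itg rz PP.
have E0 : Ex P z = 0.
  apply: le_anti; apply/andP; split; last first.
    by rewrite -(Ex_cst P 0); apply: Ex_le => //; exact: itg_cst.
  by apply/ler_addgt0Pr => e e0; rewrite add0r; exact: H.
have : (\int[P]_w `|(z w)%:E| = 0)%E.
  under eq_integral => w _ do rewrite /= ger0_norm//.
  by rewrite ExE// E0.
have mz' : measurable_fun setT (EFin \o z) by apply/measurable_EFinP; exact: rv_meas rz.
move=> /(ae_eq_integral_abs P measurableT mz')[M [mM M0 HM]].
apply/eqP; rewrite eq_le measure_ge0 andbT -M0; apply: le_measure; rewrite ?inE//.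
move=> w /= zw; apply: HM => /= /(_ I) [] h; exact: zw.
Qed.

Lemma half_sum n : \sum_(i < n) (2^-1) ^+ i <= 2 :> R.
Proof.
have : \sum_(i < n) (2^-1) ^+ i = 2 - 2 * (2^-1) ^+ n :> R.
  elim: n => [|n IH]; first by rewrite big_ord0 expr0; lra.
  by rewrite big_ord_recr /= IH exprS; field.
by move=> ->; rewrite gerBl mulr_ge0// exprn_ge0.
Qed.

Lemma rv_sum n (f : nat -> Omega R -> R) : (forall i, rv (f i)) -> rv (fun w => \sum_(i < n) f i w).
Proof.
move=> rf; elim: n => [|n IH].
  by under eq_fun do rewrite big_ord0; exact: rv_cst.
by under eq_fun do rewrite big_ord_recr; apply: rvD.
Qed.

Lemma summable_cvg0 (d : nat -> Omega R -> R) c : (forall n, rv (d n)) -> 0 <= c ->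
  (forall n, nle (d n) (c * (2^-1) ^+ n)) ->
  exists2 s, rv s & qs (fun w => (\sum_(i < n) `|d i w|) @[n --> \oo] --> s w /\
    forall n, \sum_(i < n) `|d i w| <= s w) /\ forall m, nle (fun w => s w - \sum_(i < m) `|d i w|) (2 * c * (2^-1) ^+ m).
Proof.
move=> rd c0 dc.
have rn n : rv (fun w => `|d n w|) by exact: rv_norm.
have rs n : rv (fun w => \sum_(i < n) `|d i w|) by exact: (@rv_sum n (fun i w => `|d i w|)).
have Es P n : PS P -> Ex P (fun w => \sum_(i < n) `|d i w|) <= c * 2.
  move=> PP; have [_ ->] := @Ex_sum _ _ _ P n (fun i w => `|d i w|) (fun i => rv_itg (rn i) PP).
  apply: le_trans (_ : \sum_(i < n) c * (2^-1) ^+ i <= _); first by apply: ler_sum => i _; exact: dc.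
  by rewrite -mulr_sumr ler_wpM2l// half_sum.
have inc : qs (fun w => forall n, \sum_(i < n) `|d i w| <= \sum_(i < n.+1) `|d i w|).
  by apply: qs_all => // w n; rewrite big_ord_recr /= lerDl.
have [s [ss sl su]] := monotone_limit rs inc (fun P n PP => Es P n PP).
exists s => //; split; first by apply: filterS2 sl su => w h1 h2.
move=> m P PP; have rB := rvB ss (rs m).
have -> : Ex P (fun w => `|s w - \sum_(i < m) `|d i w| |) = Ex P s - Ex P (fun w => \sum_(i < m) `|d i w|).
  rewrite -(E_B PP ss (rs m)); apply: (E_eq PP) => //; first exact: rv_norm.
  by apply: filterS su => w h; rewrite ger0_norm// subr_ge0.
have lim := dct PP rs ss (rv_norm ss) _ sl.
have {}lim := lim _; rewrite lerBlDr.
have H : (fun n => Ex P (fun w => \sum_(i < n) `|d i w|)) @ \oo --> Ex P s.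
  apply: lim; apply: filterS su => w h n; rewrite ger0_norm; last exact: sumr_ge0.
  exact: le_trans (h n) (ler_norm _).
apply: (cvgn_le H) => //; exists m => // n /= mn.
rewrite -(subnKC mn); move: (n - m)%N => k {n mn}.
have -> : Ex P (fun w => \sum_(i < m + k) `|d i w|) =
    Ex P (fun w => \sum_(i < m) `|d i w|) + \sum_(i < k) Ex P (fun w => `|d (m + i)%N w|).
  have [i2 E2] := @Ex_sum _ _ _ P k (fun i w => `|d (m + i)%N w|) (fun i => rv_itg (rn _) PP).
  rewrite -E2 -ExD//; last exact: rv_itg (rs m) PP.
  by congr Ex; apply/funext => w; rewrite big_split_ord.
rewrite addrC lerD2r.
apply: le_trans (_ : \sum_(i < k) (c * (2^-1) ^+ m) * (2^-1) ^+ i <= _).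
  by apply: ler_sum => i _; rewrite -mulrA -exprD; exact: dc.
by rewrite -mulr_sumr -mulrA (mulrC 2 c) -mulrA ler_wpM2l// mulrC ler_wpM2r ?exprn_ge0// half_sum.
Qed.

Lemma L1_cvg (x : nat -> Omega R -> R) y c : (forall n, rv (x n)) -> rv y -> 0 <= c ->
  (forall n, nle (fun w => x n w - y w) (c * (2^-1) ^+ n)) -> qs (fun w => x n w @[n --> \oo] --> y w).
Proof.
move=> rx ry c0 H; have [s rs [sl _]] := summable_cvg0 (fun n => rvB (rx n) ry) c0 H.
apply: filterS sl => w [sl sb].
have h0 : `|x n w - y w| @[n --> \oo] --> (0 : R).
  have h : cvgn (series (fun n => `|x n w - y w|)).
    apply/cvg_ex; exists (s w); rewrite /series /=.
    by under eq_fun do rewrite big_mkord.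
  exact: cvg_series_cvg_0 h.
have h1 : (x n w - y w) @[n --> \oo] --> (0 : R) by apply/norm_cvg0P.
have := cvgD h1 (cvg_cst (y w)); rewrite add0r => h2.
rewrite (_ : (fun n => x n w) = (fun n => x n w - y w) + (fun=> y w)); first exact: h2.
by apply/funext => n; rewrite !fctE subrK.
Qed.

(** Completeness, with one limit valid under all measures and attained both q.s. and in norm. *)
Lemma L1_complete (x : nat -> Omega R -> R) c : (forall n, rv (x n)) -> 0 <= c ->
  (forall n, nle (fun w => x n.+1 w - x n w) (c * (2^-1) ^+ n)) ->
  exists y, [/\ rv y, qs (fun w => x n w @[n --> \oo] --> y w) &
    forall n, nle (fun w => x n w - y w) (2 * c * (2^-1) ^+ n)].
Proof.
move=> rx c0 H.
pose d n w := x n.+1 w - x n w.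
have rd n : rv (d n) by exact: rvB.
have [s rs [sl sE]] := summable_cvg0 rd c0 H.
have rsum n : rv (fun w => \sum_(i < n) `|d i w|) by apply: (@rv_sum n (fun i w => `|d i w|)) => i; exact: rv_norm.
(* Adding the sums of the absolute increments makes the sequence increasing, so [monotone_limit]
   applies; the limit of these sums is subtracted again afterwards. *)
pose p n w := x n w - x 0%N w + \sum_(i < n) `|d i w|.
have rp n : rv (p n) by apply: rvD => //; exact: rvB.
have pd n w : p n.+1 w - p n w = d n w + `|d n w|.
  by rewrite /p big_ord_recr /= /d; ring.
have dist n w : `|x n w - x 0%N w| <= \sum_(i < n) `|d i w|.
  elim: n => [|n IH]; first by rewrite subrr normr0 big_ord0.
  rewrite big_ord_recr /= addrC; apply: le_trans (ler_distD (x n w) _ _) _.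
  by rewrite lerD.
have [cs cs0 Hcs] := rv_bound rs.
have [q [rq ql qu]] : exists q, [/\ rv q, qs (fun w => p n w @[n --> \oo] --> q w) &
    qs (fun w => forall n, p n w <= q w)].
  apply: (monotone_limit rp (c := 2 * cs)).
    apply: qs_all => // w n; rewrite -subr_ge0 pd.
    by have := ler_norm (- d n w); rewrite normrN; lra.
  move=> P n PP; apply: le_trans (_ : Ex P (fun w => 2 * `|s w|) <= _); last first.
    rewrite ExZ; last exact: rv_itg (rv_norm rs) PP.
    by rewrite ler_wpM2l// Hcs.
  apply: (E_le PP) => //; first by apply: rvZ; exact: rv_norm.
  apply: filterS sl => w [_ sb]; have := dist n w; have := sb n; have := ler_norm (s w).
  by have := ler_norm (x n w - x 0%N w); rewrite /p; lra.
pose y w := x 0%N w + (q w - s w).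
have ry : rv y by apply: rvD => //; exact: rvB.
have cv : qs (fun w => x n w @[n --> \oo] --> y w).
  apply: filterS2 ql sl => w h1 [h2 _].
  have := cvgD (cvg_cst (x 0%N w)) (cvgB h1 h2).
  rewrite (_ : _ + _ = (fun n => x n w)); first exact.
  by apply/funext => n; rewrite /cst !fctE /p; ring.
exists y; split=> // n.
apply: (nle_le (y := fun w => s w - \sum_(i < n) `|d i w|)) (sE n); [exact: rvB..|].
apply: filterS2 cv sl => w h1 [h2 sb].
rewrite [leRHS]ger0_norm ?subr_ge0//.
have h3 : `|x n w - x m w| @[m --> \oo] --> `|x n w - y w|.
  by apply: cvg_norm; apply: cvgB => //; exact: cvg_cst.
apply: (cvgn_le h3) => //; exists n => // m /= nm.
rewrite lerBrDl; apply: le_trans (sb m); rewrite -(subnKC nm); move: (m - n)%N => k {m nm}.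
elim: k => [|k IH]; first by rewrite addn0 subrr normr0 addr0.
rewrite addnS big_ord_recr /=; apply: le_trans (lerD IH (lexx _)).
rewrite -addrA lerD2l /d; apply: le_trans (ler_distD (x (n + k)%N w) _ _) _.
by rewrite lerD2l distrC.
Qed.

(* The spaces $L_G^1$, $L_G^{1^*}$, $L_G^{1^*_*}$ and $\bar L_G^{1^*_*}$ over $\Omega_t$ for real-valued
   random variables. *)
Definition G1 (t : \bar R) x := rv x /\
  forall e, 0 < e -> exists2 Phi, cyl t Phi & nle (fun w => Phi (pv w) - x w) e.

Definition Gs (t : \bar R) x := rv x /\ exists xi : nat -> Omega R -> R,
  (forall k, G1 t (xi k)) /\
  qs (fun w => (forall k, xi k.+1 w <= xi k w) /\ xi k w @[k --> \oo] --> x w).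

Definition Gss (t : \bar R) x := rv x /\ exists xi : nat -> Omega R -> R,
  (forall k, Gs t (xi k)) /\
  qs (fun w => (forall k, xi k w <= xi k.+1 w) /\ xi k w @[k --> \oo] --> x w).

Definition Gb (t : \bar R) x := rv x /\
  forall e, 0 < e -> exists2 y, Gss t y & nle (fun w => y w - x w) e.

(** * Stability of the approximation classes *)

Section Approx.
Variables (t : \bar R).
Hypothesis t0 : (0 <= t)%E.

Lemma G1_rv x : G1 t x -> rv x. Proof. by case. Qed.
Lemma Gs_rv x : Gs t x -> rv x. Proof. by case. Qed.
Lemma Gss_rv x : Gss t x -> rv x. Proof. by case. Qed.

Lemma nle0 c : 0 <= c -> nle (fun=> 0) c.
Proof. by move=> c0 P _; under [X in Ex _ X]eq_fun do rewrite normr0; rewrite Ex_cst. Qed.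

Lemma G1_cyl Phi : cyl t Phi -> G1 t (fun w => Phi (pv w)).
Proof.
move=> c; split; first exact: rv_cyl c.
move=> e e0; exists Phi => //; under eq_fun do rewrite subrr; exact/nle0/ltW.
Qed.

Lemma G1_cst c : G1 t (fun=> c).
Proof. exact: G1_cyl (cyl_cst _ c). Qed.

Lemma G1_lim x : rv x ->
  (forall e, 0 < e -> exists2 y, G1 t y & nle (fun w => y w - x w) e) -> G1 t x.
Proof.
move=> rx H; split=> // e e0; have e2 : 0 < e / 2 by rewrite divr_gt0.
have [y [ry Hy] yx] := H _ e2; have [Phi c1 h1] := Hy _ e2; exists Phi => //.
by rewrite [e]splitr; apply: nle_tri h1 yx => //; exact: rv_cyl c1.
Qed.

Lemma G1_lip2 (op : R -> R -> R) x y : (forall Phi Psi, cyl t Phi -> cyl t Psi -> cyl t (fun g => op (Phi g) (Psi g))) ->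
  (forall x y, rv x -> rv y -> rv (fun w => op (x w) (y w))) ->
  (forall a b c d, `|op a b - op c d| <= `|a - c| + `|b - d|) ->
  G1 t x -> G1 t y -> G1 t (fun w => op (x w) (y w)).
Proof.
move=> Hc Hr Hop [rx Hx] [ry Hy]; split; first exact: Hr.
move=> e e0; have e2 : 0 < e / 2 by rewrite divr_gt0.
have [Phi c1 h1] := Hx _ e2; have [Psi c2 h2] := Hy _ e2.
exists (fun g => op (Phi g) (Psi g)); first exact: Hc.
have r1 := rvB (rv_cyl c1) rx; have r2 := rvB (rv_cyl c2) ry.
have := nleD (rv_norm r1) (rv_norm r2) (c := e / 2) (d := e / 2).
rewrite -splitr => h3.
apply: (nle_le (y := fun w => `|Phi (pv w) - x w| + `|Psi (pv w) - y w|)).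
- by apply: rvB; apply: Hr => //; [exact: rv_cyl c1|exact: rv_cyl c2].
- by apply: rvD; exact: rv_norm.
- by apply: qs_all => w; rewrite [leRHS]ger0_norm ?addr_ge0.
by apply: h3 => P PP; under [X in Ex _ X]eq_fun do rewrite normr_id; [exact: h1|exact: h2].
Qed.

Lemma G1D x y : G1 t x -> G1 t y -> G1 t (fun w => x w + y w).
Proof.
apply: (@G1_lip2 (fun a b => a + b)) => [Phi Psi|u v|a b c d]; [exact: cylD|exact: rvD|].
by rewrite opprD addrACA ler_normD.
Qed.

Lemma G1B x y : G1 t x -> G1 t y -> G1 t (fun w => x w - y w).
Proof.
apply: (@G1_lip2 (fun a b => a - b)) => [Phi Psi|u v|a b c d]; [exact: cylB|exact: rvB|].
by rewrite (_ : _ - _ = (a - c) - (b - d)) ?ler_normB//; ring.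
Qed.

Lemma maxr_dist (a b c d : R) : `|Num.max a b - Num.max c d| <= `|a - c| + `|b - d|.
Proof.
have h1 := ler_norm (a - c); have h2 := ler_norm (b - d).
have := ler_norm (- (a - c)); have := ler_norm (- (b - d)); rewrite !normrN => h3 h4.
by rewrite ler_norml; case: (leP a b); case: (leP c d) => *; apply/andP; split; lra.
Qed.

Lemma G1_max x y : G1 t x -> G1 t y -> G1 t (fun w => Num.max (x w) (y w)).
Proof.
apply: (@G1_lip2 (fun a b => Num.max a b)) => [Phi Psi|u v|a b c d]; [exact: cyl_max|exact: rv_max|].
exact: maxr_dist.
Qed.

Lemma G1Z c x : G1 t x -> G1 t (fun w => c * x w).
Proof.
move=> [rx Hx]; split; first exact: rvZ.
move=> e e0; have c1 : 0 < `|c| + 1 by rewrite ltr_wpDl.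
have [Phi cPhi h] := Hx (e / (`|c| + 1)) (divr_gt0 e0 c1).
exists (fun g => c * Phi g); first exact: cylZ.
move=> P PP; under [X in Ex _ X]eq_fun do rewrite -mulrBr normrM.
rewrite ExZ; last by apply: rv_itg PP; apply/rv_norm/rvB => //; exact: rv_cyl cPhi.
apply: le_trans (ler_wpM2l (normr_ge0 c) (h P PP)) _.
rewrite mulrA ler_pdivrMr// mulrC ler_wpM2l ?(ltW e0)// lerDl//.
Qed.

Lemma G1N x : G1 t x -> G1 t (fun w => - x w).
Proof. by move=> /(G1Z (-1)); under eq_fun do rewrite mulN1r. Qed.

Lemma G1_norm x : G1 t x -> G1 t (fun w => `|x w|).
Proof.
move=> Gx; have := G1_max Gx (G1N Gx); congr (G1 t _).
by apply/funext => w; case: (leP 0 (x w)) => h; [rewrite max_l ?ger0_norm//|rewrite max_r ?ltr0_norm//]; lra.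
Qed.

Lemma G1_mul x y K : G1 t x -> G1 t y -> (forall w, `|y w| <= K) -> G1 t (fun w => y w * x w).
Proof.
move=> [rx Hx] [ry Hy] yK; have K0 : 0 <= K := le_trans (normr_ge0 _) (yK point).
have my := rv_meas ry; split; first exact: (rv_mul rx my yK).
move=> e e0; have e2 : 0 < e / 2 by rewrite divr_gt0.
have K1 : 0 < K + 1 by rewrite ltr_wpDl.
have [Phi c1 h1] := Hx _ (divr_gt0 e2 K1); have [C C0 HC] := cyl_bounded c1.
have C1 : 0 < C + 1 by rewrite ltr_wpDl.
(* Phi comes first: the error of Psi is multiplied by Phi, so its size is chosen relative to the
   bound of Phi, while the error of Phi is multiplied by y itself, which K bounds. *)
have [Psi c2 h2] := Hy _ (divr_gt0 e2 C1).
have r1 := rvB (rv_cyl c1) rx; have r2 := rvB (rv_cyl c2) ry.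
exists (fun g => Psi g * Phi g); first exact: cylM.
rewrite [e]splitr => P PP.
have h : Ex P (fun w => `|Psi (pv w) * Phi (pv w) - y w * x w|) <=
    Ex P (fun w => C * `|Psi (pv w) - y w| + K * `|Phi (pv w) - x w|).
  apply: E_le => //.
  - by apply/rv_norm/rvB; [exact: rv_cyl (cylM c2 c1)|exact: rv_mul rx my yK].
  - by apply: rvD; apply: rvZ; exact: rv_norm.
  apply: qs_all => w.
  rewrite (_ : _ - _ = Phi (pv w) * (Psi (pv w) - y w) + y w * (Phi (pv w) - x w)); last by ring.
  apply: le_trans (ler_normD _ _) _; rewrite !normrM lerD// ler_wpM2r//.
apply: le_trans h _; rewrite (E_D PP); [|exact/rvZ/rv_norm..].
rewrite !ExZ; [|exact: rv_itg (rv_norm _) PP..].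
have scale (c d : R) : 0 <= c -> d <= e / 2 / (c + 1) -> c * d <= e / 2.
  move=> c0 /(ler_wpM2l c0) h'; apply: le_trans h' _; have c1' : 0 < c + 1 by rewrite ltr_wpDl.
  by rewrite mulrA ler_pdivrMr// mulrC ler_wpM2l ?(ltW e2)// lerDl.
by apply: lerD; apply: scale => //; [exact: h2|exact: h1].
Qed.

Lemma G1_adp x : G1 t x -> adp t x.
Proof.
move=> [rx Hx]; have H n : exists Phi, cyl t Phi /\ nle (fun w => Phi (pv w) - x w) (1 * 2^-1 ^+ n).
  by have [|Phi ? ?] := Hx (1 * 2^-1 ^+ n); [rewrite mul1r exprn_gt0//|exists Phi].
pose f n := sval (cid (H n)); have Hf n : cyl t (f n) /\ nle (fun w => f n (pv w) - x w) (1 * 2^-1 ^+ n).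
  by rewrite /f; case: cid.
apply: (adp_lim (x := fun n w => f n (pv w))).
  by move=> n; apply: adp_cyl => //; exact: (Hf n).1.
by apply: (L1_cvg (c := 1)) => // n; [exact: rv_cyl (Hf n).1|exact: (Hf n).2].
Qed.

Lemma Gs_adp x : Gs t x -> adp t x.
Proof.
move=> [_ [xi [Gxi H]]]; apply: (adp_lim (x := xi)); first by move=> n; exact: G1_adp.
by apply: filterS H => w [].
Qed.

Lemma Gss_adp x : Gss t x -> adp t x.
Proof.
move=> [_ [xi [Gxi H]]]; apply: (adp_lim (x := xi)); first by move=> n; exact: Gs_adp.
by apply: filterS H => w [].
Qed.

Lemma Gb_adp x : Gb t x -> adp t x.
Proof.
move=> [rx Hx]; have H n : exists y, Gss t y /\ nle (fun w => y w - x w) (1 * 2^-1 ^+ n).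
  by have [|y ? ?] := Hx (1 * 2^-1 ^+ n); [rewrite mul1r exprn_gt0//|exists y].
pose f n := sval (cid (H n)); have Hf n : Gss t (f n) /\ nle (fun w => f n w - x w) (1 * 2^-1 ^+ n).
  by rewrite /f; case: cid.
apply: (adp_lim (x := f)).
  by move=> n; apply: Gss_adp => //; exact: (Hf n).1.
by apply: (L1_cvg (c := 1)) => // n; [exact: Gss_rv (Hf n).1|exact: (Hf n).2].
Qed.

Lemma G1_Gs x : G1 t x -> Gs t x.
Proof.
move=> Gx; split; first exact: G1_rv.
by exists (fun=> x); split=> //; apply: qs_all => w; split=> //; exact: cvg_cst.
Qed.

Lemma Gs_Gss x : Gs t x -> Gss t x.
Proof.
move=> Gx; split; first exact: Gs_rv.
by exists (fun=> x); split=> //; apply: qs_all => w; split=> //; exact: cvg_cst.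
Qed.

Lemma Gss_Gb x : Gss t x -> Gb t x.
Proof.
move=> Gx; split; first exact: Gss_rv.
by move=> e e0; exists x => //; under eq_fun do rewrite subrr; exact/nle0/ltW.
Qed.

Lemma cvgnD (u v : nat -> R) a b : u n @[n --> \oo] --> a -> v n @[n --> \oo] --> b ->
  u n + v n @[n --> \oo] --> a + b.
Proof. exact: cvgD. Qed.

Lemma GsD x y : Gs t x -> Gs t y -> Gs t (fun w => x w + y w).
Proof.
move=> [rx [xi [Gxi Hx]]] [ry [yi [Gyi Hy]]]; split; first exact: rvD.
exists (fun k w => xi k w + yi k w); split=> [k|]; first exact: G1D.
by apply: filterS2 Hx Hy => w [h1 h2] [h3 h4]; split=> [k|]; [exact: lerD|exact: cvgnD].
Qed.

Lemma GssD x y : Gss t x -> Gss t y -> Gss t (fun w => x w + y w).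
Proof.
move=> [rx [xi [Gxi Hx]]] [ry [yi [Gyi Hy]]]; split; first exact: rvD.
exists (fun k w => xi k w + yi k w); split=> [k|]; first exact: GsD.
by apply: filterS2 Hx Hy => w [h1 h2] [h3 h4]; split=> [k|]; [exact: lerD|exact: cvgnD].
Qed.

Lemma cvgn_max (u : nat -> R) a c : u n @[n --> \oo] --> a ->
  Num.max (u n) c @[n --> \oo] --> Num.max a c.
Proof.
move=> ua; have h : {for a, continuous ((id : R -> R^o) \max (cst c : R -> R^o))}.
  by apply: continuous_max; [exact: cvg_id|exact: cvg_cst].
exact: cvg_comp ua h.
Qed.

(** Truncation to [0, 1], written as -max(-max(xi, 0), -1), keeps the sequence decreasing and within
    L_G^1. *)
Lemma Gs_unit x : Gs t x -> (forall w, 0 <= x w <= 1) -> exists2 xi : nat -> Omega R -> R,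
  forall k, G1 t (xi k) /\ (forall w, 0 <= xi k w <= 1) &
  qs (fun w => (forall k, xi k.+1 w <= xi k w) /\ xi k w @[k --> \oo] --> x w).
Proof.
move=> [rx [xi [Gxi H]]] x01; exists (fun k w => - Num.max (- Num.max (xi k w) 0) (- 1)).
  move=> k; split; first by apply/G1N/G1_max; [apply/G1N/G1_max => //|]; exact: G1_cst.
  by move=> w; case: (leP (xi k w) 0) => h; case: (leP _ (-1)) => h'; apply/andP; split; lra.
apply: filterS H => w [h1 h2]; split=> [k|].
  have := h1 k; case: (leP (xi k w) 0) => a; case: (leP (xi k.+1 w) 0) => b;
  repeat case: (leP _ (-1)) => ?; lra.
have := x01 w; move=> /andP[x0 x1].
rewrite [x in _ --> x](_ : x w = - Num.max (- Num.max (x w) 0) (- 1)); last first.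
  by rewrite (max_l x0) max_l ?opprK// lerN2.
by apply: cvgN; apply: cvgn_max; apply: cvgN; exact: cvgn_max.
Qed.

Lemma Gs_mul x y : G1 t x -> (forall w, 0 <= x w) -> Gs t y -> (forall w, 0 <= y w <= 1) ->
  Gs t (fun w => y w * x w).
Proof.
move=> Gx x0 Gy y01; have [xi Gxi H] := Gs_unit Gy y01.
have b (z : Omega R -> R) w : (forall w, 0 <= z w <= 1) -> `|z w| <= 1.
  by move=> /(_ w)/andP[? ?]; rewrite ger0_norm.
split; first by apply: (rv_mul (K := 1)) (G1_rv Gx) (rv_meas (Gs_rv Gy)) _ => w; exact: b.
exists (fun k w => xi k w * x w); split=> [k|].
  by apply: (G1_mul (K := 1)) => //; [exact: (Gxi k).1|move=> w; apply: b; exact: (Gxi k).2].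
apply: filterS H => w [h1 h2]; split=> [k|]; first by rewrite ler_wpM2r.
by apply: cvgM => //; exact: cvg_cst.
Qed.

(** Multiplication by -x reverses the monotonicity of the approximations of y, so the product is an
    increasing limit, one class further out than in [Gs_mul]. *)
Lemma Gss_mulN x y : G1 t x -> (forall w, 0 <= x w) -> Gs t y -> (forall w, 0 <= y w <= 1) ->
  Gss t (fun w => - (y w * x w)).
Proof.
move=> Gx x0 Gy y01; have [xi Gxi H] := Gs_unit Gy y01.
have b (z : Omega R -> R) w : (forall w, 0 <= z w <= 1) -> `|z w| <= 1.
  by move=> /(_ w)/andP[? ?]; rewrite ger0_norm.
split; first by apply: rvN; apply: (rv_mul (K := 1)) (G1_rv Gx) (rv_meas (Gs_rv Gy)) _ => w; exact: b.
exists (fun k w => - (xi k w * x w)); split=> [k|].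
  by apply/G1_Gs/G1N; apply: (G1_mul (K := 1)) => //; [exact: (Gxi k).1|move=> w; apply: b; exact: (Gxi k).2].
apply: filterS H => w [h1 h2]; split=> [k|]; first by rewrite lerN2 ler_wpM2r.
by apply: cvgN; apply: cvgM => //; exact: cvg_cst.
Qed.

(* $xI = x^+I - x^-I$ with both terms in the class. *)
Lemma Gss_ind x y : G1 t x -> Gs t y -> (forall w, 0 <= y w <= 1) -> Gss t (fun w => y w * x w).
Proof.
move=> Gx Gy y01; pose a w := Num.max (x w) 0; pose b w := Num.max (- x w) 0.
have Ga : G1 t a by apply: G1_max => //; exact: G1_cst.
have Gb' : G1 t b by apply: G1_max; [exact: G1N|exact: G1_cst].
have := GssD (Gs_Gss (Gs_mul Ga (fun w => _) Gy y01)) (Gss_mulN Gb' (fun w => _) Gy y01).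
rewrite (_ : (fun w => y w * x w) = (fun w => y w * a w + - (y w * b w))).
  by apply=> w; rewrite le_max lexx orbT.
apply/funext => w; rewrite -mulrBr; congr *%R; rewrite /a /b.
by case: (leP (x w) 0) => h; case: (leP (- x w) 0) => h'; lra.
Qed.

End Approx.

Lemma G1_le (t t' : \bar R) x : (t <= t')%E -> G1 t x -> G1 t' x.
Proof.
move=> tt [rx H]; split=> // e e0; have [Phi c h] := H e e0.
by exists Phi => //; exact: cyl_le tt c.
Qed.

Lemma Gs_le (t t' : \bar R) x : (t <= t')%E -> Gs t x -> Gs t' x.
Proof.
by move=> tt [rx [xi [Gxi H]]]; split=> //; exists xi; split=> // k; exact: G1_le tt (Gxi k).
Qed.

Lemma Gss_le (t t' : \bar R) x : (t <= t')%E -> Gss t x -> Gss t' x.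
Proof.
by move=> tt [rx [xi [Gxi H]]]; split=> //; exists xi; split=> // k; exact: Gs_le tt (Gxi k).
Qed.

(** * Conditional expectation through upper bounds and near attainment *)

Definition past (t : R) (B : set (Omega R)) := @stop R t%:E @^-1` B.

(* [y] is a version of $\hat{\mathbb E}_t[x]$: the two clauses say that $E^P[x|F_t]\le y$ for every
   [P] and that the bound is nearly attained within $\mathcal P(t,P)$. *)
Definition GC (t : R) x y := [/\ rv x, rv y, adp t%:E y,
  forall P B, PS P -> measurable B ->
    Ex P (fun w => \1_(past t B) w * x w) <= Ex P (fun w => \1_(past t B) w * y w) &
  forall P e, PS P -> 0 < e -> exists2 Q, Pset_from slo shi t%:E P Q & Ex P y - e <= Ex Q x].

Lemma past_measurable t B : measurable B -> measurable (past t B).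
Proof. exact: preim_stop. Qed.

Lemma pastC t B : past t (~` B) = ~` past t B.
Proof. by []. Qed.

Lemma rv_past t B x : rv x -> measurable B -> rv (fun w => \1_(past t B) w * x w).
Proof. by move=> rx mB; apply: rv_ind => //; exact: past_measurable. Qed.

Lemma past_split P t B x : PS P -> rv x -> measurable B ->
  Ex P (fun w => \1_(past t B) w * x w) + Ex P (fun w => \1_(past t (~` B)) w * x w) = Ex P x.
Proof.
move=> PP rx mB; rewrite -(E_D PP); [|exact: rv_past|by apply: rv_past => //; exact: measurableC].
congr Ex; apply/funext => w; rewrite pastC !indicE in_setC.
by case: (w \in _); rewrite /= ?mul1r ?mul0r ?addr0 ?add0r.
Qed.

Lemma past_cst P (x : Omega R -> R) t : Ex P (fun w => \1_(past t setT) w * x w) = Ex P x.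
Proof. by congr Ex; apply/funext => w; rewrite /past preimage_setT indicT mul1r. Qed.

Lemma past_le P t B x c : PS P -> rv x -> measurable B -> nle x c ->
  Ex P (fun w => \1_(past t B) w * x w) <= c.
Proof.
move=> PP rx mB xc; apply: le_trans (xc P PP); apply: E_le => //; [exact: rv_past|exact: rv_norm|].
apply: qs_all => w; rewrite indicE; case: (w \in _); rewrite ?mul1r ?mul0r//; exact: ler_norm.
Qed.

Section FixedTime.
Variable t : R.
Hypothesis t0 : 0 <= t.
Let t0E : (0 <= t%:E)%E. Proof. by rewrite lee_fin. Qed.

Lemma from_PS P Q : Pset_from slo shi t%:E P Q -> PS Q.
Proof. by case. Qed.

Lemma from_refl P : PS P -> Pset_from slo shi t%:E P P.
Proof. by split. Qed.

Lemma from_adp P Q y : PS P -> Pset_from slo shi t%:E P Q -> rv y -> adp t%:E y -> Ex Q y = Ex P y.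
Proof.
move=> PP PQ ry [f mf yf]; have PQ' := from_PS PQ.
have rf : rv (fun w => f (stop t%:E w)).
  apply: (rv_eq ry _ yf); apply: measurableT_comp => //; exact: measurable_stop.
rewrite (E_eq PQ' ry rf yf) (E_eq PP ry rf yf).
by apply: (Pset_from_int t0E PQ) => //; exact: rv_itg rf _.
Qed.

Lemma adp_past B y : adp t%:E y -> measurable B -> adp t%:E (fun w => \1_(past t B) w * y w).
Proof.
move=> ay mB; apply: adpM => //.
by exists (\1_B) => //; exact: qs_all.
Qed.

Lemma from_past P Q B y : PS P -> Pset_from slo shi t%:E P Q -> rv y -> adp t%:E y -> measurable B ->
  Ex Q (fun w => \1_(past t B) w * y w) = Ex P (fun w => \1_(past t B) w * y w).
Proof. by move=> PP PQ ry ay mB; apply: from_adp => //; [exact: rv_past|exact: adp_past]. Qed.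

Lemma GC_rvl x y : GC t x y -> rv x. Proof. by case. Qed.
Lemma GC_rvr x y : GC t x y -> rv y. Proof. by case. Qed.
Lemma GC_adp x y : GC t x y -> adp t%:E y. Proof. by case. Qed.
Lemma GC_past P x y B : GC t x y -> PS P -> measurable B ->
  Ex P (fun w => \1_(past t B) w * x w) <= Ex P (fun w => \1_(past t B) w * y w).
Proof. by case=> _ _ _ H _; exact: H. Qed.

Lemma GC_E P x y : GC t x y -> PS P -> Ex P x <= Ex P y.
Proof. by move=> G PP; have := GC_past G PP measurableT; rewrite !past_cst. Qed.

Lemma GC_attain P x y e : GC t x y -> PS P -> 0 < e -> exists2 Q, Pset_from slo shi t%:E P Q &
  forall B, measurable B ->
    Ex P (fun w => \1_(past t B) w * y w) - e <= Ex Q (fun w => \1_(past t B) w * x w).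
Proof.
move=> G PP e0; have [rx ry ay H1 H2] := G; have [Q PQ HQ] := H2 P e PP e0; exists Q => // B mB.
have PQ' := from_PS PQ; have mC := measurableC mB.
have := H1 Q _ PQ' mC; rewrite (@from_past P Q _ y)// => h.
have := past_split t PP ry mB; have := past_split t PQ' rx mB; lra.
Qed.

(** Source of monotonicity and of the contraction estimate: over an event of F_t, a difference of
    conditional expectations is controlled by the worst expectation of the difference. *)
Lemma GC_cmp P x y x' y' B c : GC t x y -> GC t x' y' -> PS P -> measurable B ->
  (forall Q, PS Q -> Ex Q (fun w => \1_(past t B) w * (x w - x' w)) <= c) ->
  Ex P (fun w => \1_(past t B) w * (y w - y' w)) <= c.
Proof.
move=> G G' PP mB H; apply/ler_addgt0Pr => e e0.
have [Q PQ HQ] := GC_attain G PP e0; have PQ' := from_PS PQ.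
have [rx ry ay _ _] := G; have [rx' ry' ay' H1 _] := G'.
have D P' (u v : Omega R -> R) : PS P' -> rv u -> rv v -> Ex P' (fun w => \1_(past t B) w * (u w - v w)) =
    Ex P' (fun w => \1_(past t B) w * u w) - Ex P' (fun w => \1_(past t B) w * v w).
  move=> PP' ru rv'; rewrite -(E_B PP'); [|exact: rv_past|exact: rv_past].
  by congr Ex; apply/funext => w; rewrite mulrBr.
have := H Q PQ'; rewrite !D//; have := HQ B mB; have := H1 Q B PQ' mB; rewrite (@from_past P Q _ y')//.
lra.
Qed.

(** Testing integrals on {y' < y}, an event of F_t up to q.s. equality, turns inequalities between
    integrals into q.s. inequalities. *)
Lemma adp_gt y y' : adp t%:E y -> adp t%:E y' -> exists2 B, measurable B &
  qs (fun w => \1_(past t B) w = (y' w < y w)%R%:R :> R).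
Proof.
move=> [f mf yf] [f' mf' yf']; exists ((fun w => f w - f' w) @^-1` `]0, +oo[).
  by rewrite -[X in measurable X]setTI; apply: (measurable_funB mf mf').
apply: filterS2 yf yf' => w -> ->; rewrite indicE /past; congr (_%:R); apply: congr1.
by apply/idP/idP; rewrite inE /= in_itv /= andbT subr_gt0.
Qed.

Lemma GC_le x y x' y' : GC t x y -> GC t x' y' -> qs (fun w => x w <= x' w) ->
  qs (fun w => y w <= y' w).
Proof.
move=> G G' xx; have [rx ry ay _ _] := G; have [rx' ry' ay' _ _] := G'.
have [B mB HB] := adp_gt ay ay'.
have rz : rv (fun w => Num.max (y w - y' w) 0) by apply: rv_max; [exact: rvB|exact: rv_cst].
have : qs (fun w => Num.max (y w - y' w) 0 = 0).
  apply: qs_zero => // [w|P e PP e0]; first by rewrite le_max lexx orbT.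
  apply: le_trans (ltW e0); rewrite (E_eq PP rz (rv_past t (rvB ry ry') mB)).
    apply: (GC_cmp G G') => // Q PQ; rewrite -[leRHS](Ex_cst Q); apply: E_le => //.
    - by apply: rv_past => //; exact: rvB.
    - exact: rv_cst.
    apply: filterS xx => w h; rewrite indicE; case: (w \in _); rewrite ?mul1r ?mul0r//; lra.
  apply: filterS HB => w ->; case: ltP => h; rewrite ?mul1r ?mul0r; [rewrite max_l//|rewrite max_r//]; lra.
by apply: filterS => w h; have : y w - y' w <= 0; [rewrite -h le_max lexx|lra].
Qed.

(** The factor 2 comes from bounding the parts {y > y'} and {y <= y'} separately. *)
Lemma GC_contr x y x' y' c : GC t x y -> GC t x' y' -> nle (fun w => x w - x' w) c ->
  nle (fun w => y w - y' w) (2 * c).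
Proof.
move=> G G' xx P PP; have [rx ry ay _ _] := G; have [rx' ry' ay' _ _] := G'.
have [B mB HB] := adp_gt ay ay'; have mC := measurableC mB.
have h1 : Ex P (fun w => \1_(past t B) w * (y w - y' w)) <= c.
  by apply: (GC_cmp G G') => // Q PQ; apply: past_le => //; exact: rvB.
have h2 : Ex P (fun w => \1_(past t (~` B)) w * (y' w - y w)) <= c.
  apply: (GC_cmp G' G) => // Q PQ; apply: past_le => //; [exact: rvB|exact: nle_sym].
rewrite mulr_natl mulr2n; apply: le_trans (lerD h1 h2).
have r1 := rv_past t (rvB ry ry') mB; have r2 := rv_past t (rvB ry' ry) mC.
rewrite -(E_D PP r1 r2); apply: E_le => //; [exact/rv_norm/rvB|exact: rvD|].
apply: filterS HB => w; rewrite pastC !indicE in_setC.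
case: (w \in past t B); case: ltP => h; rewrite /= ?mul1r ?mul0r ?addr0 ?add0r => /eqP.
- by rewrite gtr0_norm// subr_gt0.
- by rewrite oner_eq0.
- by rewrite eq_sym oner_eq0.
- by rewrite ler0_norm ?opprB// subr_le0.
Qed.

Lemma GC_id y : rv y -> adp t%:E y -> GC t y y.
Proof.
by move=> ry ay; split=> // P e PP e0; exists P; [exact: from_refl|rewrite gerBl ltW].
Qed.

Lemma GC_eq x y x' y' : GC t x y -> measurable_fun setT x' -> measurable_fun setT y' ->
  qs (fun w => x w = x' w) -> qs (fun w => y w = y' w) -> GC t x' y'.
Proof.
move=> [rx ry ay H1 H2] mx' my' xx yy; have rx' := rv_eq rx mx' xx; have ry' := rv_eq ry my' yy.
split=> //; first exact: adp_eq ay yy.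
  move=> P B PP mB; have := H1 P B PP mB.
  rewrite (E_eq PP (rv_past t rx mB) (rv_past t rx' mB)); last by apply: filterS xx => w ->.
  rewrite (E_eq PP (rv_past t ry mB) (rv_past t ry' mB)) //; by apply: filterS yy => w ->.
move=> P e PP e0; have [Q PQ HQ] := H2 P e PP e0; exists Q => //.
by rewrite -(E_eq PP ry ry' yy) -(E_eq (from_PS PQ) rx rx' xx).
Qed.

Lemma E_dist P x y c : PS P -> rv x -> rv y -> nle (fun w => x w - y w) c -> Ex P x <= Ex P y + c.
Proof.
move=> PP rx ry xy; rewrite addrC -lerBlDr -(E_B PP rx ry); apply: le_trans (ler_norm _) _.
by apply: le_trans (E_abs PP (rvB rx ry)) _; exact: xy.
Qed.

Lemma past_dist P x y B c : PS P -> rv x -> rv y -> measurable B -> nle (fun w => x w - y w) c ->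
  Ex P (fun w => \1_(past t B) w * x w) <= Ex P (fun w => \1_(past t B) w * y w) + c.
Proof.
move=> PP rx ry mB xy; rewrite addrC -lerBlDr -(E_B PP (rv_past t rx mB) (rv_past t ry mB)).
have := past_le t PP (rvB rx ry) mB xy; congr (_ <= _); congr Ex.
by apply/funext => w; rewrite mulrBr.
Qed.

(** Both clauses of [GC] are inequalities between expectations, so they survive norm limits of the
    two arguments. *)
Lemma GC_close x y : rv x -> rv y -> adp t%:E y ->
  (forall e, 0 < e -> exists x' y', [/\ GC t x' y', nle (fun w => x' w - x w) e &
     nle (fun w => y' w - y w) e]) -> GC t x y.
Proof.
move=> rx ry ay H; split=> //.
  move=> P B PP mB; apply/ler_addgt0Pr => e e0; have e2 : 0 < e / 2 by rewrite divr_gt0.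
  have [x' [y' [G xx yy]]] := H _ e2; have [rx' ry' _ H1 _] := G.
  have := past_dist PP rx rx' mB (nle_sym xx); have := past_dist PP ry' ry mB yy.
  have := H1 P B PP mB; lra.
move=> P e PP e0; have e2 : 0 < e / 4 by rewrite divr_gt0.
have [x' [y' [G xx yy]]] := H _ e2; have [rx' ry' _ _ H2] := G.
have [Q PQ HQ] := H2 P _ PP e2; exists Q => //.
have := E_dist PP ry ry' (nle_sym yy); have := E_dist (from_PS PQ) rx' rx xx; lra.
Qed.

(** By [GC_contr] the conditional expectations of approximations at distance 2^-n form a Cauchy
    sequence. *)
Lemma GC_lim x : rv x -> (forall e, 0 < e -> exists x' y', GC t x' y' /\ nle (fun w => x' w - x w) e) ->
  exists y, GC t x y.
Proof.
move=> rx H; have H' n : exists xy : (Omega R -> R) * (Omega R -> R), GC t xy.1 xy.2 /\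
    nle (fun w => xy.1 w - x w) (2^-1 ^+ n).
  by have [|x' [y' ?]] := H (2^-1 ^+ n); [rewrite exprn_gt0//|exists (x', y')].
pose f n := sval (cid (H' n)); have Gf n : GC t (f n).1 (f n).2 by rewrite /f; case: cid => ? [].
have nf n : nle (fun w => (f n).1 w - x w) (2^-1 ^+ n) by rewrite /f; case: cid => ? [].
have r1 n := GC_rvl (Gf n); have r2 n := GC_rvr (Gf n).
have step n : nle (fun w => (f n.+1).2 w - (f n).2 w) (4 * 2^-1 ^+ n).
  move=> P PP; apply: le_trans (_ : 2 * (2^-1 ^+ n.+1 + 2^-1 ^+ n) <= _).
    by apply: (GC_contr (Gf n.+1) (Gf n) _ PP); exact: nle_tri (r1 _) rx (r1 _) (nf _) (nle_sym (nf n)).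
  rewrite exprS; have := exprn_ge0 n (_ : 0 <= 2^-1 :> R); lra.
have [//|y [ry yl yn]] := L1_complete r2 _ step.
exists y; apply: GC_close => //.
  by apply: adp_lim yl => n; exact: GC_adp (Gf n).
move=> e e0; have : (fun n => 8 * 2^-1 ^+ n) @ \oo --> (8 * 0 : R).
  by apply: cvgM; [exact: cvg_cst|apply: cvg_expr; rewrite ger0_norm// invf_lt1// ltr1n].
rewrite mulr0 => /cvgrPdist_lt/(_ e e0)[N _ /(_ N (leqnn N))] /=; rewrite sub0r normrN => hN.
have hN' : 8 * 2^-1 ^+ N <= e by apply: le_trans (ltW hN); exact: ler_norm.
have p0 : 0 <= 2^-1 ^+ N :> R by exact: exprn_ge0.
exists (f N).1, (f N).2; split=> // P PP.
  apply: le_trans (nf N P PP) _; lra.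
apply: le_trans (yn N P PP) _; lra.
Qed.

(** The upper bound passes to the limit by dominated convergence; near attainment already holds at
    one large index n, because x n <= x0. *)
Lemma GC_up (x y : nat -> Omega R -> R) x0 : rv x0 -> (forall n, GC t (x n) (y n)) ->
  qs (fun w => (forall n, x n w <= x n.+1 w) /\ x n w @[n --> \oo] --> x0 w) ->
  exists y0, [/\ GC t x0 y0, qs (fun w => y n w @[n --> \oo] --> y0 w) &
    qs (fun w => forall n, y n w <= y0 w)].
Proof.
move=> rx0 G Hx; have rx n := GC_rvl (G n); have ry n := GC_rvr (G n).
have xi : qs (fun w => forall n, x n w <= x n.+1 w) by apply: filterS Hx => w [].
have xle : qs (fun w => forall n, x 0%N w <= x n w /\ x n w <= x0 w).
  apply: filterS Hx => w [h1 h2] n; have nd : {homo x^~ w : m n / (m <= n)%N >-> m <= n}.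
    by apply: homo_leq h1 => //; exact: le_trans.
  by split; [exact: nd|apply: (cvgn_ge h2); exists n => // m /= nm; exact: nd].
have yi : qs (fun w => forall n, y n w <= y n.+1 w).
  by apply: qs_forall => n; apply: (GC_le (G n) (G n.+1)); apply: filterS xi.
have [c c0 Hc] := rv_bound rx0.
have yb P n : PS P -> Ex P (y n) <= c + 1.
  move=> PP; have [_ _ _ _ H2] := G n; have [Q PQ HQ] := H2 P 1 PP ltr01.
  have PQ' := from_PS PQ; have : Ex Q (x n) <= Ex Q x0.
    by apply: E_le => //; apply: filterS xle => w /(_ n)[].
  have := E_abs PQ' rx0; have := Hc Q PQ'; have := ler_norm (Ex Q x0); lra.
have [y0 [ry0 yl yu]] := monotone_limit ry yi yb.
exists y0; split=> //; split=> //; first by apply: adp_lim yl => n; exact: GC_adp (G n).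
  move=> P B PP mB.
  have l1 : Ex P (fun w => \1_(past t B) w * x n w) @[n --> \oo] --> Ex P (fun w => \1_(past t B) w * x0 w).
    apply: (dct (g := fun w => `|x0 w| + `|x 0%N w|)) => //; [by move=> n; exact: rv_past|exact: rv_past|
      by apply: rvD; exact: rv_norm| |].
      apply: filterS xle => w h n; have [h1 h2] := h n; rewrite indicE.
      apply: le_trans (_ : `|x n w| <= _).
        by case: (w \in _); rewrite ?mul1r// mul0r normr0.
      have := ler_norm (x0 w); have := ler_norm (- x 0%N w); rewrite normrN => ? ?.
      have := normr_ge0 (x0 w); have := normr_ge0 (x 0%N w).
      by rewrite ler_norml => ? ?; apply/andP; split; lra.
    by apply: filterS Hx => w [_ h]; apply: cvgM => //; exact: cvg_cst.
  apply: (cvgn_le l1); exists 0%N => // n _ /=.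
  apply: le_trans (GC_past (G n) PP mB) _; apply: E_le => //; [exact: rv_past|exact: rv_past|].
  by apply: filterS yu => w h; apply: ler_wpM2l => //; rewrite indicE.
move=> P e PP e0; have e2 : 0 < e / 2 by rewrite divr_gt0.
have l2 : Ex P (y n) @[n --> \oo] --> Ex P y0.
  apply: (dct (g := fun w => `|y0 w| + `|y 0%N w|)) => //; first by apply: rvD; exact: rv_norm.
  apply: filterS2 yu yi => w h hi n.
  have : y 0%N w <= y n w by elim: n => // n IH; exact: le_trans IH (hi n).
  have := h n; have := ler_norm (y0 w); have := ler_norm (- y 0%N w); rewrite normrN => ? ? ? ?.
  have := normr_ge0 (y0 w); have := normr_ge0 (y 0%N w).
  by rewrite ler_norml => ? ?; apply/andP; split; lra.
move: l2 => /cvgrPdist_lt/(_ _ e2)[N _ /(_ N (leqnn N))] /= hN.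
have [_ _ _ _ H2] := G N; have [Q PQ HQ] := H2 P _ PP e2; exists Q => //.
have : Ex Q (x N) <= Ex Q x0.
  by apply: (E_le (from_PS PQ)) => //; apply: filterS xle => w /(_ N)[].
have := ler_norm (Ex P y0 - Ex P (y N)); lra.
Qed.

End FixedTime.

(** If Q lies in P(s, P), then P(t, Q) is contained in P(s, P), so near optimizers can be
    chained. *)
Lemma GC_tower s t x y z : 0 <= s -> s <= t -> GC t x y -> GC s y z -> GC s x z.
Proof.
move=> s0 st G G'; have [rx ry ay H1 H2] := G; have [_ rz az H1' H2'] := G'.
have t0 : 0 <= t by exact: le_trans st.
have pst B : past s B = past t (past s B).
  by apply/seteqP; split=> w; rewrite /past /= stop_stop ?lee_fin.
split=> // [P B PP mB|P e PP e0].
  by apply: le_trans (H1' P B PP mB); rewrite pst; apply: H1 => //; exact: past_measurable.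
have e2 : 0 < e / 2 by rewrite divr_gt0.
have [Q PQ HQ] := H2' P _ PP e2; have [Q' PQ' HQ'] := H2 Q _ (from_PS PQ) e2.
exists Q'; last by lra.
have s0E : (0 <= s%:E)%E by rewrite lee_fin.
have t0E : (0 <= t%:E)%E by rewrite lee_fin.
move/(Pset_fromP _ _ _ _ s0E): PQ => [_ h1]; move/(Pset_fromP _ _ _ _ t0E): PQ' => [h2 h3].
apply/(Pset_fromP _ _ _ _ s0E); split=> // Phi c; rewrite h3 ?h1//.
by apply: cyl_le c; rewrite lee_fin.
Qed.

(** The upper bound for y comes from a measure that nearly attains y and agrees with P on F_s; the
    attainment comes from E^Q[x] <= E^Q[y]. *)
Lemma GC_tower_inv s t x y z : 0 <= s -> s <= t -> GC s x z -> GC t x y -> GC s y z.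
Proof.
move=> s0 st G' G; have [rx ry ay H1 H2] := G; have [_ rz az H1' H2'] := G'.
have t0 : 0 <= t by exact: le_trans st.
have pst B : past s B = past t (past s B).
  by apply/seteqP; split=> w; rewrite /past /= stop_stop ?lee_fin.
have s0E : (0 <= s%:E)%E by rewrite lee_fin.
have t0E : (0 <= t%:E)%E by rewrite lee_fin.
split=> // [P B PP mB|P e PP e0].
  apply/ler_addgt0Pr => e e0; have [Q PQ HQ] := GC_attain t0 G PP e0.
  have := HQ _ (past_measurable s mB); rewrite -pst.
  have := H1' Q _ (from_PS PQ) mB; rewrite (@from_past s s0 P Q B z)//; first by lra.
  move/(Pset_fromP _ _ _ _ t0E): PQ => [h2 h3]; apply/(Pset_fromP _ _ _ _ s0E); split=> // Phi c.
  by rewrite h3//; apply: cyl_le c; rewrite lee_fin.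
have [Q PQ HQ] := H2' P _ PP e0; exists Q => //; apply: le_trans HQ _.
exact: GC_E G (from_PS PQ).
Qed.

Hypothesis slo0 : 0 <= slo.
Hypothesis sloshi : slo <= shi.

(** * Existence of conditional G-expectations *)

Section GCondExists.
Local Notation S := (fun d phi => Gheat slo shi phi d).
Let HS : @semigroup R S := Pset_semigroup slo0 sloshi PS0.

Lemma Pset_functional (L : ((R -> R) -> R) -> R) :
  (forall Phi Psi, cyl +oo Phi -> cyl +oo Psi -> L (fun g => Phi g + Psi g) = L Phi + L Psi) ->
  (forall c Phi, cyl +oo Phi -> L (fun g => c * Phi g) = c * L Phi) ->
  (forall Phi, cyl +oo Phi -> L Phi <= gexp S Phi) ->
  exists2 Q, PS Q & forall Phi, cyl +oo Phi -> Ex Q (fun w => Phi (pv w)) = L Phi.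
Proof.
move=> LD LZ Lg; have C0 : 0 <= 3 * shi ^+ 4.
  by rewrite mulr_ge0// exprn_ge0// (le_trans slo0).
have [Q HQ] := representation HS C0 (fun phi A a d bp A0 h d0 =>
  Gheat_moment slo0 sloshi (fun _ bq => Pset_Gheat_ex PS0 bq) bp A0 h d0) LD LZ Lg.
by exists Q => //; apply/(PsetP HS) => Phi c; rewrite HQ// Lg.
Qed.

Section FixedTime.
Variable t : R.
Hypothesis t0 : 0 <= t.
Let t0E : (0 <= t%:E)%E. Proof. by rewrite lee_fin. Qed.

(** With a cylinder functional Psi of time t, valued in [0, 1], in place of the indicator, the
    conditional expectation of Psi (Phi - E_t[Phi]) is 0, so its expectation under P is at most 0.
    Density of such Psi gives the indicator. *)
Lemma cyl_cexp_past P Phi B : PS P -> cyl +oo Phi -> measurable B ->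
  Ex P (fun w => \1_(past t B) w * Phi (pv w)) <=
  Ex P (fun w => \1_(past t B) w * cexp S t Phi (pv w)).
Proof.
move=> PP c mB; have ct := cexp_cyl HS t c; have c' := cyl_pinfty ct.
have [K K0 HK] := cyl_bounded (cylB c c'); pose D g := Phi g - cexp S t Phi g.
have cD : cyl +oo D by exact: cylB.
have r1 := rv_past t (rv_cyl c) mB; have r2 := rv_past t (rv_cyl c') mB.
rewrite -subr_le0 -(E_B PP r1 r2).
have -> : (fun w => \1_(past t B) w * Phi (pv w) - \1_(past t B) w * cexp S t Phi (pv w)) =
    (fun w => \1_(past t B) w * D (pv w)) by apply/funext => w; rewrite -mulrBr.
apply/ler_addgt0Pr => e e0; rewrite add0r.
have K1 : 0 < K + 1 by rewrite ltr_wpDl.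
have [Psi [cP P01 HP _]] := cyl_dense P P t0E mB (divr_gt0 e0 K1).
have cP' := cyl_pinfty cP.
have le0 : Ex P (fun w => Psi (pv w) * D (pv w)) <= 0.
  apply: le_trans ((PsetP HS P).1 PP _ (cylM cP' cD)) _.
  have -> : (fun g => Psi g * D g) = (fun g => Psi g * Phi g + - (Psi g * cexp S t Phi g)).
    by apply/funext => g; rewrite /D; ring.
  have cb : cyl t%:E (fun g => - (Psi g * cexp S t Phi g)) by apply: cylN; exact: cylM.
  rewrite -(gexp_cexp HS t0); last by apply: cylD; [exact: cylM|exact: cyl_pinfty cb].
  rewrite (_ : cexp S t _ = fun=> 0) ?gexp_cst//.
  apply/funext => g; rewrite (cexp_affine HS g c cP cb); first by rewrite subrr.
  by move=> h; have /andP[] := P01 h.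
have rM := rv_cyl (cylM cP' cD).
have rD := rv_past t (rv_cyl cD) mB.
rewrite -[Ex _ _](subrK (Ex P (fun w => Psi (pv w) * D (pv w)))).
rewrite -[leRHS]addr0 lerD// -(E_B PP rD rM).
have ri : rv (fun w => \1_(past t B) w - Psi (pv w)).
  apply: rvB; last exact: rv_cyl cP.
  have := rv_past t (rv_cst 1) mB; by under eq_fun do rewrite mulr1.
apply: le_trans (_ : Ex P (fun w => K * `|\1_(past t B) w - Psi (pv w)|) <= _).
  apply: E_le => //; [exact: rvB|exact/rvZ/rv_norm|].
  apply: qs_all => w; rewrite -mulrBl mulrC; apply: le_trans (ler_norm _) _.
  by rewrite normrM ler_wpM2r// HK.
rewrite ExZ; last exact: rv_itg (rv_norm ri) PP.
apply: le_trans (ler_wpM2l K0 HP) _.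
by rewrite mulrA ler_pdivrMr// mulrC ler_wpM2l ?(ltW e0)// lerDl.
Qed.

(* Hahn-Banach, applied to the sublinear functional $\Phi\mapsto E^P[\hat{\mathbb E}_t[\Phi]]$,
   yields a measure in $\mathcal P(t,P)$ attaining it. *)
Lemma cexp_attained P Phi : PS P -> cyl +oo Phi -> exists2 Q, Pset_from slo shi t%:E P Q &
  Ex Q (fun w => Phi (pv w)) = Ex P (fun w => cexp S t Phi (pv w)).
Proof.
move=> PP c; pose p (F : (R -> R) -> R^o) : R := Ex P (fun w => cexp S t F (pv w)).
have i F : cyl +oo F -> itg P (fun w => cexp S t F (pv w)).
  by move=> cF; exact: cyl_itg (cexp_cyl HS t cF).
have cZ (a : R) F : cyl +oo F -> cyl +oo (fun g => a * F g) by exact: cylZ.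
have sp : sublinear_on [set F : (R -> R) -> R^o | cyl +oo F] p.
  split=> [F1 F2 /= c1 c2|a F /= cF a0]; rewrite /p.
    rewrite -ExD; [|exact: i..].
    apply: Ex_le => [|| w].
    - by apply: i; exact: cylD.
    - by apply: itgD; exact: i.
    - exact: cexpD.
  rewrite -ExZ; last exact: i.
  apply: Ex_le => [|| w].
  - by apply: i; exact: cZ.
  - by apply: itgZ; exact: i.
  have := cexp_affine HS (t := t) (pv w) cF (cyl_cst _ a) (cyl_cst _ 0) (fun=> a0).
  rewrite addr0 => <-; rewrite le_eqVlt; apply/orP; left; apply/eqP; congr (cexp _ _ _ _).
  by apply/funext => g; rewrite addr0.
have DD (F1 F2 : (R -> R) -> R^o) : cyl +oo F1 -> cyl +oo F2 -> cyl +oo (F1 + F2) by exact: cylD.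
have DZ (a : R) (F : (R -> R) -> R^o) : cyl +oo F -> cyl +oo (a *: F) by exact: cylZ.
have [L [LD LZ Lp Lx]] := hahn_banach DD DZ sp c.
have Lg F : cyl +oo F -> L F <= gexp S F.
  move=> cF; apply: le_trans (Lp F cF) _; rewrite -(gexp_cexp HS t0 cF).
  by apply: (PsetP HS P).1 => //; exact: cyl_pinfty (cexp_cyl HS t cF).
have [Q PQ HQ] := Pset_functional LD LZ Lg.
have Lle F : cyl t%:E F -> Ex Q (fun w => F (pv w)) <= Ex P (fun w => F (pv w)).
  move=> cF; rewrite (HQ _ (cyl_pinfty cF)).
  by have := Lp F (cyl_pinfty cF); rewrite /p (cexp_id HS cF).
exists Q; last by rewrite HQ// Lx.
apply/(Pset_fromP _ _ _ _ t0E); split=> // F cF; apply: le_anti; rewrite Lle//=.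
have := Lle _ (cylN cF).
have N P' : Ex P' (fun w => - F (pv w)) = - Ex P' (fun w => F (pv w)).
  rewrite -[RHS]mulN1r -ExZ; last exact: cyl_itg cF.
  by congr Ex; apply/funext => w; rewrite mulN1r.
by rewrite !N lerN2.
Qed.

Lemma GC_cyl Phi : cyl +oo Phi -> GC t (fun w => Phi (pv w)) (fun w => cexp S t Phi (pv w)).
Proof.
move=> c; have ct := cexp_cyl HS t c; split.
- exact: rv_cyl c.
- exact: rv_cyl ct.
- exact: adp_cyl ct.
- by move=> P B PP mB; exact: cyl_cexp_past.
- by move=> P e PP e0; have [Q PQ HQ] := cexp_attained PP c; exists Q => //; rewrite HQ gerBl ltW.
Qed.

Lemma GC_G1_ex x : G1 +oo x -> exists y, GC t x y.
Proof.
move=> [rx Hx]; apply: GC_lim => // e e0; have [Phi c h] := Hx e e0.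
by exists (fun w => Phi (pv w)), (fun w => cexp S t Phi (pv w)); split=> //; exact: GC_cyl.
Qed.

Lemma GC_G1 x y : G1 +oo x -> GC t x y -> G1 t%:E y.
Proof.
move=> [rx Hx] G; have [_ ry _ _ _] := G; apply: G1_lim => // e e0.
have e2 : 0 < e / 2 by rewrite divr_gt0.
have [Phi c h] := Hx _ e2; exists (fun w => cexp S t Phi (pv w)).
  by apply: G1_cyl; exact: cexp_cyl.
have := GC_contr t0 (GC_cyl c) G h; congr (nle _ _); by field.
Qed.

(** Compactness: near optimizers [q n] for y n have a limit functional along an ultrafilter, which
    is represented by some Q in P(t, P). Since x m is in L_G^1, its expectations under [q n] are
    close to those of a cylinder functional, which converge; and x n <= x m for n >= m carries over
    the lower bound. *)
Lemma GC_down (x y : nat -> Omega R -> R) x0 : rv x0 -> (forall n, G1 +oo (x n)) ->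
  (forall n, GC t (x n) (y n)) ->
  qs (fun w => (forall n, x n.+1 w <= x n w) /\ x n w @[n --> \oo] --> x0 w) ->
  exists y0, [/\ GC t x0 y0 & qs (fun w => y n w @[n --> \oo] --> y0 w)].
Proof.
move=> rx0 Gx G Hx; have rx n : rv (x n) by have [] := G n.
have ry n : rv (y n) by have [] := G n.
have xle : qs (fun w => forall n m, (n <= m)%N -> x m w <= x n w).
  apply: filterS Hx => w [h1 h2] n m nm.
  have nd : {homo (fun n => - x n w) : m n / (m <= n)%N >-> m <= n}.
    by apply: homo_leq => //; [exact: le_trans|move=> k; rewrite lerN2].
  by have := nd _ _ nm; rewrite lerN2.
have x0le : qs (fun w => forall n, x0 w <= x n w).
  apply: filterS2 Hx xle => w [_ h2] h n; apply: (cvgn_le h2); exists n => // m /= nm; exact: h.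
have yi : qs (fun w => forall n, - y n w <= - y n.+1 w).
  apply: qs_forall => n; have := GC_le t0 (G n.+1) (G n).
  move=> h; apply: filterS (h _) => [w|]; first by rewrite lerN2.
  by apply: filterS xle => w; apply.
have [c c0 Hc] := rv_bound rx0.
have N P z : PS P -> rv z -> Ex P (fun w => - z w) = - Ex P z.
  move=> PP rz; rewrite -[RHS]mulN1r -ExZ; last exact: rv_itg rz PP.
  by congr Ex; apply/funext => w; rewrite mulN1r.
have ylow P n : PS P -> Ex P x0 <= Ex P (y n).
  move=> PP; apply: le_trans (GC_E (G n) PP); apply: E_le => //.
  by apply: filterS x0le => w; apply.
have yb P n : PS P -> Ex P (fun w => - y n w) <= c.
  move=> PP; rewrite N//; have := E_abs PP rx0; have := Hc P PP; have := ylow P n PP.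
  have := ler_norm (- Ex P x0); rewrite normrN; lra.
have [z [rz zl zu]] := monotone_limit (fun n => rvN (ry n)) yi yb.
have yl : qs (fun w => y n w @[n --> \oo] --> - z w).
  apply: filterS zl => w h; have h' := cvgN h; rewrite (_ : (fun n => y n w) = - (fun n => - y n w)); first exact: h'.
  by apply/funext => n; rewrite !fctE opprK.
have dct' P (u : nat -> Omega R -> R) v : PS P -> (forall n, rv (u n)) -> rv v ->
    qs (fun w => forall n, v w <= u n w /\ u n w <= u 0%N w) ->
    qs (fun w => u n w @[n --> \oo] --> v w) -> Ex P (u n) @[n --> \oo] --> Ex P v.
  move=> PP ru rv' h; apply: (dct (g := fun w => `|v w| + `|u 0%N w|)) => //.
    by apply: rvD; exact: rv_norm.
  apply: filterS h => w h n; have [h1 h2] := h n.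
  have := ler_norm (u 0%N w); have := ler_norm (- v w); rewrite normrN => ? ?.
  have := normr_ge0 (v w); have := normr_ge0 (u 0%N w).
  by rewrite ler_norml => ? ?; apply/andP; split; lra.
have ybd : qs (fun w => forall n, - z w <= y n w /\ y n w <= y 0%N w).
  apply: filterS2 yi zu => w h1 h2 n; split; first by rewrite lerNl.
  by elim: n => // n IH; apply: le_trans IH; rewrite -lerN2.
have xbd : qs (fun w => forall n, x0 w <= x n w /\ x n w <= x 0%N w).
  by apply: filterS2 x0le xle => w h1 h2 n; split; [exact: h1|exact: h2].
have xl : qs (fun w => x n w @[n --> \oo] --> x0 w) by apply: filterS Hx => w [].
exists (fun w => - z w); split=> //; split=> //.
- exact: rvN.
- by apply: adp_lim yl => n; have [] := G n.
- move=> P B PP mB.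
  have bd (u : nat -> Omega R -> R) (v : Omega R -> R) : qs (fun w => forall n, v w <= u n w /\ u n w <= u 0%N w) ->
     qs (fun w => forall n, \1_(past t B) w * v w <= \1_(past t B) w * u n w /\
       \1_(past t B) w * u n w <= \1_(past t B) w * u 0%N w).
    by apply: filterS => w h n; have [h1 h2] := h n; split; apply: ler_wpM2l => //; rewrite indicE.
  have cl (u : nat -> Omega R -> R) (v : Omega R -> R) : qs (fun w => u n w @[n --> \oo] --> v w) ->
     qs (fun w => \1_(past t B) w * u n w @[n --> \oo] --> \1_(past t B) w * v w).
    by apply: filterS => w h; apply: cvgM => //; exact: cvg_cst.
  have l1 := dct' P _ _ PP (fun n => rv_past t (rx n) mB) (rv_past t rx0 mB) (bd _ _ xbd) (cl _ _ xl).
  have l2 := dct' P _ _ PP (fun n => rv_past t (ry n) mB) (rv_past t (rvN rz) mB) (bd _ _ ybd) (cl _ _ yl).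
  apply: (ler_cvg_to l1 l2); apply: nearW => n; exact: GC_past.
move=> P e PP e0.
have ex n : exists Q, Pset_from slo shi t%:E P Q /\ Ex P (y n) - 2^-1 ^+ n <= Ex Q (x n).
  have [_ _ _ _ H2] := G n; have [|Q PQ HQ] := H2 P (2^-1 ^+ n) PP; first by rewrite exprn_gt0.
  by exists Q.
pose q n := sval (cid (ex n)); have Hq n : Pset_from slo shi t%:E P (q n) by rewrite /q; case: cid => ? [].
have Eq n : Ex P (y n) - 2^-1 ^+ n <= Ex (q n) (x n) by rewrite /q; case: cid => ? [].
have qPS n : PS (q n) := from_PS (Hq n).
have [U [UU Uoo]] := ultraFilterLemma (@eventually_filter).
have PU := @ultra_proper _ U UU.
pose L Phi := ulim U (fun n => Ex (q n) (fun w => Phi (pv w))).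
have Ll Phi : cyl +oo Phi -> Ex (q n) (fun w => Phi (pv w)) @[n --> U] --> L Phi.
  move=> cP; have [K K0 HK] := cyl_bounded cP; apply: (ulimP UU Uoo (M := K)).
  apply: nearW => n; apply: le_trans (E_abs (qPS n) (rv_cyl cP)) _.
  rewrite -[leRHS](Ex_cst (q n)); apply: Ex_le => //; last exact: itg_cst.
  by apply: itg_norm; exact: cyl_itg cP.
have [Q PQ HQ] : exists2 Q, PS Q & forall Phi, cyl +oo Phi -> Ex Q (fun w => Phi (pv w)) = L Phi.
  apply: Pset_functional.
  - move=> Phi Psi c1 c2; apply: (ulim_unique UU); have := cvgD (Ll _ c1) (Ll _ c2).
    rewrite (_ : _ + _ = fun n => Ex (q n) (fun w => Phi (pv w) + Psi (pv w))); first by apply.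
    by apply/funext => n; rewrite !fctE ExD//; [exact: cyl_itg c1|exact: cyl_itg c2].
  - move=> a Phi cP; apply: (ulim_unique UU); have := cvgM (cvg_cst a) (Ll _ cP).
    rewrite (_ : _ \* _ = fun n => Ex (q n) (fun w => a * Phi (pv w))); first by apply.
    by apply/funext => n /=; rewrite ExZ//; exact: cyl_itg cP.
  - move=> Phi cP; apply: (ler_cvg_to (Ll _ cP) (cvg_cst _)); apply: nearW => n.
    by apply: (PsetP HS (q n)).1.
have PQ' : Pset_from slo shi t%:E P Q.
  apply/(Pset_fromP _ _ _ _ t0E); split=> // Phi cP; rewrite HQ; last exact: cyl_pinfty cP.
  apply: (ulim_unique UU); rewrite (_ : (fun n => _) = fun=> Ex P (fun w => Phi (pv w))); first exact: cvg_cst.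
  by apply/funext => n; have /(Pset_fromP _ _ _ _ t0E)[_ ->] := Hq n.
exists Q => //.
suff Qx m : Ex P (fun w => - z w) <= Ex Q (x m).
  have l := dct' Q _ _ PQ rx rx0 xbd xl.
  apply: le_trans (_ : Ex P (fun w => - z w) <= _); first by rewrite gerBl ltW.
  by apply: (cvgn_ge l); apply: nearW.
apply/ler_addgt0Pr => d d0; have d2 : 0 < d / 4 by rewrite divr_gt0.
have [_ /(_ _ d2)[Phi cP h]] := Gx m; have rP := rv_cyl cP.
have h1 : Ex Q (fun w => Phi (pv w)) <= Ex Q (x m) + d / 4 by exact: (E_dist PQ rP (rx m) h).
suff h2 : Ex P (fun w => - z w) <= Ex Q (fun w => Phi (pv w)) + d / 2 by lra.
rewrite HQ// -lerBlDr; apply: (ler_cvg_to (cvg_cst _) (Ll _ cP)); apply: Uoo.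
have : (fun n => 2^-1 ^+ n) @ \oo --> (0 : R) by apply: cvg_expr; rewrite ger0_norm// invf_lt1// ltr1n.
move=> /cvgrPdist_lt/(_ _ d2)[N' _ HN]; exists (maxn m N') => // n /=; rewrite geq_max => /andP[mn Nn].
have := HN n Nn; rewrite /= sub0r normrN => /(le_lt_trans (ler_norm _)) hn.
have h3 : Ex (q n) (x m) <= Ex (q n) (fun w => Phi (pv w)) + d / 4.
  by exact: (E_dist (qPS n) (rx m) rP (nle_sym h)).
have h4 : Ex (q n) (x n) <= Ex (q n) (x m).
  by apply: E_le => //; apply: filterS xle => w hw; exact: hw.
have h5 : Ex P (fun w => - z w) <= Ex P (y n).
  by apply: E_le => //; [exact: rvN|apply: filterS ybd => w /(_ n)[]].
have := Eq n; lra.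
Qed.

Lemma GC_Gs_ex x : Gs +oo x -> exists y, GC t x y.
Proof.
move=> [rx [xi [Gxi H]]].
have ex n := GC_G1_ex (Gxi n).
have [y [Gy _]] := GC_down rx Gxi (fun n => projT2 (cid (ex n))) H.
by exists y.
Qed.

Lemma GC_Gss_ex x : Gss +oo x -> exists y, GC t x y.
Proof.
move=> [rx [xi [Gxi H]]].
have ex n := GC_Gs_ex (Gxi n).
have [y [Gy _ _]] := GC_up t0 rx (fun n => projT2 (cid (ex n))) H.
by exists y.
Qed.

Lemma GC_Gb_ex x : Gb +oo x -> exists y, GC t x y.
Proof.
move=> [rx H]; apply: GC_lim => // e e0; have [x' /GC_Gss_ex[y' G] xx] := H e e0.
by exists x', y'.
Qed.

End FixedTime.
End GCondExists.

(** * Classical conditional expectations *)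

Lemma Rintegral_ind P x (A : set (Omega R)) : measurable A -> itg P x ->
  (\int[P]_(w in A) (x w)%:E = (Ex P (fun w => \1_A w * x w))%:E)%E.
Proof.
move=> mA ix; rewrite -ExE; last first.
  apply: (itg_le (y := x)) => //.
    by apply: measurable_funM; [exact: measurable_indic|exact: itg_measurable ix].
  apply: nearW => w; rewrite normrM indicE; case: (w \in A); rewrite ?normr1 ?mul1r//.
  by rewrite normr0 mul0r.
rewrite integral_mkcond; apply: eq_integral => w _; rewrite patchE indicE.
by case: (w \in A); rewrite ?mul1r ?mul0r.
Qed.

(** F_t-measurable functions are functions of the stopped path, so the conditional expectation is
    the Radon-Nikodym derivative between the images under stopping of x dQ and of Q. *)
Lemma condexp_ex t Q x : itg Q x -> exists f : Omega R -> R, [/\ measurable_fun setT f,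
  itg Q (fun w => f (stop t w)) & forall B, measurable B ->
   (\int[Q]_(w in @stop R t @^-1` B) (f (stop t w))%:E = \int[Q]_(w in @stop R t @^-1` B) (x w)%:E)%E].
Proof.
move=> ix; have ms := measurable_stop t; have mp B := preim_stop t (A := B).
have [m Hm] : exists m : {measure set (Omega R) -> \bar R}, forall B, m B = Q (@stop R t @^-1` B).
  by unshelve eexists (pushforward Q (@stop R t)).
have m1 : m setT = 1%E by rewrite Hm preimage_setT; exact: probability_setT.
pose m0 (B : set (Omega R)) := Q (@stop R t @^-1` B).
have m0E : m0 = m by apply/funext => B; rewrite Hm.
have h0 : m0 set0 = 0%E by rewrite m0E measure0.
have hge B : (0 <= m0 B)%E by rewrite m0E measure_ge0.
have hadd : semi_sigma_additive m0 by rewrite m0E; exact: measure_semi_sigma_additive.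
pose m2 : {measure set (Omega R) -> \bar R} := HB.pack m0 (isMeasure.Build _ (Omega R) R m0 h0 hge hadd).
have m21 : m2 setT = 1%E by rewrite -m1 -m0E.
have [mu muE] : exists mu : probability (Omega R) R, forall B, mu B = Q (@stop R t @^-1` B).
  pose mu : probability (Omega R) R :=
    HB.pack m0 (isMeasure.Build _ (Omega R) R m0 h0 hge hadd) (Measure_isProbability.Build _ _ _ m2 m21).
  by exists mu.
have [nu Hnu] : exists nu : {charge set (Omega R) -> \bar R}, forall B,
    nu B = (\int[Q]_(w in @stop R t @^-1` B) (x w)%:E)%E.
  by unshelve eexists (pushforward (induced_charge ix) (@stop R t)).
have dom : nu `<< mu.
  apply/null_content_dominatesP => B mB muB; rewrite Hnu.
  have QB0 : Q (@stop R t @^-1` B) = 0%E by rewrite -muE.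
  apply: null_set_integral => //; first exact: mp.
  by apply/measurable_funTS/measurable_EFinP; exact: itg_measurable ix.
pose f0 := Radon_Nikodym nu mu.
have f0fin w : f0 w \is a fin_num by exact: Radon_Nikodym_fin_num.
have if0 : mu.-integrable setT f0 by exact: Radon_Nikodym_integrable.
have mf0 : measurable_fun setT f0 := measurable_int _ if0.
have f0E w : (fine (f0 w))%:E = f0 w by rewrite fineK.
have mf : measurable_fun setT (fine \o f0) by exact: measurableT_comp.
have push (g : Omega R -> \bar R) B : measurable B -> measurable_fun setT g -> (forall w, 0 <= g w)%E ->
    (\int[mu]_(w in B) g w = \int[Q]_(w in @stop R t @^-1` B) g (stop t w))%E.
  move=> mB mg g0; rewrite -(ge0_integral_pushforward ms)//; last exact: measurable_funTS.
  by apply: eq_measure_integral => A mA _; exact: muE.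
have iQ : itg Q (fun w => fine (f0 (stop t w))).
  apply/integrableP; split; first by apply/measurable_EFinP; exact: (measurableT_comp mf ms).
  have /integrableP[_] := if0; rewrite push//; last exact: measurableT_comp.
  rewrite preimage_setT; congr (_ < _)%E; apply: eq_integral => w _ /=; by rewrite -[in LHS]f0E.
exists (fine \o f0); split=> // B mB; rewrite -Hnu.
have -> : nu B = (\int[mu]_(w in B) f0 w)%E by exact: Radon_Nikodym_integral.
transitivity (\int[pushforward Q (@stop R t)]_(w in B) (fine (f0 w))%:E)%E.
  rewrite integral_pushforward//; first exact/measurable_EFinP.
  apply: integrableS (_ : Q.-integrable setT _) => //; exact: mp.
transitivity (\int[mu]_(w in B) (fine (f0 w))%:E)%E.
  by apply: eq_measure_integral => //= A mA _; exact/esym/muE.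
by apply: eq_integral => w _; rewrite f0E.
Qed.

(** * From real representatives to extended random variables *)

Section Transfer.
Variables (X : Omega R -> \bar R) (x : Omega R -> R).
Hypotheses (mX : measurable_fun setT X) (rx : rv x) (Xx : qs (fun w => X w = (x w)%:E)).

Lemma transfer_int P (A : set (Omega R)) : PS P -> measurable A ->
  (\int[P]_(w in A) X w = (Ex P (fun w => \1_A w * x w))%:E)%E.
Proof.
move=> PP mA; rewrite -Rintegral_ind//; last exact: rv_itg rx PP.
apply: ae_eq_integral => //; first exact: measurable_funTS.
  by apply/measurable_funTS/measurable_EFinP; exact: rv_meas rx.
by apply: filterS (qs_ae PP Xx) => w ->.
Qed.

Lemma transfer_integrable P : PS P -> P.-integrable setT X.
Proof.
move=> PP; have ix := rv_itg rx PP; apply/integrableP; split=> //.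
have /integrableP[_] := ix; congr (_ < _)%E; apply: ae_eq_integral => //.
- by apply: measurableT_comp => //; apply/measurable_EFinP; exact: rv_meas rx.
- exact: measurableT_comp.
by apply: filterS (qs_ae PP Xx) => w ->.
Qed.

End Transfer.

Section GCondTransfer.
Variables (t : R) (X : Omega R -> \bar R) (x y : Omega R -> R).
Hypotheses (t0 : 0 <= t) (mX : measurable_fun setT X).
Hypotheses (G : GC t x y) (Xx : qs (fun w => X w = (x w)%:E)).
Let t0E : (0 <= t%:E)%E. Proof. by rewrite lee_fin. Qed.

(** The event where a conditional expectation under Q exceeds y belongs to F_t and is Q-null by the
    upper bound in [GC]; P and Q agree on F_t, so it is P-null. *)
Lemma condexp_le P Q Z : PS P -> Pset_from slo shi t%:E P Q -> is_condexp Q t%:E X Z ->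
  {ae P, forall w, (Z w <= (y w)%:E)%E}.
Proof.
move=> PP PQ [FZ iX iZ HZ]; have PQ' := from_PS PQ; have [rx ry [g mg yg] _ _] := G.
have [f mf Zf] := (F_measurableP _ t0E).1 FZ.
pose B := (fun w => f w - (g w)%:E)%E @^-1` `]0%E, +oo%E].
have mB : measurable B.
  rewrite -[X in measurable X]setTI; apply: (_ : measurable_fun setT _) => //; last exact: emeasurable_itv.
  by apply: emeasurable_funB => //; exact/measurable_EFinP.
have BE w : B w <-> ((g w)%:E < f w)%E by rewrite /B /= in_itv /= leey andbT EFinN sube_gt0.
have mA := past_measurable t mB; set A := past t B in mA.
pose z w := fine (Z w).
have mZ : measurable_fun setT Z := measurable_int _ iZ.
have Zfin := integrable_ae measurableT iZ.
have iz : itg Q z.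
  apply/integrableP; split; first by apply/measurable_EFinP; exact: measurableT_comp.
  have /integrableP[_] := iZ; apply: le_lt_trans; apply: ge0_le_integral => //.
  - by apply: measurableT_comp => //; apply/measurable_EFinP; exact: measurableT_comp.
  - exact: measurableT_comp.
  move=> w _; rewrite /z /=; case: (Z w) => [r||] /=; rewrite ?normr0 ?leey ?lexx//.
have Ez : Ex Q (fun w => \1_A w * z w) = Ex Q (fun w => \1_A w * x w).
  apply: EFin_inj; rewrite -(Rintegral_ind mA iz) -(transfer_int mX rx Xx PQ' mA) -HZ; last first.
    by apply/F_P; exists B.
  apply: ae_eq_integral => //; [by apply/measurable_funTS/measurable_EFinP; exact: itg_measurable iz|
    exact: measurable_funTS|].
  by apply: filterS Zfin => w /(_ I) h _; rewrite /z fineK.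
have iy := rv_itg ry PQ'.
have i1 (u : Omega R -> R) : itg Q u -> itg Q (fun w => \1_A w * u w).
  move=> iu; apply: (itg_le (y := u)) => //.
    by apply: measurable_funM; [exact: measurable_indic|exact: itg_measurable iu].
  apply: nearW => w; rewrite normrM indicE; case: (w \in A); rewrite ?normr1 ?mul1r//.
  by rewrite normr0 mul0r.
pose u w := \1_A w * z w - \1_A w * y w.
have iu : itg Q u by apply: itgB; exact: i1.
have u0 : {ae Q, forall w, (0 <= u w /\ (A w -> 0 < u w))}.
  apply: filterS2 Zfin (qs_ae PQ' yg) => w /(_ I) zf yw.
  rewrite /u indicE -mulrBr; have [/[!inE] Aw|/negP] := boolP (w \in A); last first.
    by rewrite inE => nA; rewrite mul0r.
  have : ((y w)%:E < Z w)%E by rewrite yw Zf /=; exact/BE.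
  rewrite -[Z w]fineK// lte_fin mul1r => h; rewrite subr_ge0 subr_gt0; split=> //; exact: ltW.
have Eu : Ex Q u <= 0.
  by rewrite ExB; [|exact: i1|exact: i1]; rewrite Ez subr_le0; exact: GC_past G PQ' mB.
have Eu0 : (\int[Q]_w `|(u w)%:E| = 0)%E.
  have e : (\int[Q]_w `|(u w)%:E| = \int[Q]_w (u w)%:E)%E.
    apply: ae_eq_integral => //; [by apply: measurableT_comp => //; exact: measurable_int iu|
      exact: measurable_int iu|].
    by apply: filterS u0 => w [h _] _; rewrite /= ger0_norm.
  apply: le_anti; apply/andP; split; last by apply: integral_ge0 => w _; exact: abse_ge0.
  by rewrite e ExE// lee_fin.
have QA : Q A = 0%E.
  have mu' : measurable_fun setT (EFin \o u) := measurable_int _ iu.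
  have h0 := (ae_eq_integral_abs Q measurableT mu').1 Eu0.
  have [N [mN N0 HN]] : {ae Q, forall w, ~ A w}.
    apply: filterS2 h0 u0 => w /(_ I) [] h [_ h'] Aw; have := h' Aw.
    by rewrite h ltxx.
  apply/eqP; rewrite eq_le measure_ge0 andbT -N0; apply: le_measure; rewrite ?inE//.
  by move=> w Aw; apply: HN; apply.
have PA : P A = 0%E by rewrite -QA; exact/esym/(Pset_from_preim t0E PQ mB).
have : {ae P, forall w, ~ A w} by exists A; split=> // w /= /contrapT.
move=> h; apply: filterS2 h (qs_ae PP yg) => w nA yw; rewrite leNgt; apply/negP => h'; apply: nA.
by apply/BE; rewrite -yw /=; move: h'; rewrite Zf.
Qed.

(** The first clause of [GC] is the upper bound, the second gives minimality: a Y' that fell 2^-k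
    below y with positive probability could not dominate conditional expectations whose means under
    P approach that of y. *)
Lemma GC_esssup P (Y : Omega R -> \bar R) : PS P -> measurable_fun setT Y ->
  qs (fun w => Y w = (y w)%:E) ->
  is_esssup_as P [set Z | exists2 Q, Pset_from slo shi t%:E P Q & is_condexp Q t%:E X Z] Y.
Proof.
move=> PP mY Yy; have [rx ry ay _ H2] := G.
split=> //.
  move=> Z [Q PQ cZ]; have := condexp_le PP PQ cZ.
  by apply: filterS2 (qs_ae PP Yy) => w ->.
move=> Y' mY' HY'.
have key (n : nat) : exists f : Omega R -> R, [/\ measurable_fun setT f,
    {ae P, forall w, ((f (stop t%:E w))%:E <= Y' w)%E},
    {ae P, forall w, f (stop t%:E w) <= y w}, itg P (fun w => f (stop t%:E w)) &
    Ex P y - 2^-1 ^+ n <= Ex P (fun w => f (stop t%:E w))].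
  have [|Q PQ HQ] := H2 P (2^-1 ^+ n) PP; first by rewrite exprn_gt0.
  have PQ' := from_PS PQ.
  have [f [mf iQ Hf]] := condexp_ex t%:E (rv_itg rx PQ').
  have ms := measurable_stop (t%:E : \bar R).
  have cf : is_condexp Q t%:E X (fun w => (f (stop t%:E w))%:E).
    split=> //.
    - by apply/(F_measurableP _ t0E); exists (EFin \o f) => //; exact/measurable_EFinP.
    - exact: (transfer_integrable mX rx Xx PQ').
    move=> A /F_P[B mB ->]; rewrite Hf// (transfer_int mX rx Xx PQ' (preim_stop _ mB)) Rintegral_ind//.
      exact: preim_stop.
    exact: rv_itg rx PQ'.
  have le1 : {ae P, forall w, f (stop t%:E w) <= y w} by have := condexp_le PP PQ cf.
  have iP : itg P (fun w => f (stop t%:E w)).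
    have QP : Pset_from slo shi t%:E Q P by split=> // X' LX'; have [_ ->] := PQ.
    have mF : measurable_fun setT (fun w => `|f w|) by exact: measurableT_comp.
    apply/integrableP; split; first by apply/measurable_EFinP; exact: measurableT_comp.
    have /integrableP[_] := iQ; congr (_ < _)%E.
    have push P' : (\int[P']_w `|(f (stop t%:E w))%:E| = \int[pushforward P' (@stop R t%:E)]_w `|(f w)%:E|)%E.
      rewrite ge0_integral_pushforward//.
      by apply: measurableT_comp => //; exact/measurable_EFinP.
    rewrite /comp !push; apply: eq_measure_integral => // A mA _.
    exact: (Pset_from_preim t0E PQ mA).
  exists f; split=> //.
    by apply: HY'; exists Q.
  rewrite -(Pset_from_int t0E PQ mf iP iQ) (_ : Ex Q _ = Ex Q x)//.
  apply: EFin_inj; rewrite -!ExE//; last exact: rv_itg rx PQ'.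
  by have := Hf _ measurableT; rewrite preimage_setT.
have low k : {ae P, forall w, ((y w - 2^-1 ^+ k)%:E < Y' w)%E}.
  set e := 2^-1 ^+ k : R; have e0 : 0 < e by rewrite exprn_gt0.
  pose D := (fun w => (y w - e)%:E - Y' w)%E @^-1` `[0%E, +oo%E].
  have mD : measurable D.
    rewrite -[X in measurable X]setTI; apply: (_ : measurable_fun setT _) => //; last exact: emeasurable_itv.
    apply: emeasurable_funB => //; apply/measurable_EFinP; apply: measurable_funB => //.
    exact: rv_meas ry.
  have DE w : D w <-> (Y' w <= (y w - e)%:E)%E by rewrite /D /= in_itv /= leey andbT sube_ge0//= orbT.
  have iD := itg_indic P mD.
  have PD n : e * fine (P D) <= 2^-1 ^+ n.
    have [f [mf fY' fy iP HE]] := key n; rewrite -(Ex_indic P mD) -ExZ//.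
    have iy := rv_itg ry PP.
    apply: le_trans (_ : Ex P (fun w => y w - f (stop t%:E w)) <= _); last by rewrite ExB//; lra.
    apply: Ex_le_ae => //; [exact: itgZ|exact: itgB|].
    apply: filterS2 fY' fy => w h1 h2; rewrite indicE; have [/[!inE]/DE Dw|_] := boolP (w \in D).
      by have := le_trans h1 Dw; rewrite lee_fin mulr1; lra.
    by rewrite mulr0 subr_ge0.
  have : P D = 0%E.
    rewrite -[P D]fineK ?fin_num_measure//; congr (_%:E); apply: le_anti; rewrite fine_ge0// andbT.
    rewrite -(pmulr_rle0 _ e0); apply: (cvgn_ge (u := fun n => 2^-1 ^+ n)); last exact: nearW.
    by apply: cvg_expr; rewrite ger0_norm// invf_lt1// ltr1n.
  move=> PD0; exists D; split=> // w /= /negP; rewrite -leNgt => ?; exact/DE.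
have := ae_foralln low; apply: filterS2 (qs_ae PP Yy) => w -> h.
case: (Y' w) h => [r h| |/(_ 0%N)//]; last by rewrite leey.
rewrite lee_fin -subr_le0; apply: (cvgn_ge (u := fun n => 2^-1 ^+ n)); last first.
  by apply: nearW => n; have := h n; rewrite lte_fin; lra.
by apply: cvg_expr; rewrite ger0_norm// invf_lt1// ltr1n.
Qed.

End GCondTransfer.

(** * Moments, uniform integrability and passage from L_G^p to L_G^1 *)

Lemma powR_young (z d p : R) : 0 <= z -> 0 < d -> 1 <= p -> z <= d + d `^ (1 - p) * z `^ p.
Proof.
move=> z0 d0 p1; have h0 := powR_ge0 z p; have h1 := powR_gt0 (1 - p) d0.
have [zd|dz] := leP z d; first by rewrite (le_trans zd)// lerDl mulr_ge0// ltW.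
apply: le_trans (_ : d `^ (1 - p) * z `^ p <= _); last by rewrite lerDr ltW.
rewrite -(mulr_powRB1 z0 (lt_le_trans ltr01 p1)).
have : z * (d `^ (1 - p) * d `^ (p - 1)) <= z * (d `^ (1 - p) * z `^ (p - 1)).
  rewrite ler_wpM2l// ler_wpM2l ?(ltW h1)// ge0_ler_powR ?subr_ge0// ?nnegrE//; exact: ltW.
rewrite -powRD; last by rewrite (gt_eqF d0) implybT.
by rewrite (_ : 1 - p + (p - 1) = 0) ?powRr0 ?mulr1//; [rewrite mulrCA|ring].
Qed.

(** Comparing z with a free level d takes the place of Hoelder's inequality: on the whole space it
    bounds the L^1 norm, on small events it gives uniform integrability. *)
Lemma powR_bound P z p C (A : set (Omega R)) d : measurable_fun setT z -> (forall w, 0 <= z w) ->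
  1 <= p -> (\int[P]_w (z w `^ p)%:E <= C%:E)%E -> measurable A -> 0 < d ->
  itg P z /\ Ex P (fun w => \1_A w * z w) <= d * fine (P A) + d `^ (1 - p) * C.
Proof.
move=> mz z0 p1 HC mA d0; have dp := powR_gt0 (1 - p) d0.
have mzp : measurable_fun setT (fun w => z w `^ p) by exact: (measurableT_comp (measurable_powR _) mz).
have izp : itg P (fun w => z w `^ p).
  apply/integrableP; split; first exact/measurable_EFinP.
  apply: le_lt_trans (ltry C); apply: le_trans HC; rewrite le_eqVlt; apply/orP; left; apply/eqP.
  by apply: eq_integral => w _; rewrite /= ger0_norm// powR_ge0.
have ip := itgZ (d `^ (1 - p)) izp.
have iz : itg P z.
  apply: (itg_le (y := fun w => 1 + 1 `^ (1 - p) * z w `^ p)) => //.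
    by apply: itgD; [exact: itg_cst|exact: itgZ].
  apply: nearW => w; rewrite (ger0_norm (z0 w)) ger0_norm; first exact: powR_young.
  by rewrite addr_ge0// mulr_ge0// powR_ge0.
have iA := itgZ d (itg_indic P mA).
split=> //; rewrite -(Ex_indic P mA) -ExZ; last exact: itg_indic.
have : Ex P (fun w => z w `^ p) <= C by rewrite -lee_fin -ExE.
move=> /(ler_wpM2l (ltW dp)); rewrite -ExZ// => h; apply: le_trans (lerD (lexx _) h).
rewrite -ExD//; apply: Ex_le => [||w].
- apply: (itg_le (y := z)) => //; first by apply: measurable_funM => //; exact: measurable_indic.
  apply: nearW => w; rewrite normrM indicE; case: (w \in A); rewrite ?normr1 ?mul1r//.
  by rewrite normr0 mul0r.
- exact: itgD.
- rewrite indicE; case: (w \in A); rewrite ?mul1r ?mulr1 ?mul0r ?mulr0 ?add0r.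
    exact: powR_young.
  by rewrite mulr_ge0// ?powR_ge0// ltW.
Qed.

Lemma Ghat_le (X : Omega R -> \bar R) c : (forall P, PS P -> (\int[P]_w X w <= c)%E) ->
  (Ghat slo shi X <= c)%E.
Proof. by move=> H; apply: ge_ereal_sup => _ [P PP <-]; exact: H. Qed.

Lemma Ghat_ge (X : Omega R -> \bar R) P : PS P -> (\int[P]_w X w <= Ghat slo shi X)%E.
Proof. by move=> PP; apply: ereal_sup_ubound; exists P. Qed.

Lemma Ghat_ge0 (X : Omega R -> \bar R) : (forall w, (0 <= X w)%E) -> (0 <= Ghat slo shi X)%E.
Proof. by move=> X0; apply: le_trans (Ghat_ge X PS0); apply: integral_ge0. Qed.

Lemma qs_fin (D : Omega R -> \bar R) p C : measurable_fun setT D -> 0 < p ->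
  (forall P, PS P -> (\int[P]_w (`|D w| `^ p)%E <= C%:E)%E) -> qs (fun w => D w \is a fin_num).
Proof.
move=> mD p0 H; pose A := D @^-1` [set +oo; -oo]%E.
have mA : measurable A.
  rewrite -[X in measurable X]setTI; apply: (_ : measurable_fun setT _) => //.
  by apply: measurableU; exact: emeasurable_set1.
suff PA P : PS P -> P A = 0%E.
  apply: filterS (qs_null mA PA) => w /= nA; rewrite fin_numE; apply/andP; split; apply/eqP => h; apply: nA; rewrite /A /= h; [by right|by left].
move=> PP; have mDp : measurable_fun setT (fun w => `|D w| `^ p)%E.
  apply: (measurableT_comp (measurable_poweR _)); exact: measurableT_comp.
have iD : P.-integrable setT (fun w => `|D w| `^ p)%E.
  apply/integrableP; split=> //; apply: le_lt_trans (ltry C); apply: le_trans (H P PP).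
  rewrite le_eqVlt; apply/orP; left; apply/eqP.
  by apply: eq_integral => w _; rewrite gee0_abs// poweR_ge0.
have [N [mN N0 HN]] := integrable_ae measurableT iD.
apply/eqP; rewrite eq_le measure_ge0 andbT -N0; apply: le_measure; rewrite ?inE//.
by move=> w Aw; apply: HN => /= /(_ I); case: Aw => -> /=; rewrite gt_eqF.
Qed.

Lemma Gnorm_small p (D : nat -> Omega R -> \bar R) d : 0 < p -> 0 < d ->
  Gnorm slo shi p (D k) @[k --> \oo] --> 0%E ->
  exists k, forall P, PS P -> (\int[P]_w (`|D k w| `^ p) <= (d `^ p)%:E)%E.
Proof.
move=> p0 d0 H; have d0E : (0 < d%:E)%E by rewrite lte_fin.
have [k _ /(_ k (leqnn k)) hk] : \forall k \near \oo, (Gnorm slo shi p (D k) < d%:E)%E.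
  exact: (H _ (open_ereal_lt' d0E)).
exists k => P PP; apply: le_trans (Ghat_ge _ PP) _.
have G0 : (0 <= Ghat slo shi (fun w => `|D k w| `^ p))%E by apply: Ghat_ge0 => w; exact: poweR_ge0.
move: hk; rewrite /Gnorm; set g := Ghat slo shi _ in G0 * => hk.
have -> : g = ((g `^ p^-1) `^ p)%E by rewrite -poweRrM mulVf ?gt_eqF// poweRe1.
rewrite -poweR_EFin; apply: (gt0_ler_poweR (ltW p0)); last exact: ltW.
  by rewrite in_itv /= poweR_ge0 leey.
by rewrite in_itv /= leey andbT ltW.
Qed.

(** X is finite q.s. because some |xi k - X|^p with real-valued [xi k] has finite G-expectation. *)
Lemma LG_G1 t p (X : Omega R -> \bar R) : (0 <= t)%E -> 1 <= p -> LG slo shi p t X ->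
  qs (fun w => X w = (fine (X w))%:E) /\ G1 t (fun w => fine (X w)).
Proof.
move=> t0 p1 [mX [xi [Lxi Hxi]]]; have p0 : 0 < p by exact: lt_le_trans p1.
have cx k : exists2 Phi, cyl t Phi & xi k = Phi \o pv by exact: (LipP _ t0).1 (Lxi k).
have mxi k : measurable_fun setT (xi k) by have [Phi c ->] := cx k; exact: cyl_measurable c.
pose x w := fine (X w); have mx : measurable_fun setT x by exact: measurableT_comp.
have mD k : measurable_fun setT (fun w => (xi k w)%:E - X w)%E.
  by apply: emeasurable_funB => //; exact/measurable_EFinP.
have fX : qs (fun w => X w = (x w)%:E).
  have [k hk] := Gnorm_small p0 ltr01 Hxi.
  apply: filterS (qs_fin (mD k) p0 hk) => w h; rewrite /x fineK//.
  by move: h; case: (X w).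
(* At level d the two terms of [powR_bound] are d and d^(1-p) d^p = d. *)
have near d : 0 < d -> exists k, forall P, PS P -> itg P (fun w => `|xi k w - x w|) /\
    Ex P (fun w => `|xi k w - x w|) <= 2 * d.
  move=> d0; have [k hk] := Gnorm_small p0 d0 Hxi; exists k => P PP.
  have mz : measurable_fun setT (fun w => `|xi k w - x w|).
    by apply: measurableT_comp => //; exact: measurable_funB.
  have hz : (\int[P]_w (`|xi k w - x w| `^ p)%:E <= (d `^ p)%:E)%E.
    apply: le_trans (hk P PP); rewrite le_eqVlt; apply/orP; left; apply/eqP; apply: ae_eq_integral => //.
    - apply/measurable_EFinP; exact: (measurableT_comp (measurable_powR _) mz).
    - apply: (measurableT_comp (measurable_poweR _)); exact: measurableT_comp.
    by apply: filterS (qs_ae PP fX) => w -> _; rewrite -poweR_EFin.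
  have [iz] := powR_bound mz (fun w => normr_ge0 _) p1 hz measurableT d0; split=> //.
  move: b; rewrite probability_setT /= mulr1 -powRD ?(gt_eqF d0) ?implybT//.
  rewrite (_ : 1 - p + p = 1); last by ring.
  rewrite powRr1 ?(ltW d0)// => h; rewrite mulr_natl mulr2n; apply: le_trans h.
  rewrite le_eqVlt; apply/orP; left; apply/eqP; congr Ex; apply/funext => w.
  by rewrite indicE in_setT mul1r.
split=> //; have rxi k : rv (xi k) by have [Phi c ->] := cx k; exact: rv_cyl c.
have rx : rv x.
  have [k hk] := near 1 ltr01; have rd : rv (fun w => xi k w - x w).
    split; first exact: measurable_funB.
    exists (2 * 1) => P PP; have [h1 h2] := hk P PP; split=> //.
    by apply: (itg_le _ h1); [exact: measurable_funB|apply: nearW => w; rewrite normr_id].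
  have := rvB (rxi k) rd; congr rv; apply/funext => w; ring.
split=> // e e0; have e2 : 0 < e / 2 by rewrite divr_gt0.
have [k hk] := near _ e2; have [Phi c xk] := cx k; exists Phi => // P PP.
have [_] := hk P PP; rewrite xk; move/le_trans; apply; by rewrite mulrC divfK.
Qed.

Lemma Ghat_dist (X Y : Omega R -> \bar R) x y c : measurable_fun setT X -> measurable_fun setT Y ->
  rv x -> rv y -> qs (fun w => X w = (x w)%:E) -> qs (fun w => Y w = (y w)%:E) ->
  nle (fun w => x w - y w) c -> (Ghat slo shi (fun w => `|X w - Y w|) <= c%:E)%E.
Proof.
move=> mX mY rx ry Xx Yy xy; apply: Ghat_le => P PP.
have r := rv_norm (rvB rx ry); apply: le_trans (_ : (Ex P (fun w => `|x w - y w|))%:E <= _)%E.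
  rewrite -ExE; last exact: rv_itg r PP.
  rewrite le_eqVlt; apply/orP; left; apply/eqP; apply: ae_eq_integral => //.
  - by apply: measurableT_comp => //; exact: emeasurable_funB.
  - by apply/measurable_EFinP; exact: rv_meas r.
  by apply: filterS2 (qs_ae PP Xx) (qs_ae PP Yy) => w -> ->.
by rewrite lee_fin; exact: xy.
Qed.

(** * Introduction rules for the spaces of the statement *)

Section Intro.
Variables (t : \bar R).
Hypothesis t0 : (0 <= t)%E.

Lemma L0_intro (X : Omega R -> \bar R) x : measurable_fun setT X -> adp t x ->
  qs (fun w => X w = (x w)%:E) -> L0_ slo shi t X.
Proof.
move=> mX [f mf xf] Xx; split=> //; exists (EFin \o f \o @stop R t).
  by apply/(F_measurableP _ t0); exists (EFin \o f) => //; exact/measurable_EFinP.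
by apply: filterS2 Xx xf => w -> ->.
Qed.

Lemma bbL1_intro (X : Omega R -> \bar R) x : measurable_fun setT X -> rv x -> adp t x ->
  qs (fun w => X w = (x w)%:E) -> bbL1 slo shi t X.
Proof.
move=> mX rx ax Xx; split; first exact: L0_intro Xx.
have [c c0 hc] := rv_bound rx; apply: le_lt_trans (ltry c).
have := @Ghat_dist X (fun=> 0%E) x (fun=> 0) c mX (measurable_cst _) rx (rv_cst 0) Xx.
rewrite (_ : (fun w => `|X w - 0|)%E = fun w => `|X w|%E); last by apply/funext => w; rewrite sube0.
apply; first exact: qs_all.
by rewrite (_ : (fun w => x w - 0) = x)//; apply/funext => w; rewrite subr0.
Qed.

Lemma cvg_half_ereal (u : nat -> \bar R) : (forall k, (0 <= u k)%E) -> (forall k, (u k <= (2^-1 ^+ k)%:E)%E) ->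
  u k @[k --> \oo] --> 0%E.
Proof.
move=> u0 uk; apply: (@squeeze_cvge _ _ _ _ (fun=> 0%E) _ (fun k => (2^-1 ^+ k)%:E)).
- by apply: nearW => k; rewrite u0 uk.
- exact: cvg_cst.
- apply: cvg_EFin; first exact: nearW.
  by apply: cvg_expr; rewrite ger0_norm// invf_lt1// ltr1n.
Qed.

Lemma LG_intro (X : Omega R -> \bar R) x : measurable_fun setT X -> G1 t x ->
  qs (fun w => X w = (x w)%:E) -> LG slo shi 1 t X.
Proof.
move=> mX [rx Gx] Xx; split=> //.
have H k : exists Phi, cyl t Phi /\ nle (fun w => Phi (pv w) - x w) (2^-1 ^+ k).
  by have [|Phi c h] := Gx (2^-1 ^+ k); [rewrite exprn_gt0//|exists Phi].
pose f k := sval (cid (H k)); have cf k : cyl t (f k) by rewrite /f; case: cid => ? [].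
have hf k : nle (fun w => f k (pv w) - x w) (2^-1 ^+ k) by rewrite /f; case: cid => ? [].
exists (fun k => f k \o pv); split=> [k|]; first exact: Lip_cyl.
have E k : Gnorm slo shi 1 (fun w => (f k (pv w))%:E - X w)%E =
    Ghat slo shi (fun w => `|(f k (pv w))%:E - X w|)%E.
  rewrite /Gnorm invr1 poweRe1; last by apply: Ghat_ge0 => w; exact: poweR_ge0.
  by congr Ghat; apply/funext => w; rewrite poweRe1// abse_ge0.
rewrite (_ : (fun k => _) = fun k => Ghat slo shi (fun w => `|(f k (pv w))%:E - X w|)%E); last exact/funext.
apply: cvg_half_ereal => k; first by apply: Ghat_ge0 => w; exact: abse_ge0.
apply: (@Ghat_dist _ _ (fun w => f k (pv w)) x) => //.
- by apply/measurable_EFinP; exact: cyl_measurable (cf k).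
- exact: rv_cyl (cf k).
- exact: qs_all.
Qed.

Lemma LG1s_intro (X : Omega R -> \bar R) x : measurable_fun setT X -> Gs t x ->
  qs (fun w => X w = (x w)%:E) -> LG1s slo shi t X.
Proof.
move=> mX Gx Xx; have [rx [xi [Gxi Hxi]]] := Gx.
split; first by apply: bbL1_intro Xx => //; exact: Gs_adp.
exists (fun k w => (xi k w)%:E); split=> [k|].
  apply: (LG_intro (x := xi k)) => //; last exact: qs_all.
  by apply/measurable_EFinP; exact: rv_meas (G1_rv (Gxi k)).
apply: filterS2 Xx Hxi => w -> [h1 h2]; split=> [k|]; first by rewrite lee_fin.
by apply: cvg_EFin => //; exact: nearW.
Qed.

Lemma LG1ss_intro (X : Omega R -> \bar R) x : measurable_fun setT X -> Gss t x ->
  qs (fun w => X w = (x w)%:E) -> LG1ss slo shi t X.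
Proof.
move=> mX Gx Xx; have [rx [xi [Gxi Hxi]]] := Gx.
split; first by apply: bbL1_intro Xx => //; exact: Gss_adp.
exists (fun k w => (xi k w)%:E); split=> [k|].
  apply: (LG1s_intro (x := xi k)) => //; last exact: qs_all.
  by apply/measurable_EFinP; exact: rv_meas (Gs_rv (Gxi k)).
apply: filterS2 Xx Hxi => w -> [h1 h2]; split=> [k|]; first by rewrite lee_fin.
by apply: cvg_EFin => //; exact: nearW.
Qed.

Lemma LG1ss_bar_intro (X : Omega R -> \bar R) x : measurable_fun setT X -> Gb t x ->
  qs (fun w => X w = (x w)%:E) -> LG1ss_bar slo shi t X.
Proof.
move=> mX Gx Xx; have [rx Hx] := Gx.
split; first by apply: bbL1_intro Xx => //; exact: Gb_adp.
have H k : exists y, Gss t y /\ nle (fun w => y w - x w) (2^-1 ^+ k).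
  by have [|y c h] := Hx (2^-1 ^+ k); [rewrite exprn_gt0//|exists y].
pose f k := sval (cid (H k)); have cf k : Gss t (f k) by rewrite /f; case: cid => ? [].
have hf k : nle (fun w => f k w - x w) (2^-1 ^+ k) by rewrite /f; case: cid => ? [].
have mf k : measurable_fun setT (EFin \o f k) by apply/measurable_EFinP; exact: rv_meas (Gss_rv (cf k)).
exists (fun k => EFin \o f k); split=> [k|].
  by apply: (LG1ss_intro (x := f k)) => //; exact: qs_all.
apply: cvg_half_ereal => k; first by apply: Ghat_ge0 => w; exact: abse_ge0.
apply: (@Ghat_dist _ _ (f k) x) => //; [exact: Gss_rv (cf k)|exact: qs_all].
Qed.

Lemma LG1s_Gs (I : Omega R -> R) : rv I -> LG1s slo shi t (EFin \o I) -> Gs t I.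
Proof.
move=> rI [_ [xi [Lxi Hxi]]]; split=> //; exists (fun k w => fine (xi k w)).
have G k := LG_G1 t0 (lexx 1) (Lxi k).
split=> [k|]; first by have [] := G k.
apply: filterS2 Hxi (qs_forall (fun k => (G k).1)) => w [h1 h2] h; split=> [k|].
  by rewrite -lee_fin -!h.
by apply: fine_cvg; move: h2; rewrite /=.
Qed.

End Intro.

(** * Versions of the conditional expectation [Gcond] *)

Section GcondE.
Variables (t : R) (X : Omega R -> \bar R) (x y : Omega R -> R).
Hypotheses (t0 : 0 <= t) (mX : measurable_fun setT X) (Xx : qs (fun w => X w = (x w)%:E)).
Hypotheses (Gx : Gb +oo x) (G : GC t x y).
Let t0E : (0 <= t%:E)%E. Proof. by rewrite lee_fin. Qed.

Lemma is_Gcond_intro (Y : Omega R -> \bar R) : measurable_fun setT Y ->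
  qs (fun w => Y w = (y w)%:E) -> is_Gcond slo shi t%:E X Y.
Proof.
move=> mY Yy; split.
- by apply: LG1ss_bar_intro Xx => //; exact: leey.
- by apply: L0_intro Yy => //; exact: GC_adp G.
- by move=> P PP; exact: (GC_esssup t0 mX G Xx PP mY Yy).
Qed.

(** Essential suprema under one P agree almost surely, and the set where two versions differ is a
    single Borel set for all P. *)
Lemma is_Gcond_unique (Y Y' : Omega R -> \bar R) : is_Gcond slo shi t%:E X Y ->
  is_Gcond slo shi t%:E X Y' -> qs (fun w => Y w = Y' w).
Proof.
move=> [_ [mY _] H] [_ [mY' _] H'].
have mN : measurable (~` [set w | Y w = Y' w]).
  apply: measurableC; rewrite -[X in measurable X]setTI; exact: emeasurable_fun_eq.
suff N0 P : PS P -> P (~` [set w | Y w = Y' w]) = 0%E.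
  by apply: filterS (qs_null mN N0) => w /= /contrapT.
move=> PP; have [_ h1 h2] := H P PP; have [_ h1' h2'] := H' P PP.
have [N [mN' N0 HN]] : {ae P, forall w, Y w = Y' w}.
  have := h2' _ mY h1; apply: filterS2 (h2 _ mY' h1') => w a b.
  by apply: le_anti; rewrite a b.
by apply/eqP; rewrite eq_le measure_ge0 andbT -N0; apply: le_measure; rewrite ?inE.
Qed.

Lemma Gcond_GC : measurable_fun setT (Gcond slo shi t%:E X) /\
  qs (fun w => Gcond slo shi t%:E X w = (y w)%:E).
Proof.
have my : measurable_fun setT (EFin \o y) by apply/measurable_EFinP; exact: rv_meas (GC_rvr G).
have I0 : is_Gcond slo shi t%:E X (EFin \o y) by apply: is_Gcond_intro => //; exact: qs_all.
have I1 : is_Gcond slo shi t%:E X (Gcond slo shi t%:E X) by exact: (xgetPex _ (ex_intro _ _ I0)).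
by split; [have [_ [h _] _] := I1|exact: is_Gcond_unique I1 I0].
Qed.

Lemma is_Gcond_GC (Y : Omega R -> \bar R) : is_Gcond slo shi t%:E X Y ->
  measurable_fun setT Y /\ qs (fun w => Y w = (y w)%:E).
Proof.
have my : measurable_fun setT (EFin \o y) by apply/measurable_EFinP; exact: rv_meas (GC_rvr G).
have I0 : is_Gcond slo shi t%:E X (EFin \o y) by apply: is_Gcond_intro => //; exact: qs_all.
by move=> IY; split; [have [_ [h _] _] := IY|exact: is_Gcond_unique IY I0].
Qed.

End GcondE.

(** * Products, pasting and stopped sequences *)

Local Notation "n %:t" := (n%:R%:E : \bar R) (at level 2, format "n %:t").

Let nat0 n : (0 <= n%:t)%E. Proof. by rewrite lee_fin. Qed.
Let nat0R n : 0 <= n%:R :> R. Proof. by []. Qed.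
Let natS n : (n%:t <= n.+1%:t)%E. Proof. by rewrite lee_fin ler_nat. Qed.

Lemma cvgn_max2 (u v : nat -> R) a b : u n @[n --> \oo] --> a -> v n @[n --> \oo] --> b ->
  Num.max (u n) (v n) @[n --> \oo] --> Num.max a b.
Proof.
move=> ua vb; have E (c d : R) : Num.max c d = Num.max (c - d) 0 + d.
  by case: (leP c d) => h; [rewrite max_r ?add0r// subr_le0|rewrite max_l ?subrK// subr_ge0 ltW].
rewrite E; under eq_fun do rewrite E.
by apply: cvgnD => //; apply: cvgn_max; apply: cvgB.
Qed.

Lemma Gs_max t x y : Gs t x -> Gs t y -> Gs t (fun w => Num.max (x w) (y w)).
Proof.
move=> [rx [xi [Gxi Hx]]] [ry [yi [Gyi Hy]]]; split; first exact: rv_max.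
exists (fun k w => Num.max (xi k w) (yi k w)); split=> [k|]; first exact: G1_max.
apply: filterS2 Hx Hy => w [h1 h2] [h3 h4]; split=> [k|]; last exact: cvgn_max2.
by rewrite ge_max !le_max h1 h3 orbT.
Qed.

(** y is a decreasing limit, so 1 - y is an increasing one, and products of nonnegative increasing
    sequences increase. This covers an x that is itself an increasing limit of elements of L_G^1. *)
Lemma Gss_prod t (a : nat -> Omega R -> R) x y : (forall n, G1 t (a n)) -> (forall n w, 0 <= a n w) ->
  rv x -> qs (fun w => (forall n, a n w <= a n.+1 w) /\ a n w @[n --> \oo] --> x w) ->
  Gs t y -> (forall w, 0 <= y w <= 1) -> Gss t (fun w => (1 - y w) * x w).
Proof.
move=> Ga a0 rx ax Gy y01; have [xi Gxi H] := Gs_unit Gy y01.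
have b (z : Omega R -> R) w : (forall w, 0 <= z w <= 1) -> `|1 - z w| <= 1.
  by move=> /(_ w)/andP[? ?]; rewrite ger0_norm; lra.
split.
  apply: (rv_mul (K := 1)) => // [|w]; last exact: b.
  by apply: measurable_funB => //; exact: rv_meas (Gs_rv Gy).
exists (fun n w => (1 - xi n w) * a n w); split=> [n|].
  apply/G1_Gs; apply: (G1_mul (K := 1)) => //.
    by apply: G1B; [exact: G1_cst|exact: (Gxi n).1].
  by move=> w; apply: b; exact: (Gxi n).2.
apply: filterS2 ax H => w [h1 h2] [h3 h4]; split=> [n|].
  have /andP[x0 x1] := (Gxi n).2 w; have /andP[x0' x1'] := (Gxi n.+1).2 w.
  by apply: ler_pM => //; [lra|have := h3 n; lra].
by apply: cvgM => //; apply: cvgB => //; exact: cvg_cst.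
Qed.

Lemma GC_ub t x y z : 0 <= t -> GC t x y -> rv z -> adp t%:E z ->
  (forall Q B, PS Q -> measurable B ->
     Ex Q (fun w => \1_(past t B) w * x w) <= Ex Q (fun w => \1_(past t B) w * z w)) ->
  qs (fun w => y w <= z w).
Proof.
move=> t0 G rz az H; have [rx ry ay _ _] := G; have [B mB HB] := adp_gt ay az.
have rm : rv (fun w => Num.max (y w - z w) 0) by apply: rv_max; [exact: rvB|exact: rv_cst].
have : qs (fun w => Num.max (y w - z w) 0 = 0).
  apply: qs_zero => // [w|P e PP e0]; first by rewrite le_max lexx orbT.
  rewrite (E_eq PP rm (rv_past t (rvB ry rz) mB)); last first.
    by apply: filterS HB => w ->; case: ltP => h; rewrite ?mul1r ?mul0r; [rewrite max_l//|rewrite max_r//]; lra.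
  have -> : Ex P (fun w => \1_(past t B) w * (y w - z w)) =
      Ex P (fun w => \1_(past t B) w * y w) - Ex P (fun w => \1_(past t B) w * z w).
    rewrite -(E_B PP); [|exact: rv_past|exact: rv_past].
    by congr Ex; apply/funext => w; rewrite mulrBr.
  have [Q PQ HQ] := GC_attain t0 G PP e0.
  by have := HQ B mB; have := H Q B (from_PS PQ) mB; rewrite (@from_past _ t0 P Q B z)//; lra.
by apply: filterS => w h; have : y w - z w <= 0; [rewrite -h le_max lexx|lra].
Qed.

Lemma adp_bool t (T : Omega R -> bool) : adp t (fun w => (T w)%:R) ->
  exists2 B, measurable B & qs (fun w => T w = (w \in @stop R t @^-1` B)).
Proof.
move=> [f mf Tf]; exists (f @^-1` [set 1]).
  by rewrite -[X in measurable X]setTI; apply: (mf measurableT); exact: measurable_set1.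
apply: filterS Tf => w h; apply/idP/idP; rewrite inE /= -h; first by move=> ->.
by case: (T w) => // /esym/eqP; rewrite oner_eq0.
Qed.

Lemma pastI t B B' : past t (B `&` B') = past t B `&` past t B'.
Proof. by []. Qed.

(** On an event of F_t the variable may be replaced by an F_t-measurable one: a measure of P(t, P)
    that is nearly optimal for x remains so for the pasted variable. *)
Lemma GC_paste t x y z (T : Omega R -> bool) : 0 <= t -> GC t x y -> rv z -> adp t%:E z ->
  adp t%:E (fun w => (T w)%:R) -> measurable_fun setT (fun w => (T w)%:R : R) ->
  GC t (fun w => if T w then z w else x w) (fun w => if T w then z w else y w).
Proof.
move=> t0 G rz az aT mT; have [rx ry ay H1 H2] := G; have [B mB HB] := adp_bool aT.
have mC := measurableC mB.
have r1 (u : Omega R -> R) : rv u -> rv (fun w => \1_(past t (~` B)) w * u w + \1_(past t B) w * z w).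
  by move=> ru; apply: rvD; exact: rv_past.
have qE (u : Omega R -> R) : qs (fun w => \1_(past t (~` B)) w * u w + \1_(past t B) w * z w =
    if T w then z w else u w).
  apply: filterS HB => w ->; rewrite pastC !indicE in_setC.
  by case: (w \in _) => /=; rewrite ?mul1r ?mul0r ?add0r ?addr0.
have mE (u : Omega R -> R) : rv u -> measurable_fun setT (fun w => if T w then z w else u w).
  move=> ru; rewrite (_ : (fun w => _) = (fun w => u w + (T w)%:R * (z w - u w))).
    apply: measurable_funD; first exact: rv_meas ru.
    by apply: measurable_funM => //; apply: measurable_funB; [exact: rv_meas rz|exact: rv_meas ru].
  by apply/funext => w; case: (T w); rewrite ?mul1r ?mul0r ?addr0// addrC subrK.
apply: (GC_eq _ (mE _ rx) (mE _ ry) (qE x) (qE y)); split; [exact: r1|exact: r1| | |].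
- by apply: adpD; exact: adp_past.
- move=> P A PP mA.
  have D (u : Omega R -> R) : rv u -> Ex P (fun w => \1_(past t A) w *
      (\1_(past t (~` B)) w * u w + \1_(past t B) w * z w)) =
      Ex P (fun w => \1_(past t (A `&` ~` B)) w * u w) + Ex P (fun w => \1_(past t (A `&` B)) w * z w).
    have mI B' : measurable B' -> measurable (A `&` B') by exact: measurableI.
    move=> ru; rewrite -(E_D PP); [|by apply: rv_past => //; exact: mI|by apply: rv_past => //; exact: mI].
    by congr Ex; apply/funext => w; rewrite !pastI !indicI mulrDr !mulrA.
  by rewrite !D// lerD2r; apply: H1 => //; exact: measurableI.
move=> P e PP e0; have [Q PQ HQ] := GC_attain t0 G PP e0; exists Q => //; have PQ' := from_PS PQ.
rewrite (E_D PP); [|exact: rv_past|exact: rv_past].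
rewrite (E_D PQ'); [|exact: rv_past|exact: rv_past].
by rewrite (@from_past _ t0 P Q B z)//; have := HQ _ mC; lra.
Qed.

(** With T n standing for {sigma <= n}, this is a at time min(sigma, n), described by indicators
    only so that the approximation classes apply step by step. *)
Fixpoint stp (U : Type) (T : nat -> Omega R -> bool) (a : nat -> Omega R -> U) n w : U :=
  if n is m.+1 then if T m w then stp T a m w else a n w else a 0%N w.

Definition gc t x : Omega R -> R := xget (fun=> 0) [set y | GC t x y].

Lemma gcP t x : (exists y, GC t x y) -> GC t x (gc t x).
Proof. by move=> h; exact: xgetPex h. Qed.

(** * Optimal stopping *)

Section Snell.
Variables (x : nat -> Omega R -> R) (s : Omega R -> R).
Hypothesis Gx : forall n, G1 n%:t (x n).
Hypothesis rs : rv s.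
Hypothesis s_ge0 : forall w, 0 <= s w.
Hypothesis xs : qs (fun w => forall n, `|x n w| <= s w).
Hypothesis UI : forall e, 0 < e -> exists2 d, 0 < d & forall P A, PS P -> measurable A ->
  fine (P A) <= d -> Ex P (fun w => \1_A w * s w) <= e.

(** Real counterpart of [Vback], built from chosen versions of the conditional expectations. *)
Fixpoint vb N k : Omega R -> R :=
  if k is k'.+1 then fun w => Num.max (x (N - k) w) (gc (N - k)%:R (vb N k') w) else x N.

Definition v N n := vb N (N - n).

Let rx n : rv (x n) := G1_rv (Gx n).
Let ax n : adp n%:t (x n). Proof. by apply: G1_adp (Gx n). Qed.

Lemma vb_G1 N k : (k <= N)%N -> G1 (N - k)%:t (vb N k).
Proof.
elim: k => [|k IH] kN; first by rewrite subn0.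
have G : G1 +oo (vb N k) by apply: G1_le (IH (ltnW kN)); exact: leey.
have Gg := gcP (GC_G1_ex (nat0R (N - k.+1)) G).
by apply: G1_max => //; exact: (GC_G1 _ G Gg).
Qed.

Lemma v_G1 N n : (n <= N)%N -> G1 n%:t (v N n).
Proof. by move=> nN; have := @vb_G1 N (N - n) (leq_subr _ _); rewrite subKn. Qed.

Lemma vN N : v N N = x N.
Proof. by rewrite /v subnn. Qed.

Lemma vS N n : (n < N)%N -> v N n = fun w => Num.max (x n w) (gc n%:R (v N n.+1) w).
Proof.
move=> nN; rewrite /v -(subnSK nN) /=.
by rewrite subnSK// subKn// ltnW.
Qed.

Lemma v_gc N n : (n < N)%N -> GC n%:R (v N n.+1) (gc n%:R (v N n.+1)).
Proof. by move=> nN; apply/gcP/GC_G1_ex => //; apply: G1_le (v_G1 nN); exact: leey. Qed.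

Lemma x_le_v N n w : (n <= N)%N -> x n w <= v N n w.
Proof.
rewrite leq_eqVlt => /orP[/eqP ->|nN]; first by rewrite vN.
by rewrite vS// le_max lexx.
Qed.

Lemma v_rv N n : (n <= N)%N -> rv (v N n). Proof. by move/v_G1/G1_rv. Qed.

Lemma v_incr N n : (n <= N)%N -> qs (fun w => v N n w <= v N.+1 n w).
Proof.
move=> nN; rewrite -(subKn nN); elim: (N - n)%N (leq_subr n N) => [|k IH] kN.
  by rewrite subn0 vN; apply: qs_all => w; exact: x_le_v.
have h := subnSK kN; have lt : (N - k.+1 < N)%N by rewrite ltn_subrL (leq_ltn_trans _ kN).
have lt' : (N - k.+1 < N.+1)%N by rewrite ltnS ltnW.
rewrite (vS lt) (vS lt').
have g1 := v_gc lt; have g2 := v_gc lt'.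
have := GC_le (nat0R _) g1 g2; rewrite h => /(_ (IH (ltnW kN))).
by apply: filterS => w hw; rewrite ge_max !le_max lexx hw orbT.
Qed.

(** s is merely a measurable majorant, whereas the supremum of the |x n| is an increasing limit of
    elements of L_G^1 and therefore has conditional expectations. *)
Lemma sup_x : exists S, [/\ rv S, Gss +oo S, qs (fun w => forall n, `|x n w| <= S w) &
  qs (fun w => S w <= s w)].
Proof.
pose m := fix m N (w : Omega R) : R := if N is N'.+1 then Num.max (m N' w) `|x N w| else `|x 0%N w|.
have Gm N : G1 +oo (m N).
  have Gn n : G1 +oo (fun w => `|x n w|) by apply: G1_norm; apply: G1_le (Gx n); exact: leey.
  by elim: N => [|N IH] //=; exact: G1_max.
have ms : qs (fun w => forall N, m N w <= s w).
  by apply: filterS xs => w h; elim=> [|N IH] /=; [exact: h|rewrite ge_max IH h].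
have mi : qs (fun w => forall N, m N w <= m N.+1 w).
  by apply: qs_all => w N /=; rewrite le_max lexx.
have [c c0 hc] := rv_bound rs.
have mb P n : PS P -> Ex P (m n) <= c.
  move=> PP; apply: le_trans (hc P PP); apply: E_le => //; [exact: G1_rv|exact: rv_norm|].
  by apply: filterS ms => w h; exact: le_trans (h n) (ler_norm _).
have [S [rS Sl Su]] := monotone_limit (fun n => G1_rv (Gm n)) mi mb.
exists S; split=> //.
- split=> //; exists m; split=> [N|]; first exact/G1_Gs.
  by apply: filterS2 mi Sl.
- apply: filterS Su => w h n; apply: le_trans (h n); case: n => //= n.
  by rewrite le_max lexx orbT.
- by apply: filterS2 ms Sl => w h1 h2; apply: (cvgn_le h2); exact: nearW.
Qed.

(** The conditional expectations u n of the supremum dominate x n and satisfy E_n[u (n + 1)] = u n,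
    so backward induction keeps every [v N n] below u n, uniformly in N. *)
Lemma v_bound : exists u : nat -> Omega R -> R,
  [/\ forall n, rv (u n), exists2 S, qs (fun w => 0 <= S w <= s w) & forall n, GC n%:R S (u n),
      qs (fun w => forall n, 0 <= u n w) &
      forall N n, (n <= N)%N -> qs (fun w => v N n w <= u n w)].
Proof.
have [S [rS GS xS Ss]] := sup_x; pose u n := gc n%:R S.
have Gu n : GC n%:R S (u n) by apply/gcP/GC_Gss_ex.
have S0 : qs (fun w => 0 <= S w <= s w).
  by apply: filterS2 xS Ss => w h1 ->; rewrite andbT (le_trans (normr_ge0 _) (h1 0%N)).
have xu n : qs (fun w => x n w <= u n w).
  apply: (GC_le (nat0R n) (GC_id (rx n) (ax n)) (Gu n)).
  by apply: filterS xS => w h; exact: le_trans (ler_norm _) (h n).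
exists u; split=> [n||| N n nN]; first exact: GC_rvr (Gu n).
- by exists S.
- apply: qs_forall => n; apply: (GC_le (nat0R n) (GC_id (rv_cst 0) (adp_cst _ 0)) (Gu n)).
  by apply: filterS S0 => w /andP[].
rewrite -(subKn nN); elim: (N - n)%N (leq_subr n N) => [|k IH] kN; first by rewrite subn0 vN.
have h := subnSK kN; have lt : (N - k.+1 < N)%N by rewrite ltn_subrL (leq_ltn_trans _ kN).
rewrite vS//; set p := (N - k.+1)%N in h lt *.
have g2 : GC p%:R (u p.+1) (u p).
  by apply: (GC_tower_inv _ _ (Gu p) (Gu p.+1)) => //; rewrite ler_nat.
have := GC_le (nat0R _) (v_gc lt) g2; rewrite h => /(_ (IH (ltnW kN))).
by apply: filterS2 (xu p) => w h1 h2; rewrite ge_max h1.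
Qed.

(** The last clause is uniform integrability of the value process: |V n| is at most s + u n, and on
    an event of F_n a nearly optimal measure reduces the expectation of u n to that of s. *)
Lemma value_ex : exists V : nat -> Omega R -> R, [/\ forall n, Gss n%:t (V n),
  forall n, qs (fun w => (forall N, v (n + N) n w <= v (n + N).+1 n w) /\
     v (n + N) n w @[N --> \oo] --> V n w),
  qs (fun w => forall n, x n w <= V n w),
  forall n, exists2 g, GC n%:R (V n.+1) g & qs (fun w => V n w = Num.max (x n w) (g w)) &
  forall e, 0 < e -> exists2 d, 0 < d & forall n B, measurable B ->
    (forall P, PS P -> fine (P (past n%:R B)) <= d) ->
    nle (fun w => \1_(past n%:R B) w * V n w) e].
Proof.
have [u [ru [S S0 Gu] u0 vu]] := v_bound.
have iV n : qs (fun w => forall N, v (n + N) n w <= v (n + N.+1) n w).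
  by apply: qs_forall => N; rewrite addnS; exact: v_incr (leq_addr _ _).
have H n : exists Vn, [/\ rv Vn, qs (fun w => v (n + N) n w @[N --> \oo] --> Vn w) &
    qs (fun w => forall N, v (n + N) n w <= Vn w)].
  have [c c0 hc] := rv_bound (ru n).
  have [||Vn [h1 h2 h3]] := monotone_limit (x := fun N => v (n + N) n) (c := c) _ (iV n).
  - by move=> N; exact: v_rv (leq_addr _ _).
  - move=> P N PP; apply: le_trans (hc P PP); apply: E_le => //; [exact: v_rv (leq_addr _ _)|exact: rv_norm|].
    by apply: filterS (vu _ _ (leq_addr N n)) => w h; exact: le_trans h (ler_norm _).
  by exists Vn.
pose V n := sval (cid (H n)).
have rV n : rv (V n) by rewrite /V; case: cid => ? [].
have lV n : qs (fun w => v (n + N) n w @[N --> \oo] --> V n w) by rewrite /V; case: cid => ? [].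
have uV n : qs (fun w => forall N, v (n + N) n w <= V n w) by rewrite /V; case: cid => ? [].
have xV : qs (fun w => forall n, x n w <= V n w).
  apply: qs_forall => n; apply: filterS (uV n) => w h; apply: le_trans (h 0%N).
  exact: x_le_v (leq_addr _ _).
have Vu : qs (fun w => forall n, V n w <= u n w).
  apply: qs_forall => n; apply: filterS2 (lV n) (qs_forall (fun N => vu _ _ (leq_addr N n))) => w h1 h2.
  by apply: (cvgn_le h1); exact: nearW.
exists V; split=> //.
- move=> n; split=> //; exists (fun N => v (n + N) n); split=> [N|].
    by apply/G1_Gs; exact: v_G1 (leq_addr _ _).
  by apply: filterS2 (iV n) (lV n) => w h1 h2; split=> // k; rewrite h1.
- by move=> n; apply: filterS2 (iV n) (lV n) => w h1 h2; split=> // N; rewrite -addnS.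
- move=> n; have lt N : (n < n.+1 + N)%N by rewrite addSn ltnS leq_addr.
  have [||g [Gg lg _]] := GC_up (t := n%:R) (x := fun N => v (n.+1 + N) n.+1)
     (y := fun N => gc n%:R (v (n.+1 + N) n.+1)) (x0 := V n.+1) _ (rV _) (fun N => v_gc (lt N)).
  - exact: nat0R.
  - by apply: filterS2 (iV n.+1) (lV n.+1) => w h1 h2; split=> // k; rewrite h1.
  exists g => //; apply: filterS2 (lV n) lg => w h1 h2.
  have h3 : v (n + N.+1) n w @[N --> \oo] --> V n w.
    by have := h1; rewrite -(cvg_shiftS (fun N => v (n + N) n w)).
  have h4 : Num.max (x n w) (gc n%:R (v (n.+1 + N) n.+1) w) @[N --> \oo] --> Num.max (x n w) (g w).
    by apply: cvgn_max2 => //; exact: cvg_cst.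
  have E : (fun N => v (n + N.+1) n w) = fun N => Num.max (x n w) (gc n%:R (v (n.+1 + N) n.+1) w).
    by apply/funext => N; rewrite addnS -addSn vS.
  by rewrite E in h3; exact: (cvg_unique _ h3 h4).
move=> e e0; have e4 : 0 < e / 4 by rewrite divr_gt0.
have [d d0 Hd] := UI e4; exists d => // n B mB HB P PP.
have mA := past_measurable n%:R mB.
have rA (y : Omega R -> R) : rv y -> rv (fun w => \1_(past n%:R B) w * y w) by move=> ry; exact: rv_past.
have h1 : Ex P (fun w => \1_(past n%:R B) w * s w) <= e / 4 by apply: Hd => //; exact: HB.
have h2 : Ex P (fun w => \1_(past n%:R B) w * u n w) <= e / 4 + e / 4.
  have [Q PQ HQ] := GC_attain (nat0R n) (Gu n) PP e4; have PQ' := from_PS PQ.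
  have rS := GC_rvl (Gu n).
  have : Ex Q (fun w => \1_(past n%:R B) w * S w) <= Ex Q (fun w => \1_(past n%:R B) w * s w).
    apply: E_le => //; [exact: rA|exact: rA|apply: filterS S0 => w /andP[_ h]].
    by rewrite ler_wpM2l// indicE.
  by have := HQ B mB; have := Hd Q _ PQ' mA (HB Q PQ'); lra.
apply: le_trans (_ : Ex P (fun w => \1_(past n%:R B) w * s w + \1_(past n%:R B) w * u n w) <= _).
  apply: E_le => //; [exact/rv_norm/rA|by apply: rvD; exact: rA|].
  apply: filterS2 (filterI xV xs) (filterI Vu u0) => w [a b] [c' d'].
  rewrite normrM -mulrDr ger0_norm ?indicE// ler_wpM2l//.
  have := a n; have := b n; have := c' n; have := d' n; rewrite ler_norml => ? ? /andP[? ?] ?.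
  by have := s_ge0 w; rewrite ler_norml => ?; apply/andP; split; lra.
by rewrite (E_D PP); [lra|exact: rA|exact: rA].
Qed.

End Snell.

(* [T n w] stands for $\sigma(\omega)\le n$. *)
Definition stopping (T : nat -> Omega R -> bool) :=
  [/\ forall k, Gs k%:t (fun w => (T k w)%:R), forall k w, T k w -> T k.+1 w &
      forall d, 0 < d -> exists N, forall P, PS P -> Ex P (fun w => (~~ T N w)%:R) <= d].

Lemma stp_notT (U : Type) (T : nat -> Omega R -> bool) (a : nat -> Omega R -> U) n w : (forall k w, T k w -> T k.+1 w) -> ~~ T n w -> stp T a n w = a n w.
Proof. by move=> TS; case: n => //= n nT; rewrite ifN//; apply: contra nT; exact: TS. Qed.

(** * Stopped payoffs and the supermartingale bound *)

Section Optional.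
Variables (x : nat -> Omega R -> R) (s : Omega R -> R).
Hypothesis Gx : forall n, G1 n%:t (x n).
Hypothesis rs : rv s.
Hypothesis s_ge0 : forall w, 0 <= s w.
Hypothesis xs : qs (fun w => forall n, `|x n w| <= s w).
Hypothesis UI : forall e, 0 < e -> exists2 d, 0 < d & forall P A, PS P -> measurable A ->
  fine (P A) <= d -> Ex P (fun w => \1_A w * s w) <= e.
Let rx n : rv (x n) := G1_rv (Gx n).

(** A version of the payoff at the stopping time; where stopping never occurs, only the bound by s
    is prescribed. *)
Definition stopped (T : nat -> Omega R -> bool) y :=
  measurable_fun setT y /\
  qs (fun w => `|y w| <= s w /\ forall k, T k w -> y w = stp T x k w).

Section StoppingTime.
Variable T : nat -> Omega R -> bool.
Hypothesis sT : stopping T.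
Let TG k : Gs k%:t (fun w => (T k w)%:R). Proof. by have [] := sT. Qed.
Let TS k w : T k w -> T k.+1 w. Proof. by have [_ H _] := sT; exact: H. Qed.
Let T01 k w : 0 <= ((T k w)%:R : R) <= 1. Proof. by case: (T k w); rewrite lexx ler01. Qed.

Lemma stopping_le k n w : (k <= n)%N -> T k w -> T n w.
Proof. by move=> kn Tk; rewrite -(subnKC kn); elim: (n - k)%N => [|m IH]; rewrite ?addn0// addnS TS. Qed.

Lemma notT_measurable k : measurable [set w | ~~ T k w].
Proof.
have := rv_meas (Gs_rv (TG k)) => mT.
rewrite (_ : [set w | ~~ T k w] = (fun w => (T k w)%:R : R) @^-1` [set 0]).
  by rewrite -[X in measurable X]setTI; apply: (mT measurableT); exact: measurable_set1.
apply/seteqP; split=> w /=; first by move/negbTE ->.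
by case: (T k w) => // /eqP; rewrite oner_eq0.
Qed.

Lemma notT_ind k : (fun w => (~~ T k w)%:R) = \1_[set w | ~~ T k w] :> (Omega R -> R).
Proof.
apply/funext => w; rewrite indicE; congr (_%:R); apply: congr1.
by apply/idP/idP; rewrite inE.
Qed.

Lemma notT_rv n : rv (fun w => (~~ T n w)%:R * s w).
Proof. by have := rv_ind rs (notT_measurable n); rewrite -notT_ind. Qed.

Lemma stopping_small e : 0 < e -> exists N, forall n, (N <= n)%N ->
  nle (fun w => (~~ T n w)%:R * s w) e.
Proof.
move=> e0; have [d d0 Hd] := UI e0; have [_ _ /(_ d d0)[N HN]] := sT.
exists N => n Nn P PP; have mN := notT_measurable n.
have E w : (~~ T n w)%:R = \1_[set w | ~~ T n w] w :> R by rewrite -notT_ind.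
have -> : Ex P (fun w => `|(~~ T n w)%:R * s w|) = Ex P (fun w => \1_[set w | ~~ T n w] w * s w).
  by congr Ex; apply/funext => w; rewrite E ger0_norm// mulr_ge0// indicE.
apply: Hd => //; rewrite -(Ex_indic P mN); apply: le_trans (HN P PP).
rewrite notT_ind; apply: Ex_le => [||w]; [exact: itg_indic|by apply: itg_indic; exact: notT_measurable|].
rewrite -!notT_ind ler_nat; have := @stopping_le N n w Nn.
by case: (T N w); case: (T n w) => // /(_ isT).
Qed.

(** The increment at step n + 1 is x (n + 1) - x n plus the indicator of {sigma <= n} times x n - x
    (n + 1). The indicator is a decreasing limit and its factor is in L_G^1, so [Gss_ind]
    applies. *)
Lemma stp_Gss n : Gss n%:t (stp T x n).
Proof.
elim: n => [|n IH]; first exact/Gs_Gss/G1_Gs.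
have G : Gss n.+1%:t (fun w => stp T x n w + (x n.+1 w - x n w) + (T n w)%:R * (x n w - x n.+1 w)).
  have Gxn : G1 n.+1%:t (x n) by exact: G1_le (natS n) (Gx n).
  apply: GssD; first apply: GssD.
  - exact: Gss_le (natS n) IH.
  - by apply/Gs_Gss/G1_Gs; apply: G1B.
  - by apply: Gss_ind => //; [exact: G1B|exact: Gs_le (natS n) (TG n)].
move: G; congr (Gss _ _); apply/funext => w /=.
case: ifPn => [_|nT]; first by rewrite mul1r; ring.
by rewrite stp_notT// mul0r; ring.
Qed.

Lemma stp_bound : qs (fun w => forall n, `|stp T x n w| <= s w).
Proof. by apply: filterS xs => w h; elim=> [|n IH] /=; [exact: h|case: ifP]. Qed.

Variable y : Omega R -> R.
Hypothesis sy : stopped T y.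

Lemma stopped_rv : rv y.
Proof.
have [my ys] := sy; apply: (rv_dom my rs); apply: filterS ys => w [h _].
exact: le_trans h (ler_norm _).
Qed.

(** Truncating the stopping time at N changes the payoff only on {sigma > N}, and there by at most
    2s. *)
Lemma stopped_Gb : Gb +oo y.
Proof.
split; first exact: stopped_rv.
move=> e e0; have e2 : 0 < e / 2 by rewrite divr_gt0.
have [N HN] := stopping_small e2; have [my ys] := sy.
exists (stp T x N); first by apply: Gss_le (stp_Gss N); exact: leey.
have rN := notT_rv N.
have rp := Gss_rv (stp_Gss N).
apply: (nle_le (y := fun w => (~~ T N w)%:R * s w + (~~ T N w)%:R * s w)).
- exact: rvB rp stopped_rv.
- exact: rvD.
- apply: filterS2 ys stp_bound => w [h1 yT] h2; have [TN|nT] := boolP (T N w).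
    by rewrite (yT _ TN) subrr normr0.
  rewrite !mul1r [leRHS]ger0_norm; last by rewrite addr_ge0.
  by apply: le_trans (ler_normB _ _) _; rewrite lerD.
by rewrite [e]splitr; apply: nleD => //; exact: HN.
Qed.

End StoppingTime.

Variable V : nat -> Omega R -> R.
Hypothesis GV : forall n, Gss n%:t (V n).
Hypothesis lV : forall n, qs (fun w => (forall N, v x (n + N) n w <= v x (n + N).+1 n w) /\
  v x (n + N) n w @[N --> \oo] --> V n w).
Hypothesis xV : qs (fun w => forall n, x n w <= V n w).
Hypothesis dyn : forall n, exists2 g, GC n%:R (V n.+1) g & qs (fun w => V n w = Num.max (x n w) (g w)).
Hypothesis tailV : forall e, 0 < e -> exists2 d, 0 < d & forall n B, measurable B ->
    (forall P, PS P -> fine (P (past n%:R B)) <= d) ->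
    nle (fun w => \1_(past n%:R B) w * V n w) e.
Let rV n : rv (V n) := Gss_rv (GV n).
Let aV n : adp n%:t (V n). Proof. by apply: Gss_adp (GV n). Qed.

Section Supermartingale.
Variables (T : nat -> Omega R -> bool) (j : nat) (y : Omega R -> R).
Hypothesis sT : stopping T.
Hypothesis Tj : forall k w, (k < j)%N -> ~~ T k w.
Hypothesis sy : stopped T y.
Let TS k w : T k w -> T k.+1 w. Proof. by have [_ H _] := sT; exact: H. Qed.

Lemma stopped_super Q B : PS Q -> measurable B ->
  Ex Q (fun w => \1_(past j%:R B) w * y w) <= Ex Q (fun w => \1_(past j%:R B) w * V j w).
Proof.
move=> PQ mB; have [TG _ _] := sT; have [my ys] := sy; have ry := stopped_rv sy.
(* [Z] is V up to and including the stopping time and the payoff from the next step on. It is a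
   supermartingale from j on, and it equals V j at time j because stopping does not occur before
   j. *)
pose Z n w := if n is m.+1 then if T m w then stp T x m w else V n w else V 0%N w.
have xZ : qs (fun w => forall n, stp T x n w <= Z n w).
  by apply: filterS xV => w h [|n] /=; [exact: h|case: ifP].
have ZV n w : ~~ T n w -> Z n w = V n w.
  by case: n => //= n nT; rewrite ifN//; apply: contra nT; exact: TS.
have rp n : rv (stp T x n) := Gss_rv (stp_Gss sT n).
have ap n : adp n%:t (stp T x n) by apply: Gss_adp (stp_Gss sT n).
have aT n : adp n%:t (fun w => (T n w)%:R) by apply: Gs_adp (TG n).
have mT n : measurable_fun setT (fun w => (T n w)%:R : R) by exact: rv_meas (Gs_rv (TG n)).
have G n : exists2 h, GC n%:R (Z n.+1) h & qs (fun w => h w <= Z n w).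
  have [g Gg Vg] := dyn n; have Gp := GC_paste (nat0R n) Gg (rp n) (ap n) (aT n) (mT n).
  exists (fun w => if T n w then stp T x n w else g w) => //.
  apply: filterS2 Vg xZ => w h1 h2; case: ifPn => [_|nT]; first exact: h2.
  by rewrite ZV// h1 le_max lexx orbT.
have rZ n : rv (Z n) by case: n => [|n]; [exact: rV|have [h /GC_rvl] := G n].
have key n : (j <= n)%N -> Ex Q (fun w => \1_(past j%:R B) w * Z n w) <=
    Ex Q (fun w => \1_(past j%:R B) w * V j w).
  move=> jn; rewrite -(subnKC jn); elim: (n - j)%N => [|k IH].
    rewrite addn0 le_eqVlt; apply/orP; left; apply/eqP; congr Ex; apply/funext => w.
    by congr (_ * _); case: j Tj => //= m H; rewrite ifN// H.
  rewrite addnS; apply: le_trans IH; have [h Gh hZ] := G (j + k)%N.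
  have jk : (j%:t <= (j + k)%:t)%E by rewrite lee_fin ler_nat leq_addr.
  have -> : past j%:R B = past (j + k)%:R (past j%:R B).
    by apply/seteqP; split=> w; rewrite /past /= stop_stop.
  have mB' := past_measurable j%:R mB.
  apply: le_trans (GC_past Gh PQ mB') _.
  apply: E_le => //; [exact: rv_past (GC_rvr Gh) _|exact: rv_past|].
  by apply: filterS hZ => w hw; rewrite ler_wpM2l// indicE.
apply/ler_addgt0Pr => e e0; have e2 : 0 < e / 2 by rewrite divr_gt0.
have [N HN] := stopping_small sT e2; pose n := maxn N j.
have := HN n (leq_maxl _ _) Q PQ => hn; have jn : (j <= n.+1)%N by rewrite leqW// leq_maxr.
have rN := notT_rv sT n.
apply: le_trans (lerD (key _ jn) (lexx e)).
(* Where stopping has not occurred by time n, the payoff is at most s while [Z] is at least x (n +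
   1), hence at least -s; this costs 2s. *)
apply: le_trans (_ : Ex Q (fun w => \1_(past j%:R B) w * Z n.+1 w +
    2 * `|(~~ T n w)%:R * s w|) <= _); last first.
  rewrite (E_D PQ); [|exact: rv_past|exact/rvZ/rv_norm].
  by rewrite lerD2l ExZ; [lra|exact: rv_itg (rv_norm rN) PQ].
apply: E_le => //; [exact: rv_past|by apply: rvD; [exact: rv_past|exact/rvZ/rv_norm]|].
apply: filterS2 (filterI ys xs) xV => w [[h1 yT] h2] h3; rewrite /=.
have [Tn|nT] := boolP (T n w).
  by rewrite (yT _ Tn) mul0r normr0 mulr0 addr0.
rewrite mul1r (ger0_norm (s_ge0 w)) indicE; have s0 := s_ge0 w; case: (w \in _) => /=; last by rewrite !mul0r add0r; lra.
rewrite !mul1r; have := h2 n.+1; have := h3 n.+1; move: h1; rewrite !ler_norml => /andP[? ?] ? /andP[? ?].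
lra.
Qed.

Lemma stopped_le z : GC j%:R y z -> qs (fun w => z w <= V j w).
Proof.
move=> G; apply: (GC_ub _ G (rV j) (aV j)) => // Q B PQ mB.
exact: stopped_super.
Qed.

End Supermartingale.

Fixpoint hit (j n : nat) w : bool :=
  if n is m.+1 then hit j m w || ((j <= n)%N && (V n w == x n w))
  else (j <= 0)%N && (V 0%N w == x 0%N w).

(* $1_{\{V_n=X_n\}}=\lim_N\downarrow(1-N(\tilde V_n^{n+N}-X_n))^+$ *)
Lemma contact_Gs n : Gs n%:t (fun w => (V n w == x n w)%:R).
Proof.
have me : measurable_fun setT (fun w => (V n w == x n w)%:R : R).
  rewrite (_ : (fun w => _) = \1_((fun w => V n w - x n w) @^-1` [set 0])).
    apply: measurable_indic; rewrite -[X in measurable X]setTI.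
    by apply: (measurable_funB (rv_meas (rV n)) (rv_meas (rx n))) => //; exact: measurable_set1.
  apply/funext => w; rewrite indicE; congr (_%:R); apply: congr1.
  by rewrite -subr_eq0; apply/eqP/idP; rewrite inE.
split.
  by apply: (@rv_bounded _ 1) => // w; rewrite ger0_norm// lern1 leq_b1.
exists (fun N w => Num.max (1 - N%:R * (v x (n + N) n w - x n w)) 0); split=> [N|].
  apply: G1_max; last exact: G1_cst.
  by apply: G1B; [exact: G1_cst|apply: G1Z; apply: G1B => //; exact: (v_G1 Gx (leq_addr _ _))].
apply: filterS2 (lV n) xV => w [h1 h2] h3.
have d0 N : 0 <= v x (n + N) n w - x n w by rewrite subr_ge0; exact: x_le_v (leq_addr _ _).
split=> [N|].
  rewrite ge_max; apply/andP; split; last by rewrite le_max lexx orbT.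
  rewrite le_max; apply/orP; left.
  rewrite lerD2l lerN2; apply: ler_pM => //; rewrite ?ler_nat//.
  by rewrite lerD2r addnS.
have [E|ne] := eqVneq (V n w) (x n w).
  rewrite (_ : (fun N => _) = fun=> 1); first exact: cvg_cst.
  apply/funext => N; rewrite (_ : v x (n + N) n w = x n w) ?subrr ?mulr0 ?subr0 ?max_l//.
  apply: le_anti; rewrite x_le_v ?leq_addr// andbT -E.
  have nd : {homo (fun N => v x (n + N) n w) : a b / (a <= b)%N >-> a <= b}.
    by apply: homo_leq => //; [exact: le_trans|move=> k; rewrite addnS].
  by apply: (cvgn_ge h2); exists N => // m /= Nm; exact: nd.
have gap : 0 < V n w - x n w by rewrite subr_gt0 lt_neqAle eq_sym ne h3.
have g2 : 0 < (V n w - x n w) / 2 by rewrite divr_gt0.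
have /cvgrPdist_lt/(_ _ g2)[N1 _ H1] := h2.
have [N2 HN2] : exists N2 : nat, 2 / (V n w - x n w) <= N2%:R.
  by exists (Num.truncn (2 / (V n w - x n w))).+1; apply/ltW/truncnS_gt.
apply: cvg_near_cst; exists (maxn N1 N2) => // N /=; rewrite geq_max => /andP[N1N N2N].
have := H1 N N1N => /= /(le_lt_trans (ler_norm _)) hN.
apply/max_r; rewrite subr_le0.
have h4 : 2 / (V n w - x n w) <= N%:R by apply: le_trans HN2 _; rewrite ler_nat.
have := ler_wpM2r (ltW g2) h4; rewrite (_ : _ * _ = 1) => [|]; last by field; rewrite gt_eqF.
by move=> h5; apply: le_trans h5 _; rewrite ler_wpM2l//; lra.
Qed.

(** * The first contact time and the stopped value process *)

Section Optimal.
Variable j : nat.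
Local Notation T := (hit j).
Local Notation M := (stp T V).

Lemma hit_Gs n : Gs n%:t (fun w => (T n w)%:R).
Proof.
elim: n => [|n IH] /=.
  by case: (j <= 0)%N => /=; [exact: contact_Gs|exact/G1_Gs/G1_cst].
have IH' := Gs_le (natS n) IH; case: (j <= n.+1)%N => /=.
  have := Gs_max IH' (contact_Gs n.+1); congr (Gs _ _); apply/funext => w.
  by case: (T n w); case: (V n.+1 w == x n.+1 w) => /=; rewrite ?maxxx// ?(max_l ler01) ?(max_r ler01).
by move: IH'; congr (Gs _ _); apply/funext => w; rewrite orbF.
Qed.

Lemma hitS n w : T n w -> T n.+1 w.
Proof. by move=> /= ->. Qed.

Lemma hit_lt k w : (k < j)%N -> ~~ T k w.
Proof.
elim: k => [|k IH] kj /=; first by rewrite leqNgt kj.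
by rewrite negb_or (IH (ltnW kj)) [(j <= _)%N]leqNgt kj.
Qed.

Lemma hit_stp n w : T n w -> M n w = stp T x n w.
Proof.
elim: n => [/andP[_ /eqP]//|n IH] /=; case: ifP => [Tn _|_ /=]; first exact: IH.
by move=> /andP[_ /eqP].
Qed.

Hypothesis sT : stopping T.

(** V is an increasing limit and the indicator of {tau <= n} a decreasing one, so their product is
    avoided. From contact on x takes the place of V, and the nonnegative excess V - x only appears
    with the factor 1 minus the indicator, which [Gss_prod] handles. *)
Lemma value_Gss n : Gss n%:t (M n).
Proof.
case: n => [|n]; first exact: GV.
pose a N w := v x (n.+1 + N) n.+1 w - x n.+1 w.
have Gp : Gss n.+1%:t (fun w => (1 - (T n w)%:R) * (V n.+1 w - x n.+1 w)).
  apply: (@Gss_prod _ a) => [N|N w||||w].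
  - by apply: G1B => //; exact: (v_G1 Gx (leq_addr _ _)).
  - by rewrite subr_ge0 x_le_v// leq_addr.
  - exact: rvB.
  - apply: filterS (lV n.+1) => w [h1 h2]; split=> [N|]; first by rewrite lerD2r addnS.
    by apply: cvgB => //; exact: cvg_cst.
  - exact: Gs_le (natS n) (hit_Gs n).
  - by case: (T n w); rewrite lexx ler01.
have := GssD (stp_Gss sT n.+1) Gp; congr (Gss _ _); apply/funext => w /=.
case: ifPn => [Tn|nT]; first by rewrite subrr mul0r addr0 hit_stp.
by rewrite subr0 mul1r addrC subrK.
Qed.

(** Without contact by time n the maximum in the recursion for V n is not x n, so V n is the
    conditional expectation of V (n + 1); after contact nothing moves. *)
Lemma value_step n : (j <= n)%N -> GC n%:R (M n.+1) (M n).
Proof.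
move=> jn; have [g Gg Vg] := dyn n.
have rM m : rv (M m) := Gss_rv (value_Gss m).
have aM : adp n%:t (M n) by apply: Gss_adp (value_Gss n).
have aT : adp n%:t (fun w => (T n w)%:R) by apply: Gs_adp (hit_Gs n).
have G := GC_paste (nat0R n) Gg (rM n) aM aT (rv_meas (Gs_rv (hit_Gs n))).
apply: (GC_eq G (rv_meas (rM n.+1)) (rv_meas (rM n))); first exact: qs_all.
apply: filterS Vg => w h; case: ifPn => // nT; rewrite (stp_notT V hitS nT).
have : V n w != x n w.
  by apply: contra nT => E; case: (n) jn E => /= [|m] -> ->; rewrite ?orbT.
rewrite h; case: (leP (x n w) (g w)) => //.
by rewrite eqxx.
Qed.

Lemma value_martingale m n : (j <= m)%N -> (m <= n)%N -> GC m%:R (M n) (M m).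
Proof.
move=> jm mn; rewrite -(subnKC mn); elim: (n - m)%N => [|k IH].
  by rewrite addn0; apply: GC_id; [exact: Gss_rv (value_Gss m)|apply: Gss_adp (value_Gss m)].
rewrite addnS; apply: (GC_tower _ _ (value_step _) IH) => //; first by rewrite ler_nat leq_addr.
exact: leq_trans jm (leq_addr _ _).
Qed.

Lemma value_at_j : M j = V j.
Proof.
apply/funext => w; case: j (@hit_lt) => //= k H; rewrite ifN//.
by have := H k w (ltnSn k).
Qed.

(** The stopped value at a large time n differs from the payoff only where contact has not occurred
    by n, by at most s + |V n|. Both terms are small there by uniform integrability, and the
    martingale property leads from n back to V j. *)
Lemma value_GC y : stopped T y -> GC j%:R y (V j).
Proof.
move=> sy; have [my ys] := sy; have ry := stopped_rv sy.
apply: GC_close => // e e0; have e2 : 0 < e / 2 by rewrite divr_gt0.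
have [N1 HN1] := stopping_small sT e2.
have [d d0 Hd] := tailV e2; have [_ _ /(_ d d0)[N2 HN2]] := sT.
pose n := maxn j (maxn N1 N2).
have jn : (j <= n)%N by exact: leq_maxl.
have N1n : (N1 <= n)%N by rewrite leq_max leq_maxl orbT.
have N2n : (N2 <= n)%N by rewrite leq_max leq_maxr !orbT.
exists (M n), (M j); split; first exact: value_martingale.
  have rM := Gss_rv (value_Gss n).
  have aT : adp n%:t (fun w => (T n w)%:R) by apply: Gs_adp (hit_Gs n).
  have [B mB HB] := adp_bool aT; have mC := measurableC mB.
  have small P : PS P -> fine (P (past n%:R (~` B))) <= d.
    move=> PP; have mp := past_measurable n%:R mC; rewrite -(Ex_indic P mp).
    apply: le_trans (HN2 P PP); apply: Ex_le_ae.
    - exact: itg_indic.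
    - by rewrite notT_ind; apply: itg_indic; exact: notT_measurable sT _.
    apply: filterS (qs_ae PP HB) => w h; rewrite indicE pastC in_setC /past -h ler_nat.
    by have := stopping_le sT N2n (w := w); case: (T N2 w); case: (T n w) => // /(_ isT).
  have hV := Hd n _ mC small.
  have rN := notT_rv sT n.
  have rB : rv (fun w => \1_(past n%:R (~` B)) w * V n w) by exact: rv_past.
  have := nleD (rv_norm rN) (rv_norm rB) (c := e / 2) (d := e / 2).
  have nn (z : Omega R -> R) c : nle z c -> nle (fun w => `|z w|) c.
    by move=> h P PP; under [X in Ex _ X]eq_fun do rewrite normr_id; exact: h.
  rewrite -splitr => /(_ (nn _ _ (HN1 n N1n)) (nn _ _ hV)).
  apply: nle_le; [exact: rvB|by apply: rvD; exact: rv_norm|].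
  apply: filterS2 HB ys => w h1 [h2 yT]; rewrite [leRHS]ger0_norm ?addr_ge0//.
  have [Tn|nT] := boolP (T n w).
    by rewrite (yT _ Tn) hit_stp// subrr normr0 addr_ge0.
  rewrite stp_notT//; last exact: hitS.
  rewrite indicE pastC in_setC /past -h1 nT !mul1r (ger0_norm (s_ge0 w)).
  by rewrite [leRHS]addrC; apply: le_trans (ler_normB _ _) _; rewrite lerD2l.
by rewrite value_at_j; under [X in nle X]eq_fun do rewrite subrr; exact/nle0/ltW.
Qed.

End Optimal.
End Optional.

(** [limn] of a divergent sequence is a default point, so the function is pieced together from the
    upper limit on the measurable set of convergence and a constant elsewhere. *)
Lemma measurable_limn (f : nat -> Omega R -> \bar R) : (forall n, measurable_fun setT (f n)) ->
  measurable_fun setT (fun w => limn (fun n => f n w)).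
Proof.
move=> mf; pose hi w := limn_esup (fun n => f n w); pose lo w := limn_einf (fun n => f n w).
have mhi : measurable_fun setT hi by exact: measurable_fun_limn_esup.
have mlo : measurable_fun setT lo.
  rewrite (_ : lo = fun w => (- limn_esup (fun n => - f n w))%E).
    apply: measurableT_comp => //; apply: measurable_fun_limn_esup => n; exact: measurableT_comp.
  by apply/funext => w; rewrite (limn_esupN (fun n => f n w)) oppeK.
have mE : measurable [set w | lo w = hi w].
  by rewrite -[X in measurable X]setTI; exact: emeasurable_fun_eq.
have cvP w : lo w = hi w -> cvgn (fun n => f n w).
  move=> E; apply/cvg_ex; exists (hi w).
  apply: (squeeze_cvge (f := einfs (fun n => f n w)) (h := esups (fun n => f n w))).
  - apply: nearW => n; apply/andP; split.
      by apply: ereal_inf_lbound; exists n => /=.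
    by apply: ereal_sup_ubound; exists n => /=.
  - by rewrite -E /lo limn_einf_lim; exact: is_cvg_einfs.
  - by rewrite /hi limn_esup_lim; exact: is_cvg_esups.
pose b w := `[< lo w = hi w >].
have mb : measurable_fun setT b.
  apply: (measurable_fun_bool true); rewrite setTI (_ : _ @^-1` _ = [set w | lo w = hi w])//.
  by apply/seteqP; split=> w /= /asboolP.
rewrite (_ : (fun w => _) = fun w => if b w then hi w else (point : \bar R)).
  by apply: measurable_fun_ifT => //; exact: measurable_cst.
apply/funext => w; rewrite /b; case: asboolP => E.
  by rewrite /hi is_cvg_limn_esupE//; exact: cvP.
apply: dvgP => cv; apply: E; rewrite /hi /lo.
by rewrite is_cvg_limn_esupE// is_cvg_limn_einfE.
Qed.

Lemma stp_measurable (T : nat -> Omega R -> bool) (a : nat -> Omega R -> \bar R) n :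
  (forall k, measurable [set w | T k w]) -> (forall k, measurable_fun setT (a k)) ->
  measurable_fun setT (stp T a n).
Proof.
move=> mT ma; elim: n => [|n IH] /=; first exact: ma.
have mb : measurable_fun setT (T n) by apply: (measurable_fun_bool true); rewrite setTI; exact: mT.
exact: (measurable_fun_ifT mb IH (ma n.+1)).
Qed.

Lemma stp_ext (U W : Type) (T T' : nat -> Omega R -> bool) (a : nat -> Omega R -> U)
  (b : nat -> Omega R -> W) (f : W -> U) w : (forall k, T k w = T' k w) ->
  (forall k, a k w = f (b k w)) -> forall n, stp T a n w = f (stp T' b n w).
Proof. by move=> TT ab; elim=> [|n IH] /=; rewrite ?ab// TT IH; case: ifP. Qed.

(** * Integer-valued random times *)

Section Times.
Variable sigma : Omega R -> \bar R.
Hypothesis sigma_val : forall w, sigma w = +oo%E \/ exists l, sigma w = l%:t.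
Definition before k w := (sigma w <= k%:t)%E.

Lemma beforeE k w l : sigma w = l%:t -> before k w = (l <= k)%N.
Proof. by rewrite /before => ->; rewrite lee_fin ler_nat. Qed.

Lemma beforeS k w : before k w -> before k.+1 w.
Proof. by move=> h; apply: le_trans h _; rewrite lee_fin ler_nat. Qed.

Lemma at_time_before (a : nat -> Omega R -> \bar R) k w : before k w -> at_time a sigma w = stp before a k w.
Proof.
case: (sigma_val w) => [E|[l E]]; first by rewrite /before E.
rewrite /at_time E /= natrK (beforeE _ E); elim: k => [|k IH] /=; first by rewrite leqn0 => /eqP ->.
rewrite (beforeE _ E); case: (leqP l k) => [lk _|kl lk]; first exact: IH.
by congr (a _ w); apply/eqP; rewrite eqn_leq lk.
Qed.

(** At +oo [fine] returns 0, so [at_time] falls back to the index 0. *)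
Lemma at_time_never (a : nat -> Omega R -> \bar R) w : (forall k, ~~ before k w) ->
  at_time a sigma w = a 0%N w.
Proof.
case: (sigma_val w) => [E _|[l E] /(_ l)]; first by rewrite /at_time E /= truncn0.
by rewrite (beforeE _ E) leqnn.
Qed.

Lemma at_time_min (a : nat -> Omega R -> \bar R) n w :
  at_time a (fun w => mine n%:t (sigma w)) w = stp before a n w.
Proof.
have [b|nb] := boolP (before n w).
  rewrite -at_time_before// /at_time; congr (a _ w); congr (Num.truncn (fine _)).
  exact/min_r.
rewrite (stp_notT a beforeS nb) /at_time min_l ?natrK//.
by apply: ltW; rewrite ltNge.
Qed.

Lemma at_time_measurable (a : nat -> Omega R -> \bar R) : (forall k, measurable [set w | before k w]) ->
  (forall k, measurable_fun setT (a k)) -> measurable_fun setT (at_time a sigma).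
Proof.
move=> mT ma _ A mA; rewrite setTI.
have -> : at_time a sigma @^-1` A = (\bigcup_k ([set w | before k w] `&` stp before a k @^-1` A)) `|`
    ((\bigcap_k ~` [set w | before k w]) `&` a 0%N @^-1` A).
  apply/seteqP; split=> w /=.
    move=> Aw; have [[k bk]|nb] := pselect (exists k, before k w).
      by left; exists k => //; split=> //=; rewrite -at_time_before.
    right; have nb' k : ~~ before k w by apply/negP => b; apply: nb; exists k.
    by split=> /=; [move=> k _; exact/negP|rewrite -at_time_never].
  case=> [[k _ [b]]|[nb]] /=; first by rewrite -at_time_before.
  by rewrite -at_time_never// => k; apply/negP; exact: nb.
apply: measurableU.
  apply: bigcup_measurable => k _; apply: measurableI; first exact: mT.
  by rewrite -[X in measurable X]setTI; apply: stp_measurable.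
apply: measurableI; first by apply: bigcap_measurable => // k _; exact: measurableC.
by rewrite -[X in measurable X]setTI; exact: ma.
Qed.

End Times.

Lemma capacity_small (A : nat -> set (Omega R)) d : 0 < d ->
  capacity slo shi (A N) @[N --> \oo] --> 0%E ->
  exists N, forall P, PS P -> (P (A N) <= d%:E)%E.
Proof.
move=> d0 H; have d0E : (0 < d%:E)%E by rewrite lte_fin.
have [N _ /(_ N (leqnn N)) hN] : \forall N \near \oo, (capacity slo shi (A N) < d%:E)%E.
  exact: (H _ (open_ereal_lt' d0E)).
exists N => P PP; apply: le_trans (ltW hN); apply: ereal_sup_ubound; by exists P.
Qed.

Lemma Tset_stopping j sigma : Tset slo shi j sigma -> stopping (before sigma).
Proof.
move=> [[s0 sG] sval scap].
have mI k : measurable_fun setT (fun w => (before sigma k w)%:R : R).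
  have [[[mX _] _] _] := sG k%:R (nat0R k).
  rewrite (_ : (fun w => _) = fine \o (fun w => (\1_[set w | (sigma w <= k%:t)%E] w)%:E)).
    exact: measurableT_comp.
  apply/funext => w /=; rewrite indicE; congr (_%:R); apply: congr1.
  by apply/idP/idP; rewrite inE.
split=> [k|k w|d d0]; last 2 first.
- exact: beforeS.
- have [N HN] := capacity_small d0 scap; exists N => P PP.
  have mN : measurable [set w | (N%:t < sigma w)%E].
    rewrite (_ : [set w | _] = (fun w => (before sigma N w)%:R : R) @^-1` [set 0]).
      by rewrite -[X in measurable X]setTI; apply: (mI N measurableT); exact: measurable_set1.
    apply/seteqP; split=> w /=; rewrite /before; first by rewrite ltNge => /negbTE ->.
    by case: leP => // _ /eqP; rewrite oner_eq0.
  rewrite (_ : Ex P _ = fine (P [set w | (N%:t < sigma w)%E])).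
    by rewrite -lee_fin fineK ?fin_num_measure// HN.
  rewrite -Ex_indic//; congr Ex; apply/funext => w; rewrite indicE; congr (_%:R); apply: congr1.
  by rewrite /before -ltNge; apply/idP/idP; rewrite inE.
apply: LG1s_Gs => //.
  by apply: (@rv_bounded _ 1) => // w; rewrite ger0_norm// lern1 leq_b1.
have := sG k%:R (nat0R k); congr (LG1s _ _ _ _); apply/funext => w /=; rewrite indicE.
by congr ((_%:R)%:E); apply: congr1; apply/idP/idP; rewrite inE.
Qed.

Lemma stopping_measurable (T : nat -> Omega R -> bool) k : stopping T -> measurable [set w | T k w].
Proof.
move=> sT; rewrite -[X in measurable X]setCK; apply: measurableC.
rewrite (_ : ~` _ = [set w | ~~ T k w]); first exact: notT_measurable sT k.
by apply/seteqP; split=> w /= /negP.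
Qed.

(** * From the hypotheses on X to the optimal stopping statement *)

Section Main.
Variables (beta : R) (X : nat -> Omega R -> \bar R).
Hypothesis beta1 : 1 < beta.
Hypothesis X_LG : forall n, LG slo shi beta n%:t (X n).
Hypothesis X_sup : (Ghat slo shi (fun w => ereal_sup (range (fun n => `|X n w| `^ beta))) < +oo)%E.
Local Notation x := (fun n w => fine (X n w)).
Let mX n : measurable_fun setT (X n). Proof. by have [] := X_LG n. Qed.
Let b0 : 0 < beta. Proof. exact: lt_trans beta1. Qed.
Let Gx n : G1 n%:t (x n).
Proof. by have [] := LG_G1 (nat0 n) (ltW beta1) (X_LG n). Qed.
Let Xx : qs (fun w => forall n, X n w = (x n w)%:E).
Proof. by apply: qs_forall => n; have [] := LG_G1 (nat0 n) (ltW beta1) (X_LG n). Qed.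

(** s is the power 1/beta of the supremum in the hypothesis, made real by [fine] at the cost of a
    set of capacity zero. *)
Lemma sup_power : exists (s : Omega R -> R) (C : R), [/\ measurable_fun setT s, forall w, 0 <= s w,
  qs (fun w => forall n, `|x n w| <= s w), 0 <= C &
  forall P, PS P -> (\int[P]_w (s w `^ beta)%:E <= C%:E)%E].
Proof.
pose Y w := ereal_sup (range (fun n => `|X n w| `^ beta))%E.
have HY : (Ghat slo shi Y < +oo)%E := X_sup.
have Y0 w : (0 <= Y w)%E.
  by apply: le_trans (poweR_ge0 _ _) (ereal_sup_ubound _); exists 0%N.
have mY : measurable_fun setT Y.
  have := @measurable_fun_esups _ _ R setT (fun n w => `|X n w| `^ beta)%E; rewrite /esups => H.
  have := H _ 0%N; rewrite (_ : (fun w => _) = Y).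
    by apply=> n; apply: (measurableT_comp (measurable_poweR _)); exact: measurableT_comp.
  by apply/funext => w; congr ereal_sup; apply/seteqP; split=> z /= [n _ <-]; exists n.
have G0 := Ghat_ge0 Y0; pose C := fine (Ghat slo shi Y).
have CE : C%:E = Ghat slo shi Y by rewrite fineK// ge0_fin_numE.
have hC P : PS P -> (\int[P]_w Y w <= C%:E)%E by rewrite CE; exact: Ghat_ge.
have fY : qs (fun w => Y w \is a fin_num).
  apply: (qs_fin (p := 1) (C := C)) => // P PP; apply: le_trans (hC P PP).
  rewrite le_eqVlt; apply/orP; left; apply/eqP; apply: eq_integral => w _.
  by rewrite gee0_abs// poweRe1.
have fY0 w : 0 <= fine (Y w) by exact: fine_ge0.
exists (fun w => fine (Y w) `^ beta^-1), C; split.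
- by apply: (measurableT_comp (measurable_powR _)); exact: measurableT_comp.
- by move=> w; exact: powR_ge0.
- apply: filterS2 Xx fY => w h1 h2 n.
  have : (`|X n w| `^ beta <= Y w)%E by apply: ereal_sup_ubound; exists n.
  rewrite h1 -[Y w]fineK// poweR_EFin lee_fin => h.
  have bi : 0 <= beta^-1 by rewrite invr_ge0 ltW.
  have := ge0_ler_powR bi (powR_ge0 _ _) (fY0 w) h.
  by rewrite -powRrM mulfV ?gt_eqF// powRr1// h1.
- exact: fine_ge0.
move=> P PP; apply: le_trans (hC P PP); rewrite le_eqVlt; apply/orP; left; apply/eqP.
apply: ae_eq_integral => //.
  apply/measurable_EFinP; apply: (measurableT_comp (measurable_powR _)).
  by apply: (measurableT_comp (measurable_powR _)); exact: measurableT_comp.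
apply: filterS (qs_ae PP fY) => w h _.
by rewrite -powRrM mulVf ?gt_eqF// powRr1// fineK.
Qed.

Lemma sup_uniform (s : Omega R -> R) (C : R) : measurable_fun setT s -> (forall w, 0 <= s w) -> 0 <= C ->
  (forall P, PS P -> (\int[P]_w (s w `^ beta)%:E <= C%:E)%E) ->
  rv s /\ forall e, 0 < e -> exists2 d, 0 < d & forall P A, PS P -> measurable A ->
  fine (P A) <= d -> Ex P (fun w => \1_A w * s w) <= e.
Proof.
move=> ms s0 C0 HC; split.
  split=> //; exists (1 + C) => P PP.
  have [h1 h2] := powR_bound ms s0 (ltW beta1) (HC P PP) measurableT ltr01; split=> //.
  move: h2; rewrite probability_setT powR1 !mul1r; apply: le_trans.
  rewrite le_eqVlt; apply/orP; left; apply/eqP; congr Ex; apply/funext => w.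
  by rewrite indicE in_setT mul1r ger0_norm.
move=> e e0; pose q := 2 * (C + 1) / e; have C1 : 0 < C + 1 by rewrite ltr_wpDl.
have q0 : 0 < q by rewrite divr_gt0// mulr_gt0.
have be : 0 < beta - 1 by rewrite subr_gt0.
(* [D] makes D^(1 - beta) C at most e/2; the bound e/(2D) on the probability of A takes care of the
   other half. *)
pose D := q `^ (beta - 1)^-1; have D0 : 0 < D by exact: powR_gt0.
have DE : D `^ (1 - beta) = e / (2 * (C + 1)).
  rewrite /D -powRrM (_ : _ * _ = - 1); last by field; rewrite gt_eqF.
  by rewrite powR_inv1 ?(ltW q0)// invf_div.
exists (e / (2 * D)); first by rewrite divr_gt0// mulr_gt0.
move=> P A PP mA hA.
have [_ h] := powR_bound ms s0 (ltW beta1) (HC P PP) mA D0; apply: le_trans h _.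
rewrite DE [leRHS]splitr lerD//.
  apply: le_trans (ler_wpM2l (ltW D0) hA) _.
  by rewrite le_eqVlt; apply/orP; left; apply/eqP; field; rewrite gt_eqF.
have -> : e / (2 * (C + 1)) * C = e / 2 * (C / (C + 1)) by field; rewrite gt_eqF.
by rewrite ler_piMr ?divr_ge0 ?(ltW e0)// ler_pdivrMr// mul1r lerDl.
Qed.

(** Each [Gcond] is determined only up to a set of capacity zero; countably many such choices still
    leave a single exceptional set for the limit. *)
Lemma Vback_E N k : (k <= N)%N -> measurable_fun setT (Vback slo shi X N k) /\
  qs (fun w => Vback slo shi X N k w = (vb x N k w)%:E).
Proof.
elim: k => [|k IH] kN.
  by split; [exact: mX|apply: filterS Xx => w h; exact: h].
have [mV qV] := IH (ltnW kN).
have G : G1 +oo (vb x N k).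
  by apply: G1_le (vb_G1 Gx (ltnW kN)); exact: leey.
have Gb' : Gb +oo (vb x N k) by exact/Gss_Gb/Gs_Gss/G1_Gs.
have Gg := gcP (GC_G1_ex (nat0R (N - k.+1)) G).
have [mG qG] := Gcond_GC (nat0R (N - k.+1)) mV qV Gb' Gg.
split; first by apply: measurable_maxe; [exact: mX|exact: mG].
by apply: filterS2 Xx qG => w /= -> ->; rewrite -EFin_max.
Qed.

Lemma Vtilde_measurable N n : measurable_fun setT (Vtilde slo shi X N n).
Proof. by have [] := Vback_E (leq_subr n N). Qed.

Lemma Vinf_measurable n : measurable_fun setT (Vinf slo shi X n).
Proof. by apply: measurable_limn => N; exact: Vtilde_measurable. Qed.

Lemma Vinf_E (V : nat -> Omega R -> R) :
  (forall n, qs (fun w => (forall N, v x (n + N) n w <= v x (n + N).+1 n w) /\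
     v x (n + N) n w @[N --> \oo] --> V n w)) ->
  qs (fun w => forall n, Vinf slo shi X n w = (V n w)%:E).
Proof.
move=> lV; apply: qs_forall => n.
have := qs_forall (fun N => (Vback_E (leq_subr n N)).2).
apply: filterS2 (lV n) => w [_ h1] h2; apply/cvg_lim => //.
have h3 : v x N n w @[N --> \oo] --> V n w.
  rewrite -(cvg_shiftn n (fun N => v x N n w)).
  by rewrite (_ : (fun N => _) = fun N => v x (n + N) n w)//; apply/funext => N; rewrite addnC.
rewrite (_ : (fun N => _) = fun N => (v x N n w)%:E); last first.
  by apply/funext => N; exact: h2.
by apply: cvg_EFin => //; exact: nearW.
Qed.

Lemma tau_value j w :
  (tau_opt slo shi X j w = +oo%E /\ forall l, (j <= l)%N -> Vinf slo shi X l w <> X l w) \/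
  exists m, [/\ (j <= m)%N, Vinf slo shi X m w = X m w,
    forall l, (j <= l)%N -> Vinf slo shi X l w = X l w -> (m <= l)%N &
    tau_opt slo shi X j w = m%:t].
Proof.
pose p l := (j <= l)%N && `[< Vinf slo shi X l w = X l w >].
have [[l pl]|np] := pselect (exists l, p l); last first.
  left; split=> [|l jl E]; last by apply: np; exists l; rewrite /p jl; exact/asboolP.
  rewrite /tau_opt (_ : [set _ | _ in _] = set0) ?ereal_inf0//.
  apply/seteqP; split=> // z /= [l [jl E] _].
  by apply: np; exists l; rewrite /p jl; exact/asboolP.
right; have ex : exists l, p l by exists l.
case: (ex_minnP ex) => m /andP[jm /asboolP Em] mmin; exists m.
have min l' : (j <= l')%N -> Vinf slo shi X l' w = X l' w -> (m <= l')%N.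
  by move=> jl E; apply: mmin; rewrite /p jl; exact/asboolP.
split=> //; apply/eqP; rewrite eq_le; apply/andP; split.
  by apply: ereal_inf_lbound; exists m.
by apply: le_ereal_inf_tmp => _ [l' [jl E] <-]; rewrite lee_fin ler_nat; exact: min.
Qed.

Lemma tau_before j k w : (tau_opt slo shi X j w <= k%:t)%E <->
  exists l, [/\ (j <= l)%N, (l <= k)%N & Vinf slo shi X l w = X l w].
Proof.
case: (tau_value j w) => [[-> H]|[m [jm Em min ->]]].
  by split=> // -[l [jl _ /(H l jl)]].
rewrite lee_fin ler_nat; split=> [mk|[l [jl lk E]]]; first by exists m.
exact: leq_trans (min l jl E) lk.
Qed.

Section ValueProcess.
Variable j : nat.
Local Notation tau := (tau_opt slo shi X j).
Hypothesis tau_fin : capacity slo shi [set w | (N%:t < tau w)%E] @[N --> \oo] --> 0%E.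

Let tau_val w : tau w = +oo%E \/ exists l, tau w = l%:t.
Proof. by case: (tau_value j w) => [[-> _]|[m [_ _ _ ->]]]; [left|right; exists m]. Qed.

Lemma hitP (V : nat -> Omega R -> R) k w : (forall n, X n w = (x n w)%:E) ->
  (forall n, Vinf slo shi X n w = (V n w)%:E) -> before tau k w = hit x V j k w.
Proof.
move=> Xw Vw; have E l : Vinf slo shi X l w = X l w <-> V l w = x l w.
  by rewrite Vw Xw; split=> [[]|->].
apply/idP/idP.
  move=> /tau_before[l [jl lk /E h]]; elim: k lk => [|k IH]; rewrite /=.
    by rewrite leqn0 => /eqP l0; rewrite -l0 jl h eqxx.
  by rewrite leq_eqVlt => /orP[/eqP <-|/IH ->//]; rewrite jl h eqxx orbT.
move=> h; apply/tau_before; elim: k h => [|k IH] /=.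
  by move=> /andP[j0 /eqP h]; exists 0%N; split=> //; exact/E.
by case/orP => [/IH[l [jl lk h]]|/andP[jk /eqP h]]; [exists l; split=> //; exact: leqW|exists k.+1; split=> //; exact/E].
Qed.

Lemma before_tau_measurable k : measurable [set w | before tau k w].
Proof.
rewrite (_ : [set w | _] = \bigcup_(l in [set l | (j <= l <= k)%N]) [set w | Vinf slo shi X l w = X l w]).
  apply: bigcup_measurable => l _; rewrite -[X in measurable X]setTI.
  by apply: emeasurable_fun_eq => //; exact: Vinf_measurable.
apply/seteqP; split=> w /=; first by move=> /tau_before[l [jl lk E]]; exists l; rewrite /= ?jl.
by move=> [l /= /andP[jl lk] E]; apply/tau_before; exists l.
Qed.

Lemma sigma_stopped s sigma : Tset slo shi j sigma -> qs (fun w => forall n, `|x n w| <= s w) ->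
  measurable_fun setT (at_time X sigma) /\
  qs (fun w => at_time X sigma w = (fine (at_time X sigma w))%:E) /\
  stopped x s (before sigma) (fun w => fine (at_time X sigma w)).
Proof.
move=> sT xs; have [_ sval _] := sT; have st := Tset_stopping sT.
have sv w : sigma w = +oo%E \/ exists l, sigma w = l%:t.
  by case: (sval w) => [->|[l _ ->]]; [left|right; exists l].
have mY : measurable_fun setT (at_time X sigma).
  by apply: at_time_measurable => // k; exact: stopping_measurable st.
split=> //; split; first by apply: filterS Xx => w h; rewrite /at_time h.
split; first exact: measurableT_comp.
apply: filterS2 Xx xs => w h hs; split=> [|k bk]; first exact: hs.
rewrite (at_time_before sv X bk); have := @stp_ext (\bar R) R (before sigma) (before sigma) X x EFin w.
by move=> ->.
Qed.

Lemma optimal_stopping :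
  let V := Vinf slo shi X in
  let M := fun n => at_time V (fun w => mine n%:t (tau w)) in
  [/\ Tset slo shi j tau /\ (forall n, LG1ss slo shi n%:t (M n)),
      Gmartingale_from slo shi j M,
      is_Gcond slo shi j%:t (at_time X tau) (V j),
      (forall sigma, Tset slo shi j sigma ->
         exists xi, is_Gcond slo shi j%:t (at_time X sigma) xi)
    & is_qs_esssup slo shi
        [set xi | exists2 sigma, Tset slo shi j sigma
                & is_Gcond slo shi j%:t (at_time X sigma) xi] (V j)].
Proof.
move=> V M; have [s [C [ms s0 xs C0 HC]]] := sup_power.
have [rs UI] := sup_uniform ms s0 C0 HC.
have [W [GW lW xW dyn tailW]] := value_ex Gx rs s0 xs UI.
have VW := Vinf_E lW.
have bh : qs (fun w => forall k, before tau k w = hit x W j k w).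
  by apply: filterS2 Xx VW => w h1 h2 k; exact: hitP.
have mV := Vinf_measurable.
have hG := hit_Gs Gx GW lW xW j.
have tT : Tset slo shi j tau.
  split=> //; last by move=> w; case: (tau_value j w) => [[-> _]|[m [jm _ _ ->]]]; [left|right; exists m].
  split=> [w|t t0].
    by case: (tau_val w) => [->|[l ->]]; [rewrite leey|rewrite lee_fin].
  (* The finite values of tau are integers, so {tau <= t} is already decided at the integer part of
     t. *)
  have kt : (Num.truncn t)%:R <= t by rewrite truncn_le.
  have bE w : (tau w <= t%:E)%E = before tau (Num.truncn t) w.
    rewrite /before; case: (tau_val w) => [->//|[l ->]].
    by rewrite !lee_fin ler_nat truncn_ge_nat.
  have E : [set w | (tau w <= t%:E)%E] = [set w | before tau (Num.truncn t) w].
    by apply/seteqP; split=> w /=; rewrite bE.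
  have q : qs (fun w => (\1_[set w | (tau w <= t%:E)%E] w)%:E = ((hit x W j (Num.truncn t) w)%:R)%:E :> \bar R).
    apply: filterS bh => w h; rewrite E indicE; congr ((_%:R)%:E); apply: congr1.
    by rewrite -h; apply/idP/idP; rewrite inE.
  apply: (LG1s_intro _ _ _ q).
  - by rewrite lee_fin.
  - by rewrite E; apply/measurable_EFinP; apply: measurable_indic; exact: before_tau_measurable.
  - by apply: Gs_le (hG _); rewrite lee_fin.
have sT : stopping (hit x W j).
  have [_ _ sm] := Tset_stopping tT; split=> [//|k w|d d0]; first exact: hitS.
  have [N HN] := sm d d0; exists N => P PP; apply: le_trans (HN P PP).
  have neg (b : Omega R -> bool) : Gs N%:t (fun w => (b w)%:R) -> rv (fun w => (~~ b w)%:R).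
    move=> /Gs_rv/(rvB (rv_cst 1)); congr rv; apply/funext => w.
    by case: (b w); rewrite /= ?subrr ?subr0.
  rewrite le_eqVlt; apply/orP; left; apply/eqP; apply: E_eq => //.
  - exact/neg/hG.
  - by apply: neg; have [] := Tset_stopping tT.
  by apply: filterS bh => w h; rewrite h.
have GM := value_Gss Gx GW lW xW sT.
have Mm := value_martingale Gx GW lW xW dyn sT.
have ME n : M n = stp (before tau) V n by apply/funext => w; exact: at_time_min.
have mM n : measurable_fun setT (M n).
  by rewrite ME; apply: stp_measurable => //; exact: before_tau_measurable.
have Mx n : qs (fun w => M n w = (stp (hit x W j) W n w)%:E).
  by rewrite ME; apply: filterS2 bh VW => w h1 h2; exact: (stp_ext (f := EFin)).
have GMb n : Gb +oo (stp (hit x W j) W n) by apply/Gss_Gb; apply: Gss_le (GM n); exact: leey.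
have [mY [Yy sy]] := sigma_stopped tT xs.
have sy' : stopped x s (hit x W j) (fun w => fine (at_time X tau w)).
  split; first exact: measurableT_comp.
  apply: filterS2 bh sy.2 => w h [h1 h2]; split=> // k hk; rewrite (h2 k) ?h//.
  exact: (stp_ext (f := id)).
have GY := stopped_Gb Gx rs s0 xs UI sT sy'.
have VG := value_GC Gx rs s0 UI GW lW xW dyn tailW sT sy'.
have VE : qs (fun w => V j w = (W j w)%:E) by apply: filterS VW => w h; exact: h.
have Icond : is_Gcond slo shi j%:t (at_time X tau) (V j).
  by apply: (is_Gcond_intro (nat0R j) mY Yy GY VG).
have other sigma : Tset slo shi j sigma -> exists y, [/\ Gb +oo (fun w => fine (at_time X sigma w)),
    GC j%:R (fun w => fine (at_time X sigma w)) y & qs (fun w => y w <= W j w)].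
  move=> tS; have st := Tset_stopping tS; have [mS [Sx ss]] := sigma_stopped tS xs.
  have GS := stopped_Gb Gx rs s0 xs UI st ss.
  have [y Gy] := GC_Gb_ex (nat0R j) GS; exists y; split=> //.
  apply: (stopped_le Gx rs s0 xs UI GW xW dyn st _ ss Gy) => k w kj.
  have [_ sv _] := tS; case: (sv w) => [E|[l jl E]]; first by rewrite /before E.
  by rewrite (beforeE _ E) -ltnNge; exact: leq_trans kj jl.
split=> //.
- by split=> // n; apply: (LG1ss_intro (nat0 n) (mM n) (GM n)).
- split=> [n jn|m n jm mn].
    by apply: (LG1ss_bar_intro (nat0 n) (mM n) (Gss_Gb (GM n))).
  by apply: (is_Gcond_intro (nat0R m) (mM n) (Mx n) (GMb n) (Mm m n jm mn)).
- move=> sigma tS; have [y [GS Gy _]] := other sigma tS.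
  have [mS [Sx _]] := sigma_stopped tS xs.
  exists (EFin \o y); apply: (is_Gcond_intro (nat0R j) mS Sx GS Gy).
    by apply/measurable_EFinP; exact: rv_meas (GC_rvr Gy).
  exact: qs_all.
split=> //.
- move=> xi [sigma tS Ixi]; have [y [GS Gy _]] := other sigma tS.
  have [mS [Sx _]] := sigma_stopped tS xs.
  have [mxi xiy] := is_Gcond_GC (nat0R j) mS Sx GS Gy Ixi.
  apply: (bbL1_intro _ mxi (GC_rvr Gy) _ xiy); first exact: leey.
  by apply: adp_pinfty; exact: rv_meas (GC_rvr Gy).
- exact: mV.
- move=> xi [sigma tS Ixi]; have [y [GS Gy yW]] := other sigma tS.
  have [mS [Sx _]] := sigma_stopped tS xs.
  have [mxi xiy] := is_Gcond_GC (nat0R j) mS Sx GS Gy Ixi.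
  by apply: filterS2 xiy (filterI VE yW) => w -> [-> h]; rewrite lee_fin.
(* Minimality is immediate because the supremum is attained: V j belongs to the family, with sigma
   equal to tau. *)
by move=> eta' _; apply; exists tau.
Qed.

End ValueProcess.
End Main.

End QuasiSure.

(** Over an empty set of measures every capacity is -oo, and a constant sequence at -oo does not
    tend to 0. *)
Lemma Pset_nonempty (R : realType) (slo shi : R) (A : nat -> set (Omega R)) :
  capacity slo shi (A N) @[N --> \oo] --> 0%E -> exists P, Pset slo shi P.
Proof.
move=> H; apply: contrapT => nP.
have E : (fun N => capacity slo shi (A N)) = fun=> -oo%E.
  apply/funext => N; rewrite /capacity (_ : [set _ | _ in _] = set0) ?ereal_sup0//.
  by apply/seteqP; split=> // z [P PP _]; apply: nP; exists P.
have h : (fun=> -oo%E : \bar R) @ \oo --> (-oo%E : \bar R) by exact: cvg_cst.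
rewrite E in H; have : (0 == -oo :> \bar R)%E by apply/eqP; exact: (cvg_unique (@ereal_hausdorff R) H h).
by [].
Qed.

Local Open Scope ereal_scope.

Theorem proposition3p8 (R : realType) (slo shi : R)
    (slo_ge0 : (0 <= slo)%R) (slo_le_shi : (slo <= shi)%R)
    (beta : R) (beta_gt1 : (1 < beta)%R)
    (X : nat -> Omega R -> \bar R)
    (X_lb : forall n, exists c : R, qs slo shi (fun w => c%:E <= X n w))
    (X_LG : forall n, LG slo shi beta n%:R%:E (X n))
    (X_sup : Ghat slo shi
       (fun w => ereal_sup (range (fun n => (`|X n w| `^ beta)%E))) < +oo)
    (j : nat)
    (tau_fin : capacity slo shi [set w | N%:R%:E < tau_opt slo shi X j w]
                 @[N --> \oo] --> 0) :
  let tau := tau_opt slo shi X j in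
  let V := Vinf slo shi X in
  let M := fun n => at_time V (fun w => mine n%:R%:E (tau w)) in
  [/\ Tset slo shi j tau /\ (forall n, LG1ss slo shi n%:R%:E (M n)),
      Gmartingale_from slo shi j M,
      is_Gcond slo shi j%:R%:E (at_time X tau) (V j),
      (forall sigma, Tset slo shi j sigma ->
         exists xi, is_Gcond slo shi j%:R%:E (at_time X sigma) xi)
    & is_qs_esssup slo shi
        [set xi | exists2 sigma, Tset slo shi j sigma
                & is_Gcond slo shi j%:R%:E (at_time X sigma) xi] (V j)].
Proof.
have [P0 PS0] := Pset_nonempty tau_fin.
exact: (optimal_stopping PS0 slo_ge0 slo_le_shi beta_gt1 X_LG X_sup tau_fin).
Qed.
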